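(* Let $u\in C(M\times\mathbb{S}^1,\mathbb{R})$. Then $u$ is a backward weak KAM solution of $u_\tau+H(x,u_x,\tau)=0$ if and only if it is a viscosity solution of $u_\tau+H(x,u_x,\tau)=0$.
   Context: Setting. $M$ is a compact connected smooth manifold with a fixed $C^\infty$ Riemannian metric. $L:TM\times\mathbb{R}\to\mathbb{R}$, $(x,v,t)\mapsto L(x,v,t)$, is $C^\infty$ and satisfies: (i) periodicity: $L(x,v,t)=L(x,v,t+1)$; (ii) positive definiteness: for each $x\in M$, $t\in\mathbb{R}$, the Hessian of $v\mapsto L(x,v,t)$ on $T_xM$ is everywhere positive definite; (iii) superlinear growth: $L(x,v,t)/\|v\|_x\to+\infty$ as $\|v\|_x\to+\infty$, uniformly in $x\in M$, $t\in\mathbb{R}$; (iv) completeness: the maximal solutions of the Euler-Lagrange equation $\frac{d}{dt}\frac{\partial L}{\partial v}(x,\dot x,t)=\frac{\partial L}{\partial x}(x,\dot x,t)$ are defined on all of $\mathbb{R}$. The Hamiltonian is $H(x,p,t)=\sup_{v\in T_xM}\{\langle p,v\rangle_x-L(x,v,t)\}$. It is assumed that the Mañé critical value vanishes, $c(L)=0$, where $c(L)=\alpha(0)=-\min_\mu\int L\,d\mu$, the minimum being over Borel probability measures on $TM\times\mathbb{S}^1$ invariant under the Euler-Lagrange flow. Conventions. $\mathbb{S}^1=\mathbb{R}/\mathbb{Z}$; $[t]=t \bmod 1$. ''Paths'' are continuous and piecewise $C^1$. Action potential. For $t'\ge t$ and $x,y\in M$, $F_{t,t'}(x,y)=\inf_\gamma\int_t^{t'}L(\gamma(s),\dot\gamma(s),s)\,ds$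 over paths $\gamma:[t,t']\to M$ with $\gamma(t)=x$, $\gamma(t')=y$. For $\tau,\tau'\in\mathbb{S}^1$, $x,x'\in M$, $\Phi_{\tau,\tau'}(x,x')=\inf F_{t,t'}(x,x')$ over $(t,t')\in\mathbb{R}^2$ with $[t]=\tau$, $[t']=\tau'$, $t'\ge t+1$. Backward weak KAM solution of $u_\tau+H(x,u_x,\tau)=0$: a function $u:M\times\mathbb{S}^1\to\mathbb{R}$ such that (1) $u(x,\tau)-u(y,s)\le\Phi_{s,\tau}(y,x)$ for all $(x,\tau),(y,s)\in M\times\mathbb{S}^1$; (2) for every $(x,\tau)\in M\times\mathbb{S}^1$ there is a curve $\gamma:(-\infty,\tilde\tau]\to M$ with $\gamma(\tilde\tau)=x$, $[\tilde\tau]=\tau$ and $u(x,\tau)-u(\gamma(t),[t])=\int_t^{\tilde\tau}L(\gamma(s),\dot\gamma(s),s)\,ds$ for all $t\in(-\infty,\tilde\tau]$. *)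

(* Defs.v *)
From HB Require Import structures.
From mathcomp Require Import all_boot all_order all_algebra generic_quotient.
From mathcomp Require Import all_classical all_reals all_analysis.

Set Implicit Arguments.
Unset Strict Implicit.
Unset Printing Implicit Defensive.

Import Order.TTheory GRing.Theory Num.Theory.
Import numFieldNormedType.Exports.

Local Open Scope classical_set_scope.
Local Open Scope ring_scope.

Section circle.
Context {R : realType}.

Definition circle_rel (s t : R) : bool := s - t \is a Num.int.

Lemma circle_rel_equiv : equiv_class_of circle_rel.
Proof.
split=> [s|s t|s t r]; rewrite /circle_rel.
- by rewrite subrr rpred0.
- by rewrite -opprB rpredN.
- by move=> ts sr; rewrite -(subrKA s) rpredD.
Qed.

Canonical circle_equiv := EquivRelPack circle_rel_equiv.

End circle.

Definition circle (R : realType) : Type :=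
  quotient_topology {eq_quot (@circle_equiv R)}%qT.
HB.instance Definition _ (R : realType) := PointedTopological.on (circle R).
HB.instance Definition _ (R : realType) := Quotient.on (circle R).

Definition circle_of {R : realType} (t : R) : circle R := (\pi_(circle R) t)%qT.

(* f is C^k at every point of the open set U; meant for finite-dimensional V,
   where continuity of all directional derivatives of order k is equivalent to
   continuity of the k-th Frechet derivative *)
Fixpoint Ck {R : realType} {V W : normedModType R} (k : nat) (U : set V)
    (f : V -> W) : Prop :=
  match k with
  | 0 => forall x, U x -> {for x, continuous f}
  | k'.+1 => (forall x, U x -> differentiable f x) /\
             forall v, Ck k' U ('D_v f)
  end.

Definition smooth_on {R : realType} {V W : normedModType R} (U : set V)
  (f : V -> W) : Prop := forall k, Ck k U f.

(* [chart_inv] is only meaningful on [chart_target c] *)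
Record chart (R : realType) (n : nat) (M : topologicalType) := Chart {
  chart_source : set M;
  chart_map : M -> 'rV[R]_n;
  chart_inv : 'rV[R]_n -> M;
  chart_source_open : open chart_source;
  chart_target_open : open (chart_map @` chart_source);
  chart_mapK : {in chart_source, cancel chart_map chart_inv};
  chart_map_continuous : {within chart_source, continuous chart_map};
  chart_inv_continuous :
    {within chart_map @` chart_source, continuous chart_inv} }.

Definition chart_target (R : realType) (n : nat) (M : topologicalType)
  (c : chart R n M) : set 'rV[R]_n := chart_map c @` chart_source c.

(* The smooth structure is the one generated by [atlas], which need not be
   maximal. [chart_at x] is an arbitrary choice of a chart of the atlas around x:
   as in Lean's Mathlib, the tangent space T_xM is 'rV[R]_n, where v stands for
   the tangent vector whose coordinates in the chart [chart_at x] are v.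
   No regularity of x |-> chart_at x is required, so that smooth or topological
   notions on TM are always expressed through the charts of the atlas, see
   [tangent_of]. *)
Record smooth_manifold (R : realType) (n : nat) := SmoothManifold {
  manifold_space :> ptopologicalType;
  atlas : set (chart R n manifold_space);
  chart_at : manifold_space -> chart R n manifold_space;
  atlas_chart_at : forall x, atlas (chart_at x);
  source_chart_at : forall x, chart_source (chart_at x) x;
  atlas_compatible : forall c c', atlas c -> atlas c' ->
    smooth_on (chart_map c @` (chart_source c `&` chart_source c'))
      (chart_map c' \o chart_inv c);
  manifold_hausdorff : hausdorff_space manifold_space;
  manifold_second_countable : @second_countable manifold_space }.

Section manifold.
Context {R : realType} {n : nat} {M : smooth_manifold R n}.
Local Notation E := 'rV[R]_n.

(* the tangent vector at the point with coordinates y in the chart c whose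
   coordinates in c are w *)
Definition tangent_of (c : chart R n M) (y w : E) : E :=
  'd (chart_map (chart_at (chart_inv c y)) \o chart_inv c) y w.

Definition velocity (gamma : R -> M) (s : R) : E :=
  derive1 (chart_map (chart_at (gamma s)) \o gamma) s.

Definition curve_Ck (k : nat) (I : set R) (gamma : R -> M) : Prop :=
  (forall s, I s -> {for s, continuous gamma}) /\
  forall c, atlas c ->
    Ck k (I `&` gamma @^-1` chart_source c) (chart_map c \o gamma).

(* continuous and piecewise C^1 on [a, b]; a piece is C^1 on a closed interval
   when it extends to a C^1 curve on a neighbourhood of it *)
Definition is_path (a b : R) (gamma : R -> M) : Prop :=
  {within `[a, b], continuous gamma} /\
  exists2 s : seq R, itv_partition a b s &
    forall i, (i < size s)%N ->
      let a' := nth b (a :: s) i in let b' := nth b (a :: s) i.+1 in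
      exists e : R, exists delta : R -> M,
        [/\ 0 < e, curve_Ck 1 `]a' - e, b' + e[ delta &
            {in `[a', b'], gamma =1 delta}].

Record riemannian_metric := RiemannianMetric {
  metric :> M -> E -> E -> R;
  metric_linear : forall x w (a : R) v v',
    metric x (a *: v + v') w = a * metric x v w + metric x v' w;
  metric_sym : forall x v w, metric x v w = metric x w v;
  metric_pos : forall x v, v != 0 -> 0 < metric x v v;
  metric_smooth : forall c, atlas c -> forall v w : E,
    smooth_on (chart_target c)
      (fun y => metric (chart_inv c y) (tangent_of c y v) (tangent_of c y w)) }.

Definition metric_norm (g : riemannian_metric) (x : M) (v : E) : R :=
  Num.sqrt (g x v v).

Section lagrangian.
Variable L : M -> E -> R -> R.

Definition lagrangian_in (c : chart R n M) (y w : E) (t : R) : R :=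
  L (chart_inv c y) (tangent_of c y w) t.

Definition lagrangian_smooth : Prop := forall c, atlas c ->
  smooth_on [set z : E * E * R | chart_target c z.1.1]
    (fun z => lagrangian_in c z.1.1 z.1.2 z.2).

(* d/dt (dL/dv) = dL/dx in the chart c, both sides being linear forms evaluated
   at w *)
Definition euler_lagrange_on (J : set R) (gamma : R -> M) : Prop :=
  curve_Ck 2 J gamma /\
  forall c s, atlas c -> J s -> chart_source c (gamma s) ->
    let q := chart_map c \o gamma in
    forall w : E,
      is_derive s 1
        (fun r => 'D_w (fun v => lagrangian_in c (q r) v r) (derive1 q r))
        ('D_w (fun y => lagrangian_in c y (derive1 q s) s) (q s)).

Definition maximal_euler_lagrange (J : set R) (gamma : R -> M) : Prop :=
  [/\ open J, is_interval J, J !=set0, euler_lagrange_on J gamma &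
      forall (J' : set R) (gamma' : R -> M), open J' -> is_interval J' ->
        euler_lagrange_on J' gamma' -> J `<=` J' ->
        {in J, gamma =1 gamma'} -> J' = J].

Definition tonelli (g : riemannian_metric) : Prop :=
  [/\ lagrangian_smooth,
      forall x v t, L x v t = L x v (t + 1),
      forall x t (v w : E), w != 0 ->
        0 < 'D_w ('D_w (fun v' => L x v' t)) v,
      forall A : R, exists2 B : R, 0 < B &
        forall x v t, B <= metric_norm g x v ->
          A <= L x v t / metric_norm g x v &
      forall J gamma, maximal_euler_lagrange J gamma -> J = setT].

(* a covector at x is a linear form on T_xM = 'rV[R]_n *)
Definition hamiltonian (x : M) (p : {linear E -> R}) (t : R) : R :=
  sup [set p v - L x v t | v in [set: E]].

(* W is open in TM x S^1, for the bundle topology on TM *)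
Definition phase_open : set (set (M * E * circle R)) :=
  [set W | forall c, atlas c ->
    open [set z : E * E * R | chart_target c z.1.1 /\
      W (chart_inv c z.1.1, tangent_of c z.1.1 z.1.2, circle_of z.2)]].

Definition phase_space : Type := g_sigma_algebraType phase_open.
HB.instance Definition _ := Measurable.on phase_space.

Definition phase_of (gamma : R -> M) (t : R) : phase_space :=
  (gamma t, velocity gamma t, circle_of t).

(* preimage of A under the time-s map of the Euler-Lagrange flow *)
Definition flow_preimage (s : R) (A : set phase_space) : set phase_space :=
  [set z | exists gamma t, [/\ euler_lagrange_on setT gamma,
    z = phase_of gamma t & A (phase_of gamma (t + s))]].

Definition flow_invariant (mu : probability phase_space R) : Prop :=
  forall s A, measurable A -> mu (flow_preimage s A) = mu A.

Definition mean_lagrangian (mu : probability phase_space R) : \bar R :=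
  (\int[mu]_z (L z.1.1 z.1.2 (repr z.2))%:E)%E.

(* c = - min { mean_lagrangian mu | mu invariant } *)
Definition mane_critical_value (c : R) : Prop :=
  (exists2 mu, flow_invariant mu & mean_lagrangian mu = (- c)%:E) /\
  forall mu, flow_invariant mu -> ((- c)%:E <= mean_lagrangian mu)%E.

Definition action (gamma : R -> M) (a b : R) : R :=
  \int[lebesgue_measure]_(s in `[a, b]) L (gamma s) (velocity gamma s) s.

Definition min_action (t t' : R) (x y : M) : \bar R :=
  ereal_inf [set (action gamma t t')%:E | gamma in
    [set gamma | [/\ is_path t t' gamma, gamma t = x & gamma t' = y]]].

Definition action_potential (tau tau' : circle R) (x x' : M) : \bar R :=
  ereal_inf [set min_action z.1 z.2 x x' | z in
    [set z : R * R | [/\ circle_of z.1 = tau, circle_of z.2 = tau' &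
                         z.1 + 1 <= z.2]]].

Definition backward_weak_KAM (u : M * circle R -> R) : Prop :=
  (forall x tau y sigma,
    ((u (x, tau) - u (y, sigma))%:E <= action_potential sigma tau y x)%E) /\
  forall x tau, exists gamma : R -> M, exists t1 : R,
    [/\ gamma t1 = x, circle_of t1 = tau,
        forall t, t <= t1 -> is_path t t1 gamma &
        forall t, t <= t1 ->
          u (x, tau) - u (gamma t, circle_of t) = action gamma t t1].

Definition C1_test (phi : M * circle R -> R) : Prop :=
  forall c, atlas c -> Ck 1 [set z : E * R | chart_target c z.1]
    (fun z => phi (chart_inv c z.1, circle_of z.2)).

(* phi_tau + H(x, phi_x, tau) at (x, [t]) *)
Definition hamilton_jacobi (phi : M * circle R -> R) (x : M) (t : R) : R :=
  derive1 (fun s => phi (x, circle_of s)) t +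
  hamiltonian x
    ('d (fun y => phi (chart_inv (chart_at x) y, circle_of t))
        (chart_map (chart_at x) x)) t.

Definition viscosity_subsolution (u : M * circle R -> R) : Prop :=
  forall phi, C1_test phi -> forall x t,
    (\forall z \near (x, circle_of t),
       u z - phi z <= u (x, circle_of t) - phi (x, circle_of t)) ->
    hamilton_jacobi phi x t <= 0.

Definition viscosity_supersolution (u : M * circle R -> R) : Prop :=
  forall phi, C1_test phi -> forall x t,
    (\forall z \near (x, circle_of t),
       u (x, circle_of t) - phi (x, circle_of t) <= u z - phi z) ->
    0 <= hamilton_jacobi phi x t.

Definition viscosity_solution (u : M * circle R -> R) : Prop :=
  viscosity_subsolution u /\ viscosity_supersolution u.

End lagrangian.
End manifold.

Arguments riemannian_metric {R n} M.

(* Main.v *)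
Require Import Defs.
From HB Require Import structures.
From mathcomp Require Import all_boot all_order all_algebra generic_quotient.
From mathcomp Require Import all_classical all_reals all_analysis.
From mathcomp Require Import ring lra.
Set Implicit Arguments.
Unset Strict Implicit.
Unset Printing Implicit Defensive.
Import Order.TTheory GRing.Theory Num.Theory.
Import numFieldNormedType.Exports.
Local Open Scope classical_set_scope.
Local Open Scope ring_scope.

(* A weak KAM solution is tested along short curves: domination by the action
   gives the subsolution inequality, a calibrated curve the supersolution one.

   Conversely, a viscosity subsolution u is dominated by the action along every
   C^1 curve, since otherwise a quadratic penalisation around the curve yields a
   test function violating the inequality. To find calibrated curves, let a
   paraboloid of slope p touch u(-, t) from below at y, and let gamma be the
   extremal leaving (y, t) with momentum p. Domination along the translates of
   gamma shows that at earlier times s the function u(-, s) is still bounded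
   below, near gamma s, by a paraboloid whose slope is the momentum of gamma; if
   u(gamma s, s) were above its expected value, a strict subsolution built from
   these paraboloids would touch u from below, against the supersolution
   property. So gamma is calibrated on all of (-oo, t]. The touched points y are
   dense, calibrated extremals have bounded velocity at some time of [t - 1, t]
   because u is bounded, and by continuous dependence on initial conditions a
   limit of calibrated extremals is a calibrated extremal through any point. *)

(** * Real functions and C^k maps *)

(** No minimiser of the action is constructed: calibrated curves are sought among the solutions of
    an ordinary differential equation, which completeness extends to the whole line. The price is
    the comparison argument. Its test function has a curvature growing in time at a rate [kap]: the
    errors are quadratic in the distance to the curve, or mix that distance with the velocity
    defect, and uniform convexity turns the mixed ones into quadratic ones that [kap] pays for. This
    growth forces time steps of length about [1 / kap]. They can be repeated because the lower
    paraboloids are always rebuilt by domination from the final time, so that their curvature does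
    not accumulate. In the other direction the obstacle is that [action_potential] compares only
    times at distance at least 1, while viscosity inequalities are infinitesimal. As [chart_at] is
    arbitrary, coordinates on the tangent bundle are not continuous in their raw form: local
    statements live in one chart, and are passed along a curve by [local_transitive_global] once
    their invariance under transitions is known. *)

Section real_analysis.
Context {R : realType}.
Implicit Types (F f : R -> R) (a b x s t : R).

Lemma is_derive_continuous F f x : is_derive x 1 F (f x) -> {for x, continuous F}.
Proof.
by move=> dF; apply: differentiable_continuous; apply/derivable1_diffP; case: dF.
Qed.

Lemma is_derive_within_continuous F f a b :
  (forall x, a <= x <= b -> is_derive x 1 F (f x)) ->
  {within `[a, b], continuous F}.
Proof.
move=> dF; apply: derivable_within_continuous => x.
by rewrite in_itv/= => /dF [].
Qed.

Lemma MVT_closed F f a b : a <= b ->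
  (forall x, a <= x <= b -> is_derive x 1 F (f x)) ->
  exists2 c, a <= c <= b & F b - F a = f c * (b - a).
Proof.
move=> ab dF; have dF' x : x \in `]a, b[%R -> is_derive x 1 F (f x).
  by rewrite in_itv/= => /andP[ax xb]; apply: dF; rewrite !ltW.
have [c] := MVT_segment ab dF' (is_derive_within_continuous dF).
by rewrite in_itv/= => cab E; exists c.
Qed.

Lemma derive_le0_nincr F f a b : a <= b ->
  (forall x, a <= x <= b -> is_derive x 1 F (f x)) ->
  (forall x, a <= x <= b -> f x <= 0) -> F b <= F a.
Proof.
move=> ab dF f0; have [c cab E] := MVT_closed ab dF.
by rewrite -subr_le0 E mulr_le0_ge0 ?subr_ge0 ?f0.
Qed.

Lemma derive_bounded_lipschitz F f a b C : a <= b ->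
  (forall x, a <= x <= b -> is_derive x 1 F (f x)) ->
  (forall x, a <= x <= b -> `|f x| <= C) -> `|F b - F a| <= C * (b - a).
Proof.
move=> ab dF fC; have [c cab ->] := MVT_closed ab dF.
by rewrite normrM (ger0_norm (_ : 0 <= b - a)) ?subr_ge0// ler_wpM2r ?subr_ge0 ?fC.
Qed.

(** The fundamental theorem gives a two-sided derivative only in the interior, so applications start
    from an interval larger than the one on which the derivative is wanted. *)
Lemma antiderivative f a b : {within `[a, b], continuous f} ->
  exists F, forall x, a < x < b -> is_derive x 1 F (f x).
Proof.
move=> cf; exists (fun x => \int[lebesgue_measure]_(t in `[a, x]) f t) => x.
move=> /andP[ax xb].
have fi : (@lebesgue_measure R).-integrable `[a, b] (EFin \o f).
  by apply: continuous_compact_integrable => //; exact: segment_compact.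
have cfx : {for x, continuous f}.
  have /continuous_within_itvP := cf.
  move=> /(_ (lt_trans ax xb))[+ _ _]; apply.
  by rewrite in_itv/= ax.
have [dF F'] := continuous_FTC1_closed xb fi ax cfx.
by apply: (DeriveDef dF); rewrite -derive1E F'.
Qed.

(** Multiplying [E] by [expR (- (C * x))] or by [expR (C * x)] gives a monotone function; one serves
    when [t] lies after [s], the other when it lies before, so the estimate works in both directions
    of time. *)
Lemma gronwall (E e : R -> R) a b C :
  (forall x, a <= x <= b -> is_derive x 1 E (e x)) ->
  (forall x, a <= x <= b -> `|e x| <= C * E x) ->
  forall s t, a <= s <= b -> a <= t <= b -> E t <= E s * expR (C * `|t - s|).
Proof.
move=> dE eC s t sab tab; have [st|/ltW ts] := leP s t.
- rewrite ger0_norm ?subr_ge0//.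
  have H : E t * expR (- (C * t)) <= E s * expR (- (C * s)).
    apply: (@derive_le0_nincr (fun x => E x * expR (- (C * x)))
      (fun x => (e x - C * E x) * expR (- (C * x))) _ _ st) => x xst.
      have := dE x (ltac:(lra)) => dEx.
      by apply: is_derive_eq; rewrite /GRing.scale/=; ring.
    rewrite mulr_le0_ge0 ?expR_ge0// subr_le0.
    by apply: le_trans (eC x (ltac:(lra))); rewrite ler_norm.
  rewrite -(ler_pM2r (expR_gt0 (- (C * t)))) -mulrA -expRD.
  by apply: le_trans H _; rewrite le_eqVlt; apply/orP; left; apply/eqP; congr (_ * expR _); ring.
- rewrite ler0_norm ?subr_le0//.
  have H : - (E s * expR (C * s)) <= - (E t * expR (C * t)).
    apply: (@derive_le0_nincr (fun x => - (E x * expR (C * x)))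
      (fun x => - ((e x + C * E x) * expR (C * x))) _ _ ts) => x xst.
      have := dE x (ltac:(lra)) => dEx.
      by apply: is_derive_eq; rewrite /GRing.scale/=; ring.
    rewrite oppr_le0 mulr_ge0 ?expR_ge0//.
    by have := eC x (ltac:(lra)); rewrite ler_norml => /andP[+ _]; lra.
  rewrite -(ler_pM2r (expR_gt0 (C * t))) -mulrA -expRD.
  rewrite lerN2 in H; apply: le_trans H _.
  by rewrite le_eqVlt; apply/orP; left; apply/eqP; congr (_ * expR _); ring.
Qed.

(** Induction over the reals: by [lim] the supremum of the times up to which [S] holds is one of
    them, and [step] would go past it if it were below [b]. *)
Lemma real_induction (S : R -> Prop) a b :
  S a ->
  (forall r, a <= r < b -> (forall s, a <= s <= r -> S s) ->
    exists2 d, 0 < d & forall s, r < s < r + d -> s <= b -> S s) ->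
  (forall r, a < r <= b -> (forall s, a <= s < r -> S s) -> S r) ->
  forall s, a <= s <= b -> S s.
Proof.
move=> Sa step lim s0 /andP[as0 s0b].
pose A := [set r | a <= r <= b /\ forall s, a <= s <= r -> S s].
have Aa : A a.
  split; first by lra.
  by move=> s /andP[sa1 sa2]; have -> : s = a by lra.
have ubA : ubound A b by move=> r [/andP[]].
have hA : has_sup A by split; [exists a|exists b].
pose m := sup A.
have am : a <= m by apply: ub_le_sup Aa; exists b.
have mb : m <= b by apply: ge_sup; [exists a|].
have Sltm s : a <= s < m -> S s.
  move=> /andP[as_ sm]; have [r [_ Ar] sr] := @sup_adherent R A (m - s) (ltac:(lra)) hA.
  by apply: Ar; rewrite as_/=; move: sr; rewrite -/m; lra.
have Sm s : a <= s <= m -> S s.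
  move=> /andP[as_]; rewrite le_eqVlt => /predU1P[->|sm]; last by apply: Sltm; rewrite as_.
  move: am; rewrite le_eqVlt => /predU1P[<-//|am].
  by apply: lim; rewrite ?am.
have [bm|mb'] := leP b m; first by apply: Sm; lra.
have [d d0 Sd] := step m (ltac:(rewrite am//)) Sm.
pose r := Num.min b (m + d / 2).
have mr : m < r by rewrite lt_min mb'/=; lra.
have : A r.
  split; first by rewrite (le_trans am (ltW mr))/= ge_min lexx.
  move=> s /andP[as_ sr]; have [sm|ms] := leP s m; first by apply: Sm; rewrite as_.
  have [rb rd] : r <= b /\ r <= m + d / 2 by rewrite !ge_min !lexx orbT.
  by apply: Sd; lra.
move=> Ar; suff : r <= m by lra.
by apply: ub_le_sup Ar; exists b.
Qed.

(** Stands for cutting [a, b] into pieces so short that each lies in a single chart: real induction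
    on the right end replaces the Lebesgue number. *)
Lemma local_transitive_global (P : R -> R -> Prop) a b : a <= b ->
  (forall x y z, a <= x -> x <= y -> y <= z -> z <= b -> P x y -> P y z -> P x z) ->
  (forall r, a <= r <= b -> exists2 d, 0 < d &
    forall s t, a <= s -> s <= t -> t <= b -> r - d < s -> t < r + d -> P s t) ->
  P a b.
Proof.
move=> ab trP locP.
apply: (@real_induction (P a) a b _ _ _ b); rewrite ?ab ?lexx//.
- have [d d0 h] := locP a (ltac:(lra)); apply: h => //; lra.
- move=> r /andP[ar rb] Pr; have [d d0 h] := locP r (ltac:(lra)).
  exists d => // s /andP[rs sd] sb.
  have Par : P a r by apply: Pr; lra.
  apply: (trP _ _ _ _ ar (ltW rs)) => //; apply: h => //; lra.
- move=> r /andP[ar rb] Pr; have [d d0 h] := locP r (ltac:(lra)).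
  pose s := Num.max a (r - d / 2).
  have as_ : a <= s by rewrite le_max lexx.
  have rs : r - d / 2 <= s by rewrite le_max lexx orbT.
  have sr : s < r by rewrite gt_max ar/=; lra.
  apply: (trP _ s _ _ as_ (ltW sr)) => //; first by apply: Pr; lra.
  apply: h => //; lra.
Qed.

End real_analysis.

(** * Calculus of [Ck] maps *)

Section smooth_calculus.
Context {R : realType}.
Implicit Types V W Z : normedModType R.

Lemma open_near (T : topologicalType) (U : set T) x : open U -> U x -> nbhs x U.
Proof. by move=> oU Ux; exact: open_nbhs_nbhs. Qed.

Lemma continuous_pair (S T T' : topologicalType) (f : S -> T) (g : S -> T') x :
  {for x, continuous f} -> {for x, continuous g} -> {for x, continuous (fun s => (f s, g s))}.
Proof. by move=> cf cg; apply: cvg_pair. Qed.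

Lemma open_pre (S T : topologicalType) (f : S -> T) (D : set T) :
  continuous f -> open D -> open [set x | D (f x)].
Proof. by move=> /continuousP cf /cf. Qed.

Lemma continuous_near_le (S : topologicalType) V (f : S -> V) x e :
  {for x, continuous f} -> 0 < e -> \forall y \near x, `|f x - f y| <= e.
Proof. by move=> /cvgrPdist_le cf e0; exact: cf. Qed.

Lemma near_within_open (T S : topologicalType) (f g : T -> S) (U : set T) x :
  open U -> U x -> {in U, f =1 g} -> \near x, f x = g x.
Proof.
move=> oU Ux fg; near=> y; apply: fg; rewrite inE; near: y; exact: open_near.
Unshelve. all: by end_near. Qed.

Lemma continuous_near_eq (T S : topologicalType) (f g : T -> S) x :
  (\near x, f x = g x) -> {for x, continuous f} -> {for x, continuous g}.
Proof.
move=> fg cf; have fgx : f x = g x := nbhs_singleton fg.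
rewrite /prop_for /continuous_at -fgx; apply: cvg_trans cf.
by apply: near_eq_cvg; near=> y; near: y.
Unshelve. all: by end_near. Qed.

Lemma differentiable_near_eq V W (f g : V -> W) x :
  (\near x, f x = g x) -> differentiable f x -> differentiable g x.
Proof.
move=> fg /diff_locallyP[cd dl].
have fgx : f x = g x := nbhs_singleton fg.
have fg0 : \forall y \near 0, f (y + x) = g (y + x).
  by rewrite (near_shift x)/=; apply: filterS fg => y /=; rewrite sub0r subrK.
have dl' : g \o shift x = cst (g x) + 'd f x +o_ 0 id.
  apply/eqaddoP => _/posnumP[e].
  move/eqaddoP: dl => /(_ _ (gt0 e)) dl.
  by apply: filterS2 fg0 dl => y fgy; rewrite !fctE /= fgy fgx.
have dgf := diff_unique cd dl'.
by apply/diff_locallyP; rewrite dgf.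
Qed.

Lemma derive_compE V W Z (g : V -> W) (f : W -> Z) x v :
  differentiable g x -> differentiable f (g x) ->
  'D_v (f \o g) x = 'D_('D_v g x) f (g x).
Proof.
move=> dg df; rewrite !deriveE//; last exact: differentiable_comp.
by rewrite diff_comp.
Qed.

(** A directional derivative sees only the restriction to a line. Partial derivatives can thus be
    exchanged for derivatives of the joint function, and translations removed, without any
    differentiability. *)
Lemma derive_on_line V V' W (f : V -> W) (g : V' -> W) x v y w :
  (forall h : R, f (h *: v + x) = g (h *: w + y)) -> 'D_v f x = 'D_w g y.
Proof.
move=> fg; rewrite /derive.
have fg0 : f x = g y by have := fg 0; rewrite !scale0r !add0r.
suff -> : (fun h => h^-1 *: ((f \o shift x) (h *: v) - f x)) =
          (fun h => h^-1 *: ((g \o shift y) (h *: w) - g y)) by [].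
by apply/funext => h /=; rewrite fg fg0.
Qed.

Lemma CkSE V W k (U : set V) (f : V -> W) :
  Ck k.+1 U f = ((forall x, U x -> differentiable f x) /\ forall v, Ck k U ('D_v f)).
Proof. by []. Qed.

Lemma Ck_subset V W k (U U' : set V) (f : V -> W) :
  U' `<=` U -> Ck k U f -> Ck k U' f.
Proof.
move=> U'U; elim: k f => [f cf x /U'U|k IH f]; first exact: cf.
by rewrite !CkSE => -[df Df]; split=> [x /U'U /df//|v]; exact: IH.
Qed.

Lemma Ck_bigcup V W k I (D : set I) (U : I -> set V) (f : V -> W) :
  (forall i, D i -> Ck k (U i) f) -> Ck k (\bigcup_(i in D) U i) f.
Proof.
elim: k f => [f cf x [i /cf]|k IH f cf]; first exact.
rewrite CkSE; split=> [x [i /cf[df _]]|v]; first exact: df.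
by apply: IH => i /cf[_]; exact.
Qed.

(** [Ck] is a condition at each point of the set, for functions defined on the whole space, so that
    covering the points is enough. *)
Lemma Ck_near V W k (U : set V) (f : V -> W) :
  (forall x, U x -> exists2 U', U' x & Ck k U' f) -> Ck k U f.
Proof.
move=> h; apply: (@Ck_subset _ _ _ (\bigcup_(U' in [set U' | Ck k U' f]) U')).
  by move=> x /h[U' ? ?]; exists U'.
exact: Ck_bigcup.
Qed.

Lemma Ck_eq V W k (U : set V) (f g : V -> W) :
  open U -> {in U, f =1 g} -> Ck k U f -> Ck k U g.
Proof.
move=> oU; elim: k f g => [f g fg cf x Ux|k IH f g fg].
  exact: continuous_near_eq (near_within_open oU Ux fg) (cf _ Ux).
rewrite !CkSE => -[df Df]; split=> [x Ux|v]; first exact: differentiable_near_eq (near_within_open oU Ux fg) (df _ Ux).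
apply: (IH ('D_v f)) => // x; rewrite inE => Ux.
exact/near_eq_derive/(near_within_open oU Ux).
Qed.

Lemma Ck_continuous V W k (U : set V) (f : V -> W) : Ck k U f ->
  forall x, U x -> {for x, continuous f}.
Proof. by case: k => // k [df _] x /df; exact: differentiable_continuous. Qed.

Lemma CkS V W k (U : set V) (f : V -> W) : Ck k.+1 U f -> Ck k U f.
Proof.
elim: k f => [f cf x Ux|k IH f [df Df]].
  exact: Ck_continuous cf _ Ux.
by rewrite CkSE; split=> // v; exact/IH/Df.
Qed.

Lemma Ck_le V W k k' (U : set V) (f : V -> W) : (k <= k')%N -> Ck k' U f -> Ck k U f.
Proof.
elim: k' => [|k' IH]; first by rewrite leqn0 => /eqP->.
by rewrite leq_eqVlt => /predU1P[->//|kk' /CkS]; exact: IH.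
Qed.

Lemma Ck_cst V W k (U : set V) (a : W) : Ck k U (cst a).
Proof.
elim: k a => [a x _|k IH a]; first exact: cst_continuous.
rewrite CkSE; split=> [x _|v]; first exact: differentiable_cst.
suff -> : 'D_v (cst a) = cst (0 : W) :> (V -> W) by [].
by apply/funext => x; rewrite derive_cst.
Qed.

Lemma Ck_linear V W k (U : set V) (f : {linear V -> W}) : continuous f -> Ck k U f.
Proof.
move=> cf; case: k => [x _|k]; first exact: cf.
have df x : differentiable f x by exact: linear_differentiable.
rewrite CkSE; split=> [x _//|v]; suff -> : 'D_v f = cst (f v) :> (V -> W) by exact: Ck_cst.
by apply/funext => x; rewrite deriveE// diff_lin.
Qed.

Lemma Ck_id V k (U : set V) : Ck k U (id : V -> V).
Proof. by apply: (@Ck_linear _ _ k U idfun) => x; exact: cvg_id. Qed.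

Lemma CkD V W k (U : set V) (f g : V -> W) : open U ->
  Ck k U f -> Ck k U g -> Ck k U (f + g).
Proof.
move=> oU; elim: k f g => [f g cf cg x Ux|k IH f g].
  by apply: continuousD; [exact: cf|exact: cg].
rewrite !CkSE => -[df Df] [dg Dg]; split=> [x Ux|v]; first by apply: differentiableD; [exact: df|exact: dg].
apply: (Ck_eq oU _ (IH _ _ (Df v) (Dg v))) => x; rewrite inE => Ux.
by rewrite deriveD//; apply: diff_derivable; [exact: df|exact: dg].
Qed.

Lemma CkN V W k (U : set V) (f : V -> W) : open U -> Ck k U f -> Ck k U (- f).
Proof.
move=> oU; elim: k f => [f cf x Ux|k IH f].
  by apply: continuousN; exact: cf.
rewrite !CkSE => -[df Df]; split=> [x Ux|v]; first by apply: differentiableN; exact: df.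
apply: (Ck_eq oU _ (IH _ (Df v))) => x; rewrite inE => Ux.
by rewrite deriveN//; apply: diff_derivable; exact: df.
Qed.

Lemma CkB V W k (U : set V) (f g : V -> W) : open U ->
  Ck k U f -> Ck k U g -> Ck k U (f - g).
Proof. by move=> oU Cf Cg; apply: CkD => //; exact: CkN. Qed.

Lemma CkM V k (U : set V) (f g : V -> R) : open U ->
  Ck k U f -> Ck k U g -> Ck k U (f * g).
Proof.
move=> oU; elim: k f g => [f g cf cg x Ux|k IH f g].
  by apply: continuousM; [exact: cf|exact: cg].
rewrite !CkSE => -[df Df] [dg Dg]; split=> [x Ux|v]; first by apply: differentiableM; [exact: df|exact: dg].
have Cf : Ck k U f by apply: CkS.
have Cg : Ck k U g by apply: CkS.
apply: (Ck_eq oU _ (CkD oU (IH _ _ Cf (Dg v)) (IH _ _ Cg (Df v)))) => x.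
rewrite inE => Ux.
by rewrite deriveM//; apply: diff_derivable; [exact: df|exact: dg].
Qed.

Lemma Ck_add V W k (U : set V) (f g : V -> W) : open U ->
  Ck k U f -> Ck k U g -> Ck k U (fun x => f x + g x).
Proof. exact: CkD. Qed.

Lemma Ck_sub V W k (U : set V) (f g : V -> W) : open U ->
  Ck k U f -> Ck k U g -> Ck k U (fun x => f x - g x).
Proof. exact: CkB. Qed.

Lemma Ck_mul V k (U : set V) (f g : V -> R) : open U ->
  Ck k U f -> Ck k U g -> Ck k U (fun x => f x * g x).
Proof. exact: CkM. Qed.

Lemma Ck_cmul V k (U : set V) (r : R) (g : V -> R) : open U ->
  Ck k U g -> Ck k U (fun x => r * g x).
Proof. by move=> oU Cg; apply: Ck_mul => //; exact: Ck_cst. Qed.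

Lemma Ck_sum V W k (U : set V) I (r : seq I) (P : pred I) (f : I -> V -> W) : open U ->
  (forall i, P i -> Ck k U (f i)) -> Ck k U (\sum_(i <- r | P i) f i).
Proof.
move=> oU Cf; elim/big_ind : _ => //; first exact: (@Ck_cst _ _ k U 0).
by move=> *; exact: CkD.
Qed.

Lemma Ck_pair V W Z k (U : set V) (f : V -> W) (g : V -> Z) : open U ->
  Ck k U f -> Ck k U g -> Ck k U (fun x => (f x, g x)).
Proof.
move=> oU; elim: k f g => [f g cf cg x Ux|k IH f g].
  by apply: cvg_pair; [exact: cf|exact: cg].
rewrite !CkSE => -[df Df] [dg Dg]; split=> [x Ux|v]; first by apply: differentiable_pair; [exact: df|exact: dg].
apply: (Ck_eq oU _ (IH _ _ (Df v) (Dg v))) => x; rewrite inE => Ux.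
have dfx := df _ Ux; have dgx := dg _ Ux.
by rewrite !deriveE// ?diff_pair//; exact: differentiable_pair.
Qed.

Lemma derive_linear_comb V W (f : V -> W) x N (c : 'I_N -> R) (e : 'I_N -> V) :
  differentiable f x ->
  'D_(\sum_(i < N) c i *: e i) f x = \sum_(i < N) c i *: 'D_(e i) f x.
Proof.
move=> df; rewrite deriveE// linear_sum; apply: eq_bigr => i _.
by rewrite linearZ deriveE.
Qed.

Lemma differentiable_mx V m n (f : V -> 'M[R]_(m, n)) x :
  (forall i j, differentiable (fun y => f y i j) x) -> differentiable f x.
Proof.
move=> df.
have -> : f = \sum_(i < m) \sum_(j < n) (fun y => f y i j *: (delta_mx i j : 'M[R]_(m, n))).
  apply/funext => y; rewrite [LHS]matrix_sum_delta fct_sumE; apply: eq_bigr => i _.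
  by rewrite fct_sumE.
apply: differentiable_sum => i; apply: differentiable_sum => j.
exact: differentiableZl.
Qed.

Lemma Ck_mx V m n k (U : set V) (f : V -> 'M[R]_(m, n)) : open U ->
  (forall i j, Ck k U (fun y => f y i j)) -> Ck k U f.
Proof.
move=> oU; elim: k f => [f cf x Ux|k IH f].
  have -> : f = \sum_(i < m) \sum_(j < n) (fun y => f y i j *: (delta_mx i j : 'M[R]_(m, n))).
    apply/funext => y; rewrite [LHS]matrix_sum_delta fct_sumE; apply: eq_bigr => i _.
    by rewrite fct_sumE.
  rewrite /prop_for; elim/big_ind : _ => [|g h cg ch|i _]; [exact: cst_continuous|exact: continuousD|].
  elim/big_ind : _ => [|g h cg ch|j _]; [exact: cst_continuous|exact: continuousD|].
  by apply: continuousZr_tmp; exact: (cf i j x Ux).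
move=> Cf; rewrite CkSE; have df i j x : U x -> differentiable (fun y => f y i j) x.
  by move=> Ux; have [+ _] := Cf i j; exact.
have df' x : U x -> differentiable f x by move=> Ux; apply: differentiable_mx => i j; exact: df.
split=> // v; apply: IH => i j; have [_ /(_ v)] := Cf i j.
apply: Ck_eq => // x; rewrite inE => Ux.
by rewrite derive_mx ?mxE//; apply/diff_derivable/df'.
Qed.

Lemma Ck_coord V m n k (U : set V) (f : V -> 'M[R]_(m, n)) i j :
  open U -> Ck k U f -> Ck k U (fun y => f y i j).
Proof.
move=> oU; elim: k f => [f cf x Ux|k IH f].
  apply: (@continuous_comp _ _ _ f (fun A : 'M[R]_(m, n) => A i j) x (cf x Ux)).
  exact: coord_continuous.
rewrite !CkSE => -[df Df]; split=> [x Ux|v].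
  apply: (@differentiable_comp _ _ _ _ f (fun A : 'M[R]_(m, n) => A i j) x (df x Ux)).
  exact: differentiable_coord.
apply: Ck_eq (IH _ (Df v)) => // x; rewrite inE => Ux.
by rewrite derive_mx ?mxE//; apply/diff_derivable/df.
Qed.

Lemma Ck_linear_comp V W Z k (U : set V) (f : V -> W) (g : {linear W -> Z}) :
  continuous g -> open U -> Ck k U f -> Ck k U (g \o f).
Proof.
move=> cg oU; elim: k f => [f cf x Ux|k IH f].
  by apply: (continuous_comp (cf x Ux)); exact: cg.
have dg x : differentiable g x by exact: linear_differentiable.
rewrite !CkSE => -[df Df]; split=> [x Ux|v].
  exact: differentiable_comp (df x Ux) (dg _).
apply: Ck_eq (IH _ (Df v)) => // x; rewrite inE => Ux.
by rewrite derive_compE ?[RHS]deriveE ?diff_lin//; exact: df.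
Qed.

Lemma Ck_fst V W Z k (U : set V) (f : V -> W * Z) : open U -> Ck k U f ->
  Ck k U (fun x => (f x).1).
Proof. by apply: (@Ck_linear_comp _ _ _ _ _ _ fst) => x; exact: cvg_fst. Qed.

Lemma Ck_snd V W Z k (U : set V) (f : V -> W * Z) : open U -> Ck k U f ->
  Ck k U (fun x => (f x).2).
Proof. by apply: (@Ck_linear_comp _ _ _ _ _ _ snd) => x; exact: cvg_snd. Qed.

(** The bound makes the coordinate forms continuous, which the chain rule [Ck_compR] relies on; the
    sup norms of products and rows allow the constant 1. *)
Definition dual_basis V N (e : 'I_N -> V) (xi : 'I_N -> {linear V -> R}) :=
  (forall v, v = \sum_(i < N) xi i v *: e i) /\ forall i v, `|xi i v| <= `|v|.

Definition finite_dim V := exists N, exists (e : 'I_N -> V) xi, dual_basis e xi.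

Lemma linear_norm_continuous V W (f : {linear V -> W}) :
  (forall v, `|f v| <= `|v|) -> continuous f.
Proof.
move=> fle x; apply/cvgrPdist_lt => e e0; near=> y.
rewrite -linearB; apply: le_lt_trans (fle _) _.
by near: y; apply: cvgr_dist_lt.
Unshelve. all: by end_near. Qed.

Lemma finite_dim_prod V W : finite_dim V -> finite_dim W -> finite_dim (V * W)%type.
Proof.
move=> [N [e [xi [exi xile]]]] [M [d [eta [deta etale]]]].
exists (N + M)%N.
exists (fun i => match fintype.split i with inl j => (e j, 0) | inr j => (0, d j) end).
have l1 j : linear (fun v : V * W => xi j v.1) by move=> k u v; rewrite linearP.
have l2 j : linear (fun v : V * W => eta j v.2) by move=> k u v; rewrite linearP.
pose L1 j : {linear (V * W)%type -> R} := HB.pack (fun v : V * W => xi j v.1) (GRing.isLinear.Build _ _ _ _ _ (l1 j)).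
pose L2 j : {linear (V * W)%type -> R} := HB.pack (fun v : V * W => eta j v.2) (GRing.isLinear.Build _ _ _ _ _ (l2 j)).
exists (fun i => match fintype.split i with inl j => L1 j | inr j => L2 j end).
split=> [[v w]|i [v w]].
  rewrite big_split_ord/=.
  under eq_bigr do rewrite (unsplitK (inl _)).
  under [X in _ + X]eq_bigr do rewrite (unsplitK (inr _)).
  rewrite /=; apply/pair_equal_spec; split.
    rewrite (raddf_sum fst)/= (raddf_sum fst)/=.
    by rewrite [X in _ + X]big1 ?addr0 -?exi// => i _; rewrite scaler0.
  rewrite (raddf_sum snd)/= (raddf_sum snd)/=.
  by rewrite [X in X + _]big1 ?add0r -?deta// => i _; rewrite scaler0.
case: fintype.split => j /=; rewrite prod_normE le_max ?xile//.
by rewrite etale orbT.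
Qed.

Lemma finite_dim_real : finite_dim R.
Proof.
exists 1%N, (fun=> 1), (fun=> (idfun : {linear R -> R})); split => [v|i v]//.
by rewrite big_ord1 /= -[RHS]/(v * 1) mulr1.
Qed.

Lemma mx_norm_coord m n (A : 'M[R]_(m, n)) i j : `|A i j| <= `|A|.
Proof.
rewrite [leRHS]/Num.Def.normr/= mx_normrE.
exact: (le_bigmax _ (fun ij : 'I_m * 'I_n => `|A ij.1 ij.2|) (i, j)).
Qed.

Lemma finite_dim_row n : finite_dim 'rV[R]_n.
Proof.
exists n, (fun i => delta_mx 0 i).
have l1 j : linear (fun v : 'rV[R]_n => v 0 j) by move=> k u v; rewrite !mxE.
pose L1 j : {linear 'rV[R]_n -> R} := HB.pack (fun v : 'rV[R]_n => v 0 j) (GRing.isLinear.Build _ _ _ _ _ (l1 j)).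
exists L1.
split=> [v|i v]; first exact: row_sum_delta.
exact: mx_norm_coord.
Qed.

Section finite_dimensional.
Context {V W : normedModType R} (fV : finite_dim V).

(** [Ck] gives continuity in the point for each fixed direction only. Expanding [v] in a basis
    leaves finitely many such directions, with coefficients continuous in [v]. *)
Lemma derive_cvg_joint (U : set V) (f : V -> W) x v : open U -> Ck 1 U f -> U x ->
  {for (x, v), continuous (fun z : V * V => 'D_(z.2) f z.1)}.
Proof.
have [N [e [xi [exi xile]]]] := fV.
move=> oU [df Df] Ux.
have cxi i : continuous (xi i) := linear_norm_continuous (xile i).
apply: (@continuous_near_eq _ _ (\sum_(i < N) (fun z => xi i z.2 *: 'D_(e i) f z.1))).
  near=> z.
    rewrite fct_sumE [in RHS](exi z.2) derive_linear_comb//.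
    apply: df; near: z; exact: (cvg_fst (open_near oU Ux)).
rewrite /prop_for; elim/big_ind : _ => [|g h cg ch|i _]; [exact: cst_continuous|exact: continuousD|].
apply: (@continuousZ _ _ _ (fun z : V * V => xi i z.2) (fun z => 'D_(e i) f z.1)).
  by apply: (@continuous_comp _ _ _ snd (xi i)); [exact: cvg_snd|exact: cxi].
apply: (@continuous_comp _ _ _ fst ('D_(e i) f)); first exact: cvg_fst.
exact: Df.
Unshelve. all: by end_near. Qed.

Lemma derive_bounded (K U : set V) (f : V -> W) : compact K -> K `<=` U -> Ck 1 U f ->
  exists2 C, 0 <= C & forall x v, K x -> `|'D_v f x| <= C * `|v|.
Proof.
have [N [e [xi [exi xile]]]] := fV.
move=> cK KU [df Df].
have bnd i : exists2 C, 0 <= C & forall x, K x -> `|'D_(e i) f x| <= C.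
  have cD : {within K, continuous (fun x => `|'D_(e i) f x|)}.
    apply: continuous_in_subspaceT => x; rewrite inE => /KU Ux.
    by apply: (@continuous_comp _ _ _ ('D_(e i) f) Num.norm); [exact: Df|exact: norm_continuous].
  have [[x Kx]|K0] := pselect (K !=set0); last first.
    by exists 0 => // x Kx; exfalso; apply: K0; exists x.
  have [c cc mc] := compact_EVT_max (ex_intro _ x Kx) cK cD.
  by exists `|'D_(e i) f c| => // y Ky; apply: mc; rewrite inE.
have [C C0 hC] : exists2 C : 'I_N -> R, (forall i, 0 <= C i) &
    forall i x, K x -> `|'D_(e i) f x| <= C i.
  by exists (fun i => sval (cid2 (bnd i))) => i; case: cid2.
exists (\sum_(i < N) C i); first exact: sumr_ge0.
move=> x v Kx; rewrite (exi v) derive_linear_comb -?exi; last exact/df/KU.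
rewrite (le_trans (ler_norm_sum _ _ _))// mulr_suml ler_sum// => i _.
by rewrite normrZ mulrC ler_pM ?hC.
Qed.

(** The chain rule, expanded in a basis, expresses a derivative of [f \o g] by products of
    coordinates of ['D_v g] with functions ['D_(e i) f \o g], to which the induction on [k]
    applies. *)
Lemma Ck_compR Z k (U : set Z) (U' : set V) (g : Z -> V) (f : V -> R) : open U ->
  (forall x, U x -> U' (g x)) -> Ck k U g -> Ck k U' f -> Ck k U (f \o g).
Proof.
have [N [e [xi [exi xile]]]] := fV.
have cxi i : continuous (xi i) := linear_norm_continuous (xile i).
move=> oU gU; elim: k f g gU => [f g gU cg cf x Ux|k IH f g gU Cg Cf].
  by apply: continuous_comp; [exact: cg|exact/cf/gU].
have Cgk := CkS Cg; move: Cg Cf; rewrite !CkSE => -[dg Dg] [df Df].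
split=> [x Ux|v]; first by apply: differentiable_comp; [exact: dg|exact/df/gU].
apply: (@Ck_eq _ _ _ _ (\sum_(i < N) ((xi i \o 'D_v g) * ('D_(e i) f \o g)))) => //.
  move=> x; rewrite inE => Ux; rewrite derive_compE; [|exact: dg|exact/df/gU].
  rewrite [in RHS](exi ('D_v g x)) derive_linear_comb ?fct_sumE//; exact/df/gU.
apply: Ck_sum => // i _; apply: CkM => //; first exact: Ck_linear_comp.
exact: IH.
Qed.

End finite_dimensional.

Lemma Ck_comp V Z m n k (U : set Z) (U' : set V) (g : Z -> V) (f : V -> 'M[R]_(m, n)) :
  finite_dim V -> open U -> open U' ->
  (forall x, U x -> U' (g x)) -> Ck k U g -> Ck k U' f -> Ck k U (f \o g).
Proof.
move=> fV oU oU' gU Cg Cf; apply: Ck_mx => // i j.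
by apply: (Ck_compR fV oU gU Cg (f := fun y => f y i j)); exact: Ck_coord.
Qed.

End smooth_calculus.

(** * Taylor estimates and symmetry of second derivatives *)

Section taylor.
Context {R : realType}.
Implicit Types V W : normedModType R.

Lemma is_derive_line V W (f : V -> W) x v (s : R) :
  derivable f (s *: v + x) v ->
  is_derive s 1 (fun h => f (h *: v + x)) ('D_v f (s *: v + x)).
Proof.
move=> df.
pose g (h : R) := f (h *: v + x).
have fE (h : R) : f (h *: v + (s *: v + x)) = g (h *: 1 + s).
  by rewrite /g addrA -scalerDl [h *: 1]mulr1.
apply: DeriveDef; last by rewrite -/g (derive_on_line fE).
move: df; rewrite /derivable -/g.
suff -> : (fun h => h^-1 *: ((g \o shift s) (h *: 1) - g s)) =
    (fun h => h^-1 *: ((f \o shift (s *: v + x)) (h *: v) - f (s *: v + x))) by [].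
by apply/funext => h /=; rewrite fE.
Qed.

Lemma segment_le V (f : V -> R) x v B :
  (forall s, 0 <= s <= 1 -> derivable f (s *: v + x) v) ->
  (forall s, 0 <= s <= 1 -> `|'D_v f (s *: v + x)| <= B) ->
  `|f (v + x) - f x| <= B.
Proof.
move=> df fB.
have := @derive_bounded_lipschitz R (fun s => f (s *: v + x)) (fun s => 'D_v f (s *: v + x)) 0 1 B ler01.
rewrite scale1r scale0r add0r subr0 mulr1; apply=> // s s01.
exact/is_derive_line/df.
Qed.

(** Each of the two mean value estimates costs the full bound, whence [B] instead of [B / 2]. *)
Lemma taylor2_le V (f : V -> R) x v B :
  (forall s, 0 <= s <= 1 -> derivable f (s *: v + x) v) ->
  (forall s, 0 <= s <= 1 -> derivable ('D_v f) (s *: v + x) v) ->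
  (forall s, 0 <= s <= 1 -> `|'D_v ('D_v f) (s *: v + x)| <= B) ->
  `|f (v + x) - f x - 'D_v f x| <= B.
Proof.
move=> df ddf fB.
have B0 : 0 <= B by apply: le_trans (fB 0 _) => //; rewrite lexx ler01.
have := @derive_bounded_lipschitz R (fun s => f (s *: v + x) - s * 'D_v f x)
  (fun s => 'D_v f (s *: v + x) - 'D_v f x) 0 1 B ler01.
rewrite scale1r scale0r !add0r !mul0r mul1r !subr0 mulr1 addrAC; apply=> s s01.
  have := is_derive_line (df s s01) => dfs.
  have dm : is_derive s 1 (fun s => s * 'D_v f x) ('D_v f x).
    by apply: is_derive_eq; rewrite /GRing.scale/= mulr0 add0r mulr1.
  exact: is_deriveB.
have s0 : 0 <= s by lra.
have := @derive_bounded_lipschitz R (fun s => 'D_v f (s *: v + x)) (fun s => 'D_v ('D_v f) (s *: v + x)) 0 s B s0.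
rewrite scale0r add0r => h; apply: le_trans (h _ _) _.
- by move=> r r0s; apply/is_derive_line/ddf; lra.
- by move=> r r0s; apply/fB; lra.
- by rewrite subr0 ler_piMr//; lra.
Qed.

(** Two monotonicity arguments keep the constant [a / 2]; the case [a = 0] is the gradient
    inequality of convex functions. *)
Lemma taylor2_ge V (f : V -> R) x v a :
  (forall s, 0 <= s <= 1 -> derivable f (s *: v + x) v) ->
  (forall s, 0 <= s <= 1 -> derivable ('D_v f) (s *: v + x) v) ->
  (forall s, 0 <= s <= 1 -> a <= 'D_v ('D_v f) (s *: v + x)) ->
  f x + 'D_v f x + a / 2 <= f (v + x).
Proof.
move=> df ddf fB.
pose F s : R := - (f (s *: v + x) - s * 'D_v f x - a / 2 * s ^+ 2).
suff : F 1 <= F 0.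
  rewrite /F scale1r scale0r add0r mul0r mul1r expr1n mulr1 expr0n /= mulr0; lra.
apply: (@derive_le0_nincr _ F (fun s => - ('D_v f (s *: v + x) - 'D_v f x - a * s)) _ _ ler01).
  move=> s s01; have := is_derive_line (df s s01) => dfs.
  have dm : is_derive s 1 (fun s => s * 'D_v f x) ('D_v f x).
    by apply: is_derive_eq; rewrite /GRing.scale/= mulr0 add0r mulr1.
  have dm2 : is_derive s 1 (fun s => a / 2 * s ^+ 2) (a * s).
    by apply: is_derive_eq; rewrite /GRing.scale/=; field.
  by apply: is_deriveN; apply: is_deriveB; apply: is_deriveB.
move=> s s01; rewrite oppr_le0.
have s0 : 0 <= s by lra.
pose G s : R := - ('D_v f (s *: v + x) - a * s).
suff : G s <= G 0 by rewrite /G scale0r add0r; lra.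
apply: (@derive_le0_nincr _ G (fun s => - ('D_v ('D_v f) (s *: v + x) - a)) _ _ s0).
  move=> r r0s; have r01 : 0 <= r <= 1 by lra.
  have := is_derive_line (ddf r r01) => dfs.
  have dm : is_derive r 1 (fun s => a * s) a.
    by apply: is_derive_eq; rewrite /GRing.scale/= mulr1.
  by apply: is_deriveN; apply: is_deriveB.
by move=> r r0s; have := fB r (ltac:(lra)); lra.
Qed.

(** The mean value theorem is applied in the direction [a] to the increment of [f] along [b], then
    in the direction [b] to ['D_a f]. The second difference itself is symmetric in [a] and [b]. *)
Lemma second_difference V (U : set V) (f : V -> R) x a b e : open U -> Ck 2 U f ->
  U x -> 0 < e -> exists2 d, 0 < d & forall h, 0 < h < d ->
  `|f (h *: a + (h *: b + x)) - f (h *: b + x) - (f (h *: a + x) - f x) - h ^+ 2 * 'D_b ('D_a f) x| <= e * h ^+ 2.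
Proof.
move=> oU [df Df] Ux e0.
have [dDa Cba] := Df a.
have : \forall y \near x, U y /\ `|'D_b ('D_a f) x - 'D_b ('D_a f) y| < e.
  near=> y; split; first by near: y; exact: open_near.
  by near: y; have /cvgrPdist_lt := Cba b x Ux; apply.
move=> /nbhs_normP[r /= r0 hr].
have ab0 : 0 < `|a| + `|b| + 1 by rewrite ltr_wpDl ?addr_ge0.
exists (r / (`|a| + `|b| + 1)); first by rewrite divr_gt0.
move=> h /andP[h0 hd].
have inU s t : 0 <= s <= h -> 0 <= t <= h -> U (s *: a + (t *: b + x)) /\
    `|'D_b ('D_a f) x - 'D_b ('D_a f) (s *: a + (t *: b + x))| < e.
  move=> s0h t0h; apply: hr; rewrite /ball_/= addrA opprD addrCA subrr addr0 normrN.
  rewrite (le_lt_trans (ler_normD _ _))// !normrZ !ger0_norm; try lra.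
  apply: (@le_lt_trans _ _ (h * (`|a| + `|b| + 1))); last by rewrite -ltr_pdivlMr.
  rewrite !mulrDr mulr1 -addrA lerD ?ler_wpM2r//; try lra.
  by rewrite ler_wpDr ?ler_wpM2r//; lra.
have [|c c0h Ec] := @MVT_closed R (fun s => f (s *: a + (h *: b + x)) - f (s *: a + x))
  (fun s => 'D_a f (s *: a + (h *: b + x)) - 'D_a f (s *: a + x)) 0 h (ltW h0).
  move=> s s0h; apply: is_deriveB; apply: is_derive_line; apply/diff_derivable/df.
    by have [] := inU s h s0h (ltac:(lra)).
  by have [] := inU s 0 s0h (ltac:(lra)); rewrite scale0r add0r.
have [|t t0h Et] := @MVT_closed R (fun t => 'D_a f (t *: b + (c *: a + x)))
  (fun t => 'D_b ('D_a f) (t *: b + (c *: a + x))) 0 h (ltW h0).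
  move=> t t0h; apply: is_derive_line; apply/diff_derivable/dDa.
  by rewrite addrCA; have [] := inU c t c0h t0h.
rewrite !scale0r !add0r subr0 in Ec Et.
have -> : f (h *: a + (h *: b + x)) - f (h *: b + x) - (f (h *: a + x) - f x) =
    f (h *: a + (h *: b + x)) - f (h *: a + x) - (f (h *: b + x) - f x) by ring.
rewrite Ec (addrCA (c *: a)) Et (addrCA (t *: b)) -mulrA -expr2 mulrC -mulrBr normrM.
rewrite ger0_norm ?sqr_ge0// mulrC ler_wpM2r ?sqr_ge0// distrC ltW//.
by have [] := inU c t c0h t0h.
Unshelve. all: by end_near. Qed.

(** Both mixed derivatives approximate the same second difference, each up to [e / 3] after division
    by [h ^+ 2]. *)
Lemma derive_sym V (U : set V) (f : V -> R) x a b : open U -> Ck 2 U f -> U x ->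
  'D_a ('D_b f) x = 'D_b ('D_a f) x.
Proof.
move=> oU Cf Ux; apply/eqP; rewrite -subr_eq0 -normr_le0.
apply/ler_addgt0Pr => e e0; rewrite add0r.
have e20 : 0 < e / 3 by lra.
have [d d0 hd] := second_difference a b oU Cf Ux e20.
have [c c0 hc] := second_difference b a oU Cf Ux e20.
pose h := Num.min d c / 2.
have [h0 hd' hc'] : [/\ 0 < h, h < d & h < c].
  have m0 : 0 < Num.min d c by rewrite lt_min d0.
  have [m1 m2] : Num.min d c <= d /\ Num.min d c <= c by rewrite !ge_min !lexx orbT.
  rewrite /h; split; lra.
have h20 : 0 < h ^+ 2 by rewrite exprn_gt0.
rewrite -(ler_pM2r h20) -[X in _ * X <= _]ger0_norm ?ltW// -normrM.
have := hd h (ltac:(by rewrite h0)); have := hc h (ltac:(by rewrite h0)).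
rewrite (addrCA (h *: b)).
move: h20 ('D_a ('D_b f) x) ('D_b ('D_a f) x) (f (h *: a + (h *: b + x))) (f (h *: a + x))
  (f (h *: b + x)) (f x) => + p q A B C D; move: (h ^+ 2) => k k0.
by rewrite ler_norml => /andP[? ?]; rewrite ler_norml => /andP[? ?]; rewrite ?ltr_norml ?ler_norml; nra.
Qed.

Lemma derive_sym_mx V m n (U : set V) (f : V -> 'M[R]_(m, n)) x a b : open U -> Ck 2 U f -> U x ->
  'D_a ('D_b f) x = 'D_b ('D_a f) x.
Proof.
move=> oU Cf Ux.
have E c d : 'D_c ('D_d f) x = \matrix_(i, j) 'D_c ('D_d (fun y => f y i j)) x.
  have [df Df] := Cf; have [dD _] := Df d.
  rewrite derive_mx; last exact/diff_derivable/dD.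
  apply/matrixP => i j; rewrite !mxE; apply: near_eq_derive.
  near=> y; rewrite derive_mx ?mxE//; apply/diff_derivable/df.
  by near: y; exact: open_near.
rewrite !E; apply/matrixP => i j; rewrite [LHS]mxE [RHS]mxE.
apply: (@derive_sym _ U (fun y => f y i j) x a b oU _ Ux).
exact: Ck_coord.
Unshelve. all: by end_near. Qed.

End taylor.

(** * Charts *)

Section circle_topology.
Context {R : realType}.
Implicit Types s t : R.

Lemma circle_of_eq s t : circle_of s = circle_of t <-> s - t \is a Num.int.
Proof.
rewrite -[s - t \is a Num.int]/(circle_equiv s t); split => [h|h].
  exact/eqmodP.
by move/eqmodP : h.
Qed.

Lemma circle_of_continuous : continuous (@circle_of R).
Proof. exact: pi_continuous. Qed.

Lemma circle_of_addn t (k : int) : circle_of (t + k%:~R) = circle_of t.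
Proof. by apply/circle_of_eq; rewrite addrAC subrr add0r intr_int. Qed.

Lemma circle_of_open_map (A : set R) : open A -> open (@circle_of R @` A).
Proof.
move=> oA.
suff : open (@circle_of R @^-1` (@circle_of R @` A)) by [].
rewrite openE => s [a Aa] /esym sa; rewrite /interior/=.
move/circle_of_eq : sa => sa.
have : \forall s' \near s, A (s' - (s - a)).
  have cf : {for s, continuous (fun s' : R => s' - (s - a))}.
    by apply: cvgB; [exact: cvg_id|exact: cvg_cst].
  apply: cf; rewrite opprB addrCA subrr addr0.
  exact: open_near.
apply: filterS => s' As'; exists (s' - (s - a)) => //.
by apply/circle_of_eq; rewrite addrAC subrr sub0r rpredN.
Qed.

Lemma near_circle (T : topologicalType) (x : T) t (P : T * circle R -> Prop) :
  (\forall z \near (x, t), P (z.1, circle_of z.2)) ->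
  \forall z \near (x, circle_of t), P z.
Proof.
move=> [[A B] [/= nA nB] AB].
exists (A, @circle_of R @` interior B) => /=.
  split=> //; apply: open_near; last by exists t => //; exact: nbhs_singleton (nbhs_interior nB).
  exact/circle_of_open_map/open_interior.
move=> [y _] /= [Ay [s Bs <-]]; apply: (AB (y, s)); split => //=.
exact: interior_subset.
Qed.

End circle_topology.

Section charts.
Context {R : realType} {n : nat} {M : smooth_manifold R n}.
Local Notation E := 'rV[R]_n.
Implicit Types (c : chart R n M) (x : M) (y w : E).

Lemma open_chart_target c : open (chart_target c).
Proof. exact: chart_target_open. Qed.

Lemma chart_invK c y : chart_target c y ->
  chart_source c (chart_inv c y) /\ chart_map c (chart_inv c y) = y.
Proof. by move=> [x cx <-]; rewrite chart_mapK ?inE. Qed.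

Lemma chart_map_target c x : chart_source c x -> chart_target c (chart_map c x).
Proof. by move=> cx; exists x. Qed.

Lemma chart_map_cvg c x : chart_source c x -> {for x, continuous (chart_map c)}.
Proof.
move=> cx; have := @chart_map_continuous _ _ _ c.
by rewrite continuous_open_subspace; [apply; rewrite inE|exact: chart_source_open].
Qed.

Lemma chart_inv_cvg c y : chart_target c y -> {for y, continuous (chart_inv c)}.
Proof.
move=> cy; have := @chart_inv_continuous _ _ _ c.
by rewrite continuous_open_subspace; [apply; rewrite inE|exact: chart_target_open].
Qed.

Definition overlap c c' : set E := chart_target c `&` chart_inv c @^-1` chart_source c'.

Lemma overlapE c c' :
  chart_map c @` (chart_source c `&` chart_source c') = overlap c c'.
Proof.
apply/seteqP; split => [_ [x [cx c'x] <-]|y [cy c'y]].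
  by split; [exact: chart_map_target|rewrite /= chart_mapK ?inE].
by have [cy' E] := chart_invK cy; exists (chart_inv c y).
Qed.

Lemma open_overlap c c' : open (overlap c c').
Proof.
rewrite openE => y [cy c'y]; rewrite /interior /overlap.
apply: filterI; first exact: (open_near (@open_chart_target c) cy).
apply: (chart_inv_cvg cy); apply: open_near => //; exact: chart_source_open.
Qed.

Definition transition c c' : E -> E := chart_map c' \o chart_inv c.

Lemma overlap_transition c c' y : overlap c c' y -> overlap c' c (transition c c' y).
Proof.
move=> [cy c'y]; split; first exact: chart_map_target.
by rewrite /= /transition/= chart_mapK ?inE//; have [] := chart_invK cy.
Qed.

Lemma transitionK c c' y : overlap c c' y -> transition c' c (transition c c' y) = y.
Proof.
move=> [cy c'y]; rewrite /transition/= chart_mapK ?inE//.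
by have [] := chart_invK cy.
Qed.

Lemma chart_inv_transition c c' y : overlap c c' y ->
  chart_inv c' (transition c c' y) = chart_inv c y.
Proof. by move=> [cy c'y]; rewrite /transition/= chart_mapK ?inE. Qed.

Section atlas_charts.
Variables (c c' : chart R n M).
Hypotheses (ac : atlas c) (ac' : atlas c').

Lemma transition_Ck k : Ck k (overlap c c') (transition c c').
Proof. by have := atlas_compatible ac ac'; rewrite overlapE; exact. Qed.

Lemma transition_differentiable y : overlap c c' y -> differentiable (transition c c') y.
Proof. by have [df _] := transition_Ck 1; exact: df. Qed.

End atlas_charts.

Lemma tangent_ofE c y w : atlas c -> chart_target c y ->
  tangent_of c y w = 'D_w (transition c (chart_at (chart_inv c y))) y.
Proof.
move=> ac cy; rewrite deriveE//; apply: transition_differentiable => //.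
  exact: atlas_chart_at.
by split => //=; exact: source_chart_at.
Qed.

Lemma derive_transition c c' c'' y w : atlas c -> atlas c' -> atlas c'' ->
  overlap c c' y -> overlap c c'' y ->
  'D_('D_w (transition c c') y) (transition c' c'') (transition c c' y) =
  'D_w (transition c c'') y.
Proof.
move=> ac ac' ac'' cc'y cc''y.
have c'c''y : overlap c' c'' (transition c c' y).
  split; first by have [] := overlap_transition cc'y.
  by rewrite /= chart_inv_transition//; have [] := cc''y.
rewrite -derive_compE; [|exact: transition_differentiable|exact: transition_differentiable].
apply: near_eq_derive; near=> z.
have cc'z : overlap c c' z by near: z; apply: open_near => //; exact: open_overlap.
by rewrite /= {1}/transition /= chart_inv_transition.
Unshelve. all: by end_near. Qed.

Lemma derive_transition_id c y w : atlas c -> chart_target c y ->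
  'D_w (transition c c) y = w.
Proof.
move=> ac cy; rewrite (@near_eq_derive _ _ _ _ id) ?derive_id//.
near=> z; have cz : chart_target c z by near: z; apply: open_near => //; exact: open_chart_target.
by rewrite /transition/=; have [] := chart_invK cz.
Unshelve. all: by end_near. Qed.

Lemma derive_transitionK c c' y w : atlas c -> atlas c' -> overlap c c' y ->
  'D_('D_w (transition c c') y) (transition c' c) (transition c c' y) = w.
Proof.
move=> ac ac' cc'y; have cy : chart_target c y by have [] := cc'y.
rewrite derive_transition// ?derive_transition_id//.
by split => //=; have [] := chart_invK cy.
Qed.

(** Both sides pass to the same chart [chart_at] of the common point, and the chain rule
    [derive_transition] identifies them. Hence [lagrangian_in] may be computed in any chart of the
    atlas. *)
Lemma tangent_of_transition c c' y w : atlas c -> atlas c' -> overlap c c' y ->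
  tangent_of c' (transition c c' y) ('D_w (transition c c') y) = tangent_of c y w.
Proof.
move=> ac ac' cc'y; have [cy c'y] := cc'y.
have := overlap_transition cc'y => -[c'y' _].
rewrite (tangent_ofE _ ac' c'y') (tangent_ofE _ ac cy) (chart_inv_transition cc'y).
apply: derive_transition => //; first exact: atlas_chart_at.
by split => //=; exact: source_chart_at.
Qed.

Lemma tangent_of_chart_at x w : tangent_of (chart_at x) (chart_map (chart_at x) x) w = w.
Proof.
have xx := source_chart_at x; have ax := atlas_chart_at x.
have tx := chart_map_target xx.
by rewrite tangent_ofE// chart_mapK ?inE// derive_transition_id.
Qed.

Lemma tangent_of_surj c y v : atlas c -> chart_target c y ->
  exists w, tangent_of c y w = v.
Proof.
move=> ac cy; pose c' := chart_at (chart_inv c y).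
have ac' : atlas c' := atlas_chart_at _.
have cc'y : overlap c c' y by split => //=; exact: source_chart_at.
exists ('D_v (transition c' c) (transition c c' y)).
have := derive_transitionK v ac' ac (overlap_transition cc'y).
by rewrite tangent_ofE// (transitionK cc'y).
Qed.

Lemma tangent_of_linear c y : linear (tangent_of c y).
Proof. by move=> a v w; rewrite /tangent_of linearP. Qed.

Lemma tangent_of_eq0 c y w : atlas c -> chart_target c y ->
  tangent_of c y w = 0 -> w = 0.
Proof.
move=> ac cy; pose c' := chart_at (chart_inv c y).
have ac' : atlas c' := atlas_chart_at _.
have cc'y : overlap c c' y by split => //=; exact: source_chart_at.
rewrite tangent_ofE// -/c' => E0.
by rewrite -(derive_transitionK w ac ac' cc'y) E0 derive0.
Qed.

Lemma near_curve_source c (gamma : R -> M) s : {for s, continuous gamma} ->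
  chart_source c (gamma s) -> \forall r \near s, chart_source c (gamma r).
Proof. by move=> cg cs; apply: cg; apply: open_near => //; exact: chart_source_open. Qed.

Lemma velocityE c (gamma : R -> M) s : atlas c -> {for s, continuous gamma} ->
  chart_source c (gamma s) -> derivable (chart_map c \o gamma) s 1 ->
  velocity gamma s = tangent_of c (chart_map c (gamma s)) (derive1 (chart_map c \o gamma) s).
Proof.
move=> ac cg cs dq; have tc := chart_map_target cs.
rewrite (tangent_ofE _ ac tc) chart_mapK ?inE; last by [].
set c' := chart_at _.
have ac' : atlas c' := atlas_chart_at _.
have cc' : overlap c c' (chart_map c (gamma s)).
  by split => //=; rewrite chart_mapK ?inE//; exact: source_chart_at.
rewrite derive1E -derive_compE; last exact: transition_differentiable.
  rewrite /velocity derive1E; apply: near_eq_derive; near=> r.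
  rewrite /= /transition/= chart_mapK// inE; near: r; exact: near_curve_source.
exact/derivable1_diffP.
Unshelve. all: by end_near. Qed.

Lemma lagrangian_in_transition (L : M -> E -> R -> R) c c' y w t :
  atlas c -> atlas c' -> overlap c c' y ->
  lagrangian_in L c' (transition c c' y) ('D_w (transition c c') y) t =
  lagrangian_in L c y w t.
Proof.
by move=> ac ac' cc'; rewrite /lagrangian_in tangent_of_transition// chart_inv_transition.
Qed.

Lemma lagrangian_in_velocity (L : M -> E -> R -> R) c (gamma : R -> M) s :
  atlas c -> {for s, continuous gamma} ->
  chart_source c (gamma s) -> derivable (chart_map c \o gamma) s 1 ->
  L (gamma s) (velocity gamma s) s =
  lagrangian_in L c (chart_map c (gamma s)) (derive1 (chart_map c \o gamma) s) s.
Proof.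
by move=> ac cg cs dq; rewrite /lagrangian_in chart_mapK ?inE// -velocityE.
Qed.

Lemma open_curve_source c (gamma : R -> M) (I : set R) : open I ->
  (forall s, I s -> {for s, continuous gamma}) ->
  open (I `&` gamma @^-1` chart_source c).
Proof.
move=> oI cg; rewrite openE => s [Is cs]; apply: filterI; first exact: open_near.
by apply: near_curve_source => //; exact: cg.
Qed.

Lemma curve_Ck_chart c (q : R -> E) k (I : set R) : atlas c -> open I ->
  (forall s, I s -> chart_target c (q s)) -> Ck k I q ->
  curve_Ck k I (chart_inv c \o q).
Proof.
move=> ac oI cq Cq.
have cg s : I s -> {for s, continuous (chart_inv c \o q)}.
  move=> Is; apply: continuous_comp; first exact: Ck_continuous Cq _ Is.
  exact/chart_inv_cvg/cq.
split => // c' ac'.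
have oI' := open_curve_source (c := c') oI cg.
apply: (@Ck_comp _ _ _ _ _ _ _ (overlap c c') q (transition c c')).
- exact: finite_dim_row.
- exact: oI'.
- exact: open_overlap.
- by move=> s [Is c's]; split => //; exact: cq.
- by apply: Ck_subset Cq => s [].
- exact: transition_Ck.
Qed.

End charts.

(** * Euclidean products, closed balls and cut-off functions in coordinates *)

Section dot_product.
Context {R : realType} {n : nat}.
Local Notation E := 'rV[R]_n.
Implicit Types (y z : E).

(** The norm of rows is the sup norm, which is not differentiable; penalisations and energies use
    this product, and [sqr_norm_le_dot] and [dot_sqr_le] compare the two. *)
Definition dot y z : R := \sum_(i < n) y 0 i * z 0 i.

Lemma dotC y z : dot y z = dot z y.
Proof. by apply: eq_bigr => i _; rewrite mulrC. Qed.

Lemma dotDl y y' z : dot (y + y') z = dot y z + dot y' z.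
Proof. by rewrite -big_split/=; apply: eq_bigr => i _; rewrite !mxE mulrDl. Qed.

Lemma dotZl (k : R) y z : dot (k *: y) z = k * dot y z.
Proof. by rewrite mulr_sumr; apply: eq_bigr => i _; rewrite !mxE mulrA. Qed.

Lemma dotNl y z : dot (- y) z = - dot y z.
Proof. by rewrite -scaleN1r dotZl mulN1r. Qed.

Lemma dotDr y z z' : dot y (z + z') = dot y z + dot y z'.
Proof. by rewrite !(dotC y) dotDl. Qed.

Lemma dotZr (k : R) y z : dot y (k *: z) = k * dot y z.
Proof. by rewrite !(dotC y) dotZl. Qed.

Lemma dotNr y z : dot y (- z) = - dot y z.
Proof. by rewrite !(dotC y) dotNl. Qed.

Lemma dotBr y z z' : dot y (z - z') = dot y z - dot y z'.
Proof. by rewrite dotDr dotNr. Qed.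

Lemma dot0l z : dot 0 z = 0.
Proof. by rewrite -(scale0r 0) dotZl mul0r. Qed.

Lemma dot0r z : dot z 0 = 0.
Proof. by rewrite dotC dot0l. Qed.

Lemma dot_ge0 z : 0 <= dot z z.
Proof. by apply: sumr_ge0 => i _; rewrite -expr2 sqr_ge0. Qed.

Lemma sqr_norm_le_dot z : `|z| ^+ 2 <= dot z z.
Proof.
have [z0|z0] := eqVneq (mx_norm z) 0.
  by rewrite [X in X ^+ 2]z0 expr0n/= dot_ge0.
have [[i j] /= zE] := mx_norm_neq0 z0.
rewrite [X in X ^+ 2]zE (ord1 i) real_normK ?num_real// /dot (bigD1 j)//= expr2 lerDl.
by apply: sumr_ge0 => k _; rewrite -expr2 sqr_ge0.
Qed.

Lemma dot_le_norm y z : `|dot y z| <= n%:R * (`|y| * `|z|).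
Proof.
rewrite (le_trans (ler_norm_sum _ _ _))//.
rewrite (@le_trans _ _ (\sum_(i < n) `|y| * `|z|))//.
  by apply: ler_sum => i _; rewrite normrM ler_pM// mx_norm_coord.
by rewrite sumr_const card_ord mulr_natl.
Qed.

Lemma dot_sqr_le z : dot z z <= n%:R * `|z| ^+ 2.
Proof. by rewrite (le_trans (ler_norm _))// dot_le_norm. Qed.

Lemma Ck_dot (V : normedModType R) k (U : set V) (f g : V -> E) : open U ->
  Ck k U f -> Ck k U g -> Ck k U (fun x => dot (f x) (g x)).
Proof.
move=> oU Cf Cg.
have -> : (fun x => dot (f x) (g x)) =
    \sum_(i < n) ((fun x => f x 0 i) * (fun x => g x 0 i)).
  by apply/funext => x; rewrite fct_sumE.
by apply: Ck_sum => // i _; apply: CkM => //; exact: Ck_coord.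
Qed.

Lemma is_derive_dot (f g : R -> E) (df dg : E) (s : R) :
  is_derive s 1 f df -> is_derive s 1 g dg ->
  is_derive s 1 (fun s => dot (f s) (g s)) (dot df (g s) + dot (f s) dg).
Proof.
move=> [f1 fE] [g1 gE].
have fi i : is_derive s 1 (fun s => f s 0 i) (df 0 i).
  apply: DeriveDef; first by move/derivable_mxP : f1; exact.
  by rewrite -fE (derive_mx f1) [RHS]mxE.
have gi i : is_derive s 1 (fun s => g s 0 i) (dg 0 i).
  apply: DeriveDef; first by move/derivable_mxP : g1; exact.
  by rewrite -gE (derive_mx g1) [RHS]mxE.
have -> : (fun s => dot (f s) (g s)) =
    \sum_(i < n) ((fun x => f x 0 i) * (fun x => g x 0 i)).
  by apply/funext => x; rewrite fct_sumE.
apply: is_derive_eq.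
rewrite /dot -big_split/=; apply: eq_bigr => i _.
by rewrite addrC; congr (_ + _); rewrite [LHS]mulrC.
Qed.

Lemma is_derive_dotr (f : R -> E) (df v : E) (s : R) :
  is_derive s 1 f df -> is_derive s 1 (fun s => dot (f s) v) (dot df v).
Proof.
move=> f1; have := is_derive_dot f1 (is_derive_cst v s 1).
by rewrite dot0r addr0.
Qed.

End dot_product.

Section closed_balls.
Context {R : realType}.

Lemma norm_sub_continuous (V : normedModType R) (y0 : V) : continuous (fun y => `|y - y0|).
Proof.
move=> y; apply: (@continuous_comp _ _ _ (fun y => y - y0) Num.norm).
  by apply: continuousB; [exact: cvg_id|exact: cst_continuous].
exact: norm_continuous.
Qed.

Lemma norm_ball_compact n (y0 : 'rV[R]_n) (r : R) : compact [set y | `|y - y0| <= r].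
Proof.
apply: bounded_closed_compact.
  exists (`|y0| + r); split; first by rewrite num_real.
  move=> m hm y /= hy; rewrite -[y](subrK y0) (le_trans (ler_normD _ _))//.
  by apply: le_trans (ltW hm); rewrite addrC lerD.
by move/continuous_closedP : (@norm_sub_continuous _ y0) => /(_ _ (@closed_le _ r)).
Qed.

End closed_balls.

Section cutoff.
Context {R : realType}.

(** C^1 without being C^2, which is the regularity asked of test functions; besides cut-offs it
    provides barriers in time that vanish up to a given instant. *)
Definition sqr_pos (x : R) : R := Num.max x 0 ^+ 2.

Lemma is_derive_quadratic (f : R -> R) (x l C : R) :
  (forall h, `|f (h + x) - f x - l * h| <= C * h ^+ 2) -> is_derive x 1 f l.
Proof.
move=> fC.
have C0 : 0 <= C.
  by have := le_trans (normr_ge0 _) (fC 1); rewrite expr1n (mulr1 C).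
have lim : h^-1 *: ((f \o shift x) (h *: 1) - f x) @[h --> 0^'] --> l.
  apply/cvgrPdist_le => e e0; near=> h.
  have h0 : h != 0 by near: h; exact: nbhs_dnbhs_neq.
  have -> : h *: 1 = h by rewrite /GRing.scale/= mulr1.
  rewrite /= distrC.
  have -> : h^-1 *: (f (h + x) - f x) - l = h^-1 * (f (h + x) - f x - l * h).
    by rewrite /GRing.scale/=; field.
  rewrite normrM normfV ler_pdivrMl ?normr_gt0// (le_trans (fC h))//.
  rewrite -real_normK ?num_real// expr2 mulrCA ler_wpM2l//.
  apply: (@le_trans _ _ ((C + 1) * `|h|)); first by rewrite ler_wpM2r// lerDl.
  rewrite -ler_pdivlMl ?ltr_wpDl// mulrC.
  near: h; apply: dnbhs0_le; rewrite divr_gt0// ltr_wpDl//.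
apply: DeriveDef; first by apply/cvg_ex; exists l.
exact/cvg_lim.
Unshelve. all: by end_near. Qed.

Lemma is_derive_sqr_pos (x : R) : is_derive x 1 sqr_pos (2 * Num.max x 0).
Proof.
apply: (@is_derive_quadratic _ _ _ 1) => h; rewrite mul1r /sqr_pos ler_norml.
by rewrite !maxEle; have [h1|h1] := leP (h + x) 0; have [h2|h2] := leP x 0; apply/andP; split; nra.
Qed.

Lemma Ck1_real (f df : R -> R) (U : set R) :
  (forall x, U x -> is_derive x 1 f (df x)) -> (forall x, U x -> {for x, continuous df}) ->
  open U -> Ck 1 U f.
Proof.
move=> fdf cdf oU; split=> [x /fdf[d _]|v]; first exact/derivable1_diffP.
apply: (@Ck_eq _ _ _ 0 _ (fun x => v *: df x)) => //.
  move=> x; rewrite inE => Ux; have [d E] := fdf x Ux.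
  have dx : differentiable f x by exact/derivable1_diffP.
  rewrite -E !deriveE//.
  have -> : 'd f x v = 'd f x (v *: 1) by congr ('d f x _); rewrite [RHS]mulr1.
  by rewrite [RHS]linearZ.
move=> x Ux; apply: (@continuousZ _ _ _ (fun=> v)); first exact: cst_continuous.
exact: cdf.
Qed.

Lemma sqr_pos_Ck1 : Ck 1 [set: R] sqr_pos.
Proof.
apply: (@Ck1_real _ (fun x => 2 * Num.max x 0)) => [x _|x _|]; first exact: is_derive_sqr_pos.
  apply: (@continuousM R R (fun=> 2) (fun x => Num.max x 0)); first exact: cst_continuous.
  by apply: continuous_max; [exact: cvg_id|exact: cst_continuous].
exact: openT.
Qed.

Definition cutoff (x : R) : R := sqr_pos (1 - sqr_pos x).

Lemma cutoff_Ck1 : Ck 1 [set: R] cutoff.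
Proof.
apply: (@Ck_compR _ _ finite_dim_real _ _ [set: R] [set: R] (fun x => 1 - sqr_pos x)) => //.
- exact: openT.
- apply: CkB; [exact: openT|exact: Ck_cst|exact: sqr_pos_Ck1].
- exact: sqr_pos_Ck1.
Qed.

Lemma cutoff1 x : x <= 0 -> cutoff x = 1.
Proof.
by move=> x0; rewrite /cutoff /sqr_pos (max_r x0) expr0n/= subr0 max_l ?ler01// expr1n.
Qed.

Lemma cutoff0 x : 1 <= x -> cutoff x = 0.
Proof.
move=> x1; rewrite /cutoff /sqr_pos (@max_l _ _ x); last exact: le_trans x1.
by rewrite max_r ?expr0n// subr_le0 -[1](expr1n _ 2) lerXn2r ?nnegrE// (le_trans _ x1).
Qed.

End cutoff.

(** * Test functions and local viscosity inequalities *)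

Section test_functions.
Context {R : realType} {n : nat} {M : smooth_manifold R n}.
Local Notation E := 'rV[R]_n.
Implicit Types (c : chart R n M) (x : M) (y w : E).

(** The representative of [tau] in [t0 - 1/2, t0 + 1/2). *)
Definition local_lift (t0 : R) (tau : circle R) : R :=
  let t := repr tau in t - (Num.floor (t - t0 + 2^-1))%:~R.

Lemma circle_of_lift (t0 : R) tau : circle_of (local_lift t0 tau) = tau.
Proof.
rewrite /local_lift -mulrNz circle_of_addn.
by rewrite /circle_of reprK.
Qed.

Lemma local_lift_dist (t0 : R) tau : `|local_lift t0 tau - t0| <= 2^-1.
Proof.
rewrite /local_lift; set t := repr tau.
have := Num.Theory.floor_le_tmp (t - t0 + 2^-1); have := Num.Theory.floorD1_gt (t - t0 + 2^-1).
rewrite intrD; move: (Num.floor _)%:~R => k; rewrite ler_norml => *.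
apply/andP; split; lra.
Qed.

Definition sqdist (z0 z : E * R) : R := dot (z.1 - z0.1) (z.1 - z0.1) + (z.2 - z0.2) ^+ 2.

Lemma sqdist_Ck z0 k U : open U -> Ck k U (sqdist z0).
Proof.
move=> oU.
have C1 : Ck k U (fun z : E * R => z.1 - z0.1).
  by apply: CkB => //; [apply: Ck_fst => //; exact: Ck_id|exact: Ck_cst].
have C2 : Ck k U (fun z : E * R => z.2 - z0.2).
  by apply: CkB => //; [apply: Ck_snd => //; exact: Ck_id|exact: Ck_cst].
have -> : sqdist z0 = (fun z => dot (z.1 - z0.1) (z.1 - z0.1)) +
    ((fun z => z.2 - z0.2) * (fun z => z.2 - z0.2)).
  by apply/funext => z; rewrite /sqdist expr2.
by apply: CkD => //; [exact: Ck_dot|exact: CkM].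
Qed.

Lemma sqdist_continuous z0 : continuous (sqdist z0).
Proof. by move=> z; apply: (@sqdist_Ck z0 0 setT openT). Qed.

Lemma norm_le_sqdist z0 z r : 0 <= r -> sqdist z0 z <= r ^+ 2 ->
  `|z.1 - z0.1| <= r /\ `|z.2 - z0.2| <= r.
Proof.
move=> r0 h; have := sqr_norm_le_dot (z.1 - z0.1); have := dot_ge0 (z.1 - z0.1).
move: h; rewrite /sqdist => h d0 d1.
have d2 := sqr_ge0 (z.2 - z0.2).
by split; rewrite -(@ler_pXn2r _ 2)// ?nnegrE ?real_normK ?num_real//; lra.
Qed.

(* The chart domain is embedded in [M * circle]; a function that is C^1 near one
   point of it is cut off there and extended by zero, the lift of the circle
   being chosen in the unit interval centred at the base time. *)
Lemma test_function_extension c (V : set (E * R)) (f : E * R -> R) z0 : atlas c ->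
  open V -> Ck 1 V f -> V z0 -> chart_target c z0.1 ->
  exists2 phi : M * circle R -> R, C1_test phi &
    \forall z \near z0, phi (chart_inv c z.1, circle_of z.2) = f z.
Proof.
move=> ac oV Cf Vz0 cz0.
(* A radius below 1/2 makes the support of the cut-off fit inside one period around [z0.2]. *)
have [r [r0 r2 hr]] : exists r : R, [/\ 0 < r, r < 2^-1 &
    forall z, `|z.1 - z0.1| <= r -> `|z.2 - z0.2| <= r -> V z /\ chart_target c z.1].
  have : \forall z \near z0, V z /\ chart_target c z.1.
    apply: filterI; first exact: open_near.
    exact: (cvg_fst (open_near (@open_chart_target _ _ _ c) cz0)).
  move=> /nbhs_normP[e /= e0 he].
  exists (Num.min e 2^-1 / 2); have [m1 m2 m3] : [/\ 0 < Num.min e 2^-1, Num.min e 2^-1 <= e & Num.min e 2^-1 <= 2^-1].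
    by rewrite lt_min e0/= !ge_min !lexx orbT; split => //; lra.
  split; [lra|lra|move=> z h1 h2; apply: he].
  by rewrite /ball_/= distrC prod_normE gt_max/=; apply/andP; split; lra.
pose rho z := cutoff ((sqdist z0 z - r ^+ 2 / 2) / (r ^+ 2 / 2)).
have r22 : 0 < r ^+ 2 / 2 by rewrite divr_gt0 ?exprn_gt0.
have rho0 z : r ^+ 2 <= sqdist z0 z -> rho z = 0.
  by move=> h; apply: cutoff0; rewrite ler_pdivlMr//; lra.
have rho1 z : sqdist z0 z <= r ^+ 2 / 2 -> rho z = 1.
  by move=> h; apply: cutoff1; rewrite pmulr_lle0 ?invr_gt0// subr_le0.
have Crho : Ck 1 [set: E * R] rho.
  apply: (@Ck_compR _ _ finite_dim_real _ 1 [set: E * R] [set: R]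
    (fun z => (sqdist z0 z - r ^+ 2 / 2) / (r ^+ 2 / 2)) cutoff openT) => //; last exact: cutoff_Ck1.
  apply: (CkM openT (f := fun z => sqdist z0 z - r ^+ 2 / 2) (g := cst _)); last exact: Ck_cst.
  by apply: CkB (openT) _ (@Ck_cst _ _ _ _ _ _); exact: sqdist_Ck openT.
pose h z := if `[< V z >] then rho z * f z else 0.
have h0 z : r ^+ 2 <= sqdist z0 z -> h z = 0.
  by move=> /rho0 E0; rewrite /h; case: asboolP => // _; rewrite E0 mul0r.
have Ch : Ck 1 [set: E * R] h.
  apply: Ck_near => z _; have [zr|zr] := leP (sqdist z0 z) (r ^+ 2).
    have [] := norm_le_sqdist (ltW r0) zr => h1 h2; have [Vz _] := hr _ h1 h2.
    exists V; first exact: Vz.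
    apply: (Ck_eq (f := rho * f) oV).
      by move=> z'; rewrite inE /h => Vz'; case: asboolP.
    by apply: CkM Cf; [exact: oV|exact: Ck_subset Crho].
  have oW : open [set z | r ^+ 2 < sqdist z0 z].
    exact: (open_comp (fun z _ => @sqdist_continuous z0 z) (@open_gt _ (r ^+ 2))).
  exists [set z | r ^+ 2 < sqdist z0 z]; first exact: zr.
  apply: (Ck_eq (f := cst 0) oW); last exact: Ck_cst.
  by move=> z'; rewrite inE/= => /ltW/h0 ->.
have sqd2 z : 2^-1 <= `|z.2 - z0.2| -> r ^+ 2 <= sqdist z0 z.
  move=> hz; have := dot_ge0 (z.1 - z0.1); rewrite /sqdist.
  have : r ^+ 2 <= (z.2 - z0.2) ^+ 2.
    rewrite -[leRHS]real_normK ?num_real// lerXn2r ?nnegrE ?(ltW r0)//.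
    exact: le_trans (ltW r2) hz.
  lra.
(* If the lift differs from [t], it does so by at least 1; then both times are more than [r] away
   from [z0.2], where [h] vanishes. *)
have lift_h y t : `|t - z0.2| < 1 - r -> h (y, local_lift z0.2 (circle_of t)) = h (y, t).
  move=> ht; set t' := local_lift _ _.
  have /circle_of_eq/intrP[k kE] := circle_of_lift z0.2 (circle_of t).
  have ht' := local_lift_dist z0.2 (circle_of t).
  rewrite -/t' in kE ht'.
  have [k0|k0] := eqVneq k 0.
    by congr (h (_, _)); move: kE; rewrite k0; lra.
  have k1 : 1 <= `|t' - t|.
    by rewrite kE -intr_norm -[1]/(1%:~R) ler_int -gtz0_ge1 normr_gt0.
  rewrite !h0//; apply/ltW; rewrite /sqdist/=.
  - have : r ^+ 2 < (t - z0.2) ^+ 2.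
      rewrite -[ltRHS]real_normK ?num_real// ltrXn2r ?nnegrE ?(ltW r0)//.
      have := ler_normD (t' - z0.2) (z0.2 - t); rewrite addrA subrK distrC (distrC z0.2) => *.
      rewrite (distrC t' t) in k1; lra.
    by have := dot_ge0 (y - z0.1); lra.
  - have : r ^+ 2 < (t' - z0.2) ^+ 2.
      rewrite -[ltRHS]real_normK ?num_real// ltrXn2r ?nnegrE ?(ltW r0)//.
      have := ler_normD (t' - z0.2) (z0.2 - t); rewrite addrA subrK (distrC z0.2) => *.
      lra.
    by have := dot_ge0 (y - z0.1); lra.
pose phi (p : M * circle R) : R :=
  if `[< chart_source c p.1 >] then h (chart_map c p.1, local_lift z0.2 p.2) else 0.
have phiE y t : chart_target c y -> `|t - z0.2| < 1 - r ->
    phi (chart_inv c y, circle_of t) = h (y, t).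
  move=> cy ht; have [sy yE] := chart_invK cy; rewrite /phi/=; case: asboolP => // _.
  by rewrite yE lift_h.
exists phi; last first.
  have sq0 : sqdist z0 z0 < r ^+ 2 / 2 by rewrite /sqdist !subrr dot0l expr0n addr0.
  near=> z.
  have : V z by near: z; exact: open_near.
  have : sqdist z0 z < r ^+ 2 / 2 by near: z; exact: (@sqdist_continuous z0 z0 _ (lt_nbhsl sq0)).
  move=> sz Vz; have szr : sqdist z0 z <= r ^+ 2 by lra.
  have [h1 h2] := norm_le_sqdist (ltW r0) szr.
  have [_ cz] := hr _ h1 h2.
  rewrite phiE//; last by lra.
  by rewrite -surjective_pairing /h; case: asboolP => // _; rewrite rho1 ?mul1r// ltW.
move=> c' ac'; apply: Ck_near => -[y' t'] /= c'y'.
have oc' := @open_chart_target _ _ _ c'.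
have [cy'|cy'] := pselect (chart_source c (chart_inv c' y')).
  (* Subtracting [k] brings [t'] within 1/2 of [z0.2], hence strictly within [1 - r], where [phiE]
     describes [phi]. *)
  pose k := Num.floor (t' - z0.2 + 2^-1).
  have tk : `|t' - k%:~R - z0.2| < 1 - r.
    have := Num.Theory.floor_le_tmp (t' - z0.2 + 2^-1); have := Num.Theory.floorD1_gt (t' - z0.2 + 2^-1).
    rewrite -/k intrD; move: (k%:~R) => k'; rewrite ltr_norml => *.
    by apply/andP; split; lra.
  pose W := [set z : E * R | overlap c' c z.1] `&` [set z : E * R | `|z.2 - k%:~R - z0.2| < 1 - r].
  have oW : open W.
    apply: openI.
      exact: (open_comp (fun z _ => @cvg_fst E R (nbhs z.1) (nbhs z.2) _) (@open_overlap _ _ _ c' c)).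
    have cc : continuous (fun z : E * R => `|z.2 - k%:~R - z0.2|).
      move=> z; apply: cvg_norm; apply: cvgB; last exact: cvg_cst.
      by apply: cvgB; [exact: cvg_snd|exact: cvg_cst].
    exact: (open_comp (fun z _ => cc z) (@open_lt _ (1 - r))).
  exists W => //.
  apply: (@Ck_eq _ _ _ 1 W (h \o (fun z : E * R => (transition c' c z.1, z.2 - k%:~R))) _ oW).
    move=> z; rewrite inE => -[oz tz] /=.
    have [co _] := overlap_transition oz.
    by rewrite -phiE// chart_inv_transition// -mulrNz circle_of_addn.
  apply: (@Ck_compR _ _ (finite_dim_prod (finite_dim_row n) finite_dim_real) _ 1 W setT) => //.
  apply: Ck_pair => //.
    apply: (@Ck_comp _ _ _ _ _ _ W (overlap c' c) fst (transition c' c)) => //.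
    - exact: finite_dim_row.
    - exact: open_overlap.
    - by move=> z [].
    - by apply: Ck_fst => //; exact: Ck_id.
    - exact: transition_Ck.
  by apply: CkB => //; [apply: Ck_snd => //; exact: Ck_id|exact: Ck_cst].
(* At a point outside the chart [c] the function vanishes nearby: its support projects into the
   compact set [K], which is closed since M is Hausdorff and lies in the source of [c]. *)
pose K : set M := chart_inv c @` [set y | `|y - z0.1| <= r].
have Kc y : `|y - z0.1| <= r -> chart_target c y.
  by move=> hy; have [] := hr (y, z0.2) hy; rewrite ?subrr ?normr0// ltW.
have cK : compact K.
  apply: continuous_compact; last exact: norm_ball_compact.
  by apply: continuous_in_subspaceT => y; rewrite inE => /Kc/chart_inv_cvg.
have oK : open (~` K) by apply: closed_openC; apply: compact_closed cK; exact: manifold_hausdorff.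
pose W := [set z : E * R | (chart_target c' `&` chart_inv c' @^-1` (~` K)) z.1].
have oW : open W.
  have oU : open (chart_target c' `&` chart_inv c' @^-1` (~` K)).
    rewrite openE => y [cy Ky]; apply: filterI; first exact: (open_near oc' cy).
    by apply: (chart_inv_cvg cy); apply: open_near.
  exact: (open_comp (fun z _ => @cvg_fst E R (nbhs z.1) (nbhs z.2) _) oU).
exists W.
  split => //= -[y Ky yE]; apply: cy'; rewrite -yE; exact: (chart_invK (Kc _ Ky)).1.
apply: (@Ck_eq _ _ _ 1 W (cst 0) _ oW); last exact: Ck_cst.
move=> z; rewrite inE => -[c'z Kz] /=; rewrite /phi/=; case: asboolP => // cz.
rewrite h0//; apply/ltW; rewrite ltNge; apply/negP => /(norm_le_sqdist (ltW r0))/= [h1 _].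
apply: Kz; exists (chart_map c (chart_inv c' z.1)); first exact: h1.
by rewrite chart_mapK// inE.
Unshelve. all: by end_near. Qed.

End test_functions.

(** * The metric, the Hamiltonian and the viscosity inequalities in a chart *)

Section lagrangian_charts.
Context {R : realType} {n : nat} {M : smooth_manifold R n}.
Variables (g : riemannian_metric M) (L : M -> 'rV[R]_n -> R -> R).
Local Notation E := 'rV[R]_n.
Implicit Types (c : chart R n M) (x : M) (y w v : E) (t : R).

Lemma metric0l x w : metric g x 0 w = 0.
Proof. by have := metric_linear g x w 1 0 0; rewrite scale1r addr0 mul1r => h; lra. Qed.

Lemma metric_suml x w N (a : 'I_N -> R) (v : 'I_N -> E) :
  metric g x (\sum_(i < N) a i *: v i) w = \sum_(i < N) a i * metric g x (v i) w.
Proof.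
elim/big_rec2 : _ => [|i _ r _ <-]; first exact: metric0l.
by rewrite metric_linear.
Qed.

Definition metric_in c y w : R := metric g (chart_inv c y) (tangent_of c y w) (tangent_of c y w).

Lemma metric_inE c y w : metric_in c y w =
  \sum_(i < n) \sum_(j < n) w 0 i * (w 0 j * metric g (chart_inv c y)
    (tangent_of c y (delta_mx 0 i)) (tangent_of c y (delta_mx 0 j))).
Proof.
have T : tangent_of c y w = \sum_(i < n) w 0 i *: tangent_of c y (delta_mx 0 i).
  rewrite {1}(row_sum_delta w).
  by rewrite /tangent_of linear_sum; apply: eq_bigr => i _; rewrite linearZ.
rewrite /metric_in T metric_suml; apply: eq_bigr => i _.
rewrite Defs.metric_sym metric_suml mulr_sumr; apply: eq_bigr => j _.
by rewrite Defs.metric_sym.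
Qed.

Lemma metric_in_cvg c y w : atlas c -> chart_target c y ->
  {for (y, w), continuous (fun z : E * E => metric_in c z.1 z.2)}.
Proof.
move=> ac cy.
have -> : (fun z : E * E => metric_in c z.1 z.2) =
    \sum_(i < n) \sum_(j < n) (fun z : E * E => z.2 0 i * (z.2 0 j * metric g (chart_inv c z.1)
    (tangent_of c z.1 (delta_mx 0 i)) (tangent_of c z.1 (delta_mx 0 j)))).
  apply/funext => z; rewrite metric_inE fct_sumE; apply: eq_bigr => i _.
  by rewrite fct_sumE.
have cc i : {for (y, w), continuous (fun z : E * E => z.2 0 i)}.
  apply: (@continuous_comp _ _ _ snd (fun v : E => v 0 i)); first exact: cvg_snd.
  exact: coord_continuous.
rewrite /prop_for; elim/big_ind : _ => [|f h cf ch|i _]; [exact: cst_continuous|exact: continuousD|].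
elim/big_ind : _ => [|f h cf ch|j _]; [exact: cst_continuous|exact: continuousD|].
apply: (@continuousM _ _ (fun z : E * E => z.2 0 i)); first exact: cc.
apply: (@continuousM _ _ (fun z : E * E => z.2 0 j)); first exact: cc.
pose G y := metric g (chart_inv c y) (tangent_of c y (delta_mx 0 i)) (tangent_of c y (delta_mx 0 j)).
apply: (@continuous_comp _ _ _ fst G); first exact: cvg_fst.
have h : Ck 0%N (chart_target c) G := metric_smooth g ac _ _ 0%N.
exact: (h y cy).
Qed.

Lemma metric_inZ c y (k : R) w : metric_in c y (k *: w) = k ^+ 2 * metric_in c y w.
Proof.
rewrite !metric_inE mulr_sumr; apply: eq_bigr => i _; rewrite mulr_sumr; apply: eq_bigr => j _.
by rewrite !mxE; ring.
Qed.

(** By homogeneity a bound on the unit sphere is enough; there compactness makes the lower bound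
    uniform for [y] near [y0], at the cost of halving the minimum at [y0]. *)
Lemma metric_norm_lower c y0 : atlas c -> chart_target c y0 ->
  exists2 k : R, 0 < k & \forall y \near y0, forall w,
    k * `|w| <= metric_norm g (chart_inv c y) (tangent_of c y w).
Proof.
move=> ac cy0.
pose S : set E := [set w | `|w| = 1].
have cS : compact S.
  apply: (@subclosed_compact _ S [set w | `|w - 0| <= 1]).
  - have /continuous_closedP := @norm_continuous _ E; move=> /(_ _ (@closed_eq _ 1)); exact.
  - exact: norm_ball_compact.
  - by move=> w /= Sw; rewrite subr0 Sw.
(* The sphere is empty when [n = 0], in which case 0 is the only vector. *)
have [S0|S0] := pselect (S !=set0); last first.
  exists 1 => //; near=> y => w; suff -> : w = 0 by rewrite normr0 mulr0 sqrtr_ge0.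
  apply/eqP; rewrite -normr_eq0; apply/negPn/negP => w0; apply: S0.
  exists (`|w|^-1 *: w); rewrite /S/= normrZ normfV normr_id mulVf//.
have pos w : S w -> 0 < metric_in c y0 w.
  move=> Sw; apply: metric_pos; apply/eqP => /(tangent_of_eq0 ac cy0) w0.
  by move: Sw; rewrite /S/= w0 normr0 => /esym/eqP; rewrite oner_eq0.
have [w0 Sw0 mw0] : exists2 w0, S w0 & forall w, S w -> metric_in c y0 w0 <= metric_in c y0 w.
  have cQ : {within S, continuous (metric_in c y0)}.
    apply: continuous_subspaceT => w.
    apply: (@continuous_comp _ _ _ (fun w => (y0, w)) (fun z : E * E => metric_in c z.1 z.2)).
      by apply: continuous_pair; [exact: cst_continuous|exact: cvg_id].
    exact: metric_in_cvg.
  have [w0 Sw0 h] := compact_EVT_min S0 cS cQ; exists w0; first by rewrite inE in Sw0.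
  by move=> w Sw; apply: h; rewrite inE.
pose m := metric_in c y0 w0 / 2.
have m0 : 0 < m by rewrite divr_gt0// pos.
exists (Num.sqrt m); first by rewrite sqrtr_gt0.
have hn : \forall y \near y0, S `<=` (fun w => m < metric_in c y w).
  apply: ((compact_near_coveringP S).1 cS E (nbhs y0) (fun y w => m < metric_in c y w)) => w Sw.
  have mw : m < metric_in c y0 w by have := mw0 _ Sw; rewrite /m; have := pos _ Sw0; lra.
  have [[A B] /= [nA nB] AB] := @metric_in_cvg c y0 w ac cy0 _ (lt_nbhsr mw).
  by exists (B, A) => // -[w' y'] /= [Bw Ay]; exact: (AB (y', w')).
near=> y => w; have hA : S `<=` (fun w => m < metric_in c y w) by near: y.
have [->|w0'] := eqVneq w 0; first by rewrite normr0 mulr0 sqrtr_ge0.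
have nw0 : 0 < `|w| by rewrite normr_gt0.
have wE : w = `|w| *: (`|w|^-1 *: w) by rewrite scalerA divff ?scale1r// gt_eqF.
have Sw : S (`|w|^-1 *: w) by rewrite /S/= normrZ normfV normr_id mulVf// gt_eqF.
have mE : metric_in c y w = `|w| ^+ 2 * metric_in c y (`|w|^-1 *: w).
  by rewrite {1}wE metric_inZ.
rewrite -[metric_norm _ _ _]/(Num.sqrt (metric_in c y w)) mE.
rewrite (sqrtrM _ (sqr_ge0 `|w|)) sqrtr_sqr normr_id mulrC.
by rewrite ler_wpM2l// ler_wsqrtr// ltW// hA.
Unshelve. all: by end_near. Qed.

Hypothesis hL : tonelli L g.

Definition lag c (z : E * E * R) : R := lagrangian_in L c z.1.1 z.1.2 z.2.
Definition lag_dom c : set (E * E * R) := [set z | chart_target c z.1.1].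

Lemma open_lag_dom c : open (lag_dom c).
Proof.
have cf : continuous (fun z : E * E * R => z.1.1).
  by move=> z; apply: (@continuous_comp _ _ _ fst fst); exact: cvg_fst.
exact: (open_comp (fun z _ => cf z) (@open_chart_target _ _ _ c)).
Qed.

Lemma lag_Ck c k : atlas c -> Ck k (lag_dom c) (lag c).
Proof. by move=> ac; have [h _ _ _ _] := hL; exact: h. Qed.

(** This makes the [sup] in [hamiltonian] a true supremum. Superlinear growth at rate [|C| / k],
    with [k] the constant comparing the two norms, absorbs the linear term outside a ball, and
    continuity bounds the rest. *)
Lemma legendre_bounded c y t (C : R) : atlas c -> chart_target c y ->
  exists B, forall w, C * `|w| - lagrangian_in L c y w t <= B.
Proof.
move=> ac cy; have [_ _ _ hsup _] := hL.
have [k k0 /nbhs_singleton hk] := metric_norm_lower ac cy.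
pose A := `|C| / k.
have A0 : 0 <= A by rewrite divr_ge0// ltW.
have [B0 B00 hB0] := hsup A.
pose K : set E := [set w | `|w - 0| <= B0 / k].
have cl : {within K, continuous (fun w => lagrangian_in L c y w t)}.
  apply: continuous_subspaceT => w.
  apply: (@continuous_comp _ _ _ (fun w => (y, w, t)) (lag c)).
    by do 2?apply: continuous_pair; try exact: cst_continuous; exact: cvg_id.
  exact: (lag_Ck 0%N ac).
have K0 : K !=set0 by exists 0; rewrite /K/= subrr normr0 divr_ge0// ltW.
have [w0 _ hw0] := compact_EVT_min K0 (@norm_ball_compact _ _ _ _) cl.
exists (Num.max 0 (`|C| * (B0 / k) - lagrangian_in L c y w0 t)) => w.
have Cw : C * `|w| <= `|C| * `|w| by rewrite ler_wpM2r// ler_norm.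
rewrite le_max; have [h|h] := leP B0 (metric_norm g (chart_inv c y) (tangent_of c y w)).
  apply/orP; left.
  have N0 : 0 < metric_norm g (chart_inv c y) (tangent_of c y w) by exact: lt_le_trans h.
  have := hB0 _ _ t h; rewrite ler_pdivlMr// -/(lagrangian_in L c y w t) => h1.
  rewrite subr_le0 (le_trans Cw)// (le_trans _ h1)//.
  rewrite /A -mulrA ler_wpM2l// ler_pdivlMl//; exact: hk.
have wB : `|w| <= B0 / k by rewrite ler_pdivlMr// mulrC (le_trans (hk w))// ltW.
apply/orP; right; apply: lerB.
  by rewrite (le_trans Cw)// ler_wpM2l.
by apply: hw0; rewrite inE /K/= subr0.
Qed.

Section hamilton_jacobi_charts.
Variables (phi : M * circle R -> R) (Cphi : C1_test phi).

Definition test_in c (z : E * R) : R := phi (chart_inv c z.1, circle_of z.2).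

Lemma test_in_differentiable c y t : atlas c -> chart_target c y ->
  differentiable (test_in c) (y, t).
Proof. by move=> /Cphi[df _] cy; exact: df. Qed.

Lemma derive_test_in c c' y w t : atlas c -> atlas c' -> overlap c c' y ->
  'D_(w, 1) (test_in c) (y, t) =
  'D_('D_w (transition c c') y, 1) (test_in c') (transition c c' y, t).
Proof.
move=> ac ac' ccy.
pose Psi (z : E * R) := (transition c c' z.1, z.2).
have dtr : differentiable (transition c c') (y, t).1 by exact: transition_differentiable.
have df1 : differentiable (fun z : E * R => z.1) (y, t).
  by apply: (@linear_differentiable _ _ _ fst) => z; exact: cvg_fst.
have d1 : differentiable (fun z : E * R => transition c c' z.1) (y, t).
  exact: (differentiable_comp df1 dtr).
have d2 : differentiable (fun z : E * R => z.2) (y, t).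
  by apply: (@linear_differentiable _ _ _ snd) => z; exact: cvg_snd.
have dPsi : differentiable Psi (y, t) by exact: differentiable_pair.
have DPsi : 'D_(w, 1) Psi (y, t) = ('D_w (transition c c') y, 1).
  rewrite deriveE// diff_pair//; congr pair.
    rewrite -deriveE//; apply: derive_on_line => h /=; by [].
  rewrite -deriveE// (@derive_on_line _ _ _ _ _ id _ _ t 1) ?derive_id//.
have [cy' _] := overlap_transition ccy.
rewrite -DPsi -derive_compE//; last exact: test_in_differentiable.
apply: near_eq_derive; near=> z.
have cz : overlap c c' z.1.
  by near: z; apply: (cvg_fst (open_near (@open_overlap _ _ _ c c') _)).
by rewrite /= /test_in/= chart_inv_transition.
Unshelve. all: by end_near. Qed.

Lemma hamilton_jacobi_chart_at x t :
  hamilton_jacobi L phi x t =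
  'D_(0, 1) (test_in (chart_at x)) (chart_map (chart_at x) x, t) +
  sup [set 'D_(v, 0) (test_in (chart_at x)) (chart_map (chart_at x) x, t) - L x v t | v in [set: E]].
Proof.
rewrite /hamilton_jacobi /hamiltonian; set c := chart_at x; set y := chart_map c x.
have cx : chart_source c x by exact: source_chart_at.
have cy : chart_target c y by exact: chart_map_target.
have xE : chart_inv c y = x by rewrite /y chart_mapK ?inE.
congr (_ + sup _).
  rewrite derive1E; apply: derive_on_line => h.
  by rewrite /test_in/= scaler0 add0r xE.
have dp : differentiable (fun y : E => (y, t)) y.
  by apply: differentiable_pair => //; exact: differentiable_cst.
have dt : differentiable (fun y => phi (chart_inv c y, circle_of t)) y.
  apply: (differentiable_comp dp (g := test_in c)).
  by apply: test_in_differentiable => //; exact: atlas_chart_at.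
have Ev v : 'd (fun y => phi (chart_inv c y, circle_of t)) y v = 'D_(v, 0) (test_in c) (y, t).
  rewrite -deriveE//; apply: derive_on_line => h.
  by rewrite /test_in/= scaler0 add0r.
by apply/seteqP; split => _ [v _ <-]; exists v; rewrite // Ev.
Qed.

Let hj_set x t := [set 'D_(v, 0) (test_in (chart_at x)) (chart_map (chart_at x) x, t) - L x v t | v in [set: E]].

Lemma hj_has_sup x t : has_sup (hj_set x t).
Proof.
set c := chart_at x; set y := chart_map c x.
have cx : chart_source c x by exact: source_chart_at.
have ac : atlas c by exact: atlas_chart_at.
have cy : chart_target c y by exact: chart_map_target.
have xE : chart_inv c y = x by rewrite /y chart_mapK ?inE.
split; first by exists ('D_(0, 0) (test_in c) (y, t) - L x 0 t); exists 0.
pose K : set (E * R) := [set (y, t)].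
have [|C C0 hC] := derive_bounded (finite_dim_prod (finite_dim_row n) finite_dim_real)
  (@compact_set1 _ (y, t)) (_ : [set (y, t)] `<=` [set z : E * R | chart_target c z.1]) (Cphi ac).
  by move=> _ ->.
have [B hB] := legendre_bounded t C ac cy.
exists B => _ [v _ <-]; apply: le_trans (hB v); rewrite /lagrangian_in xE tangent_of_chart_at.
rewrite lerD2r (le_trans (ler_norm _))// (le_trans (hC _ _ _))//.
by rewrite prod_normE/= normr0 max_l.
Qed.

Lemma derive_test_in_split c y v t : atlas c -> chart_target c y ->
  'D_(v, 1) (test_in c) (y, t) = 'D_(0, 1) (test_in c) (y, t) + 'D_(v, 0) (test_in c) (y, t).
Proof.
move=> ac cy; have d := test_in_differentiable t ac cy.
rewrite !deriveE// -linearD; congr ('d _ _ _).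
by apply/pair_equal_spec; rewrite /= add0r addr0.
Qed.

(** The Hamiltonian is a supremum over velocities: each single [w] gives a lower bound here, whereas
    [hamilton_jacobi_le] asks for all of them. Tangent vectors at the point correspond to velocities
    in the chart [c] by [tangent_of]. *)
Lemma hamilton_jacobi_ge c y w t : atlas c -> chart_target c y ->
  'D_(w, 1) (test_in c) (y, t) - lagrangian_in L c y w t <=
  hamilton_jacobi L phi (chart_inv c y) t.
Proof.
move=> ac cy; set x := chart_inv c y; set c' := chart_at x.
have ac' : atlas c' by exact: atlas_chart_at.
have ccy : overlap c c' y by split => //=; exact: source_chart_at.
rewrite (derive_test_in _ _ ac ac' ccy) -tangent_ofE//.
rewrite hamilton_jacobi_chart_at derive_test_in_split//; last first.
  by have [] := overlap_transition ccy.
rewrite -addrA lerD2l; apply: sup_upper_bound; first exact: hj_has_sup.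
by exists (tangent_of c y w).
Qed.

Lemma hamilton_jacobi_le c y t (B : R) : atlas c -> chart_target c y ->
  (forall w, 'D_(w, 1) (test_in c) (y, t) - lagrangian_in L c y w t <= B) ->
  hamilton_jacobi L phi (chart_inv c y) t <= B.
Proof.
move=> ac cy hB; set x := chart_inv c y; set c' := chart_at x.
have ac' : atlas c' by exact: atlas_chart_at.
have ccy : overlap c c' y by split => //=; exact: source_chart_at.
rewrite hamilton_jacobi_chart_at -lerBrDl; apply: ge_sup.
  by have [] := hj_has_sup x t.
move=> _ [v _ <-]; rewrite lerBrDl addrA -derive_test_in_split//; last first.
  by apply: chart_map_target; exact: source_chart_at.
have [w wE] := tangent_of_surj v ac cy.
have := hB w; rewrite (derive_test_in _ _ ac ac' ccy) -tangent_ofE// wE.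
by rewrite /lagrangian_in wE.
Qed.

End hamilton_jacobi_charts.

Section local_viscosity.
Variable u : M * circle R -> R.

Definition u_in c (z : E * R) : R := u (chart_inv c z.1, circle_of z.2).

Lemma near_chart c (P : M * circle R -> Prop) y t : chart_target c y ->
  (\forall z \near (y, t), P (chart_inv c z.1, circle_of z.2)) ->
  \forall p \near (chart_inv c y, circle_of t), P p.
Proof.
move=> cy [[A B] /= [nA nB] AB]; have [cx xE] := chart_invK cy.
apply: near_circle; exists (chart_source c `&` chart_map c @^-1` A, B) => /=.
  split => //; apply: filterI; first by apply: open_near => //; exact: chart_source_open.
  by apply: (chart_map_cvg cx); rewrite xE.
move=> [x s] /= [[cx' Ax] Bs]; have := AB (chart_map c x, s) (conj Ax Bs).
by rewrite /= chart_mapK ?inE.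
Qed.

(** Lets a function known only near [(y, t)] in one chart be used as a test function: its extension
    to the whole manifold has the same values and derivatives near that point. *)
Lemma subsolution_chart c V (f : E * R -> R) y t w : viscosity_subsolution L u ->
  atlas c -> open V -> Ck 1 V f -> V (y, t) -> chart_target c y ->
  (\forall z \near (y, t), u_in c z - f z <= u_in c (y, t) - f (y, t)) ->
  'D_(w, 1) f (y, t) <= lagrangian_in L c y w t.
Proof.
move=> sub ac oV Cf Vz cy hmax.
have [phi Cphi phif] := test_function_extension (z0 := (y, t)) ac oV Cf Vz cy.
have phify : phi (chart_inv c y, circle_of t) = f (y, t) := nbhs_singleton phif.
have /(sub _ Cphi) hj : \forall p \near (chart_inv c y, circle_of t),
    u p - phi p <= u (chart_inv c y, circle_of t) - phi (chart_inv c y, circle_of t).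
  apply: near_chart => //; rewrite phify.
  by apply: filterS2 phif hmax => z -> .
have := hamilton_jacobi_ge Cphi w t ac cy => /le_trans/(_ hj).
by rewrite subr_le0; rewrite (@near_eq_derive _ _ _ _ f).
Qed.

Lemma supersolution_chart c V (f : E * R -> R) y t B : viscosity_supersolution L u ->
  atlas c -> open V -> Ck 1 V f -> V (y, t) -> chart_target c y ->
  (\forall z \near (y, t), u_in c (y, t) - f (y, t) <= u_in c z - f z) ->
  (forall w, 'D_(w, 1) f (y, t) - lagrangian_in L c y w t <= B) -> 0 <= B.
Proof.
move=> sup ac oV Cf Vz cy hmin hB.
have [phi Cphi phif] := test_function_extension (z0 := (y, t)) ac oV Cf Vz cy.
have phify : phi (chart_inv c y, circle_of t) = f (y, t) := nbhs_singleton phif.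
have /(sup _ Cphi) hj : \forall p \near (chart_inv c y, circle_of t),
    u (chart_inv c y, circle_of t) - phi (chart_inv c y, circle_of t) <= u p - phi p.
  apply: near_chart => //; rewrite phify.
  by apply: filterS2 phif hmin => z -> .
apply: le_trans hj _; apply: hamilton_jacobi_le => // w.
by rewrite (@near_eq_derive _ _ _ _ f).
Qed.

End local_viscosity.

End lagrangian_charts.

(** * Domination by the action *)

(** Compactness of [a, b] makes the radius of the tube independent of time. *)
Lemma tube_near {R : realType} (V : normedModType R) (P : V -> R -> Prop) (a b : R) :
  (forall s, a <= s <= b -> \forall z \near (0 : V, s), P z.1 z.2) ->
  exists2 r : R, 0 < r & forall z s, `|z| <= r -> a <= s <= b -> P z s.
Proof.
move=> h.
have : \forall z \near (0 : V), [set` `[a, b]] `<=` P z.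
  have /compact_near_coveringP := @segment_compact R a b.
  apply => s /=; rewrite in_itv/= => /h [[A B] /= [nA nB] AB].
  by exists (B, A) => // -[s' z] /= [Bs Az]; exact: (AB (z, s')).
move=> /nbhs_normP[e /= e0 he]; exists (e / 2); first by rewrite divr_gt0.
move=> z s ze sab; apply: (he z); last by rewrite /= in_itv.
by rewrite /ball_/= sub0r normrN; lra.
Qed.

Section domination.
Context {R : realType} {n : nat} {M : smooth_manifold R n}.
Variables (g : riemannian_metric M) (L : M -> 'rV[R]_n -> R -> R).
Hypothesis hL : tonelli L g.
Variable u : M * circle R -> R.
Hypothesis hu : continuous u.
Local Notation E := 'rV[R]_n.
Implicit Types (c : chart R n M) (x : M) (y w v z : E) (s t : R).

Lemma u_in_cvg c y t : chart_target c y -> {for (y, t), continuous (u_in u c)}.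
Proof.
move=> cy; apply: (@continuous_comp _ _ _ (fun z : E * R => (chart_inv c z.1, circle_of z.2)) u); last exact: hu.
apply: continuous_pair.
  apply: (@continuous_comp _ _ _ fst (chart_inv c)); first exact: cvg_fst.
  exact: chart_inv_cvg.
apply: (@continuous_comp _ _ _ snd (@circle_of R)); first exact: cvg_snd.
exact: circle_of_continuous.
Qed.

Section curve_in_chart.
Variables (c : chart R n M) (J : set R) (q : R -> E).
Hypotheses (ac : atlas c) (oJ : open J) (Cq : Ck 1 J q).
Hypothesis tq : forall s, J s -> chart_target c (q s).

Definition lag_along (s : R) : R := lagrangian_in L c (q s) ('D_1 q s) s.

Lemma curve_cvg s : J s -> {for s, continuous q}.
Proof. exact: Ck_continuous Cq s. Qed.

Lemma velocity_cvg s : J s -> {for s, continuous ('D_1 q)}.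
Proof. by case: Cq => _ Dq Js; exact: (Dq 1 s Js). Qed.

Lemma curve_is_derive s : J s -> is_derive s 1 q ('D_1 q s).
Proof. by move=> Js; case: Cq => dq _; apply: DeriveDef => //; apply/diff_derivable/dq. Qed.

Lemma shifted_curve_cvg (T : topologicalType) (z : T -> E) (s : T -> R) p :
  J (s p) -> {for p, continuous z} -> {for p, continuous s} ->
  {for p, continuous (fun p => q (s p) + z p)}.
Proof.
move=> Js cz cs; apply: (@continuousD _ _ _ (fun p => q (s p)) z) => //.
by apply: continuous_comp => //; exact: curve_cvg.
Qed.

Lemma lag_shifted_cvg z s : J s -> chart_target c (q s + z) ->
  {for (z, s), continuous (fun p : E * R => lagrangian_in L c (q p.2 + p.1) ('D_1 q p.2) p.2)}.
Proof.
move=> Js cz.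
apply: (@continuous_comp _ _ _ (fun p : E * R => (q p.2 + p.1, 'D_1 q p.2, p.2)) (lag L c)); last first.
  exact: (lag_Ck hL 0%N ac).
apply: continuous_pair; last exact: cvg_snd.
apply: continuous_pair.
  by apply: shifted_curve_cvg; [exact: Js|exact: cvg_fst|exact: cvg_snd].
by apply: (@continuous_comp _ _ _ snd ('D_1 q)); [exact: cvg_snd|exact: velocity_cvg].
Qed.

Lemma u_shifted_cvg z s : J s -> chart_target c (q s + z) ->
  {for (z, s), continuous (fun p : E * R => u_in u c (q p.2 + p.1, p.2))}.
Proof.
move=> Js cz.
apply: (@continuous_comp _ _ _ (fun p : E * R => (q p.2 + p.1, p.2)) (u_in u c)); last exact: u_in_cvg.
apply: continuous_pair; last exact: cvg_snd.
by apply: shifted_curve_cvg; [exact: Js|exact: cvg_fst|exact: cvg_snd].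
Qed.

Lemma lag_along_cvg s : J s -> {for s, continuous lag_along}.
Proof.
move=> Js; have cz : chart_target c (q s + 0) by rewrite addr0; exact: tq.
have -> : lag_along = (fun p : E * R => lagrangian_in L c (q p.2 + p.1) ('D_1 q p.2) p.2) \o (fun s => (0, s)).
  by apply/funext => r /=; rewrite addr0.
apply: continuous_comp; last exact: lag_shifted_cvg.
by apply: continuous_pair; [exact: cst_continuous|exact: cvg_id].
Qed.

Lemma u_along_cvg s : J s -> {for s, continuous (fun s => u_in u c (q s, s))}.
Proof.
move=> Js; apply: (@continuous_comp _ _ _ (fun s => (q s, s)) (u_in u c)); last exact/u_in_cvg/tq.
by apply: continuous_pair; [exact: curve_cvg|exact: cvg_id].
Qed.

Lemma near_target_shifted s : J s ->
  \forall p \near (0 : E, s), J p.2 /\ chart_target c (q p.2 + p.1).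
Proof.
move=> Js; apply: filterI; first exact: (cvg_snd (open_near oJ Js)).
have cf : {for ((0 : E), s), continuous (fun p : E * R => q p.2 + p.1)}.
  by apply: shifted_curve_cvg; [exact: Js|exact: cvg_fst|exact: cvg_snd].
by apply: cf; apply: open_near; [exact: open_chart_target|rewrite /= addr0; exact: tq].
Qed.

Variable Lam : R -> R.
Hypothesis dLam : forall s, J s -> is_derive s 1 Lam (lag_along s).

Lemma Lam_Ck1 : Ck 1 J Lam.
Proof. exact: (Ck1_real dLam lag_along_cvg oJ). Qed.

(** [kappa] produces a strict inequality, the [K] term a barrier after time [b], and the [N] term a
    lateral barrier keeping the maximum close to the curve. *)
Definition doubling_test (kappa K N a b : R) (p : E * R) : R :=
  Lam p.2 + kappa * (p.2 - a) + K * sqr_pos (p.2 - b) + N * dot (p.1 - q p.2) (p.1 - q p.2).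

Lemma doubling_test_Ck1 kappa K N a b :
  Ck 1 [set p : E * R | J p.2] (doubling_test kappa K N a b).
Proof.
set V := [set p : E * R | J p.2].
have cs : continuous (@snd E R) by move=> z; exact: cvg_snd.
have oV : open V by exact: open_pre cs oJ.
have C2V : Ck 1 V (fun p : E * R => p.2) by apply: (Ck_snd oV); exact: Ck_id.
have Cid : Ck 1 J (id : R -> R) by exact: Ck_id.
have Csub (x : R) : Ck 1 J (fun s => s - x) by apply: (Ck_sub oJ Cid); exact: Ck_cst.
have Cz : Ck 1 V (fun p : E * R => p.1 - q p.2).
  apply: (Ck_sub oV); first by apply: (Ck_fst oV); exact: Ck_id.
  exact: (Ck_comp finite_dim_real oV oJ _ C2V Cq).
have C2 (f : R -> R) : Ck 1 J f -> Ck 1 V (fun p : E * R => f p.2).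
  by move=> Cf; exact: (Ck_compR finite_dim_real oV _ C2V Cf).
have Csq : Ck 1 J (fun s => sqr_pos (s - b)).
  exact: (Ck_compR finite_dim_real oJ _ (Csub b) sqr_pos_Ck1).
have C1 : Ck 1 J (fun s => Lam s + kappa * (s - a) + K * sqr_pos (s - b)).
  apply: (Ck_add oJ); last exact: (Ck_cmul K oJ Csq).
  apply: (Ck_add oJ); last exact: (Ck_cmul kappa oJ (Csub a)).
  exact: Lam_Ck1.
exact: (Ck_add oV (C2 _ C1) (Ck_cmul N oV (Ck_dot oV Cz Cz))).
Qed.

(** In the direction of the curve's velocity the difference [p.1 - q p.2] is stationary, so the [N]
    term contributes nothing, however large [N] is. *)
Lemma derive_doubling_test kappa K N a b y s : J s ->
  'D_('D_1 q s, 1) (doubling_test kappa K N a b) (y, s) =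
  lag_along s + kappa + K * (2 * Num.max (s - b) 0).
Proof.
move=> Js; set w := 'D_1 q s.
pose G (r : R) := Lam r + kappa * (r - a) + K * sqr_pos (r - b) +
  N * dot (y + (r - s) *: w - q r) (y + (r - s) *: w - q r).
rewrite (@derive_on_line _ _ _ _ _ G _ _ s 1); last first.
  move=> h; rewrite /doubling_test /G /= [h *: 1]mulr1.
  by rewrite addrK [y + _]addrC.
have dq := curve_is_derive Js.
have dz : is_derive s 1 (fun r => y + (r - s) *: w - q r) 0.
  have d1 : is_derive s 1 (fun r => (r - s) *: w) w.
    have dr : is_derive s 1 (fun r : R => r - s) 1.
      by apply: is_derive_eq; rewrite subr0.
    apply: DeriveDef.
      by apply/derivable1_diffP; apply: differentiableZl; apply/derivable1_diffP; case: dr.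
    rewrite -derive1E derive1E'; last first.
      by apply: differentiableZl; apply/derivable1_diffP; case: dr.
    rewrite diffZl; last by apply/derivable1_diffP; case: dr.
    rewrite /= -deriveE; last by apply/derivable1_diffP; case: dr.
    by case: dr => _ ->; rewrite scale1r.
  by apply: is_derive_eq; rewrite add0r subrr.
have ds : is_derive s 1 (fun r => sqr_pos (r - b)) (2 * Num.max (s - b) 0).
  have [dp pE] := is_derive_sqr_pos (s - b).
  apply: DeriveDef; last rewrite -pE; last by apply: derive_on_line => h; rewrite addrA.
  apply/derivable1_diffP; apply: (@differentiable_comp _ _ _ _ (fun r : R => r - b) sqr_pos).
    by apply: differentiableB => //; exact: differentiable_cst.
  exact/derivable1_diffP.
have dd := is_derive_dot dz dz.
have dL := dLam Js.
have dG : is_derive s 1 G (lag_along s + kappa + K * (2 * Num.max (s - b) 0)).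
  rewrite /G; apply: is_derive_eq; rewrite /GRing.scale/= dot0l dot0r; ring.
by case: dG.
Qed.

Hypothesis sub : viscosity_subsolution L u.

(** If domination failed by [m], then [u_in u c - f] would have a maximum interior to a tube around
    the curve, and there the derivative of [f] along the curve would exceed the Lagrangian by at
    least [kappa / 2]. *)
Lemma subsolution_dominated_chart a b : a <= b -> (forall s, a <= s <= b -> J s) ->
  u_in u c (q b, b) - u_in u c (q a, a) <= Lam b - Lam a.
Proof.
move=> ab Jab; rewrite leNgt; apply/negP => lt_ab.
pose G s := u_in u c (q s, s) - Lam s.
pose m := G b - G a.
have m0 : 0 < m by rewrite /m /G; lra.
have ab' : a < b by rewrite lt_neqAle ab andbT; apply/eqP => eab; move: m0; rewrite /m eab subrr ltxx.
(* The curve is followed a little past [b], so that a maximum at time [b] would still be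
   interior. *)
have [b1 bb1 Jb1] : exists2 b1, b < b1 & forall s, a <= s <= b1 -> J s.
  have : \forall s \near b, J s by apply: (open_near oJ); apply: Jab; rewrite ab lexx.
  move=> /nbhs_normP[e /= e0 he]; exists (b + e / 2); first lra.
  move=> s /andP[as_ sb]; have [sb'|bs] := leP s b; first by apply: Jab; rewrite as_.
  by apply: he; rewrite /ball_/= ltr_norml; apply/andP; split; lra.
(* With this slope the linear term uses up only a quarter of the gap [m] on [a, b]. *)
pose kappa := m / (4 * (b - a)).
have ba0 : 0 < b - a by lra.
have kappa0 : 0 < kappa by rewrite divr_gt0// mulr_gt0.
have kba : kappa * (b - a) = m / 4 by rewrite /kappa; field; rewrite gt_eqF.
have tz s : J s -> chart_target c (q s + 0) by move=> /tq; rewrite addr0.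
have [r r0 hr] : exists2 r : R, 0 < r & forall z s, `|z| <= r -> a <= s <= b1 ->
    [/\ J s, chart_target c (q s + z),
    `|u_in u c (q s + 0, s) - u_in u c (q s + z, s)| <= m / 8 &
    `|lagrangian_in L c (q s + 0) ('D_1 q s) s - lagrangian_in L c (q s + z) ('D_1 q s) s| <= kappa / 2].
  apply: (@tube_near _ _ (fun z s => [/\ J s, chart_target c (q s + z),
    `|u_in u c (q s + 0, s) - u_in u c (q s + z, s)| <= m / 8 &
    `|lagrangian_in L c (q s + 0) ('D_1 q s) s - lagrangian_in L c (q s + z) ('D_1 q s) s| <= kappa / 2])).
  move=> s /Jb1 Js.
  have cU := u_shifted_cvg Js (tz s Js); have cL := lag_shifted_cvg Js (tz s Js).
  have c0 : {for (0 : E, s), continuous (fun p : E * R => (0 : E, p.2))}.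
    by apply: continuous_pair; [exact: cst_continuous|exact: cvg_snd].
  have dU : {for (0 : E, s), continuous (fun p : E * R =>
      u_in u c (q p.2 + 0, p.2) - u_in u c (q p.2 + p.1, p.2))}.
    apply: continuousB; last exact: cU.
    exact: (@continuous_comp _ _ _ (fun p : E * R => (0 : E, p.2)) _ _ c0 cU).
  have dL : {for (0 : E, s), continuous (fun p : E * R =>
      lagrangian_in L c (q p.2 + 0) ('D_1 q p.2) p.2 - lagrangian_in L c (q p.2 + p.1) ('D_1 q p.2) p.2)}.
    apply: continuousB; last exact: cL.
    exact: (@continuous_comp _ _ _ (fun p : E * R => (0 : E, p.2)) _ _ c0 cL).
  have m80 : 0 < m / 8 by lra.
  have k20 : 0 < kappa / 2 by lra.
  have nU := continuous_near_le dU m80; have nL := continuous_near_le dL k20.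
  have nT := near_target_shifted Js.
  near=> p; have [Jp tp] : J p.2 /\ chart_target c (q p.2 + p.1) by near: p.
  split => //.
    have : `|u_in u c (q s + 0, s) - u_in u c (q s + 0, s) -
      (u_in u c (q p.2 + 0, p.2) - u_in u c (q p.2 + p.1, p.2))| <= m / 8 by near: p.
    by rewrite subrr sub0r normrN.
  have : `|lagrangian_in L c (q s + 0) ('D_1 q s) s - lagrangian_in L c (q s + 0) ('D_1 q s) s -
    (lagrangian_in L c (q p.2 + 0) ('D_1 q p.2) p.2 - lagrangian_in L c (q p.2 + p.1) ('D_1 q p.2) p.2)| <= kappa / 2 by near: p.
  by rewrite subrr sub0r normrN.
pose Kset : set (E * R) := [set z | `|z - 0| <= r] `*` [set` `[a, b1]].
have KsetP p : Kset p -> `|p.1| <= r /\ a <= p.2 <= b1.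
  by move=> [/=]; rewrite subr0 in_itv.
have cK : compact Kset by apply: compact_setX; [exact: norm_ball_compact|exact: segment_compact].
have [Gb hGb] : exists Gb, forall s, a <= s <= b1 -> G s <= Gb.
  have [||s0 _ hs0] := @EVT_max R G a b1; first lra.
    apply: continuous_in_subspaceT => s; rewrite inE/= in_itv/= => /Jb1 Js.
    apply: (@continuousB _ _ _ (fun s => u_in u c (q s, s)) Lam s); first exact: u_along_cvg.
    exact: (Ck_continuous Lam_Ck1 Js).
  by exists (G s0) => s sab; apply: hs0; rewrite in_itv.
(* Both barriers reach [|Gb - G b| + m] on the part of the boundary they guard, which outweighs the
   largest value that [G] can take. *)
pose N := (`|Gb - G b| + m) / r ^+ 2.
pose K := (`|Gb - G b| + m) / (b1 - b) ^+ 2.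
have r20 : 0 < r ^+ 2 by rewrite exprn_gt0.
have b20 : 0 < (b1 - b) ^+ 2 by rewrite exprn_gt0// subr_gt0.
have N0 : 0 <= N by rewrite divr_ge0 ?(ltW r20)// addr_ge0// ltW.
have K0 : 0 <= K by rewrite divr_ge0 ?(ltW b20)// addr_ge0// ltW.
have Nr : N * r ^+ 2 = `|Gb - G b| + m by rewrite /N divfK// gt_eqF.
have Kb : K * (b1 - b) ^+ 2 = `|Gb - G b| + m by rewrite /K divfK// gt_eqF.
have nGb := ler_norm (Gb - G b).
pose f := doubling_test kappa K N a b.
pose Theta (p : E * R) := u_in u c (q p.2 + p.1, p.2) - f (q p.2 + p.1, p.2).
have ThetaE z s : Theta (z, s) = u_in u c (q s + z, s) -
    (Lam s + kappa * (s - a) + K * sqr_pos (s - b) + N * dot z z).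
  by rewrite /Theta /f /doubling_test/= [q s + z]addrC addrK.
have Theta_le z s : `|z| <= r -> a <= s <= b1 ->
    Theta (z, s) <= G s + m / 8 - kappa * (s - a) - K * sqr_pos (s - b) - N * dot z z.
  move=> zr sab; have [_ _ hU _] := hr z s zr sab.
  by rewrite ThetaE /G; move: hU; rewrite addr0 ler_norml => /andP[hU _]; lra.
have ctheta : {within Kset, continuous Theta}.
  apply: continuous_in_subspaceT => -[z s]; rewrite inE => /KsetP/= [zr sab].
  have [Js tzs _ _] := hr z s zr sab.
  apply: (@continuousB _ _ _ (fun p : E * R => u_in u c (q p.2 + p.1, p.2)) (fun p : E * R => f (q p.2 + p.1, p.2))); first exact: u_shifted_cvg.
  apply: (@continuous_comp _ _ _ (fun p : E * R => (q p.2 + p.1, p.2)) f).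
    apply: continuous_pair; last exact: cvg_snd.
    by apply: shifted_curve_cvg; [exact: Js|exact: cvg_fst|exact: cvg_snd].
  by apply: (Ck_continuous (@doubling_test_Ck1 kappa K N a b)).
have K0' : Kset !=set0.
  by exists (0, b); split => /=; rewrite ?subrr ?normr0 ?(ltW r0)// in_itv/= ab (ltW bb1).
have [[z s]] := compact_EVT_max K0' cK ctheta.
rewrite inE => /KsetP/= [zr sab] hmax.
have hmax' z' s' : `|z'| <= r -> a <= s' <= b1 -> Theta (z', s') <= Theta (z, s).
  by move=> zr' sab'; apply: hmax; rewrite inE; split => /=; rewrite ?subr0 ?in_itv.
have v0 : G b - m / 4 <= Theta (z, s).
  apply: le_trans (hmax' 0 b _ _); rewrite ?normr0 ?(ltW r0) ?ab ?(ltW bb1)//.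
  rewrite ThetaE addr0 dot0l kba subrr /sqr_pos maxxx expr0n/= !mulr0 /G; lra.
have hT := Theta_le z s zr sab.
have sq0 : 0 <= K * sqr_pos (s - b) by rewrite mulr_ge0// sqr_ge0.
have dz0 : 0 <= N * dot z z by rewrite mulr_ge0// dot_ge0.
have as0 : 0 <= kappa * (s - a) by rewrite mulr_ge0 ?subr_ge0 ?(ltW kappa0)//; lra.
(* At time [a] the value is at most [G a + m / 8], below the value [G b - m / 4] found on the curve
   at time [b]. *)
have sa : a < s.
  rewrite lt_neqAle; apply/andP; split; last lra.
  apply/eqP => eas; have GE : G s = G a by rewrite -eas.
  have mE : m = G b - G a by [].
  by rewrite GE in hT; lra.
have GsGb := hGb s sab.
have sb1 : s < b1.
  rewrite lt_neqAle; apply/andP; split; last lra.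
  apply/eqP => es; move: hT v0; rewrite es {1}/sqr_pos max_l ?subr_ge0 ?(ltW bb1)// Kb -es; lra.
have zr' : `|z| < r.
  rewrite lt_neqAle zr andbT; apply/eqP => ez.
  have : N * r ^+ 2 <= N * dot z z by rewrite ler_wpM2l// -ez sqr_norm_le_dot.
  by rewrite Nr; lra.
have [Js tzs _ hLs] := hr z s zr sab.
have oV : open [set p : E * R | J p.2].
  by apply: open_pre oJ => p; exact: cvg_snd.
have := @subsolution_chart _ _ _ _ _ hL u c _ f (q s + z) s ('D_1 q s) sub ac oV
  (@doubling_test_Ck1 kappa K N a b) Js tzs.
rewrite derive_doubling_test//.
have loc : \forall p \near (q s + z, s), u_in u c p - f p <= u_in u c (q s + z, s) - f (q s + z, s).
  have cz : {for (q s + z, s), continuous (fun p : E * R => `|p.1 - q p.2|)}.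
    apply: (@continuous_comp _ _ _ (fun p : E * R => p.1 - q p.2) Num.norm); last exact: norm_continuous.
    apply: (@continuousB _ _ _ fst (fun p : E * R => q p.2)); first exact: cvg_fst.
    apply: (@continuous_comp _ _ _ snd q); [exact: cvg_snd|exact: curve_cvg].
  have n1 : \forall p \near (q s + z, s), `|p.1 - q p.2| < r.
    have hz : `|(q s + z, s).1 - q (q s + z, s).2| < r by rewrite /= [q s + z]addrC addrK.
    exact: (cz _ (lt_nbhsl hz)).
  have n2 : \forall p \near (q s + z, s), a < p.2 by apply: (cvg_snd (lt_nbhsr sa)).
  have n3 : \forall p \near (q s + z, s), p.2 < b1 by apply: (cvg_snd (lt_nbhsl sb1)).
  near=> p.
  have p1 : `|p.1 - q p.2| <= r by apply/ltW; near: p.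
  have p2 : a <= p.2 <= b1 by apply/andP; split; apply/ltW; near: p.
  by have := hmax' _ _ p1 p2; rewrite /Theta/= [q p.2 + _]addrC subrK -surjective_pairing.
move=> /(_ loc) h.
(* The barrier [K] has nonnegative time derivative, so [h] makes the Lagrangian at [q s + z] exceed
   the one on the curve by [kappa], while the tube allows a difference of [kappa / 2] only. *)
have mx0 : 0 <= K * (2 * Num.max (s - b) 0).
  by apply: mulr_ge0 => //; apply: mulr_ge0 => //; rewrite le_max lexx orbT.
move: hLs; rewrite addr0 -/(lag_along s) ler_norml => /andP[hLs _].
lra.
Unshelve. all: by end_near. Qed.

End curve_in_chart.

End domination.

(** * Integrals over intervals and actions of piecewise C^1 curves *)

Section interval_integrals.
Context {R : realType}.
Notation mu := (@lebesgue_measure R).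
Implicit Types (f h : R -> R) (a b x : R).

Lemma integrable_union (A B : set (measurableTypeR R)) f : measurable A -> measurable B ->
  mu.-integrable A (EFin \o f) -> mu.-integrable B (EFin \o f) ->
  mu.-integrable (A `|` B) (EFin \o f).
Proof.
move=> mA mB fA fB.
have mBA : measurable (B `\` A) by exact: measurableD.
have mAB := measurableU _ _ mA mB.
suff : mu.-integrable setT ((EFin \o f) \_ (A `|` B)) by move/(integrable_mkcond (mu := mu) (EFin \o f) mAB).2.
have gA := (integrable_mkcond (mu := mu) (EFin \o f) mA).1 fA.
have fBA : mu.-integrable (B `\` A) (EFin \o f).
  by apply: integrableS fB => //; exact: subDsetl.
have gB := (integrable_mkcond (mu := mu) (EFin \o f) mBA).1 fBA.
apply: eq_integrable (integrableD measurableT gA gB) => // x _ /=.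
rewrite /patch; have [xA|xA] := boolP (x \in A).
  rewrite [x \in B `\` A]memNset; last by rewrite inE in xA; case.
  by rewrite adde0 mem_set//; left; rewrite inE in xA.
rewrite add0e; have [xB|xB] := boolP (x \in B).
  rewrite !mem_set//; first by right; rewrite inE in xB.
  by split; [rewrite inE in xB|rewrite notin_setE in xA].
rewrite !memNset//.
  by move=> [/mem_set|/mem_set]; apply/negP.
by move=> [/mem_set]; rewrite (negbTE xB).
Qed.

Lemma integrable_singleton f a : mu.-integrable [set a] (EFin \o f).
Proof.
apply: null_set_integrable => //; last exact: lebesgue_measure_set1.
exact: measurable_fun_set1.
Qed.

Lemma integrable_open_closed f a b : a <= b ->
  mu.-integrable `]a, b[ (EFin \o f) -> mu.-integrable `[a, b] (EFin \o f).
Proof.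
rewrite le_eqVlt => /predU1P[<- _|ab fi].
  by rewrite set_itv1; exact: integrable_singleton.
have -> : [set` `[a, b]] = [set a] `|` ([set` `]a, b[] `|` [set b]).
  apply/seteqP; split => x /=; rewrite !in_itv/=.
    move=> /andP[]; rewrite le_eqVlt => /predU1P[->|ax]; first by left.
    rewrite le_eqVlt => /predU1P[->|xb]; first by right; right.
    by right; left; rewrite ax.
  by move=> [->|[/andP[ax xb]|->]]; rewrite ?lexx ?(ltW ab)// !ltW.
apply: integrable_union => //; first exact: measurableU.
  exact: integrable_singleton.
by apply: integrable_union => //; exact: integrable_singleton.
Qed.

(** At the ends of a piece, [velocity] also sees the neighbouring piece, so integrands agree only in
    the open interval; the ends are a null set. *)
Lemma eq_on_open_integral f h a b : a <= b ->
  (forall x, a < x < b -> f x = h x) ->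
  mu.-integrable `[a, b] (EFin \o h) ->
  mu.-integrable `[a, b] (EFin \o f) /\
  \int[mu]_(x in `[a, b]) f x = \int[mu]_(x in `[a, b]) h x.
Proof.
move=> ab fh hi.
have oc : [set` `]a, b[] `<=` [set` `[a, b]] by exact: subset_itv_oo_cc.
have hio : mu.-integrable `]a, b[ (EFin \o h) by apply: integrableS hi.
have fio : mu.-integrable `]a, b[ (EFin \o f).
  by apply: eq_integrable hio => // x; rewrite inE/= in_itv/= => /fh ->.
split; first exact: integrable_open_closed.
move: ab fh oc hio fio; rewrite le_eqVlt => /predU1P[<- _ _ _ _|ab fh oc hio fio].
  by rewrite set_itv1 !Rintegral_set1.
have H (g : R -> R) : mu.-integrable `]a, b[ (EFin \o g) ->
    \int[mu]_(x in `[a, b]) g x = \int[mu]_(x in `]a, b[) g x.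
  move=> gi; have gc := integrable_open_closed (ltW ab) gi.
  rewrite -Rintegral_itv_obnd_cbnd; last by apply: integrableS gc => //; exact: subset_itv_oc_cc.
  by rewrite -Rintegral_itv_bndo_bndc.
by rewrite !H//; apply: eq_Rintegral => x; rewrite inE/= in_itv/= => /fh.
Qed.

Lemma integral_concat f a x b : a <= x -> x <= b ->
  mu.-integrable `[a, x] (EFin \o f) -> mu.-integrable `[x, b] (EFin \o f) ->
  mu.-integrable `[a, b] (EFin \o f) /\
  \int[mu]_(t in `[a, b]) f t = \int[mu]_(t in `[a, x]) f t + \int[mu]_(t in `[x, b]) f t.
Proof.
move=> ax xb i1 i2.
have i12 : mu.-integrable `[a, b] (EFin \o f).
  have -> : [set` `[a, b]] = [set` `[a, x]] `|` [set` `[x, b]].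
    apply/seteqP; split => y /=; rewrite !in_itv/=; last by case=> /andP[]; lra.
    by move=> /andP[ay yb]; have [yx|/ltW xy] := leP y x; [left|right]; apply/andP.
  exact: integrable_union.
split => //.
have := Rintegral_itvB i12 (x := x); rewrite !bnd_simp => /(_ ax xb) => E.
rewrite -[LHS](subrK (\int[mu]_(t in `[a, x]) f t)) E addrC; congr (_ + _).
by apply: Rintegral_itv_obnd_cbnd; apply: integrableS i2 => //; exact: subset_itv_oc_cc.
Qed.

Lemma integral_derive (F f : R -> R) a b : a <= b ->
  (forall x, a <= x <= b -> is_derive x 1 F (f x)) ->
  (forall x, a <= x <= b -> {for x, continuous f}) ->
  mu.-integrable `[a, b] (EFin \o f) /\
  \int[mu]_(x in `[a, b]) f x = F b - F a.
Proof.
move=> ab dF cf.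
have cfw : {within `[a, b], continuous f}.
  by apply: continuous_in_subspaceT => x; rewrite inE/= in_itv/=; exact: cf.
have fi : mu.-integrable `[a, b] (EFin \o f).
  by apply: continuous_compact_integrable => //; exact: segment_compact.
split => //; move: ab; rewrite le_eqVlt => /predU1P[<-|ab].
  by rewrite set_itv1 Rintegral_set1 subrr.
have cF x : a <= x <= b -> {for x, continuous F} by move=> /dF; exact: is_derive_continuous.
rewrite /Rintegral (@continuous_FTC2 _ f F)//.
- split.
  + by move=> x; rewrite in_itv/= => /andP[ax xb]; have [] := dF x; rewrite ?ltW.
  + by apply: cvg_at_right_filter; apply: cF; rewrite lexx ltW.
  + by apply: cvg_at_left_filter; apply: cF; rewrite lexx ltW.
- by move=> x; rewrite in_itv/= => /andP[ax xb]; rewrite derive1E; have [] := dF x; rewrite ?ltW.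
Qed.

End interval_integrals.

Section curves.
Context {R : realType} {n : nat} {M : smooth_manifold R n}.
Variables (g : riemannian_metric M) (L : M -> 'rV[R]_n -> R -> R).
Hypothesis hL : tonelli L g.
Local Notation E := 'rV[R]_n.
Local Notation mu := (@lebesgue_measure R).
Implicit Types (c : chart R n M) (x : M) (y w v z : E) (s t a b e : R) (gamma delta : R -> M).

Definition lag_curve gamma s : R := L (gamma s) (velocity gamma s) s.

Definition curve_chart gamma J c := J `&` gamma @^-1` chart_source c.

Lemma curve_chart_open gamma J c : open J -> curve_Ck 1 J gamma -> open (curve_chart gamma J c).
Proof. by move=> oJ [cg _]; exact: open_curve_source. Qed.

Lemma curve_chart_target gamma J c s : curve_chart gamma J c s ->
  chart_target c ((chart_map c \o gamma) s).
Proof. by move=> [_ cs]; exact: chart_map_target. Qed.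

Lemma lag_curve_chart gamma J c s : atlas c -> curve_Ck 1 J gamma ->
  curve_chart gamma J c s -> lag_curve gamma s = lag_along L c (chart_map c \o gamma) s.
Proof.
move=> ac [cg Cg] Js; have [Js' cs] := Js.
rewrite /lag_curve (lagrangian_in_velocity _ ac (cg _ Js') cs).
  by rewrite /lag_along derive1E.
by have [dq _] := Cg _ ac; apply/diff_derivable/dq.
Qed.

Lemma curve_chart_at gamma J s : J s -> curve_chart gamma J (chart_at (gamma s)) s.
Proof. by move=> Js; split => //=; exact: source_chart_at. Qed.

(** [velocity gamma s] itself may jump with the choice of [chart_at (gamma s)]; the Lagrangian along
    the curve is continuous because it can be read near [s] in one fixed chart. *)
Lemma lag_curve_cvg gamma J s : open J -> curve_Ck 1 J gamma -> J s ->
  {for s, continuous (lag_curve gamma)}.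
Proof.
move=> oJ Cg Js; pose c := chart_at (gamma s).
have ac : atlas c := atlas_chart_at _.
have oc := curve_chart_open (c := c) oJ Cg.
have cs : curve_chart gamma J c s by exact: curve_chart_at.
apply: (continuous_near_eq (f := lag_along L c (chart_map c \o gamma))).
  near=> r; apply/esym/(lag_curve_chart (J := J)) => //.
  by near: r; exact: (open_near oc cs).
apply: (lag_along_cvg hL ac (J := curve_chart gamma J c)) => //.
  by have [_ Cg'] := Cg; exact: Cg'.
by move=> r cr; exact: curve_chart_target cr.
Unshelve. all: by end_near. Qed.

Lemma lag_curve_antiderivative gamma a b : a < b ->
  curve_Ck 1 `]a, b[ gamma ->
  forall a' b', a < a' -> b' < b ->
  exists Lam : R -> R, forall s, a' < s < b' -> is_derive s 1 Lam (lag_curve gamma s).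
Proof.
move=> ab Cg a' b' aa' b'b; apply: antiderivative.
apply: continuous_in_subspaceT => s; rewrite inE/= in_itv/= => /andP[as_ sb].
apply: (lag_curve_cvg (itv_open _ _) Cg) => /=.
by rewrite in_itv/=; lra.
Qed.

Lemma velocity_eq gamma delta s : (\forall r \near s, gamma r = delta r) ->
  velocity gamma s = velocity delta s.
Proof.
move=> h; have gs : gamma s = delta s := nbhs_singleton h.
rewrite /velocity !derive1E gs; apply: near_eq_derive.
by apply: filterS h => r /= ->.
Qed.

Lemma near_itv_oo a b s : a < s < b -> \forall r \near s, a < r < b.
Proof.
move=> /andP[a1 b1]; have oi : open [set` `]a, b[] by exact: itv_open.
have : [set` `]a, b[] s by rewrite /= in_itv/= a1.
by move=> /(open_near oi); apply: filterS => r /=; rewrite in_itv.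
Qed.

Lemma action_antiderivative gamma delta a b e (Lam : R -> R) : a <= b -> 0 < e ->
  curve_Ck 1 `]a - e, b + e[ delta -> {in `[a, b], gamma =1 delta} ->
  (forall s, a <= s <= b -> is_derive s 1 Lam (lag_curve delta s)) ->
  mu.-integrable `[a, b] (EFin \o lag_curve gamma) /\ action L gamma a b = Lam b - Lam a.
Proof.
move=> ab e0 Cd gd d1.
have d2 s : a <= s <= b -> {for s, continuous (lag_curve delta)}.
  by move=> sab; apply: (lag_curve_cvg (itv_open _ _) Cd); rewrite /= in_itv/=; lra.
have [di dE] := integral_derive ab d1 d2.
have gdE s : a < s < b -> lag_curve gamma s = lag_curve delta s.
  move=> sab; rewrite /lag_curve (@velocity_eq gamma delta).
    by rewrite gd; [|rewrite in_itv/=; lra].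
  by apply: filterS (near_itv_oo sab) => r rab; rewrite gd; [|rewrite in_itv/=; lra].
have [gi gE] := eq_on_open_integral ab gdE di.
by split; [exact: gi|exact: (etrans gE dE)].
Qed.

(** The antiderivative is taken along the extension [delta], on an interval larger by [e / 2] at
    each end, so that it is differentiable at [a] and [b] as well. *)
Lemma action_piece gamma delta a b e : a <= b -> 0 < e ->
  curve_Ck 1 `]a - e, b + e[ delta -> {in `[a, b], gamma =1 delta} ->
  exists Lam : R -> R,
  [/\ forall s, a - e / 2 < s < b + e / 2 -> is_derive s 1 Lam (lag_curve delta s),
      mu.-integrable `[a, b] (EFin \o lag_curve gamma) &
      action L gamma a b = Lam b - Lam a].
Proof.
move=> ab e0 Cd gd.
have [ab1 a1 b1] : [/\ a - e < b + e, a - e < a - e / 2 & b + e / 2 < b + e] by split; lra.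
have [Lam dLam] := lag_curve_antiderivative ab1 Cd a1 b1.
exists Lam; have [|gi gE] := action_antiderivative (Lam := Lam) ab e0 Cd gd.
  by move=> s sab; apply: dLam; lra.
by split; [exact: dLam|exact: gi|exact: gE].
Qed.

Lemma path_induction gamma (Q : R -> R -> Prop) a b :
  (forall r, a <= r <= b -> Q r r) ->
  (forall r1 r2 r3, a <= r1 -> r1 <= r2 -> r2 <= r3 -> r3 <= b -> Q r1 r2 -> Q r2 r3 -> Q r1 r3) ->
  (forall a' b' e delta, a <= a' -> a' < b' -> b' <= b -> 0 < e ->
     curve_Ck 1 `]a' - e, b' + e[ delta -> {in `[a', b'], gamma =1 delta} -> Q a' b') ->
  is_path a b gamma -> Q a b.
Proof.
move=> Q0 Qtr Qp [_ [s sp hs]].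
suff : forall a0, a <= a0 -> itv_partition a0 b s -> (forall i, (i < size s)%N ->
      let a' := nth b (a0 :: s) i in let b' := nth b (a0 :: s) i.+1 in
      exists e : R, exists delta : R -> M,
        [/\ 0 < e, curve_Ck 1 `]a' - e, b' + e[ delta &
            {in `[a', b'], gamma =1 delta}]) -> Q a0 b by apply.
elim: s {sp hs} => [|x s IH] a0 aa0 sp hs.
  have e := itv_partition_nil sp; rewrite e; apply: Q0; rewrite -e aa0/=.
  by rewrite e.
have sp' := itv_partition_cons sp.
have xb := itv_partition_le sp'.
have a0x : a0 < x by case: sp => /= /andP[].
have [e [delta [e0 Cd gd]]] := hs 0%N isT.
apply: (Qtr a0 x b) => //; first exact: ltW.
  exact: (Qp _ _ e delta).
apply: IH => //; first by rewrite (le_trans aa0)// ltW.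
by move=> i; exact: (hs i.+1).
Qed.

Lemma path_integrable gamma a b : is_path a b gamma ->
  mu.-integrable `[a, b] (EFin \o lag_curve gamma).
Proof.
apply: (@path_induction gamma (fun a b => mu.-integrable `[a, b] (EFin \o lag_curve gamma))) => [x _|x y z ax xy yz zb|a' b' e delta aa ab bb e0 Cd gd].
- by rewrite set_itv1; exact: integrable_singleton.
- by move=> i1 i2; have [] := integral_concat xy yz i1 i2.
- by have [Lam []] := action_piece (ltW ab) e0 Cd gd.
Qed.

Lemma path_le gamma a b : is_path a b gamma -> a <= b.
Proof. by move=> [_ [s sp _]]; exact: itv_partition_le sp. Qed.

Lemma is_path_eq gamma gamma' a b : {in `[a, b], gamma =1 gamma'} ->
  is_path a b gamma -> is_path a b gamma'.
Proof.
move=> gg [cg [s sp hs]]; split.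
  apply: subspace_eq_continuous cg => r; rewrite inE/= => rab; exact: gg.
exists s => // i si a' b'.
have [e [delta [e0 Cd gd]]] := hs i si; exists e, delta; split => // r rab.
rewrite -gg ?gd//; move: rab; rewrite !in_itv/= => /andP[ar rb].
have as_ : sorted <%R (a :: s) by case: sp.
have lb : last a s = b by case: sp => _ /eqP.
have aa' : a <= a'.
  have := @sorted_leq_nth _ (<=%R) le_trans lexx b (a :: s).
  rewrite -/a'; move=> /(_ (sub_sorted _ as_)) h.
  have := h (fun r1 r2 : R => @ltW _ _ r1 r2) 0%N i; rewrite !inE /=; apply => //.
  by rewrite ltnS ltnW.
have bb' : b' <= b.
  have := @sorted_leq_nth _ (<=%R) le_trans lexx b (a :: s).
  rewrite -/b'; move=> /(_ (sub_sorted _ as_)) h.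
  have := h (fun r1 r2 : R => @ltW _ _ r1 r2) i.+1 (size s); rewrite !inE /= ltnS si ltnSn.
  by rewrite -last_nth lb; apply.
by rewrite (le_trans aa' ar) (le_trans rb bb').
Qed.

Lemma is_path_cat gamma a b d : is_path a b gamma -> is_path b d gamma -> is_path a d gamma.
Proof.
move=> p1 p2; have ab := path_le p1; have bd := path_le p2.
case: p1 => c1 [s1 sp1 h1]; case: p2 => c2 [s2 sp2 h2]; split.
  have -> : [set` `[a, d]] = [set` `[a, b]] `|` [set` `[b, d]].
    apply/seteqP; split => y /=; rewrite !in_itv/=; last by case=> /andP[]; lra.
    by move=> /andP[ay yb]; have [yx|/ltW xy] := leP y b; [left|right]; apply/andP.
  by apply: withinU_continuous => //; exact: itv_closed.
exists (s1 ++ s2); first exact: itv_partition_cat sp1 sp2.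
have lb : last a s1 = b by case: sp1 => _ /eqP.
have nthd i (x y : R) : (i < size (a :: s1))%N -> nth x (a :: s1) i = nth y (a :: s1) i.
  by move=> ?; apply: set_nth_default.
move=> i; rewrite size_cat => si; rewrite -!cat_cons.
have [is1|is1] := ltnP i (size s1).
  have := h1 i is1; rewrite !nth_cat /= !ltnS is1 (ltnW is1).
  by rewrite (nthd i d b) ?ltnS ?(ltnW is1)// (set_nth_default b d).
have [j jE] : exists j, i = (size s1 + j)%N by exists (i - size s1)%N; rewrite subnKC.
have js : (j < size s2)%N by move: si; rewrite jE ltn_add2l.
have := h2 j js.
suff -> : nth d ((a :: s1) ++ s2) i = nth d (b :: s2) j.
  suff -> : nth d ((a :: s1) ++ s2) i.+1 = nth d (b :: s2) j.+1 by [].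
  by rewrite nth_cat /= jE ltnS ltnNge leq_addr /= subSS addKn.
rewrite nth_cat /= jE ltnS; case: j {js jE si is1} => [|j].
  by rewrite addn0 leqnn -last_nth lb.
by rewrite addnS ltnNge leq_addr /= subSS addKn.
Qed.

End curves.

Section subsolutions_are_dominated.
Context {R : realType} {n : nat} {M : smooth_manifold R n}.
Variables (g : riemannian_metric M) (L : M -> 'rV[R]_n -> R -> R).
Hypothesis hL : tonelli L g.
Variable u : M * circle R -> R.
Hypothesis hu : continuous u.
Local Notation E := 'rV[R]_n.
Local Notation mu := (@lebesgue_measure R).
Implicit Types (c : chart R n M) (x : M) (y w v z : E) (s t a b e : R) (gamma delta : R -> M).

Definition u_curve gamma s : R := u (gamma s, circle_of s).

Lemma u_curve_chart gamma c s : chart_source c (gamma s) ->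
  u_curve gamma s = u_in u c ((chart_map c \o gamma) s, s).
Proof. by move=> cs; rewrite /u_in/= chart_mapK ?inE. Qed.

Lemma near_curve_chart gamma J s : open J -> curve_Ck 1 J gamma -> J s ->
  exists2 d, 0 < d & forall r, `|r - s| < d -> curve_chart gamma J (chart_at (gamma s)) r.
Proof.
move=> oJ Cg Js.
have cs : curve_chart gamma J (chart_at (gamma s)) s by exact: curve_chart_at.
have := open_near (curve_chart_open (c := chart_at (gamma s)) oJ Cg) cs.
move=> /nbhs_normP[d /= d0 hd]; exists d => // r rd; apply: hd.
by rewrite /ball_/= distrC.
Qed.

(** Increments add up in time, so the inequality may be checked on intervals short enough to stay in
    one chart. *)
Lemma subsolution_dominated_curve gamma J (Lam : R -> R) a b :
  viscosity_subsolution L u -> open J -> curve_Ck 1 J gamma ->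
  (forall s, J s -> is_derive s 1 Lam (lag_curve L gamma s)) ->
  a <= b -> (forall s, a <= s <= b -> J s) ->
  u_curve gamma b - u_curve gamma a <= Lam b - Lam a.
Proof.
move=> sub oJ Cg dLam ab Jab.
apply: (@local_transitive_global R (fun s t => u_curve gamma t - u_curve gamma s <= Lam t - Lam s)) => //.
  by move=> *; lra.
move=> r rab; have Jr := Jab r rab.
have [d d0 hd] := near_curve_chart oJ Cg Jr.
exists d => // s t as_ st tb rs tr; set c := chart_at (gamma r).
have ac : atlas c by exact: atlas_chart_at.
have inJ s' : s <= s' <= t -> curve_chart gamma J c s'.
  by move=> ss'; apply: hd; rewrite ltr_norml; apply/andP; split; lra.
have [_ cs] := inJ s (ltac:(lra)); have [_ ct] := inJ t (ltac:(lra)).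
rewrite (u_curve_chart cs) (u_curve_chart ct).
have oc := curve_chart_open (c := c) oJ Cg.
have C1 : Ck 1 (curve_chart gamma J c) (chart_map c \o gamma) by have [_ Cg'] := Cg; exact: Cg'.
apply: (subsolution_dominated_chart hL hu ac oc C1 _ (Lam := Lam)) => //.
  by move=> s' /curve_chart_target.
move=> s' Js'; rewrite -(lag_curve_chart L ac Cg Js'); apply: dLam.
by have [] := Js'.
Qed.

Lemma subsolution_dominated_path gamma a b : viscosity_subsolution L u ->
  is_path a b gamma -> u_curve gamma b - u_curve gamma a <= action L gamma a b.
Proof.
move=> sub.
suff H : is_path a b gamma -> mu.-integrable `[a, b] (EFin \o lag_curve L gamma) /\
    u_curve gamma b - u_curve gamma a <= action L gamma a b by move=> /H[].
apply: (@path_induction _ _ _ gamma (fun a b => mu.-integrable `[a, b] (EFin \o lag_curve L gamma) /\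
    u_curve gamma b - u_curve gamma a <= action L gamma a b)).
- move=> r _; split; first by rewrite set_itv1; exact: integrable_singleton.
  by rewrite /action set_itv1 Rintegral_set1 subrr.
- move=> r1 r2 r3 _ r12 r23 _ [i1 u1] [i2 u2]; have [i12 E12] := integral_concat r12 r23 i1 i2.
  split => //; rewrite /action; move: u1 u2 E12; rewrite /action /lag_curve => u1 u2 ->; lra.
- move=> a' b' e delta aa ab bb e0 Cd gd.
  have [Lam [dLam gi aE]] := action_piece hL (ltW ab) e0 Cd gd.
  split => //; rewrite aE.
  have -> : u_curve gamma b' = u_curve delta b' by rewrite /u_curve gd// in_itv/= lexx ltW.
  have -> : u_curve gamma a' = u_curve delta a' by rewrite /u_curve gd// in_itv/= lexx ltW.
  apply: (@subsolution_dominated_curve delta [set` `]a' - e / 2, b' + e / 2[]) => //.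
  + case: Cd => cd Cd; split.
      by move=> s; rewrite /= in_itv/= => sab; apply: cd; rewrite /= in_itv/=; lra.
    move=> c ac; apply: Ck_subset (Cd c ac) => s [/=]; rewrite !in_itv/= => sab cs.
    by split => //=; lra.
  + exact: ltW.
  + by move=> s sab; rewrite /= in_itv/=; lra.
Qed.

Lemma subsolution_action_potential : viscosity_subsolution L u ->
  forall x (tau : circle R) (y : M) (sigma : circle R),
  ((u (x, tau) - u (y, sigma))%:E <= action_potential L sigma tau y x)%E.
Proof.
move=> sub x tau y sigma; apply: le_ereal_inf_tmp => _ [[t t'] /= [ts tt' _] <-].
apply: le_ereal_inf_tmp => _ [gamma [gp gx gy] <-].
rewrite lee_fin -ts -tt' -gx -gy; exact: subsolution_dominated_path.
Qed.

End subsolutions_are_dominated.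

Lemma action_potential_le {R : realType} {n : nat} {M : smooth_manifold R n}
  (L : M -> 'rV[R]_n -> R -> R) (gamma : R -> M) (a b : R) : is_path a b gamma -> a + 1 <= b ->
  (action_potential L (circle_of a) (circle_of b) (gamma a) (gamma b) <= (action L gamma a b)%:E)%E.
Proof.
move=> gp ab; apply: (@le_trans _ _ (min_action L a b (gamma a) (gamma b))).
  by apply: ereal_inf_lbound; exists (a, b).
by apply: ereal_inf_lbound; exists gamma.
Qed.

Lemma sub_le_cancel {R : numDomainType} (X Y Z A : R) : X - Z <= Y - Z + A -> X - Y <= A.
Proof. by rewrite -lerBlDl opprB addrA subrK. Qed.

Lemma sub_eq_swap {V : zmodType} (A B C D : V) : A - B = C - D -> A - C = B - D.
Proof. by move=> h; rewrite -(subrK B A) h addrAC (addrAC C) subrr add0r addrC. Qed.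

(** * Weak KAM solutions are viscosity solutions *)

Section weak_KAM_is_viscosity.
Context {R : realType} {n : nat} {M : smooth_manifold R n}.
Variables (g : riemannian_metric M) (L : M -> 'rV[R]_n -> R -> R).
Hypothesis hL : tonelli L g.
Variable u : M * circle R -> R.
Hypothesis hu : continuous u.
Hypothesis kam : backward_weak_KAM L u.
Local Notation E := 'rV[R]_n.
Local Notation mu := (@lebesgue_measure R).
Implicit Types (c : chart R n M) (x : M) (y w v z : E) (s t a b e : R) (gamma delta : R -> M).

Lemma lagrangian_int_shift x v t (k : int) : L x v (t + k%:~R) = L x v t.
Proof.
have [_ per _ _ _] := hL.
have pn (m : nat) s : L x v (s + m%:R) = L x v s.
  by elim: m => [|m IH]; rewrite ?addr0// -natr1 addrA -per IH.
case: k => m; first exact: pn.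
by have := pn m.+1 (t - m.+1%:R); rewrite subrK => ->; rewrite NegzE mulrNz -pmulrn.
Qed.

Lemma curve_Ck_subset k (I J : set R) gamma : J `<=` I -> curve_Ck k I gamma -> curve_Ck k J gamma.
Proof.
move=> JI [cg Cg]; split=> [s /JI|c ac]; first exact: cg.
by apply: Ck_subset (Cg c ac); apply: setSI.
Qed.

Lemma is_path_C1 gamma a b e : a <= b -> 0 < e -> curve_Ck 1 `]a - e, b + e[ gamma ->
  is_path a b gamma.
Proof.
move=> ab e0 Cg; split.
  apply: continuous_in_subspaceT => s; rewrite inE/= in_itv/= => sab.
  by have [cg _] := Cg; apply: cg; rewrite /= in_itv/=; lra.
move: ab; rewrite le_eqVlt => /predU1P[<-|ab].
  by exists [::] => //; split => /=.
exists [:: b]; first exact: itv_partition1.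
by case=> // _ /=; exists e, gamma.
Qed.

(** [action_potential] requires a duration of at least 1. The short segment is therefore preceded by
    a calibrated curve of duration 1 that ends at its starting point: domination holds on the whole,
    and calibration cancels the contribution of the prefix exactly. *)
Lemma weak_KAM_dominates_segment c y w t : atlas c -> chart_target c y ->
  exists2 d, 0 < d & exists Lam : R -> R, 
    is_derive t 1 Lam (lagrangian_in L c y w t) /\
    forall h, 0 <= h < d ->
    u_in u c (y, t) - u_in u c (y - h *: w, t - h) <= Lam t - Lam (t - h).
Proof.
move=> ac cy.
pose q (s : R) := y + (s - t) *: w.
have dq s : is_derive s 1 q w.
  have dr : is_derive s 1 (fun r : R => r - t) 1 by apply: is_derive_eq; rewrite subr0.
  have dfr : differentiable (fun r : R => r - t) s by apply/derivable1_diffP; case: dr.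
  have d1 : is_derive s 1 (fun r => (r - t) *: w) w.
    apply: DeriveDef; first by apply/derivable1_diffP; exact: differentiableZl.
    rewrite deriveE ?diffZl//; last exact: differentiableZl.
    by rewrite -deriveE//; case: dr => _ ->; rewrite scale1r.
  by apply: is_derive_eq; rewrite add0r.
have Cq k : Ck k [set: R] q.
  have oT : open [set: R] by exact: openT.
  apply: (Ck_add oT (f := cst y)); first exact: Ck_cst.
  have -> : (fun s => (s - t) *: w) = (fun s => \row_i ((s - t) * w 0 i)).
    by apply/funext => s; apply/rowP => i; rewrite !mxE.
  apply: (Ck_mx oT) => i j.
  have -> : (fun s : R => (\row_i0 ((s - t) * w 0 i0)) i j) = (fun s => (s - t) * w 0 j).
    by apply/funext => s; rewrite mxE.
  apply: (Ck_mul oT (f := fun s => s - t)); last exact: Ck_cst.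
  by apply: (Ck_sub oT); [exact: Ck_id|exact: Ck_cst].
have cq : continuous q by move=> s; exact: (Ck_continuous (Cq 0%N)).
have [d d0 hd] : exists2 d, 0 < d & forall s, `|s - t| < d -> chart_target c (q s).
  have : \forall s \near t, chart_target c (q s).
    by apply: (cq t); apply: (open_near (@open_chart_target _ _ _ c)); rewrite /q subrr scale0r addr0.
  move=> /nbhs_normP[d /= d0 hd]; exists d => // s sd; apply: hd.
  by rewrite /ball_/= distrC.
pose J := [set` `]t - d, t + d[].
have oJ : open J by exact: itv_open.
have JP s : J s <-> `|s - t| < d.
  by rewrite /J/= in_itv/= ltr_norml; split => /andP[? ?]; apply/andP; split; lra.
have CqJ k : Ck k J q by apply: Ck_subset (Cq k).
have tq s : J s -> chart_target c (q s) by move=> /JP/hd.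
have D1q s : 'D_1 q s = w by case: (dq s).
have lagE s : lag_along L c q s = lagrangian_in L c (q s) w s by rewrite /lag_along D1q.
have [Lam dLam] : exists Lam : R -> R, forall s, t - d / 2 < s < t + d / 2 -> is_derive s 1 Lam (lagrangian_in L c (q s) w s).
  have [Lam dLam] := @antiderivative R (lag_along L c q) (t - d / 2) (t + d / 2) (ltac:(
    apply: continuous_in_subspaceT => s; rewrite inE/= in_itv/= => sd;
    apply: (lag_along_cvg hL ac (CqJ 1%N) tq); apply/JP; rewrite ltr_norml; apply/andP; split; lra)).
  by exists Lam => s sd; rewrite -lagE; exact: dLam.
exists (d / 2); first by rewrite divr_gt0.
exists Lam; split.
  by have := dLam t (ltac:(lra)); rewrite /q subrr scale0r addr0.
move=> h /andP[h0 hd2].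
have qth : y - h *: w = q (t - h) by rewrite /q addrAC subrr sub0r scaleNr.
have qt : y = q t by rewrite /q subrr scale0r addr0.
(* The calibrated curve ends at a time [t1] equal to [t - h] modulo an integer [k] only; the segment
   is translated in time by [k] to be glued to it. *)
have [gamma [t1 [g1 ct1 gp gc]]] := kam.2 (chart_inv c (q (t - h))) (circle_of (t - h)).
have /circle_of_eq/intrP[k kE] := ct1.
have kE1 : t1 - k%:~R = t - h by rewrite -kE; ring.
have kE2 : t1 + h - k%:~R = t by rewrite -kE; ring.
have kE3 : t1 + h - t = k%:~R by rewrite -kE; ring.
have t1h : t1 <= t1 + h by rewrite lerDl.
have shift_in r : t1 - (d / 2 - h) < r < t1 + h + (d / 2 - h) -> `|r - k%:~R - t| < d.
  by rewrite -kE ltr_norml => rt; apply/andP; split; lra.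
have shift_in2 r : t1 <= r <= t1 + h -> [/\ t1 - (d / 2 - h) < r < t1 + h + (d / 2 - h),
    t1 - (d / 2 - h) / 2 < r < t1 + h + (d / 2 - h) / 2 & t - d / 2 < r - k%:~R < t + d / 2].
  by rewrite -kE => rt; split; lra.
pose delta r := chart_inv c (q (r - k%:~R)).
pose gam r := if r <= t1 then gamma r else delta r.
have gamE : {in `[t1 - 1, t1], gamma =1 gam}.
  by move=> r; rewrite in_itv/= => /andP[_ rt]; rewrite /gam rt.
have delE : {in `[t1, t1 + h], delta =1 gam}.
  move=> r; rewrite in_itv/= => /andP[tr rh]; rewrite /gam.
  case: leP => // rt; have -> : r = t1 by lra.
  by rewrite g1 /delta kE1.
have gam1 : gam (t1 - 1) = gamma (t1 - 1) by rewrite -gamE// in_itv/= lexx gerBl ler01.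
have gam2 : gam (t1 + h) = chart_inv c (q t) by rewrite -delE ?/delta ?kE2// in_itv/= lexx t1h.
have cth : circle_of (t1 + h) = circle_of t by apply/circle_of_eq; rewrite kE3 intr_int.
have t1h1 : t1 - 1 + 1 <= t1 + h by rewrite subrK.
have e0 : 0 < d / 2 - h by lra.
have Cdel : curve_Ck 1 `]t1 - (d / 2 - h), t1 + h + (d / 2 - h)[ delta.
  apply: (curve_Ck_chart ac (q := fun r => q (r - k%:~R))); first exact: itv_open.
    by move=> s; rewrite /= in_itv/= => /shift_in/hd.
  have oI : open [set` `]t1 - (d / 2 - h), t1 + h + (d / 2 - h)[] by exact: itv_open.
  have Csh : Ck 1 [set` `]t1 - (d / 2 - h), t1 + h + (d / 2 - h)[] (fun r : R => r - k%:~R).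
    by apply: (Ck_sub oI); [exact: Ck_id|exact: Ck_cst].
  exact: (Ck_comp finite_dim_real oI openT (fun _ _ => I) Csh (Cq 1%N)).
have p1 : is_path (t1 - 1) t1 gam.
  by apply: is_path_eq gamE _; apply: gp; lra.
have p2 : is_path t1 (t1 + h) gam by apply: is_path_eq delE _; exact: is_path_C1 Cdel.
have p3 := is_path_cat p1 p2.
have i1 := path_integrable hL p1; have i2 := path_integrable hL p2.
have [i3 E3] := integral_concat (ltac:(lra) : t1 - 1 <= t1) t1h i1 i2.
have A1 : action L gam (t1 - 1) t1 = action L gamma (t1 - 1) t1.
  have [||_ E1] := @eq_on_open_integral R (lag_curve L gam) (lag_curve L gamma) (t1 - 1) t1 (ltac:(lra)).
  - move=> s st; have ss : \forall r \near s, gam r = gamma r.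
      by apply: filterS (near_itv_oo st) => r /andP[_ rt]; rewrite /gam (ltW rt).
    by rewrite /lag_curve (velocity_eq ss) (nbhs_singleton ss).
  - by apply: (path_integrable hL); apply: gp; lra.
  exact: E1.
have A2 : action L gam t1 (t1 + h) = Lam t - Lam (t - h).
  have gd : {in `[t1, t1 + h], gam =1 delta} by move=> r rt; rewrite -delE.
  have [Lam' [dLam' _ ->]] := action_piece hL t1h e0 Cdel gd.
  (* By periodicity of the Lagrangian, [Lam'] and the translate of [Lam] have the same derivative,
     so [F] is constant. *)
  pose F r := Lam' r - Lam (r - k%:~R).
  suff : F (t1 + h) = F t1.
    by rewrite /F kE1 kE2; exact: sub_eq_swap.
  have dF r : t1 <= r <= t1 + h -> is_derive r 1 F 0.
    move=> /shift_in2[rt1 rt2 rt3]; have dl' := dLam' r rt2.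
    have [dl2 dl2E] := dLam (r - k%:~R) rt3.
    have dl3 : is_derive r 1 (fun r => Lam (r - k%:~R)) (lagrangian_in L c (q (r - k%:~R)) w (r - k%:~R)).
      apply: DeriveDef; last rewrite -dl2E; last by apply: derive_on_line => s; rewrite addrA.
      apply/derivable1_diffP; apply: (@differentiable_comp _ _ _ _ (fun r : R => r - k%:~R) Lam).
        by apply: differentiableB => //; exact: differentiable_cst.
      exact/derivable1_diffP.
    have -> : 0 = lag_curve L delta r - lagrangian_in L c (q (r - k%:~R)) w (r - k%:~R).
      have Jr : [set` `]t1 - (d / 2 - h), t1 + h + (d / 2 - h)[] r by rewrite /= in_itv.
      have tr : chart_target c (q (r - k%:~R)) by exact/hd/shift_in.
      have cr : curve_chart delta `]t1 - (d / 2 - h), t1 + h + (d / 2 - h)[ c r.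
        exact: (conj Jr (chart_invK tr).1).
      rewrite (lag_curve_chart L ac Cdel cr) /lag_along /= /delta (chart_invK tr).2.
      have -> : 'D_1 (chart_map c \o (fun r0 => chart_inv c (q (r0 - k%:~R)))) r = w.
        rewrite -[RHS](D1q (r - k%:~R)).
        transitivity ('D_1 (fun r0 : R => q (r0 - k%:~R)) r).
          apply: near_eq_derive; near=> r' => /=.
          apply: (chart_invK _).2; apply/hd/shift_in.
          by near: r'; exact: near_itv_oo.
        by apply: derive_on_line => s; rewrite addrA.
      have := lagrangian_int_shift (chart_inv c (q (r - k%:~R))) (tangent_of c (q (r - k%:~R)) w) (r - k%:~R) k.
      rewrite [X in L _ _ X = _]subrK => lE.
      by apply/esym/eqP; rewrite subr_eq0; apply/eqP; exact: lE.
    exact: is_deriveB.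
  have h1 := derive_le0_nincr t1h dF (fun _ _ => lexx 0).
  have h2 := derive_le0_nincr t1h (fun r rt => is_deriveN (dF r rt)) (fun _ _ => _).
  have {}h2 : - F (t1 + h) <= - F t1 by apply: h2 => *; rewrite oppr0.
  by apply/eqP; rewrite eq_le h1 -lerN2 h2.
have pot := kam.1 (chart_inv c (q t)) (circle_of t) (gamma (t1 - 1)) (circle_of (t1 - 1)).
have le1 := action_potential_le L p3 t1h1; rewrite gam1 gam2 cth in le1.
have := le_trans pot le1; rewrite lee_fin /action E3.
rewrite -/(action L gam (t1 - 1) t1) -/(action L gam t1 (t1 + h)) A1 A2.
have t11 : t1 - 1 <= t1 by rewrite gerBl ler01.
rewrite -(gc (t1 - 1) t11) => /sub_le_cancel.
by rewrite qth /u_in /= -qt.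
Unshelve. all: by end_near. Qed.

Lemma derive_left_le0 (psi : R -> R) t l d : is_derive t 1 psi l -> 0 < d ->
  (forall s, t - d < s <= t -> psi t <= psi s) -> l <= 0.
Proof.
move=> [dpsi lE] d0 hpsi; rewrite leNgt; apply/negP => l0.
have : h^-1 *: (psi (h *: 1 + t) - psi t) @[h --> 0^'] --> l by rewrite -lE; exact: dpsi.
move=> /cvgrPdist_lt/(_ _ l0)[e /= e0 he].
pose h := - (Num.min e d / 2).
have [m0 me md] : [/\ 0 < Num.min e d, Num.min e d <= e & Num.min e d <= d].
  by rewrite lt_min e0 d0 !ge_min !lexx orbT.
have h0 : h < 0 by rewrite /h; lra.
have hb : ball_ Num.norm 0 e h by rewrite /ball_/= sub0r normrN ltr0_norm//; rewrite /h; lra.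
have hn0 : h != 0 by rewrite lt_eqF.
have hp : psi t <= psi (h + t) by apply: hpsi; rewrite /h; apply/andP; split; lra.
have := he h hb hn0; rewrite (_ : h *: 1 = h); last exact: mulr1.
have : h^-1 *: (psi (h + t) - psi t) <= 0.
  by rewrite /GRing.scale/= nmulr_rle0 ?invr_lt0// subr_ge0.
by move=> h1; rewrite ger0_norm; lra.
Qed.

Lemma hamilton_jacobi_periodic (phi : M * circle R -> R) x s t : circle_of s = circle_of t ->
  hamilton_jacobi L phi x s = hamilton_jacobi L phi x t.
Proof.
move=> st; have /circle_of_eq/intrP[k kE] := st.
have sE : s = t + k%:~R by rewrite -kE addrC subrK.
rewrite /hamilton_jacobi; congr (_ + _).
  rewrite !derive1E; apply: derive_on_line => h.
  by rewrite sE addrA circle_of_addn.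
rewrite /hamiltonian st; congr sup.
by apply/seteqP; split => _ [v _ <-]; exists v => //; rewrite sE lagrangian_int_shift.
Qed.

Lemma near_chart_inv c y t (P : M * circle R -> Prop) : chart_target c y ->
  (\forall z \near (chart_inv c y, circle_of t), P z) ->
  \forall z \near (y, t), P (chart_inv c z.1, circle_of z.2).
Proof.
move=> cy hP.
have cf : {for (y, t), continuous (fun z : E * R => (chart_inv c z.1, circle_of z.2))}.
  apply: continuous_pair.
    apply: (@continuous_comp _ _ _ fst (chart_inv c)); first exact: cvg_fst.
    exact: chart_inv_cvg.
  apply: (@continuous_comp _ _ _ snd (@circle_of R)); first exact: cvg_snd.
  exact: circle_of_continuous.
exact: (cf _ hP).
Qed.

(** For each velocity [w], the segment arriving at the point with that velocity is followed
    backwards: maximality compares increments of the test function with those of [u], and domination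
    compares the latter with the action. A one-sided derivative concludes. *)
Lemma weak_KAM_subsolution : viscosity_subsolution L u.
Proof.
move=> phi Cphi x t hmax; set c := chart_at x.
have ac : atlas c by exact: atlas_chart_at.
have cx : chart_source c x by exact: source_chart_at.
have cy := chart_map_target cx; set y := chart_map c x in cy.
have xE : chart_inv c y = x by rewrite /y chart_mapK ?inE.
rewrite -xE; apply: (hamilton_jacobi_le hL Cphi ac cy) => w.
have [d d0 [Lam [dLam hLam]]] := weak_KAM_dominates_segment w t ac cy.
have df := test_in_differentiable Cphi t ac cy.
set f := test_in phi c in df *.
have hn : \forall z \near (y, t), u_in u c z - f z <= u_in u c (y, t) - f (y, t).
  rewrite -xE in hmax; exact: (near_chart_inv cy hmax).
pose line (h : R) : E * R := h *: (w, 1) + (y, t).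
have line0 : line 0 = (y, t) by rewrite /line scale0r add0r.
have cl : {for 0, continuous line}.
  apply: (@continuousD _ _ _ (fun h : R => h *: ((w, 1) : E * R)) (cst (y, t))); last exact: cst_continuous.
  by apply: (@continuousZr_tmp _ _ _ id); exact: cvg_id.
have [d' d'0 hd'] : exists2 d', 0 < d' & forall h, `|h| < d' ->
    u_in u c (line h) - f (line h) <= u_in u c (y, t) - f (y, t).
  have := cl _; rewrite line0 => /(_ _ hn)/nbhs_normP[d' /= d'0 hd'].
  by exists d' => // h hh; apply: hd'; rewrite /ball_/= sub0r normrN.
pose psi h := f (line h) - Lam (h + t).
have dpsi : is_derive (0 : R) 1 psi ('D_(w, 1) f (y, t) - lagrangian_in L c y w t).
  have d1 : is_derive (0 : R) 1 (fun h => f (line h)) ('D_(w, 1) f (y, t)).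
    have := @is_derive_line _ _ _ f (y, t) (w, 1) 0; rewrite scale0r add0r.
    by apply; exact: diff_derivable.
  have d2 : is_derive (0 : R) 1 (fun h => Lam (h + t)) (lagrangian_in L c y w t).
    have := @is_derive_line _ _ _ Lam t 1 0; rewrite scale0r add0r.
    case: dLam => dL <- /(_ dL); rewrite (_ : (fun h : R => Lam (h *: 1 + t)) = (fun h => Lam (h + t)))//.
    by apply/funext => h; rewrite [h *: 1]mulr1.
  exact: is_deriveB.
have dd0 : 0 < Num.min d d' by rewrite lt_min d0.
apply: (derive_left_le0 dpsi dd0) => h /andP[h1 h2].
rewrite sub0r in h1.
have [md md'] : Num.min d d' <= d /\ Num.min d d' <= d' by rewrite !ge_min !lexx orbT.
have hd1 : `|h| < d' by rewrite ler0_norm//; lra.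
have := hd' h hd1; have := hLam (- h) (ltac:(lra)).
have -> : (y - (- h) *: w, t - (- h)) = line h.
  rewrite /line scaleNr !opprK; congr pair; first by rewrite addrC.
  by rewrite /= [h *: 1]mulr1 addrC.
rewrite /psi line0 add0r opprK (addrC t h); lra.
Qed.

Lemma path_last_piece gamma a b : a < b -> is_path a b gamma ->
  exists a' e delta, [/\ a' < b, 0 < e, curve_Ck 1 `]a' - e, b + e[ delta &
    {in `[a', b], gamma =1 delta}].
Proof.
move=> ab [_ [s sp hs]].
case/lastP: s sp hs => [sp|s b' sp hs].
  by have := itv_partition_nil sp => e; move: ab; rewrite e ltxx.
have bE : b' = b by case: sp => _; rewrite last_rcons => /eqP.
have := hs (size s); rewrite size_rcons => /(_ (ltnSn _)) [e [delta]].
have -> : nth b (a :: rcons s b') (size s).+1 = b by rewrite /= nth_rcons ltnn eqxx.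
move=> [e0 Cd gd]; exists (nth b (a :: rcons s b') (size s)), e, delta; split => //.
case: sp => sp _; move/pathP : sp => /(_ b (size s)); rewrite size_rcons => /(_ (ltnSn _)).
by rewrite nth_rcons ltnn eqxx bE.
Qed.

(** The Hamiltonian being a supremum, a lower bound needs a single velocity: the one with which a
    calibrated curve arrives at the point. *)
Lemma weak_KAM_supersolution : viscosity_supersolution L u.
Proof.
move=> phi Cphi x t hmin.
have [gamma [t1 [g1 ct1 gp gc]]] := kam.2 x (circle_of t).
(* The calibrated curve ends at a time [t1] that agrees with [t] only modulo 1; the whole inequality
   is moved to [t1]. *)
rewrite -(hamilton_jacobi_periodic phi x ct1).
rewrite -ct1 in hmin gc.
have [a' [e [delta [a't1 e0 Cd gd]]]] := path_last_piece (ltac:(lra) : t1 - 1 < t1) (gp (t1 - 1) (ltac:(lra))).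
set c := chart_at x.
have ac : atlas c by exact: atlas_chart_at.
have cx : chart_source c x by exact: source_chart_at.
have cy := chart_map_target cx; set y := chart_map c x in cy.
have xE : chart_inv c y = x by rewrite /y chart_mapK ?inE.
have d1 : delta t1 = x by rewrite -g1 gd// in_itv/= lexx ltW.
pose J := [set` `]a' - e, t1 + e[].
have oJ : open J by exact: itv_open.
have Jt : J t1 by rewrite /J/= in_itv/=; lra.
have ct : curve_chart delta J c t1 by split => //=; rewrite d1.
have oc := curve_chart_open (c := c) oJ Cd.
pose q := chart_map c \o delta.
have dq : differentiable q t1 by case: Cd => _ /(_ _ ac)[dq _]; exact: dq.
set w := 'D_1 q t1.
have qt : q t1 = y by rewrite /q/= d1.
have df := test_in_differentiable Cphi t1 ac cy.
set f := test_in phi c in df *.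
have hge := hamilton_jacobi_ge hL Cphi w t1 ac cy; rewrite xE in hge.
apply: le_trans hge.
have [Lam [dLam _ _]] := action_piece hL (ltW a't1) e0 Cd gd.
pose psi s := - (f (q s, s) - Lam s).
have dpsi : is_derive t1 1 psi (- ('D_(w, 1) f (y, t1) - lagrangian_in L c y w t1)).
  have dp : differentiable (fun s => (q s, s)) t1 by exact: differentiable_pair.
  have Dp : 'D_1 (fun s => (q s, s)) t1 = (w, 1).
    by rewrite deriveE// diff_pair// -!deriveE// derive_id.
  have dfp : differentiable (f \o (fun s => (q s, s))) t1.
    by apply: differentiable_comp => //; rewrite qt.
  have dfq : is_derive t1 1 (fun s => f (q s, s)) ('D_(w, 1) f (y, t1)).
    apply: DeriveDef; first exact: diff_derivable dfp.
    rewrite -[LHS]/('D_1 (f \o (fun s => (q s, s))) t1) derive_compE//; last by rewrite qt.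
    by rewrite Dp qt.
  have dL := dLam t1 (ltac:(lra)).
  have dLE : lag_curve L delta t1 = lagrangian_in L c y w t1.
    by rewrite (lag_curve_chart L ac Cd ct) /lag_along -/q qt.
  rewrite dLE in dL.
  by apply: is_deriveN; exact: is_deriveB.
rewrite -oppr_le0.
have hn : \forall s \near t1, u (x, circle_of t1) - phi (x, circle_of t1) <=
    u (delta s, circle_of s) - phi (delta s, circle_of s).
  have cd : {for t1, continuous (fun s => (delta s, circle_of s))}.
    apply: continuous_pair; last exact: circle_of_continuous.
    by case: Cd => cd _; exact: cd.
  by rewrite -d1 in hmin *; exact: (cd _ hmin).
have [d d0 hd] : exists2 d, 0 < d & forall s, `|s - t1| < d -> curve_chart delta J c s /\
    u (x, circle_of t1) - phi (x, circle_of t1) <= u (delta s, circle_of s) - phi (delta s, circle_of s).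
  have : \forall s \near t1, curve_chart delta J c s /\
    u (x, circle_of t1) - phi (x, circle_of t1) <= u (delta s, circle_of s) - phi (delta s, circle_of s).
    by apply: filterI => //; exact: (open_near oc ct).
  move=> /nbhs_normP[d /= d0 hd]; exists d => // s sd; apply: hd; by rewrite /ball_/= distrC.
(* The bound [t1 - a'] keeps the comparison inside the last C^1 piece, where the calibrated curve
   coincides with [delta]. *)
have dd0 : 0 < Num.min d (t1 - a') by rewrite lt_min d0/= subr_gt0.
apply: (derive_left_le0 dpsi dd0) => s /andP[s1 s2].
have [md md'] : Num.min d (t1 - a') <= d /\ Num.min d (t1 - a') <= t1 - a' by rewrite !ge_min !lexx orbT.
have sd : `|s - t1| < d by rewrite ler0_norm; lra.
have [[_ cs] hs] := hd s sd.
have as_ : a' < s by lra.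
have ss : s <= t1 by [].
have sub_ : [set` `]s - e, t1 + e[] `<=` [set` `]a' - e, t1 + e[].
  by move=> r; rewrite /= !in_itv/= => /andP[r1 ->]; rewrite andbT; lra.
have Cds : curve_Ck 1 `]s - e, t1 + e[ delta by exact: curve_Ck_subset Cd.
have gds : {in `[s, t1], gamma =1 delta}.
  by move=> r; rewrite in_itv/= => /andP[r1 r2]; apply: gd; rewrite in_itv/=; lra.
have dLams r : s <= r <= t1 -> is_derive r 1 Lam (lag_curve L delta r).
  by move=> /andP[r1 r2]; apply: dLam; lra.
have [_ aE] := action_antiderivative hL ss e0 Cds gds dLams.
have ucal := gc s ss; rewrite aE gds in ucal; last by rewrite in_itv/= lexx.
have fs : f (q s, s) = phi (delta s, circle_of s) by rewrite /f/test_in /q/= chart_mapK ?inE.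
have ft : f (q t1, t1) = phi (x, circle_of t1) by rewrite /f/test_in qt/= xE.
rewrite /psi fs ft; move: hs ucal; clear; lra.
Qed.

End weak_KAM_is_viscosity.

(** * Extremals *)

Section picard_lindelof.
Context {R : realType}.

Lemma ler_geometric (x y C : R) : (forall k, x <= y + C / 2 ^+ k) -> x <= y.
Proof.
move=> h; rewrite leNgt; apply/negP => yx.
have d0 : 0 < x - y by rewrite subr_gt0.
pose k := Num.bound (C / (x - y)).
have k1 : C / (x - y) < k%:R.
  have [C0|C0] := leP 0 (C / (x - y)); first exact: archi_boundP.
  by apply: lt_le_trans C0 _.
have k2 : k%:R <= 2 ^+ k :> R by rewrite -natrX ler_nat ltnW// ltn_expl.
have p0 : 0 < 2 ^+ k :> R by rewrite exprn_gt0.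
have : C < (x - y) * 2 ^+ k.
  by rewrite mulrC -ltr_pdivrMr//; exact: lt_le_trans k1 k2.
rewrite -ltr_pdivrMr// => h1; have := h k; lra.
Qed.

(** [e k] is the tail of the geometric series, so the intervals of radius [e k] around [x k] are
    nested, and the supremum of their left ends lies in all of them. *)
Lemma geometric_limit (x : nat -> R) C :
  (forall k, `|x k.+1 - x k| <= C / 2 ^+ k) ->
  exists l, forall k, `|l - x k| <= 2 * C / 2 ^+ k.
Proof.
move=> h; pose e k : R := 2 * C / 2 ^+ k.
have eS k : e k = C / 2 ^+ k + e k.+1.
  rewrite /e exprS invfM mulrA -[2 * C / 2](mulrAC 2) divff ?pnatr_eq0// mul1r; lra.
have hk k : x k - C / 2 ^+ k <= x k.+1 <= x k + C / 2 ^+ k.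
  by have := h k; rewrite ler_norml; lra.
have e0 k : 0 <= e k.
  by have := le_trans (normr_ge0 _) (h k); rewrite /e; lra.
have lo : {homo (fun k => x k - e k) : i j / (i <= j)%N >-> i <= j}.
  apply: homo_leq => [//|y1 y2 y3|k]; first exact: le_trans.
  by have := hk k; rewrite (eS k); lra.
have hi : {homo (fun k => x k + e k) : i j / (i <= j)%N >-> j <= i}.
  apply: (@homo_leq _ _ (fun a b => b <= a)) => [y|y2 y1 y3 h1 h2|k]; [exact: lexx|exact: le_trans h2 h1|].
  by have := hk k; rewrite (eS k); lra.
have lohi j k : x j - e j <= x k + e k.
  have := lo _ _ (leq_maxl j k); have := hi _ _ (leq_maxr j k); have := e0 (maxn j k).
  cbn beta; lra.
pose A := [set x k - e k | k in [set: nat]].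
have As : has_sup A.
  by split; [exists (x 0%N - e 0%N), 0%N|exists (x 0%N + e 0%N) => _ [j _ <-]].
exists (sup A) => k.
have l1 : x k - e k <= sup A by apply: ub_le_sup; [case: As|exists k].
have l2 : sup A <= x k + e k by apply: ge_sup; [case: As|move=> _ [j _ <-]].
by rewrite ler_norml; rewrite -/(e k); lra.
Qed.

Lemma rowB m (v w : 'rV[R]_m) j : (v - w) 0 j = v 0 j - w 0 j.
Proof. by rewrite [LHS]mxE [X in _ + X = _]mxE. Qed.

Lemma norm_row_le m (v : 'rV[R]_m) B : 0 <= B -> (forall j, `|v 0 j| <= B) -> `|v| <= B.
Proof.
move=> B0 h; have -> : `|v| = mx_norm v by [].
rewrite mx_normrE; apply: bigmax_le => // -[i j] _ /=.
by rewrite (ord1 i).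
Qed.

Lemma antiderivative_row m (f : R -> 'rV[R]_m) (a b t0 : R) (x0 : 'rV[R]_m) : continuous f ->
  exists2 G : R -> 'rV[R]_m, G t0 = x0 &
    forall t, a < t < b -> forall j, is_derive t 1 (fun s => G s 0 j) (f t 0 j).
Proof.
move=> cf.
have hj j : exists Gj : R -> R, forall t, a < t < b -> is_derive t 1 Gj (f t 0 j).
  apply: antiderivative; apply: continuous_subspaceT => s.
  apply: (@continuous_comp _ _ _ f (fun v : 'rV[R]_m => v 0 j)); first exact: cf.
  exact: coord_continuous.
have /choice [G hG] := hj.
exists (fun s => x0 + \row_j (G j s - G j t0)).
  by apply/rowP => j; rewrite !mxE subrr addr0.
move=> t tab j.
have -> : (fun s => (x0 + \row_j (G j s - G j t0)) 0 j) = (fun s => x0 0 j + (G j s - G j t0)).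
  by apply/funext => s; rewrite !mxE.
have h := hG j t tab.
have h2 := is_deriveB h (is_derive_cst (G j t0) t 1).
by have := is_deriveD (is_derive_cst (x0 0 j) t 1) h2; rewrite subr0 add0r.
Qed.

Lemma clamp_lipschitz (T x y : R) : 0 <= T ->
  `|Num.max (- T) (Num.min T x) - Num.max (- T) (Num.min T y)| <= `|x - y|.
Proof.
move=> T0; have [xy|xy] := leP 0 (x - y); rewrite ?(ger0_norm xy) ?(ltr0_norm xy) ler_norml
  /Num.max /Num.min; do ![case: ifPn => /=; rewrite -?leNgt] => *; lra.
Qed.

Section contraction.
Context {m : nat}.
Local Notation V := 'rV[R]_m.
Variables (F : R -> V -> V) (t0 : R) (x0 : V) (r K : R).
Hypotheses (r0 : 0 < r) (K0 : 0 < K).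
Hypothesis Fc : forall t x, `|t - t0| <= r -> `|x - x0| <= r ->
  {for (t, x), continuous (fun z : R * V => F z.1 z.2)}.
Hypothesis FB : forall t x, `|t - t0| <= r -> `|x - x0| <= r -> `|F t x| <= K.
Hypothesis FK : forall t x y, `|t - t0| <= r -> `|x - x0| <= r -> `|y - x0| <= r ->
  `|F t x - F t y| <= K * `|x - y|.

(** The bound [r / K] keeps the iterates in the ball of radius [r], and the bound [(2 * K)^-1] makes
    the integral operator halve distances. *)
Let T : R := Num.min r (Num.min (r / K) (2 * K)^-1).

Let T0 : 0 < T. Proof. by rewrite !lt_min r0 divr_gt0//= invr_gt0 mulr_gt0. Qed.
Let Tr : T <= r. Proof. by rewrite ge_min lexx. Qed.
Let KTr : K * T <= r.
Proof. by rewrite mulrC -ler_pdivlMr// !ge_min lexx/= orbT. Qed.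
Let KT : K * T <= 2^-1.
Proof.
have : T <= (2 * K)^-1 by rewrite !ge_min lexx !orbT.
by move=> /(ler_wpM2l (ltW K0)); rewrite invfM mulrCA divff ?mulr1// gt_eqF.
Qed.

(** Clamping time to [t0 - T, t0 + T] makes the iterates globally defined Lipschitz functions, so no
    function space on an interval is involved. *)
Let cl (t : R) : R := t0 + Num.max (- T) (Num.min T (t - t0)).

Let cl_le t : `|cl t - t0| <= T.
Proof.
rewrite /cl addrAC subrr add0r ler_norml le_max lexx/= ge_max ge_min lexx/= andbT.
by have := T0; lra.
Qed.

Let cl_id t : `|t - t0| <= T -> cl t = t.
Proof.
rewrite ler_norml => /andP[h1 h2]; rewrite /cl; have -> : Num.min T (t - t0) = t - t0.
  by apply/min_idPr.
have -> : Num.max (- T) (t - t0) = t - t0 by apply/max_idPr.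
by rewrite addrC subrK.
Qed.

Let cl_lip s t : `|cl t - cl s| <= `|t - s|.
Proof.
rewrite /cl opprD addrACA subrr add0r.
have -> : t - s = (t - t0) - (s - t0) by rewrite opprB addrA subrK.
exact: clamp_lipschitz (ltW T0).
Qed.

Definition picard_good (X : R -> V) :=
  (forall s t, `|X t - X s| <= K * `|t - s|) /\ forall t, `|X t - x0| <= r.

(** A relation and not an operator, because antiderivatives are known only to exist; the sequence of
    iterates is chosen afterwards. *)
Definition picard_step (X Y : R -> V) := exists G : R -> V,
  [/\ G t0 = x0, forall t, `|t - t0| < 2 * T -> forall j,
      is_derive t 1 (fun s => G s 0 j) (F (cl t) (X t) 0 j) & Y = G \o cl].

Let picard_mvt (f df : R -> R) B s t : `|s - t0| <= T -> `|t - t0| <= T ->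
  (forall t, `|t - t0| <= T -> is_derive t 1 f (df t) /\ `|df t| <= B) ->
  `|f t - f s| <= B * `|t - s|.
Proof.
wlog st : s t / s <= t => [hw hs ht h|].
  have [st|/ltW ts] := leP s t; first exact: hw.
  by rewrite distrC [`|t - s|]distrC; exact: hw.
rewrite !ler_norml => /andP[s1 s2] /andP[t1 t2] h.
rewrite (ger0_norm (_ : 0 <= t - s)) ?subr_ge0//.
have ht x : s <= x <= t -> `|x - t0| <= T by rewrite ler_norml => /andP[x1 x2]; lra.
rewrite -ler_norml; apply: (@derive_bounded_lipschitz R f df) => // x /ht/h[] //.
Qed.

Let continuous_lip (X : R -> V) : (forall s t, `|X t - X s| <= K * `|t - s|) -> continuous X.
Proof.
move=> h s; apply/cvgrPdist_le => e e0; apply/nbhs_normP.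
exists (e / K); first by rewrite /= divr_gt0.
move=> t /= st; rewrite distrC; apply: le_trans (h s t) _.
by rewrite mulrC -ler_pdivlMr// distrC ltW.
Qed.

Let field_continuous X : picard_good X -> continuous (fun t => F (cl t) (X t)).
Proof.
move=> [XL Xr] t.
apply: (@continuous_comp _ _ _ (fun t => (cl t, X t)) (fun z : R * V => F z.1 z.2)).
  apply: continuous_pair; last exact: continuous_lip.
  apply/cvgrPdist_le => e e0; near=> s; rewrite distrC.
  apply: le_trans (cl_lip t s) _.
  by near: s; apply: cvgr_distC_le; [exact: cvg_id|].
by apply: Fc => //; exact: le_trans (cl_le t) Tr.
Unshelve. all: by end_near. Qed.

Let T2 t : `|t - t0| <= T -> `|t - t0| < 2 * T.
Proof. by move=> h; have := T0; lra. Qed.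

Lemma picard_step_good X : picard_good X -> exists2 Y, picard_step X Y & picard_good Y.
Proof.
move=> gX; have [G G0 dG] := @antiderivative_row m _ (t0 - 2 * T) (t0 + 2 * T) t0 x0 (field_continuous gX).
have dG' t : `|t - t0| < 2 * T -> forall j, is_derive t 1 (fun s => G s 0 j) (F (cl t) (X t) 0 j).
  by rewrite ltr_norml => /andP[? ?]; apply: dG; lra.
have GL s t : `|s - t0| <= T -> `|t - t0| <= T -> `|G t - G s| <= K * `|t - s|.
  move=> hs ht; apply: norm_row_le => [|j]; first by rewrite mulr_ge0// ltW.
  rewrite rowB.
  apply: (@picard_mvt (fun s => G s 0 j) (fun t => F (cl t) (X t) 0 j) K s t hs ht) => t' /T2 t'T.
  split; first exact: dG'.
  apply: le_trans (mx_norm_coord _ _ _) _; apply: FB; last exact: gX.2.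
  exact: le_trans (cl_le _) Tr.
exists (G \o cl); first by exists G.
split=> [s t|t] /=.
  apply: le_trans (GL _ _ (cl_le _) (cl_le _)) _.
  by rewrite ler_pM2l//; exact: cl_lip.
rewrite -G0; apply: le_trans (GL _ _ _ (cl_le _)) _; first by rewrite subrr normr0 ltW.
apply: le_trans KTr; rewrite ler_pM2l//.
Qed.

(** The integrands differ by at most [K * e], over a time at most [T], and [K * T] is at most
    1/2. *)
Lemma picard_contraction X X' Y Y' e : picard_good X -> picard_good X' ->
  picard_step X Y -> picard_step X' Y' ->
  (forall t, `|X t - X' t| <= e) -> forall t, `|Y t - Y' t| <= e / 2.
Proof.
move=> gX gX' [G [G0 dG ->]] [G' [G0' dG' ->]] h t /=.
have e0 : 0 <= e := le_trans (normr_ge0 _) (h t).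
apply: norm_row_le => [|j]; first by rewrite divr_ge0.
have := @picard_mvt (fun s => G s 0 j - G' s 0 j) (fun t => F (cl t) (X t) 0 j - F (cl t) (X' t) 0 j)
  (K * e) t0 (cl t).
rewrite G0 G0' (subrr (x0 0 j)) subr0 => hm.
rewrite rowB.
apply: le_trans (hm _ (cl_le t) _) _.
- by rewrite subrr normr0 ltW.
- move=> t' t'T; have := dG _ (T2 t'T) j; have := dG' _ (T2 t'T) j => d1 d2.
  split; first exact: is_deriveB.
  rewrite -rowB.
  apply: le_trans (mx_norm_coord _ _ _) _.
  apply: le_trans (FK (le_trans (cl_le _) Tr) (gX.2 _) (gX'.2 _)) _.
  by rewrite ler_pM2l.
rewrite mulrAC mulrC; apply: ler_wpM2l => //.
by apply: le_trans KT; rewrite ler_pM2l.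
Qed.

Lemma picard_lindelof : exists2 d, 0 < d & exists2 X : R -> V, X t0 = x0 &
  forall t, `|t - t0| < d -> `|X t - x0| <= r /\
    forall j, is_derive t 1 (fun s => X s 0 j) (F t (X t) 0 j).
Proof.
have /choice[next hnext] : forall X, exists Y, picard_good X -> picard_step X Y /\ picard_good Y.
  move=> X; have [gX|gX] := pselect (picard_good X); last by exists X.
  by have [Y sY gY] := picard_step_good gX; exists Y.
pose Xn k := iter k next (cst x0).
have gn k : picard_good (Xn k).
  elim: k => [|k IH]; last by case: (hnext _ IH).
  by split=> [s t|t]; rewrite /= subrr normr0 ?mulr_ge0// ltW.
have sn k : picard_step (Xn k) (Xn k.+1) by case: (hnext _ (gn k)).
have dn k t : `|Xn k.+1 t - Xn k t| <= r / 2 ^+ k.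
  elim: k t => [|k IH] t; first by rewrite expr0 divr1; exact: (gn 1%N).2.
  rewrite exprSr invfM mulrA.
  exact: (picard_contraction (gn k.+1) (gn k) (sn k.+1) (sn k)).
have hl t j : exists l, forall k, `|l - Xn k t 0 j| <= 2 * r / 2 ^+ k.
  apply: geometric_limit => k.
  rewrite -rowB.
  exact: le_trans (mx_norm_coord _ _ _) (dn k t).
have /choice[lim hlim] : forall t, exists f : 'I_m -> R, forall j k, `|f j - Xn k t 0 j| <= 2 * r / 2 ^+ k.
  by move=> t; have /choice[f hf] := hl t; exists f.
pose X t : V := \row_j lim t j.
have XXn k t : `|X t - Xn k t| <= 2 * r / 2 ^+ k.
  apply: norm_row_le => [|j]; first by rewrite divr_ge0 ?exprn_ge0// mulr_ge0// ltW.
  rewrite rowB [X t 0 j]mxE; exact: hlim.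
have gX : picard_good X.
  split=> [s t|t].
    apply: (@ler_geometric _ _ (4 * r)) => k.
    have := (gn k).1 s t; have := XXn k t; have := XXn k s.
    have -> : X t - X s = (X t - Xn k t) + (Xn k t - Xn k s) + (Xn k s - X s).
      by rewrite !subrKA.
    have := ler_normD (X t - Xn k t + (Xn k t - Xn k s)) (Xn k s - X s).
    have := ler_normD (X t - Xn k t) (Xn k t - Xn k s).
    rewrite [`|Xn k s - X s|]distrC -[4 * r / _](_ : 2 * r / 2 ^+ k + 2 * r / 2 ^+ k = _); lra.
  apply: (@ler_geometric _ _ (2 * r)) => k.
  have -> : X t - x0 = (X t - Xn k t) + (Xn k t - x0) by rewrite addrA subrK.
  have := ler_normD (X t - Xn k t) (Xn k t - x0).
  by have := XXn k t; have := (gn k).2 t; lra.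
(* The limit is a fixed point: by contraction, an image [Y] of [X] is approached by the same
   iterates as [X]. *)
have [Y sY gY] := picard_step_good gX.
have XY t : X t = Y t.
  apply/eqP; rewrite -subr_eq0 -normr_le0; apply: (@ler_geometric _ _ (2 * r)) => k.
  have := picard_contraction gX (gn k) sY (sn k) (XXn k) t.
  have := XXn k.+1 t.
  have -> : X t - Y t = (X t - Xn k.+1 t) + (Xn k.+1 t - Y t) by rewrite addrA subrK.
  have := ler_normD (X t - Xn k.+1 t) (Xn k.+1 t - Y t).
  rewrite [`|Xn k.+1 t - Y t|]distrC.
  have -> : 2 * r / 2 ^+ k.+1 = 2 * r / 2 ^+ k / 2 by rewrite exprSr invfM mulrA.
  lra.
have [G [G0 dG YE]] := sY.
exists T; first exact: T0.
exists X.
  by rewrite XY YE /= cl_id ?subrr ?normr0 ?(ltW T0)// G0.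
move=> t tT; split; first exact: gX.2.
move=> j; have := dG t (T2 (ltW tT)) j; rewrite cl_id; last exact: ltW.
move=> [dGj GjE].
have nGX : \forall s \near t, G s 0 j = X s 0 j.
  have : \forall s \near t, `|s - t0| < T.
    have : t0 - T < t < t0 + T by move: tT; rewrite ltr_norml => /andP[? ?]; apply/andP; split; lra.
    move=> /near_itv_oo; apply: filterS => s /andP[? ?].
    by rewrite ltr_norml; apply/andP; split; lra.
  by apply: filterS => s sT; rewrite XY YE /= cl_id// ltW.
apply: DeriveDef.
  by apply: near_eq_derivable nGX dGj.
by rewrite -GjE; apply: near_eq_derive; apply: filterS nGX => s ->.
Qed.

End contraction.
End picard_lindelof.

(** * Solving the Euler-Lagrange equation for the acceleration *)

Section smooth_matrices.
Context {R : realType} {V : normedModType R}.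
Variable U : set V.
Hypothesis oU : open U.

Lemma Ck_bigsum (W : normedModType R) k I (r : seq I) (P : pred I) (f : I -> V -> W) :
  (forall i, P i -> Ck k U (f i)) -> Ck k U (fun x => \sum_(i <- r | P i) f i x).
Proof. by move=> Cf; rewrite -fct_sumE; exact: Ck_sum. Qed.

Lemma Ck_bigprod k I (r : seq I) (P : pred I) (f : I -> V -> R) :
  (forall i, P i -> Ck k U (f i)) -> Ck k U (fun x => \prod_(i <- r | P i) f i x).
Proof.
move=> Cf; elim: r => [|i r IH].
  rewrite (_ : (fun x => _) = cst 1); last by apply/funext => x; rewrite big_nil.
  exact: Ck_cst.
rewrite (_ : (fun x => _) = fun x => (if P i then f i x else 1) * \prod_(j <- r | P j) f j x).
  apply: (Ck_mul oU (f := fun x => if P i then f i x else 1)) => //.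
  by case Pi : (P i); [exact: Cf|exact: (@Ck_cst R V R k U (1 : R))].
by apply/funext => x; rewrite big_cons; case: ifP; rewrite ?mul1r.
Qed.

Lemma Ck_inv k (f : V -> R) : (forall x, U x -> f x != 0) ->
  Ck k U f -> Ck k U (fun x => (f x)^-1).
Proof.
move=> f0; elim: k => [cf x Ux|k IH Cf].
  by apply: continuousV; [exact: f0|exact: cf].
rewrite CkSE; move: (Cf); rewrite CkSE => -[df Df]; split=> [x Ux|v].
  by apply: differentiableV; [exact: df|exact: f0].
have Cfi := IH (CkS Cf).
apply: (Ck_eq oU (f := fun x => - 1 * (((f x)^-1 * (f x)^-1) * 'D_v f x))) => [x|].
  rewrite inE => Ux; rewrite deriveV; [|exact: f0|exact/diff_derivable/df].
  by rewrite mulN1r -mulNr /GRing.scale/= expr2 invfM.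
apply: Ck_cmul => //; apply: (Ck_mul oU (f := fun x => (f x)^-1 * (f x)^-1)); last exact: Df.
exact: (Ck_mul oU (f := fun x => (f x)^-1) (g := fun x => (f x)^-1)).
Qed.

Lemma Ck_det k m (A : V -> 'M[R]_m) : (forall i j, Ck k U (fun x => A x i j)) ->
  Ck k U (fun x => \det (A x)).
Proof.
move=> CA; apply: Ck_bigsum => s _; apply: Ck_cmul => //.
by apply: Ck_bigprod => i _; exact: CA.
Qed.

(** By Cramer's rule the entries are cofactors divided by a determinant that does not vanish on
    [U]. *)
Lemma Ck_invmx k m (A : V -> 'M[R]_m) : (forall i j, Ck k U (fun x => A x i j)) ->
  (forall x, U x -> A x \in unitmx) -> forall i j, Ck k U (fun x => invmx (A x) i j).
Proof.
move=> CA uA i j.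
apply: (Ck_eq oU (f := fun x => (\det (A x))^-1 * cofactor (A x) j i)) => [x|].
  by rewrite inE => Ux; rewrite /invmx uA// [RHS]mxE [X in _ = _ * X]mxE.
apply: Ck_mul => //.
  apply: Ck_inv; last exact: Ck_det.
  by move=> x /uA; rewrite unitmxE unitfE.
apply: Ck_cmul => //; apply: Ck_det => i' j'.
rewrite (_ : (fun x => _) = fun x => A x (lift j i') (lift i j')); first exact: CA.
by apply/funext => x; rewrite !mxE.
Qed.

End smooth_matrices.

Section euler_lagrange_field.
Context {R : realType} {n : nat} {M : smooth_manifold R n}.
Variables (g : riemannian_metric M) (L : M -> 'rV[R]_n -> R -> R).
Hypothesis hL : tonelli L g.
Local Notation E := 'rV[R]_n.
Local Notation Z := (E * E * R)%type.
Implicit Types (c : chart R n M) (x : M) (y w v xi : E) (s t : R) (z : Z).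

Local Notation eb := (delta_mx 0 : 'I_n -> E).
Definition dir_x y : Z := (y, 0, 0).
Definition dir_w w : Z := (0, w, 0).
Definition dir_t : Z := (0, 0, 1).

Definition lag_w c w z : R := 'D_(dir_w w) (lag L c) z.
Definition lag_x c y z : R := 'D_(dir_x y) (lag L c) z.

Lemma line_dir_w h w z : h *: dir_w w + z = (z.1.1, h *: w + z.1.2, z.2).
Proof. by case: z => [[y v] t]; rewrite /dir_w; congr (_, _, _); rewrite /= ?scaler0 add0r. Qed.

Lemma line_dir_x h y z : h *: dir_x y + z = (h *: y + z.1.1, z.1.2, z.2).
Proof. by case: z => [[y' v] t]; rewrite /dir_x; congr (_, _, _); rewrite /= ?scaler0 add0r. Qed.

Lemma lag_wE c y v w t : 'D_w (fun v => lagrangian_in L c y v t) v = lag_w c w (y, v, t).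
Proof. by apply: derive_on_line => h; rewrite line_dir_w. Qed.

Lemma lag_xE c y v w t : 'D_w (fun y => lagrangian_in L c y v t) y = lag_x c w (y, v, t).
Proof. by apply: derive_on_line => h; rewrite line_dir_x. Qed.

(** [tangent_of c y] is linear and injective, so the Hessian read in the chart is the pull-back of
    the one assumed positive definite on the tangent space. *)
Lemma lag_convex c w z : atlas c -> lag_dom c z -> w != 0 ->
  0 < 'D_(dir_w w) ('D_(dir_w w) (lag L c)) z.
Proof.
case: z => [[y v] t] ac /= cy w0.
set T := tangent_of c y.
have Tl h v1 v2 : T (h *: v1 + v2) = h *: T v1 + T v2 by exact: tangent_of_linear.
have D1 v' : 'D_(dir_w w) (lag L c) (y, v', t) = 'D_(T w) (fun v => L (chart_inv c y) v t) (T v').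
  by apply: derive_on_line => h; rewrite line_dir_w /lag/lagrangian_in /= -/T Tl.
rewrite (@derive_on_line _ _ _ _ _ ('D_(T w) (fun v => L (chart_inv c y) v t)) _ _ (T v) (T w)).
  have [_ _ pos _ _] := hL; apply: pos.
  by apply: contra_neq w0; exact: tangent_of_eq0.
by move=> h; rewrite line_dir_w D1 Tl.
Qed.

Lemma row_basis w : w = \sum_(i < n) w 0 i *: (eb i).
Proof. exact: row_sum_delta. Qed.

Lemma dir_w_sum w : dir_w w = \sum_(i < n) w 0 i *: dir_w (eb i).
Proof.
have dl : linear dir_w by move=> k a b; rewrite /dir_w; congr (_, _, _); rewrite /= ?scaler0 addr0.
rewrite {1}(row_basis w).
elim/big_rec2 : _ => [//|i v1 v2 _ IH].
by rewrite dl IH.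
Qed.

Lemma dir_x_sum w : dir_x w = \sum_(i < n) w 0 i *: dir_x (eb i).
Proof.
have dl : linear dir_x by move=> k a b; rewrite /dir_x; congr (_, _, _); rewrite /= ?scaler0 addr0.
rewrite {1}(row_basis w).
elim/big_rec2 : _ => [//|i v1 v2 _ IH].
by rewrite dl IH.
Qed.

Section chart.
Variable c : chart R n M.
Hypothesis ac : atlas c.

Lemma lag_w_Ck w k : Ck k (lag_dom c) (lag_w c w).
Proof. by have [_] := @lag_Ck _ _ _ _ _ hL c k.+1 ac; exact. Qed.

Lemma lag_x_Ck w k : Ck k (lag_dom c) (lag_x c w).
Proof. by have [_] := @lag_Ck _ _ _ _ _ hL c k.+1 ac; exact. Qed.

Lemma lag_differentiable z : lag_dom c z -> differentiable (lag L c) z.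
Proof. by have [dl _] := @lag_Ck _ _ _ _ _ hL c 1 ac; exact: dl. Qed.

Lemma lag_w_differentiable w z : lag_dom c z -> differentiable (lag_w c w) z.
Proof. by have [dl _] := lag_w_Ck w 1; exact: dl. Qed.

Lemma lag_w_sum w z : lag_dom c z -> lag_w c w z = \sum_(j < n) w 0 j * lag_w c (eb j) z.
Proof.
move=> /lag_differentiable dz; rewrite {1}/lag_w dir_w_sum.
by rewrite (derive_linear_comb (fun i => w 0 i) (fun i => dir_w (eb i)) dz).
Qed.

Lemma lag_x_sum w z : lag_dom c z -> lag_x c w z = \sum_(j < n) w 0 j * lag_x c (eb j) z.
Proof.
move=> /lag_differentiable dz; rewrite {1}/lag_x dir_x_sum.
by rewrite (derive_linear_comb (fun i => w 0 i) (fun i => dir_x (eb i)) dz).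
Qed.

(** Linearity in [w] is a pointwise fact about the derivative of [lag]; exchanging the two
    derivatives makes [dir_w w] the outer direction, in which the expansion is available. *)
Lemma derive_lag_w_sum w z Y : lag_dom c z ->
  'D_Y (lag_w c w) z = \sum_(j < n) w 0 j * 'D_Y (lag_w c (eb j)) z.
Proof.
move=> dz; have od := @open_lag_dom _ _ _ c.
have C2 := @lag_Ck _ _ _ _ _ hL c 2 ac.
have dD : differentiable ('D_Y (lag L c)) z by case: C2 => _ /(_ Y)[dD _]; exact: dD.
have sym v : 'D_Y (lag_w c v) z = 'D_(dir_w v) ('D_Y (lag L c)) z by exact: (derive_sym Y (dir_w v) od C2 dz).
have lin := derive_linear_comb (fun i => w 0 i) (fun i => dir_w (eb i)) dD.
rewrite -dir_w_sum in lin; apply: (etrans (sym w)); apply: (etrans lin).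
by apply: eq_bigr => j _; exact: (congr1 (fun r => w 0 j * r) (esym (sym (eb j)))).
Qed.

Definition hessian z : 'M[R]_n := \matrix_(i, j) 'D_(dir_w (eb i)) (lag_w c (eb j)) z.
(** The part of the total time derivative of the momentum that does not involve the acceleration
    [xi]. The rest is [xi *m hessian z], vectors being rows, which explains the inverse acting on
    the right in [el_field]. *)
Definition drift z : E := \row_j (\sum_(k < n) z.1.2 0 k * 'D_(dir_x (eb k)) (lag_w c (eb j)) z
  + 'D_dir_t (lag_w c (eb j)) z).
Definition el_field z : E := ((\row_j lag_x c (eb j) z) - drift z) *m invmx (hessian z).

Lemma hessian_quadratic w z : lag_dom c z ->
  'D_(dir_w w) ('D_(dir_w w) (lag L c)) z = \sum_(j < n) (w *m hessian z) 0 j * w 0 j.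
Proof.
move=> dz; rewrite -/(lag_w c w) derive_lag_w_sum//; apply: eq_bigr => j _.
rewrite mulrC; congr (_ * _).
rewrite {1}dir_w_sum (derive_linear_comb (fun i => w 0 i) (fun i => dir_w (eb i)) (lag_w_differentiable _ dz)).
by rewrite [RHS]mxE; apply: eq_bigr => i _; rewrite [in RHS]mxE.
Qed.

Lemma hessian_unit z : lag_dom c z -> hessian z \in unitmx.
Proof.
move=> dz; rewrite unitmxE unitfE; apply/negP => /det0P[w w0 wH].
have := lag_convex ac dz w0; rewrite hessian_quadratic// wH big1 ?ltxx// => j _.
by rewrite mxE mul0r.
Qed.

Lemma el_field_Ck k : Ck k (lag_dom c) el_field.
Proof.
have od := @open_lag_dom _ _ _ c.
apply: (Ck_mx od) => i j.
apply: (Ck_eq od (f := fun z => \sum_(l < n) (lag_x c (eb l) z - (\sum_(k < n) z.1.2 0 k * 'D_(dir_x (eb k)) (lag_w c (eb l)) z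
  + 'D_dir_t (lag_w c (eb l)) z)) * invmx (hessian z) l j)).
  move=> z _; rewrite (ord1 i) [RHS]mxE; apply: eq_bigr => l _; congr (_ * _).
  by rewrite [RHS]mxE [X in _ = X + _]mxE [X in _ = _ + X]mxE [X in _ = _ - X]mxE.
have Dk (v : Z) l : Ck k (lag_dom c) ('D_v (lag_w c (eb l))) by have [_] := lag_w_Ck (eb l) k.+1; exact.
apply: (Ck_bigsum od) => l _; apply: (Ck_mul od).
  apply: (Ck_sub od); first exact: lag_x_Ck.
  apply: (Ck_add od); last exact: Dk.
  apply: (Ck_bigsum od) => m _; apply: (Ck_mul od); last exact: Dk.
  apply: (Ck_coord _ _ od); apply: (Ck_snd od (f := fun z => z.1)).
  by apply: (Ck_fst od); exact: Ck_id.
apply: (Ck_invmx od) => [i' j'|z]; last exact: hessian_unit.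
rewrite (_ : (fun z => _) = 'D_(dir_w (eb i')) (lag_w c (eb j'))); first exact: Dk.
by apply/funext => z; rewrite mxE.
Qed.

Lemma derive_lag_w_total xi z j : lag_dom c z ->
  'D_(z.1.2, xi, 1) (lag_w c (eb j)) z = drift z 0 j + (xi *m hessian z) 0 j.
Proof.
move=> dz; have dl := lag_w_differentiable (eb j) dz.
have -> : (z.1.2, xi, 1) = dir_x z.1.2 + dir_t + dir_w xi.
  by rewrite /dir_x/dir_t/dir_w; congr (_, _, _); rewrite /= ?addr0 ?add0r.
rewrite deriveE// !linearD/= -!deriveE//.
rewrite dir_x_sum (derive_linear_comb (fun i => z.1.2 0 i) (fun i => dir_x (eb i)) dl).
rewrite {1}dir_w_sum (derive_linear_comb (fun i => xi 0 i) (fun i => dir_w (eb i)) dl).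
rewrite [X in _ = X + _]mxE [X in _ = _ + X]mxE; congr (_ + _).
by apply: eq_bigr => i _; rewrite mxE.
Qed.

Lemma el_fieldP xi z : lag_dom c z ->
  (forall w, 'D_(z.1.2, xi, 1) (lag_w c w) z = lag_x c w z) <-> xi = el_field z.
Proof.
move=> dz; have uH := hessian_unit dz; split=> [h|-> w].
  suff : xi *m hessian z = (\row_j lag_x c (eb j) z) - drift z by rewrite /el_field => <-; rewrite mulmxK.
  apply/rowP => j; rewrite [RHS]rowB [X in _ = X - _]mxE -h derive_lag_w_total//.
  by rewrite addrC addKr.
rewrite derive_lag_w_sum// lag_x_sum//; apply: eq_bigr => j _; congr (_ * _).
rewrite derive_lag_w_total// /el_field mulmxKV// rowB [X in _ + (X - _)]mxE.
by rewrite addrC subrK.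
Qed.

Section curve.
Variables (J : set R) (q : R -> E).
Hypotheses (Cq : Ck 2 J q) (tq : forall s, J s -> chart_target c (q s)).

Definition phase_curve (r : R) : Z := (q r, 'D_1 q r, r).

Lemma phase_curve_is_derive s : J s ->
  differentiable phase_curve s /\ 'D_1 phase_curve s = ('D_1 q s, 'D_1 ('D_1 q) s, 1).
Proof.
move=> Js; have [dq Dq] := Cq; have [ddq _] := Dq 1.
have d1 : differentiable (fun r => (q r, 'D_1 q r)) s.
  by apply: differentiable_pair; [exact: dq|exact: ddq].
have d2 : differentiable phase_curve s by exact: differentiable_pair.
split=> //; rewrite deriveE// diff_pair// diff_pair; [|exact: dq|exact: ddq].
have d3 : 'd id s (1 : R) = (1 : R) by rewrite -deriveE// derive_id.
congr (_, _, _); last exact: d3.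
  exact/esym/deriveE/dq.
exact/esym/deriveE/ddq.
Qed.

Lemma euler_lagrange_chart s : J s ->
  (forall w : E, is_derive s 1
     (fun r => 'D_w (fun v => lagrangian_in L c (q r) v r) (derive1 q r))
     ('D_w (fun y => lagrangian_in L c y (derive1 q s) s) (q s))) <->
  'D_1 ('D_1 q) s = el_field (phase_curve s).
Proof.
move=> Js; have [dX DX] := phase_curve_is_derive Js.
have dz : lag_dom c (phase_curve s) by exact: tq.
have fE w : (fun r => 'D_w (fun v => lagrangian_in L c (q r) v r) (derive1 q r)) = lag_w c w \o phase_curve.
  by apply/funext => r; rewrite lag_wE derive1E.
have dw w : is_derive s 1 (lag_w c w \o phase_curve) ('D_('D_1 q s, 'D_1 ('D_1 q) s, 1) (lag_w c w) (phase_curve s)).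
  have dlw := lag_w_differentiable w dz.
  apply: DeriveDef; first by apply: diff_derivable; exact: differentiable_comp.
  by rewrite -DX; exact: derive_compE.
have := el_fieldP ('D_1 ('D_1 q) s) dz => hP; split=> [h|/hP h w].
  apply/hP => w; have := h w; rewrite fE lag_xE derive1E => -[_ <-].
  by have [_ dwE] := dw w; exact: esym dwE.
by rewrite fE lag_xE derive1E -[lag_x _ _ _]h; exact: dw.
Qed.

End curve.
End chart.
End euler_lagrange_field.

Section local_lipschitz.
Context {R : realType}.

Lemma norm_pair_le (V W : normedModType R) (z : V * W) r : (`|z| <= r) = (`|z.1| <= r) && (`|z.2| <= r).
Proof. by rewrite prod_normE ge_max. Qed.

Lemma norm_le_add (V : normedModType R) (a b : V) e : `|a - b| <= e -> `|a| <= `|b| + e.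
Proof. by move=> h; have := ler_normD (a - b) b; rewrite subrK; lra. Qed.

Lemma ball_segment (V : normedModType R) (z0 z v : V) r s : 0 <= s <= 1 ->
  `|z - z0| <= r -> `|v + z - z0| <= r -> `|s *: v + z - z0| <= r.
Proof.
move=> /andP[s0 s1] h1 h2.
have -> : s *: v + z - z0 = s *: (v + z - z0) + (1 - s) *: (z - z0).
  rewrite -(addrA (s *: v)) -(addrA v) scalerDr scalerBl scale1r -addrA; congr (_ + _).
  by rewrite [RHS]addrC subrK.
apply: le_trans (ler_normD _ _) _; rewrite !normrZ ger0_norm// [`|1 - s|]ger0_norm ?subr_ge0//.
have := ler_wpM2l s0 h2; have := ler_wpM2l (ltac:(by rewrite subr_ge0) : 0 <= 1 - s) h1; lra.
Qed.

Lemma segment_le_row (V : normedModType R) m (f : V -> 'rV[R]_m) x v B :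
  (forall s, 0 <= s <= 1 -> derivable f (s *: v + x) v) ->
  (forall s, 0 <= s <= 1 -> `|'D_v f (s *: v + x)| <= B) ->
  `|f (v + x) - f x| <= B.
Proof.
move=> df Bf; have B0 : 0 <= B by apply: le_trans (Bf 0 _); rewrite ?lexx ?ler01.
apply: norm_row_le => // j; rewrite rowB.
apply: (segment_le (f := fun z => f z 0 j)) => s s01.
  by have /derivable_mxP := df s s01; exact.
have := Bf s s01; rewrite derive_mx; last exact: df.
by move=> h; apply: le_trans h; have := mx_norm_coord (\matrix_(i < 1, j < m) 'D_v (fun z => f z i j) (s *: v + x)) 0 j; rewrite mxE.
Qed.

Lemma lipschitz_on_ball (V : normedModType R) m (U : set V) (f : V -> 'rV[R]_m) z0 r :
  finite_dim V -> Ck 1 U f -> compact [set z | `|z - z0| <= r] ->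
  [set z | `|z - z0| <= r] `<=` U ->
  exists2 C, 0 <= C & forall z z', `|z - z0| <= r -> `|z' - z0| <= r ->
    `|f z - f z'| <= C * `|z - z'|.
Proof.
move=> fV Cf cK KU; have [C C0 hC] := derive_bounded fV cK KU Cf.
exists C => // z z' zr z'r; have [df _] := Cf.
have vz : z - z' + z' = z by rewrite subrK.
rewrite -{1}vz.
have seg s : 0 <= s <= 1 -> `|s *: (z - z') + z' - z0| <= r.
  by move=> s01; apply: ball_segment => //; rewrite vz.
apply: segment_le_row => s s01; first exact/diff_derivable/df/KU/seg.
exact/hC/seg.
Qed.

Lemma is_derive_row m (X : R -> 'rV[R]_m) (s : R) (l : 'rV[R]_m) :
  (forall j, is_derive s 1 (fun r => X r 0 j) (l 0 j)) -> is_derive s 1 X l.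
Proof.
move=> dX; have dX' : derivable X s 1.
  by apply/derivable_mxP => i j; rewrite (ord1 i); case: (dX j).
apply: DeriveDef => //; rewrite derive_mx//; apply/rowP => j; rewrite mxE.
by case: (dX j).
Qed.

Lemma is_derive_coord m (X : R -> 'rV[R]_m) (s : R) (l : 'rV[R]_m) j :
  is_derive s 1 X l -> is_derive s 1 (fun r => X r 0 j) (l 0 j).
Proof.
move=> [dX XE]; have /derivable_mxP dX' := dX.
apply: DeriveDef; first exact: dX'.
by rewrite -XE derive_mx// mxE.
Qed.

Lemma CkS_real (W : normedModType R) k (f df : R -> W) (U : set R) : open U ->
  (forall x, U x -> is_derive x 1 f (df x)) -> Ck k U df -> Ck k.+1 U f.
Proof.
move=> oU fdf Cdf; rewrite CkSE; have dx x : U x -> differentiable f x.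
  by move=> /fdf[d _]; exact/derivable1_diffP.
split=> // v; apply: (Ck_eq oU (f := fun x => v *: df x)).
  move=> x; rewrite inE => Ux; have [d E] := fdf x Ux.
  rewrite -E !deriveE//; [|exact: dx|exact: dx].
  have -> : 'd f x v = 'd f x (v *: 1) by congr ('d f x _); rewrite [RHS]mulr1.
  by rewrite [RHS]linearZ.
have sc : continuous ( *:%R v : W -> W) by exact: scaler_continuous.
exact: (@Ck_linear_comp _ _ _ _ k U df ( *:%R v)) sc oU Cdf.
Qed.

End local_lipschitz.

Section local_existence.
Context {R : realType} {n : nat} {M : smooth_manifold R n}.
Variables (g : riemannian_metric M) (L : M -> 'rV[R]_n -> R -> R).
Hypothesis hL : tonelli L g.
Local Notation E := 'rV[R]_n.
Local Notation Z := (E * E * R)%type.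
Implicit Types (c : chart R n M) (x : M) (y w v xi : E) (s t : R) (z : Z).

Lemma phase_finite_dim : finite_dim Z.
Proof.
apply: finite_dim_prod finite_dim_real; apply: finite_dim_prod; exact: finite_dim_row.
Qed.

Lemma phase_ball_compact z0 r : compact [set z : Z | `|z - z0| <= r].
Proof.
rewrite (_ : [set z | _] = ([set y | `|y - z0.1.1| <= r] `*` [set w | `|w - z0.1.2| <= r])
   `*` [set t | `|t - z0.2| <= r]).
  apply: compact_setX; first by apply: compact_setX; exact: norm_ball_compact.
  have -> : [set t | `|t - z0.2| <= r] = [set` `[z0.2 - r, z0.2 + r]].
    by apply/seteqP; split => t /=; rewrite in_itv/= ler_distl.
  exact: segment_compact.
apply/seteqP; split => [[[y w] t]|[[y w] t]] /=; rewrite !norm_pair_le/= -andbA.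
  by move=> /and3P[].
by move=> [[-> ->] ->].
Qed.

Lemma phase_ball_dom c z0 : lag_dom c z0 ->
  exists2 r, 0 < r & [set z : Z | `|z - z0| <= r] `<=` lag_dom c.
Proof.
move=> dz; have /nbhs_normP[r /= r0 hr] := open_near (@open_lag_dom _ _ _ c) dz.
exists (r / 2); first by rewrite divr_gt0.
by move=> z /= zr; apply: hr; rewrite /ball_/= distrC; apply: le_lt_trans zr _; lra.
Qed.

Lemma el_field_lipschitz c z0 r : atlas c -> [set z : Z | `|z - z0| <= r] `<=` lag_dom c ->
  exists2 C, 0 <= C & forall z z', `|z - z0| <= r -> `|z' - z0| <= r ->
    `|el_field L c z - el_field L c z'| <= C * `|z - z'|.
Proof.
move=> ac rd; apply: lipschitz_on_ball rd => //; first exact: phase_finite_dim.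
  exact: (el_field_Ck hL ac 1).
exact: phase_ball_compact.
Qed.

(** The second order equation becomes a first order one for the row [row_mx y w] of position and
    velocity. Time stays outside the row, as the time argument of the field. *)
Lemma el_chart_exists c y w t : atlas c -> chart_target c y ->
  exists2 d, 0 < d & exists q : R -> E,
  [/\ q t = y, 'D_1 q t = w, Ck 2 `]t - d, t + d[ q,
      forall s, t - d < s < t + d -> chart_target c (q s) &
      forall s, t - d < s < t + d -> 'D_1 ('D_1 q) s = el_field L c (phase_curve q s)].
Proof.
move=> ac cy; have dz : lag_dom c (y, w, t) by [].
have [r r0 rd] := phase_ball_dom dz.
have [C C0 hC] := el_field_lipschitz ac rd.
pose x0 : 'rV[R]_(n + n) := row_mx y w.
pose zX (s : R) (X : 'rV[R]_(n + n)) : Z := (lsubmx X, rsubmx X, s).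
pose F (s : R) (X : 'rV[R]_(n + n)) : 'rV[R]_(n + n) := row_mx (rsubmx X) (el_field L c (zX s X)).
have lsub_le m (X : 'rV[R]_(n + n)) : `|X| <= m -> `|lsubmx X| <= m /\ `|rsubmx X| <= m.
  move=> h; have m0 := le_trans (normr_ge0 _) h.
  by split; apply: norm_row_le => // j; rewrite mxE; apply: le_trans (mx_norm_coord _ _ _) h.
have row_le m (a b : E) : `|a| <= m -> `|b| <= m -> `|row_mx a b| <= m.
  move=> h1 h2; have m0 := le_trans (normr_ge0 _) h1.
  apply: norm_row_le => // j; rewrite mxE; case: fintype.split => k; apply: le_trans (mx_norm_coord _ _ _) _ => //.
have zball s X : `|s - t| <= r -> `|X - x0| <= r -> `|zX s X - (y, w, t)| <= r.
  move=> st /lsub_le[]; rewrite !linearB/= row_mxKl row_mxKr => h1 h2.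
  by rewrite !norm_pair_le/= h1 h2 st.
(* One constant serves twice: [C + 1] exceeds the Lipschitz constants 1 and [C] of the two halves of
   the field, and the remaining terms bound the velocity and the acceleration on the ball. *)
pose K := C + 1 + (`|w| + r + (`|el_field L c (y, w, t)| + C * r)).
have e0 : 0 <= `|el_field L c (y, w, t)| by [].
have Cr : 0 <= C * r by rewrite mulr_ge0// ltW.
have w0 : 0 <= `|w| by [].
have K0 : 0 < K by rewrite /K; lra.
have [||| d d0 [X X0 hX]] := @picard_lindelof R (n + n) F t x0 r K r0 K0.
- move=> s X sr Xr.
  have cl : continuous (@lsubmx R 1 n n).
    apply: linear_norm_continuous => v; exact: (lsub_le _ _ (lexx _)).1.
  have cr : continuous (@rsubmx R 1 n n).
    apply: linear_norm_continuous => v; exact: (lsub_le _ _ (lexx _)).2.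
  pose emb (p : E * E) : 'rV[R]_(n + n) := row_mx p.1 p.2.
  have clin : linear emb by move=> k [a b] [a' b']; rewrite /emb/= scale_row_mx add_row_mx.
  have cz : {for (s, X), continuous (fun z : R * 'rV[R]_(n + n) => zX z.1 z.2)}.
    apply: (@continuous_pair _ _ _ (fun z : R * 'rV[R]_(n + n) => (lsubmx z.2, rsubmx z.2)) fst); last exact: cvg_fst.
    apply: (@continuous_pair _ _ _ (fun z : R * 'rV[R]_(n + n) => lsubmx z.2)
      (fun z : R * 'rV[R]_(n + n) => rsubmx z.2)).
      by apply: (@continuous_comp _ _ _ snd (@lsubmx R 1 n n)); [exact: cvg_snd|exact: cl].
    by apply: (@continuous_comp _ _ _ snd (@rsubmx R 1 n n)); [exact: cvg_snd|exact: cr].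
  have ce : {for (s, X), continuous (fun z : R * 'rV[R]_(n + n) => el_field L c (zX z.1 z.2))}.
    apply: (@continuous_comp _ _ _ (fun z : R * 'rV[R]_(n + n) => zX z.1 z.2) (el_field L c)); first exact: cz.
    by apply: (Ck_continuous (el_field_Ck hL ac 0)); apply/rd/zball.
  have cemb : continuous emb.
    pose HE := GRing.isLinear.Build _ _ _ _ emb clin.
    pose embl : {linear (E * E)%type -> 'rV[R]_(n + n)} := HB.pack emb HE.
    apply: (@linear_norm_continuous R _ _ embl) => p.
    by apply: row_le; have := lexx `|p|; rewrite norm_pair_le => /andP[].
  apply: (@continuous_comp _ _ _ (fun z : R * 'rV[R]_(n + n) => (rsubmx z.2, el_field L c (zX z.1 z.2))) emb); last exact: cemb.
  apply: continuous_pair; last exact: ce.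
  by apply: (@continuous_comp _ _ _ snd (@rsubmx R 1 n n)); [exact: cvg_snd|exact: cr].
- move=> s X sr Xr; have zr := zball s X sr Xr.
  have z0r : `|(y, w, t) - (y, w, t) : Z| <= r by rewrite subrr normr0 ltW.
  have h1 := hC _ _ zr z0r.
  apply: row_le.
    have /lsub_le[_] := Xr; rewrite linearB/= row_mxKr => h2.
    have := ler_normD (rsubmx X - w) w; rewrite subrK /K; lra.
  apply: le_trans (norm_le_add (le_trans h1 (ler_wpM2l C0 zr))) _.
  rewrite /K; move: C0 w0 r0; clear; lra.
- move=> s X X' sr Xr X'r; have zr := zball s X sr Xr; have zr' := zball s X' sr X'r.
  have h1 := hC _ _ zr zr'.
  have zz : `|zX s X - zX s X'| <= `|X - X'|.
    have [h2 h3] := lsub_le _ _ (lexx `|X - X'|).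
    move: h2 h3; rewrite !linearB/= => h2 h3.
    by rewrite !norm_pair_le/= h2 h3 subrr normr0 normr_ge0.
  have x0' : 0 <= `|X - X'| by [].
  have CK : C * `|X - X'| <= K * `|X - X'| by apply: ler_wpM2r => //; rewrite /K; lra.
  have K1 : 1 * `|X - X'| <= K * `|X - X'| by apply: ler_wpM2r => //; rewrite /K; lra.
  rewrite /F opp_row_mx add_row_mx; apply: row_le.
    rewrite mul1r in K1; apply: le_trans K1; rewrite -linearB/=; exact: (lsub_le _ _ (lexx _)).2.
  apply: le_trans h1 _; apply: le_trans CK; exact: ler_wpM2l.
(* The bound [r] keeps the times inside the phase ball contained in the domain of the chart. *)
pose d' := Num.min d r.
have d'0 : 0 < d' by rewrite lt_min d0.
have [d'd d'r] : d' <= d /\ d' <= r by rewrite !ge_min !lexx orbT.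
have inI s : t - d' < s < t + d' -> `|s - t| < d /\ `|s - t| <= r.
  move=> h; have sd : `|s - t| < d' by rewrite ltr_distl; lra.
  by split; lra.
exists d' => //; exists (fun s => lsubmx (X s)).
have dq s : t - d' < s < t + d' -> is_derive s 1 (fun s => lsubmx (X s)) (rsubmx (X s)).
  move=> /inI[sd sr]; have [_ dX] := hX s sd.
  apply: is_derive_row => j; have := dX (lshift n j).
  rewrite /F row_mxEl (_ : (fun s => X s 0 (lshift n j)) = (fun r => lsubmx (X r) 0 j))//.
  by apply/funext => r'; rewrite mxE.
have Dq s : t - d' < s < t + d' -> 'D_1 (fun s => lsubmx (X s)) s = rsubmx (X s).
  by move=> /dq[].
have zE s : t - d' < s < t + d' -> phase_curve (fun s => lsubmx (X s)) s = zX s (X s).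
  by move=> sI; rewrite /phase_curve Dq.
have zd s : t - d' < s < t + d' -> lag_dom c (zX s (X s)).
  by move=> /inI[sd sr]; have [Xr _] := hX s sd; apply/rd/zball.
have dv s : t - d' < s < t + d' -> is_derive s 1 (fun s => rsubmx (X s)) (el_field L c (zX s (X s))).
  move=> /inI[sd sr]; have [_ dX] := hX s sd.
  apply: is_derive_row => j; have := dX (rshift n j).
  rewrite /F row_mxEr (_ : (fun s => X s 0 (rshift n j)) = (fun r => rsubmx (X r) 0 j))//.
  by apply/funext => r'; rewrite mxE.
have oI : open [set` `]t - d', t + d'[] by exact: itv_open.
split.
- by rewrite X0 row_mxKl.
- by rewrite Dq ?X0 ?row_mxKr//; lra.
- have d1 s : [set` `]t - d', t + d'[] s -> is_derive s 1 (fun s => lsubmx (X s)) (rsubmx (X s)).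
    by rewrite /= in_itv/= => /dq.
  have d2 s : [set` `]t - d', t + d'[] s -> is_derive s 1 (fun s => rsubmx (X s)) (el_field L c (zX s (X s))).
    by rewrite /= in_itv/= => /dv.
  apply: (CkS_real oI d1); apply: (CkS_real oI d2) => s.
  rewrite /= in_itv/= => sI.
  apply: (@continuous_comp _ _ _ (fun s => zX s (X s)) (el_field L c)).
    apply: (@continuous_pair _ _ _ (fun s => (lsubmx (X s), rsubmx (X s))) id); last exact: cvg_id.
    by apply: continuous_pair; apply: differentiable_continuous; apply/derivable1_diffP; [case: (dq s sI)|case: (dv s sI)].
  by apply: (Ck_continuous (el_field_Ck hL ac 0)); exact: zd.
- by move=> s /zd.
- move=> s sI; rewrite zE//.
  have [_ <-] := dv s sI; apply: near_eq_derive.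
  by apply: filterS (near_itv_oo sI) => r' /Dq.
Qed.

End local_existence.

(** * Invariance under changes of chart, and global extremals *)

Section euler_lagrange_transition.
Context {R : realType} {n : nat} {M : smooth_manifold R n}.
Variables (g : riemannian_metric M) (L : M -> 'rV[R]_n -> R -> R).
Hypothesis hL : tonelli L g.
Local Notation E := 'rV[R]_n.
Local Notation Z := (E * E * R)%type.
Implicit Types (c : chart R n M) (x : M) (y w v xi : E) (s t : R) (z : Z) (q : R -> E)
  (gamma delta : R -> M) (J : set R).
Local Notation eb := (delta_mx 0 : 'I_n -> E).

Definition el_at c q s := forall w, is_derive s 1 (lag_w L c w \o phase_curve q)
  (lag_x L c w (phase_curve q s)).

Lemma el_atE c q s : el_at c q s <-> forall w, is_derive s 1
  (fun r => 'D_w (fun v => lagrangian_in L c (q r) v r) (derive1 q r))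
  ('D_w (fun y => lagrangian_in L c y (derive1 q s) s) (q s)).
Proof.
have fE w : (fun r => 'D_w (fun v => lagrangian_in L c (q r) v r) (derive1 q r)) = lag_w L c w \o phase_curve q.
  by apply/funext => r; rewrite lag_wE derive1E.
by split => h w; have := h w; rewrite fE lag_xE derive1E.
Qed.

Lemma phase_curve_near q q' s : (\forall r \near s, q r = q' r) ->
  \forall r \near s, phase_curve q r = phase_curve q' r.
Proof.
move=> /near_join; apply: filterS => r h; rewrite /phase_curve (nbhs_singleton h).
by rewrite (@near_eq_derive _ _ _ _ q').
Qed.

Lemma el_at_near c q q' s : (\forall r \near s, q r = q' r) -> el_at c q s -> el_at c q' s.
Proof.
move=> /phase_curve_near h el w; have hs := nbhs_singleton h.
have [dl lE] := el w; rewrite hs in lE.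
have h' : \forall r \near s, (lag_w L c w \o phase_curve q) r = (lag_w L c w \o phase_curve q') r.
  by apply: filterS h => r /= ->.
apply: DeriveDef; first exact: near_eq_derivable h' dl.
by rewrite -lE; apply: near_eq_derive; apply: filterS h' => r ->.
Qed.

Lemma derive_differentiable_linear (V W : normedModType R) (f : V -> W) p k a b :
  differentiable f p -> 'D_(k *: a + b) f p = k *: 'D_a f p + 'D_b f p.
Proof. by move=> df; rewrite !deriveE// linearP. Qed.

Lemma derive_pair (V W W' : normedModType R) (f : V -> W) (h : V -> W') (p v : V) :
  differentiable f p -> differentiable h p ->
  'D_v (fun r => (f r, h r)) p = ('D_v f p, 'D_v h p).
Proof.
move=> df dh; rewrite deriveE; last exact: differentiable_pair.
by rewrite (diff_pair df dh)/= (deriveE v df) (deriveE v dh).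
Qed.

Lemma curve_Ck_le k k' J gamma : (k <= k')%N -> curve_Ck k' J gamma -> curve_Ck k J gamma.
Proof. by move=> kk [cg Cg]; split => // c /Cg; exact: Ck_le. Qed.

Section two_charts.
Variables c c' : chart R n M.
Hypotheses (ac : atlas c) (ac' : atlas c').
Local Notation psi := (transition c' c).

Lemma lag_transition y v t : overlap c' c y ->
  lag L c' (y, v, t) = lag L c (psi y, 'D_v psi y, t).
Proof. by move=> oy; rewrite /lag/= -(lagrangian_in_transition L v t ac' ac oy). Qed.

Lemma lag_w_transition w y v t : overlap c' c y ->
  lag_w L c' w (y, v, t) = lag_w L c ('D_w psi y) (psi y, 'D_v psi y, t).
Proof.
move=> oy; have dpsi := transition_differentiable ac' ac oy.
apply: derive_on_line => h; rewrite !line_dir_w/= lag_transition//.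
by rewrite derive_differentiable_linear.
Qed.

(** The velocity ['D_v psi y] in the other chart varies with [y] too, which adds a momentum term
    containing a second derivative of the transition. *)
Lemma lag_x_transition w y v t : overlap c' c y ->
  lag_x L c' w (y, v, t) = lag_x L c ('D_w psi y) (psi y, 'D_v psi y, t) +
    lag_w L c ('D_w ('D_v psi) y) (psi y, 'D_v psi y, t).
Proof.
move=> oy; have dpsi := transition_differentiable ac' ac oy.
have oo := @open_overlap _ _ _ c' c.
have dDpsi : differentiable ('D_v psi) y.
  by have [_ /(_ v)[+ _]] := transition_Ck ac' ac 2; exact.
pose Psi y2 : Z := (psi y2, 'D_v psi y2, t).
have -> : lag_x L c' w (y, v, t) = 'D_w (lag L c \o Psi) y.
  transitivity ('D_w (fun y2 => lag L c' (y2, v, t)) y).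
    by apply: derive_on_line => h; rewrite line_dir_x.
  apply: near_eq_derive; apply: filterS (open_near oo oy) => y2 oy2 /=.
  exact: lag_transition.
have dz : lag_dom c (Psi y).
  by have [+ _] := overlap_transition oy.
have dl := lag_differentiable hL ac dz.
have dP1 : differentiable (fun y2 => (psi y2, 'D_v psi y2)) y by exact: differentiable_pair.
have dP : differentiable Psi y.
  by apply: differentiable_pair => //; exact: differentiable_cst.
have DP : 'D_w Psi y = dir_x ('D_w psi y) + dir_w ('D_w ('D_v psi) y).
  have dPt : differentiable (fun _ : E => t) y by exact: differentiable_cst.
  rewrite (derive_pair w dP1 dPt) (derive_pair w dpsi dDpsi) derive_cst.
  by rewrite /dir_x /dir_w; congr (_, _, _); rewrite /= ?addr0 ?add0r.
rewrite (derive_compE _ dP dl) DP deriveE// linearD/=.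
congr (_ + _); exact: esym (deriveE _ dl).
Qed.

Lemma phase_curve_transition gamma J s : open J -> curve_Ck 1 J gamma -> J s ->
  chart_source c (gamma s) -> chart_source c' (gamma s) ->
  let q2 := chart_map c' \o gamma in
  overlap c' c (q2 s) /\
  phase_curve (chart_map c \o gamma) s = (psi (q2 s), 'D_('D_1 q2 s) psi (q2 s), s).
Proof.
move=> oJ [cg Cg] Js cs cs' q2; pose q := chart_map c \o gamma.
have oc := open_curve_source (c := c) oJ cg; have oc' := open_curve_source (c := c') oJ cg.
pose O := (J `&` gamma @^-1` chart_source c) `&` (J `&` gamma @^-1` chart_source c').
have oO : open O by exact: openI.
have Os : O s by split.
have Oo r : O r -> overlap c' c (q2 r).
  move=> [[_ cr] [_ cr']]; split; first exact: chart_map_target.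
  by rewrite /q2/= chart_mapK ?inE.
have Oq r : O r -> q r = psi (q2 r).
  by move=> [[_ cr] [_ cr']]; rewrite /q/q2/transition/= chart_mapK ?inE.
split; first exact: Oo.
rewrite /phase_curve -/q Oq// -derive_compE; first last.
- exact/(transition_differentiable ac' ac)/Oo.
- by have [dq2 _] := Cg _ ac'; apply: dq2; split.
congr (_, _, _); apply: near_eq_derive.
by apply: filterS (open_near oO Os) => r' /Oq.
Qed.

(** Differentiating the momentum in the new chart also differentiates the coefficients [zeta].
    Symmetry of the second derivatives of the transition identifies this contribution with the
    additional term of [lag_x_transition], so the equation holds in all charts as soon as it holds
    in one. *)
Lemma el_transition gamma J s : open J -> curve_Ck 2 J gamma -> J s ->
  chart_source c (gamma s) -> chart_source c' (gamma s) ->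
  el_at c (chart_map c \o gamma) s -> el_at c' (chart_map c' \o gamma) s.
Proof.
move=> oJ Cg Js cs cs' el w; set q := chart_map c \o gamma in el; set q2 := chart_map c' \o gamma.
have C1 := curve_Ck_le (leqnSn 1) Cg; have [cg Cg'] := Cg.
have oc := open_curve_source (c := c) oJ cg; have oc' := open_curve_source (c := c') oJ cg.
pose O := (J `&` gamma @^-1` chart_source c) `&` (J `&` gamma @^-1` chart_source c').
have oO : open O by exact: openI.
have Os : O s by split.
have XO r : O r -> overlap c' c (q2 r) /\ phase_curve q r = (psi (q2 r), 'D_('D_1 q2 r) psi (q2 r), r).
  by move=> [[Jr cr] [_ cr']]; exact: (phase_curve_transition oJ C1 Jr cr cr').
have Oo r : O r -> overlap c' c (q2 r) by move=> /XO[].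
have XE r : O r -> phase_curve q r = (psi (q2 r), 'D_('D_1 q2 r) psi (q2 r), r) by move=> /XO[].
have C2 : Ck 2 O q2 by apply: Ck_subset (Cg' _ ac') => r [].
have [dq2 Dq2] := C2.
pose zeta r := 'D_w psi (q2 r).
set b := 'D_1 q2 s.
have dDpsi v : differentiable ('D_v psi) (q2 s).
  by have [_ /(_ v)[+ _]] := transition_Ck ac' ac 2; apply; exact: Oo.
have dzeta : is_derive s 1 zeta ('D_w ('D_b psi) (q2 s)).
  apply: DeriveDef; first by apply: diff_derivable; exact: (@differentiable_comp _ _ _ _ q2 ('D_w psi) s (dq2 s Os) (dDpsi w)).
  have -> : zeta = 'D_w psi \o q2 by [].
  rewrite derive_compE; [|exact: dq2|exact: dDpsi].
  exact: (derive_sym_mx b w (@open_overlap _ _ _ c' c) (transition_Ck ac' ac 2) (Oo s Os)).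
(* Expanding in the basis separates the coefficients, which depend on time, from the momenta in
   fixed directions, to which the equation in the chart [c] applies. *)
have hsum : \forall r \near s, (\sum_(j < n) (fun r => zeta r 0 j * lag_w L c (eb j) (phase_curve q r))) r = (lag_w L c' w \o phase_curve q2) r.
  apply: filterS (open_near oO Os) => r Or /=.
  rewrite fct_sumE [in RHS]/phase_curve (lag_w_transition _ _ _ (Oo r Or)) -(XE r Or).
  by rewrite [RHS](lag_w_sum hL ac)//= ; have [[_ cr] _] := Or; exact: chart_map_target.
have dz : lag_dom c (phase_curve q s) by exact: chart_map_target.
have dsum : is_derive s 1 (\sum_(j < n) (fun r => zeta r 0 j * lag_w L c (eb j) (phase_curve q r)))
    (\sum_(j < n) (zeta s 0 j * lag_x L c (eb j) (phase_curve q s) +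
      lag_w L c (eb j) (phase_curve q s) * ('D_w ('D_b psi) (q2 s)) 0 j)).
  apply: is_derive_sum => j; have h1 := is_derive_coord j dzeta; have h2 := el (eb j).
  exact: is_deriveM h1 h2.
have -> : lag_x L c' w (phase_curve q2 s) = \sum_(j < n) (zeta s 0 j * lag_x L c (eb j) (phase_curve q s) +
      lag_w L c (eb j) (phase_curve q s) * ('D_w ('D_b psi) (q2 s)) 0 j).
  rewrite [in LHS]/phase_curve (lag_x_transition _ _ _ (Oo s Os)) -(XE s Os).
  rewrite (lag_x_sum hL ac)// (lag_w_sum hL ac)// big_split/=; congr (_ + _).
  by apply: eq_bigr => j _; rewrite mulrC.
have [ds dE] := dsum; apply: DeriveDef; first exact: near_eq_derivable hsum ds.
by rewrite -dE; apply: near_eq_derive; apply: filterS hsum => r ->.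
Qed.

End two_charts.

Lemma euler_lagrange_onE J gamma : euler_lagrange_on L J gamma <->
  curve_Ck 2 J gamma /\ forall c s, atlas c -> J s -> chart_source c (gamma s) ->
    el_at c (chart_map c \o gamma) s.
Proof.
split=> -[Cg h]; (split; first exact: Cg) => c s ac Js cs.
  by apply/el_atE; exact: (h c s ac Js cs).
exact: ((el_atE c (chart_map c \o gamma) s).1 (h c s ac Js cs)).
Qed.

Lemma el_local c y w t : atlas c -> chart_target c y ->
  exists2 d, 0 < d & exists gamma, [/\ euler_lagrange_on L `]t - d, t + d[ gamma,
    gamma t = chart_inv c y & 'D_1 (chart_map c \o gamma) t = w].
Proof.
move=> ac cy; have [d d0 [q [qt Dq Cq tq elq]]] := el_chart_exists hL w t ac cy.
have oI : open [set` `]t - d, t + d[] by exact: itv_open.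
have tq' s : [set` `]t - d, t + d[] s -> chart_target c (q s) by rewrite /= in_itv/= => /tq.
have qE s : [set` `]t - d, t + d[] s -> \forall r \near s, q r = (chart_map c \o (chart_inv c \o q)) r.
  move=> Is; apply: filterS (open_near oI Is) => r /tq' /chart_invK[_].
  exact: esym.
have Cg : curve_Ck 2 `]t - d, t + d[ (chart_inv c \o q) by exact: curve_Ck_chart.
exists d => //; exists (chart_inv c \o q); split.
- apply/euler_lagrange_onE; split => // c' s ac' Is cs'.
  have [cs _] := chart_invK (tq' s Is).
  apply: (el_transition ac ac' oI Cg Is cs cs').
  apply: el_at_near (qE s Is) _; apply/el_atE.
  by apply/(euler_lagrange_chart hL ac Cq tq' Is)/elq; move: Is; rewrite /= in_itv.
- by rewrite /= qt.
- rewrite -Dq; apply: near_eq_derive; have It : [set` `]t - d, t + d[] t by rewrite /= in_itv/=; lra.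
  by apply: filterS (qE t It) => r ->.
Qed.

Lemma curve_Ck_eq k J gamma delta : open J -> {in J, gamma =1 delta} ->
  curve_Ck k J gamma -> curve_Ck k J delta.
Proof.
move=> oJ gd [cg Cg]; split=> [s Js|c ac].
  exact: continuous_near_eq (near_within_open oJ Js gd) (cg s Js).
have -> : J `&` delta @^-1` chart_source c = J `&` gamma @^-1` chart_source c.
  by apply/seteqP; split => s [Js /= cs]; split => //=; move: cs; rewrite gd ?inE.
apply: Ck_eq (Cg c ac); first exact: open_curve_source.
by move=> s; rewrite inE => -[Js _]; rewrite /= gd ?inE.
Qed.

Lemma euler_lagrange_eq J gamma delta : open J -> {in J, gamma =1 delta} ->
  euler_lagrange_on L J gamma -> euler_lagrange_on L J delta.
Proof.
move=> oJ gd /euler_lagrange_onE[Cg h]; apply/euler_lagrange_onE.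
split; first exact: curve_Ck_eq gd Cg.
move=> c s ac Js cs; apply: el_at_near (h c s ac Js _); last by rewrite gd ?inE.
by apply: filterS (near_within_open oJ Js gd) => r /= ->.
Qed.

Lemma euler_lagrange_bigcup I (D : set I) (J : I -> set R) gamma :
  (forall i, D i -> euler_lagrange_on L (J i) gamma) ->
  euler_lagrange_on L (\bigcup_(i in D) J i) gamma.
Proof.
move=> h; split; last by move=> c s ac [i Di Js]; have [_ hi] := h i Di; exact: hi.
split=> [s [i Di Js]|c ac]; first by have [[cg _] _] := h i Di; exact: cg.
apply: Ck_near => s [[i Di Js] cs]; have [[_ Cg] _] := h i Di.
by exists (J i `&` gamma @^-1` chart_source c); [split|exact: Cg].
Qed.

(** Completeness speaks of maximal solutions, so the given solution is first enlarged to a maximal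
    one by Zorn's lemma, among solutions on open intervals ordered by extension. *)
Lemma el_extend J0 gamma0 : open J0 -> is_interval J0 -> J0 !=set0 ->
  euler_lagrange_on L J0 gamma0 ->
  exists2 gamma, euler_lagrange_on L setT gamma & {in J0, gamma0 =1 gamma}.
Proof.
move=> oJ0 iJ0 nJ0 el0.
pose good (p : set R * (R -> M)) := [/\ open p.1, is_interval p.1, euler_lagrange_on L p.1 p.2,
  J0 `<=` p.1 & {in J0, gamma0 =1 p.2}].
pose T := {p : set R * (R -> M) | good p}.
have good0 : good (J0, gamma0) by split.
pose extends (p p' : T) := `[< (sval p).1 `<=` (sval p').1 /\ {in (sval p).1, (sval p).2 =1 (sval p').2} >].
have [[[J gamma] [oJ iJ elJ J0J g0]] maxp] : exists p : T, premaximal extends p.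
  apply: (ZL_preorder (exist good _ good0)).
  - by move=> p; apply/asboolP; split.
  - move=> p2 p1 p3 /asboolP[s12 e12] /asboolP[s23 e23]; apply/asboolP; split.
      exact: subset_trans s12 s23.
    by move=> r r1; rewrite e12// e23// inE; apply: s12; rewrite inE in r1.
  move=> A totA; have [[p0 Ap0]|nA] := pselect (exists p, A p); last first.
    by exists (exist good _ good0) => p Ap; case: nA; exists p.
  pose J := \bigcup_(p in A) (sval p).1.
  (* The members of a chain agree where they are both defined, so any member defined at [r] may be
     used; [gamma0] is a default value outside the union. *)
  pose gam (r : R) : M := if pselect (exists p, A p /\ (sval p).1 r) is left h
    then (sval (projT1 (cid h))).2 r else gamma0 r.
  have gamE p : A p -> {in (sval p).1, (sval p).2 =1 gam}.
    move=> Ap r; rewrite inE => pr; rewrite /gam.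
    case: pselect => [h|[]]; last by exists p.
    case: (cid h) => /= p' [Ap' pr'].
    have [/asboolP[s12 e12]|/asboolP[s12 e12]] := totA p p' Ap Ap'; first by rewrite e12 ?inE.
    by rewrite e12 ?inE.
  have gJ : good (J, gam).
    split=> /=.
    - by apply: bigcup_open => p Ap; case: (svalP p).
    - move=> a b [p1 A1 pa] [p2 A2 pb] r rab.
      have [i1 i2] : is_interval (sval p1).1 /\ is_interval (sval p2).1 by case: (svalP p1); case: (svalP p2).
      have [/asboolP[s12 e12]|/asboolP[s12 e12]] := totA p1 p2 A1 A2.
        by exists p2 => //; apply: i2 rab => //; exact: s12.
      by exists p1 => //; apply: i1 rab => //; exact: s12.
    - apply: euler_lagrange_bigcup => p Ap; have [op _ elp _ _] := svalP p.
      exact: euler_lagrange_eq op (gamE p Ap) elp.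
    - by move=> r Jr; exists p0 => //; have [_ _ _ + _] := svalP p0; exact.
    - move=> r Jr; have [_ _ _ s0 e0] := svalP p0.
      rewrite e0//; apply: gamE => //; rewrite inE; apply: s0; by rewrite inE in Jr.
  exists (exist good _ gJ) => p Ap; apply/asboolP; split => /=; last exact: gamE.
  by move=> r pr; exists p.
(* A solution extending [gamma] would be a larger element of the order, so maximality there is
   maximality in the sense of [maximal_euler_lagrange]. *)
have JT : J = setT.
  have [_ _ _ _ complete] := hL; apply: (complete J gamma); split => //.
    by have [r Jr] := nJ0; exists r; exact: (J0J r Jr).
  move=> J' gamma' oJ' iJ' el' JJ' gg'.
  have g' : good (J', gamma').
    split => //=; first exact: subset_trans J0J JJ'.
    move=> r r0; rewrite (g0 r r0) -gg'// inE; rewrite inE in r0; exact: (J0J r r0).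
  have := maxp (exist good _ g'); rewrite /extends/= => /(_ (asboolT (conj JJ' gg'))) /asboolP[J'J _].
  by apply/seteqP; split.
by exists gamma => //; rewrite -JT.
Qed.

Lemma el_exists c y w t : atlas c -> chart_target c y ->
  exists gamma, [/\ euler_lagrange_on L setT gamma, gamma t = chart_inv c y &
    'D_1 (chart_map c \o gamma) t = w].
Proof.
move=> ac cy; have [d d0 [gamma0 [el0 g0t g0w]]] := el_local w t ac cy.
have It : [set` `]t - d, t + d[] t by rewrite /= in_itv/=; lra.
have oI : open [set` `]t - d, t + d[] by exact: itv_open.
have [||gamma elg gE] := el_extend oI _ _ el0; first exact: interval_is_interval.
  by exists t.
exists gamma; split => //; first by rewrite -gE ?inE.
rewrite -g0w; apply: near_eq_derive.
by apply: filterS (near_within_open oI It gE) => r /= ->.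
Qed.

End euler_lagrange_transition.

(** * Backward propagation of touching paraboloids *)

(** Linearity is available in the outer direction only; the derivatives are exchanged to expand [w]
    in the basis, then exchanged back. *)
Lemma derive2_bounded {R : realType} (V : normedModType R) (K U : set V) (f : V -> R) :
  finite_dim V -> open U -> compact K -> K `<=` U -> Ck 2 U f ->
  exists2 C, 0 <= C & forall x v w, K x -> `|'D_v ('D_w f) x| <= C * (`|v| * `|w|).
Proof.
move=> fV oU cK KU C2; have [N [e [xi [exi xile]]]] := fV.
have [df Df] := C2.
have bnd i : exists C, 0 <= C /\ forall x v, K x -> `|'D_v ('D_(e i) f) x| <= C * `|v|.
  by have [C C0 hC] := derive_bounded fV cK KU (Df (e i)); exists C.
have [C hC] := choice bnd.
exists (\sum_(i < N) C i); first by apply: sumr_ge0 => i _; case: (hC i).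
move=> x v w Kx; have dD : differentiable ('D_v f) x by have [dD _] := Df v; exact/dD/KU.
have lin := derive_linear_comb (fun i => xi i w) e dD; rewrite -exi in lin.
rewrite (derive_sym v w oU C2 (KU _ Kx)) lin.
apply: le_trans (ler_norm_sum _ _ _) _; rewrite mulr_suml; apply: ler_sum => i _.
have [C0 hi] := hC i; rewrite normrM -(derive_sym v (e i) oU C2 (KU _ Kx)).
rewrite [C i * _]mulrA [X in _ <= X]mulrC.
by apply: ler_pM => //; exact: hi.
Qed.

Lemma unit_sphere_compact {R : realType} n : compact [set w : 'rV[R]_n | `|w| = 1].
Proof.
apply: (@subclosed_compact _ _ [set w | `|w - 0| <= 1]).
- have /continuous_closedP := @norm_continuous _ ('rV[R]_n); move=> /(_ _ (@closed_eq _ 1)); exact.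
- exact: norm_ball_compact.
- by move=> w /= Sw; rewrite subr0 Sw.
Qed.

Lemma combine_estimates {R : realFieldType} (l0 l1 l2 dx w0 w1 e1 e2 m : R) :
  `|l1 - l0 - dx| <= e1 -> `|w1 - w0| <= e2 -> l1 + w1 + m <= l2 ->
  l0 + dx - e1 + w0 - e2 + m <= l2.
Proof. by rewrite !ler_norml => /andP[h1 _] /andP[h2 _]; lra. Qed.

(** [f0], [fe] and [fx] are values of a convex function at 0, at a point of norm [r], and at [k]
    times that point; [d] is the slope at the middle one. The gain acquired at norm [r] is then
    multiplied by [k]. *)
Lemma convex_ray {R : realFieldType} (f0 fe fx l d a k r : R) : 1 <= k ->
  f0 + l + a * r ^+ 2 <= fe -> fe + - 1 * d <= f0 -> fe + (k - 1) * d <= fx ->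
  f0 + k * l + a * (r * (k * r)) <= fx.
Proof.
move=> k1 f1 f2 f3.
have h4 : (k - 1) * (fe - f0) <= (k - 1) * d by apply: ler_wpM2l; lra.
have h5 : k * (l + a * r ^+ 2) <= k * (fe - f0) by apply: ler_wpM2l; lra.
move: h4 h5 f3; rewrite expr2; lra.
Qed.

Section lagrangian_estimates.
Context {R : realType} {n : nat} {M : smooth_manifold R n}.
Variables (g : riemannian_metric M) (L : M -> 'rV[R]_n -> R -> R).
Hypothesis hL : tonelli L g.
Local Notation E := 'rV[R]_n.
Local Notation Z := (E * E * R)%type.
Implicit Types (y w v xi : E) (s t : R) (X : Z).
Local Notation eb := (delta_mx 0 : 'I_n -> E).
Variable c : chart R n M.
Hypothesis ac : atlas c.

Lemma dir_wZ k w : dir_w (k *: w) = k *: dir_w w.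
Proof. by rewrite /dir_w; congr (_, _, _); rewrite /= ?scaler0. Qed.

Lemma norm_dir_w w : `|dir_w w| = `|w|.
Proof. by rewrite /dir_w !prod_normE/= !normr0 (max_r (normr_ge0 w)) (max_l (normr_ge0 w)). Qed.

Lemma norm_dir_x w : `|dir_x w| = `|w|.
Proof. by rewrite /dir_x !prod_normE/= !normr0 !(max_l (normr_ge0 w)). Qed.

Lemma lag_wZ k w X : lag_dom c X -> lag_w L c (k *: w) X = k * lag_w L c w X.
Proof.
move=> /(lag_differentiable hL ac) dl; rewrite /lag_w dir_wZ.
by rewrite !deriveE// linearZ.
Qed.

Lemma hessian_form X xi : lag_dom c X ->
  'D_(dir_w xi) ('D_(dir_w xi) (lag L c)) X =
  \sum_(j < n) \sum_(i < n) xi 0 i * 'D_(dir_w (eb i)) (lag_w L c (eb j)) X * xi 0 j.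
Proof.
move=> dX; apply: (etrans (hessian_quadratic hL ac xi dX)); apply: eq_bigr => j _.
rewrite [X in X * _]mxE mulr_suml; apply: eq_bigr => i _.
by rewrite [X in _ * X * _]mxE.
Qed.

Lemma hessian_form0 X : lag_dom c X -> 'D_(dir_w 0) ('D_(dir_w 0) (lag L c)) X = 0.
Proof.
move=> dX; rewrite (hessian_form 0 dX) big1// => j _; rewrite big1// => i _.
by rewrite [X in _ * X]mxE mulr0.
Qed.

Lemma hessian_formZ k xi X : lag_dom c X ->
  'D_(dir_w (k *: xi)) ('D_(dir_w (k *: xi)) (lag L c)) X =
  k ^+ 2 * 'D_(dir_w xi) ('D_(dir_w xi) (lag L c)) X.
Proof.
move=> dX; apply: (etrans (hessian_form (k *: xi) dX)).
apply: (etrans _ (congr1 (fun r => k ^+ 2 * r) (esym (hessian_form xi dX)))).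
rewrite mulr_sumr; apply: eq_bigr => j _.
rewrite mulr_sumr; apply: eq_bigr => i _; rewrite [X in X * _ * _]mxE [X in _ * _ * X]mxE; ring.
Qed.

(** Written as a double sum over the basis, the Hessian form is jointly continuous in [X] and [xi];
    its minimum over the ball times the unit sphere is positive and extends by homogeneity. *)
Lemma uniformly_convex X0 r : [set X : Z | `|X - X0| <= r] `<=` lag_dom c ->
  exists2 a, 0 < a & forall X xi, `|X - X0| <= r ->
    a * `|xi| ^+ 2 <= 'D_(dir_w xi) ('D_(dir_w xi) (lag L c)) X.
Proof.
move=> rd; pose S := [set w : E | `|w| = 1].
pose K := [set X : Z | `|X - X0| <= r] `*` S.
have cK : compact K by apply: compact_setX; [exact: phase_ball_compact|exact: unit_sphere_compact].
pose G (p : Z * E) := 'D_(dir_w p.2) ('D_(dir_w p.2) (lag L c)) p.1.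
have hS w : w != 0 -> S (`|w|^-1 *: w).
  by move=> w0; rewrite /S/= normrZ normfV normr_id mulVf// normr_eq0.
have [K0|K0] := pselect (K !=set0); last first.
  exists 1 => // X xi Xr; have [->|x0] := eqVneq xi 0.
    by rewrite normr0 expr0n mulr0 (hessian_form0 (rd _ Xr)).
  by case: K0; exists (X, `|xi|^-1 *: xi); split => //=; exact: hS.
have cG : {within K, continuous G}.
  pose U := [set p : Z * E | lag_dom c p.1].
  have oU : open U by apply: open_pre; [move=> p; exact: cvg_fst|exact: open_lag_dom].
  have CG : Ck 0 U (fun p : Z * E => \sum_(j < n) \sum_(i < n) p.2 0 i * 'D_(dir_w (eb i)) (lag_w L c (eb j)) p.1 * p.2 0 j).
    have coord i : Ck 0 U (fun p : Z * E => p.2 0 i).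
      by apply: (Ck_coord _ _ oU); apply: (Ck_snd oU (f := id)); exact: Ck_id.
    apply: (Ck_bigsum oU) => j _; apply: (Ck_bigsum oU) => i _.
    apply: (Ck_mul oU); last exact: coord.
    apply: (Ck_mul oU); first exact: coord.
    move=> p Up; apply: (@continuous_comp _ _ _ fst ('D_(dir_w (eb i)) (lag_w L c (eb j)))); first exact: cvg_fst.
    have [_ /(_ (dir_w (eb i))) C0] := lag_w_Ck hL ac (eb j) 1.
    exact: C0.
  have cG' : {in K, continuous (fun p : Z * E => \sum_(j < n) \sum_(i < n) p.2 0 i * 'D_(dir_w (eb i)) (lag_w L c (eb j)) p.1 * p.2 0 j)}.
    by move=> p; rewrite inE => -[Xr _]; apply: CG; exact: rd.
  have := continuous_in_subspaceT cG'; apply: subspace_eq_continuous => p.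
  by rewrite inE => -[Xr Sp]; exact: esym (hessian_form _ (rd _ Xr)).
have [p Kp hp] := compact_EVT_min K0 cK cG.
rewrite inE in Kp; have [pr pS] := Kp.
exists (G p).
  apply: (lag_convex hL ac); first exact: rd.
  by apply: contraPneq pS => ->; rewrite /S/= normr0 => /esym/eqP; rewrite oner_eq0.
move=> X xi Xr; have [->|x0] := eqVneq xi 0.
  by rewrite normr0 expr0n mulr0 (hessian_form0 (rd _ Xr)).
have xE : xi = `|xi| *: (`|xi|^-1 *: xi) by rewrite scalerA divff ?scale1r// normr_eq0.
have dX := rd _ Xr.
have -> : 'D_(dir_w xi) ('D_(dir_w xi) (lag L c)) X = `|xi| ^+ 2 * G (X, `|xi|^-1 *: xi).
  by rewrite {1 2}xE; exact: hessian_formZ.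
rewrite mulrC; apply: ler_wpM2l; first exact: sqr_ge0.
by apply: hp; rewrite inE; split; [exact: Xr|exact: hS].
Qed.

(* The convexity gain is quadratic only for [|xi| <= r]; beyond, it is linear. *)
Lemma lag_estimates X0 : lag_dom c X0 -> exists r C a, [/\ 0 < r, 0 <= C, 0 < a,
  forall y w s z, `|(y, w, s) - X0| <= r -> `|z| <= r -> chart_target c (y + z) /\
    `|lag L c (y + z, w, s) - lag L c (y, w, s) - lag_x L c z (y, w, s)| <= C * `|z| ^+ 2 &
  forall y w s z xi, `|(y, w, s) - X0| <= r -> `|z| <= r ->
    lag L c (y, w, s) + lag_x L c z (y, w, s) - C * `|z| ^+ 2
    + lag_w L c xi (y, w, s) - C * (`|z| * `|xi|) + a * (Num.min r `|xi| * `|xi|)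
    <= lag L c (y + z, w + xi, s)].
Proof.
move=> dX0; have [r0 r00 rd] := phase_ball_dom dX0.
have cB := @phase_ball_compact R n X0 r0.
have C2 := lag_Ck hL 2 ac; have [dl Dl] := C2.
have [C C0 hC] := derive2_bounded phase_finite_dim (@open_lag_dom _ _ _ c) cB rd C2.
have [a a0 ha] := uniformly_convex rd.
(* Half for the distance of the base point to [X0], half for the increments [z] and [xi]. *)
pose r := r0 / 2; have r_gt0 : 0 < r by rewrite divr_gt0.
have inB y w s z xi : `|(y, w, s) - X0| <= r -> `|z| <= r -> `|xi| <= r -> `|(y + z, w + xi, s) - X0| <= r0.
  move=> h1 h2 h3; have -> : (y + z, w + xi, s) - X0 = ((y, w, s) - X0) + (z, xi, 0).
    by case: X0 {dX0 rd cB hC ha h1} => [[y0 w0] t0]; congr (_, _, _) => /=; rewrite ?addr0 // addrAC.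
  apply: le_trans (ler_normD _ _) _.
  have : `|(z, xi, 0) : Z| <= r by rewrite !norm_pair_le/= h2 h3 normr0 ltW.
  by move: h1; rewrite /r; lra.
have nn s V (v : V : normedModType R) : 0 <= s <= 1 -> `|s *: v| <= `|v|.
  by move=> /andP[s0 s1]; rewrite normrZ ger0_norm// ler_piMl.
have T1 y w s z : `|(y, w, s) - X0| <= r -> `|z| <= r -> chart_target c (y + z) /\
    `|lag L c (y + z, w, s) - lag L c (y, w, s) - lag_x L c z (y, w, s)| <= C * `|z| ^+ 2.
  move=> h1 h2; have z0 : `|0 : E| <= r by rewrite normr0 ltW.
  split; first by have := rd _ (inB _ _ _ _ _ h1 h2 z0).
  have seg h : 0 <= h <= 1 -> `|h *: dir_x z + (y, w, s) - X0| <= r0.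
    move=> h01; rewrite line_dir_x/= -[w]addr0 addrC -[h *: z + y]addrC.
    rewrite [X in `|X|](_ : _ = (y + h *: z, w + 0, s) - X0); last by rewrite addrC.
    by apply: inB => //; apply: le_trans (nn _ _ _ h01) h2.
  have -> : (y + z, w, s) = dir_x z + (y, w, s).
    by rewrite -[dir_x z]scale1r line_dir_x/= scale1r addrC.
  apply: taylor2_le => h h01.
  - exact/diff_derivable/dl/rd/seg.
  - by have [dD _] := Dl (dir_x z); exact/diff_derivable/dD/rd/seg.
  - by apply: le_trans (hC _ _ _ (seg h h01)) _; rewrite norm_dir_x expr2.
have T3 y w s z xi : `|(y, w, s) - X0| <= r -> `|z| <= r ->
    `|lag_w L c xi (y + z, w, s) - lag_w L c xi (y, w, s)| <= C * (`|z| * `|xi|).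
  move=> h1 h2; have z0 : `|0 : E| <= r by rewrite normr0 ltW.
  have seg h : 0 <= h <= 1 -> `|h *: dir_x z + (y, w, s) - X0| <= r0.
    move=> h01; rewrite line_dir_x/= -[w]addr0 addrC -[h *: z + y]addrC.
    rewrite [X in `|X|](_ : _ = (y + h *: z, w + 0, s) - X0); last by rewrite addrC.
    by apply: inB => //; apply: le_trans (nn _ _ _ h01) h2.
  have -> : (y + z, w, s) = dir_x z + (y, w, s).
    by rewrite -[dir_x z]scale1r line_dir_x/= scale1r addrC.
  apply: segment_le => h h01.
  - by have [dD _] := Dl (dir_w xi); exact/diff_derivable/dD/rd/seg.
  - by apply: le_trans (hC _ _ _ (seg h h01)) _; rewrite norm_dir_x norm_dir_w.
have dom y w w' s z : `|(y, w, s) - X0| <= r -> `|z| <= r -> lag_dom c (y + z, w', s).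
  by move=> h1 h2; have [] := T1 _ _ _ _ h1 h2.
have T2s y w s z xi : `|(y, w, s) - X0| <= r -> `|z| <= r -> `|xi| <= r ->
    lag L c (y + z, w, s) + lag_w L c xi (y + z, w, s) + a / 2 * `|xi| ^+ 2 <= lag L c (y + z, w + xi, s).
  move=> h1 h2 h3.
  have seg h : 0 <= h <= 1 -> `|h *: dir_w xi + (y + z, w, s) - X0| <= r0.
    move=> h01; rewrite line_dir_w/= [h *: xi + w]addrC.
    by apply: inB => //; apply: le_trans (nn _ _ _ h01) h3.
  have -> : (y + z, w + xi, s) = dir_w xi + (y + z, w, s).
    by rewrite -[dir_w xi]scale1r line_dir_w/= scale1r [w + xi]addrC.
  rewrite [a / 2 * _]mulrAC; apply: taylor2_ge => h h01.
  - exact/diff_derivable/dl/rd/seg.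
  - by have [dD _] := Dl (dir_w xi); exact/diff_derivable/dD/rd/seg.
  - exact: ha (seg h h01).
have cvx y w s xi : chart_target c y -> lag L c (y, w, s) + lag_w L c xi (y, w, s) <= lag L c (y, w + xi, s).
  move=> cy; have -> : (y, w + xi, s) = dir_w xi + (y, w, s).
    by rewrite -[dir_w xi]scale1r line_dir_w/= scale1r addrC.
  have dm h : lag_dom c (h *: dir_w xi + (y, w, s)) by rewrite line_dir_w.
  have := @taylor2_ge R Z (lag L c) (y, w, s) (dir_w xi) 0; rewrite mul0r addr0; apply => h h01.
  - exact/diff_derivable/dl.
  - by have [dD _] := Dl (dir_w xi); exact/diff_derivable/dD.
  - have [->|x0] := eqVneq xi 0; last exact/ltW/(lag_convex hL ac).
    by rewrite hessian_form0// line_dir_w.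
exists r, C, (a / 2); split => //; first by rewrite divr_gt0.
move=> y w s z xi h1 h2.
have [cz hT1] := T1 y w s z h1 h2; have hT3 := T3 y w s z xi h1 h2.
suff key : lag L c (y + z, w, s) + lag_w L c xi (y + z, w, s) + a / 2 * (Num.min r `|xi| * `|xi|) <=
    lag L c (y + z, w + xi, s).
  exact: combine_estimates hT1 hT3 key.
have [xr|xr] := leP `|xi| r.
  by rewrite -expr2; exact: T2s.
have xi0 : 0 < `|xi| := lt_trans r_gt0 xr.
(* A large [xi] is shrunk to norm [r], where the quadratic gain is known. The gradient inequality at
   [w + eta], in the directions [- eta] and [(k - 1) *: eta], transports this gain linearly along
   the ray. *)
pose k := `|xi| / r; pose eta := k^-1 *: xi.
have k0 : 0 < k by rewrite divr_gt0.
have k1 : 1 <= k by rewrite ler_pdivlMr// mul1r ltW.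
have xE : xi = k *: eta by rewrite scalerA divff ?scale1r// gt_eqF.
have er : `|eta| = r.
  by rewrite normrZ gtr0_norm ?invr_gt0// /k invfM invrK mulrC mulrA divff ?mul1r// gt_eqF.
have er' : `|eta| <= r by rewrite er.
have f1 := T2s y w s z eta h1 h2 er'.
have dz : lag_dom c (y + z, w, s) by exact: dom h1 h2.
have dz1 : lag_dom c (y + z, w + eta, s) by exact: dom h1 h2.
have f2 := cvx (y + z) (w + eta) s (- eta) cz.
have f3 := cvx (y + z) (w + eta) s ((k - 1) *: eta) cz.
rewrite addrK -scaleN1r lag_wZ// in f2.
have wE : w + eta + (k - 1) *: eta = w + xi.
  by rewrite -addrA -[X in w + (X + _)]scale1r -scalerDl [1 + _]addrC subrK -xE.
rewrite wE lag_wZ// in f3.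
have lxi : lag_w L c xi (y + z, w, s) = k * lag_w L c eta (y + z, w, s) by rewrite {1}xE lag_wZ.
rewrite er in f1; rewrite lxi.
have xn : `|xi| = k * r by rewrite /k -mulrA mulVf ?mulr1// gt_eqF.
rewrite xn; exact: convex_ray k1 f1 f2 f3.
Qed.

End lagrangian_estimates.

(** [Z] and [Y] stand for the distance to the curve and the velocity defect, and [B] collects the
    coefficients of their product. For [Y] at most [r], completing the square lets the convexity
    gain absorb that product at a cost [B ^+ 2 / (4 * a)] per [Z ^+ 2], which [kap] covers; for
    larger [Y] the gain is only linear, and the smallness of [Z] takes over. *)
Lemma velocity_gap_bound {R : realFieldType} (C a r K Kb nn B kap e Z Y d dz l px pw lg m : R) :
  0 <= C -> 0 < a -> 0 <= Z -> 0 <= Y -> 0 <= K <= Kb -> B = 2 * Kb * nn + C ->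
  `|d| <= nn * (Z * Y) -> Z ^+ 2 <= dz -> B * Z <= a * r -> C + B ^+ 2 / (4 * a) <= kap ->
  0 <= m ->
  l + px - C * Z ^+ 2 + pw - C * (Z * Y) + a * (Num.min r Y * Y) <= lg ->
  l + px + pw - kap * dz - 2 * K * d - e - m - lg <= - e.
Proof.
move=> C0 a0 Z0 Y0 /andP[K0 KK] BE hd hdz hB hk m0 hl.
set G := B ^+ 2 / (4 * a) in hk *.
have GE : 4 * a * G = B ^+ 2 by rewrite /G mulrC divfK// mulf_neq0// gt_eqF.
have G0 : 0 <= G by rewrite divr_ge0 ?sqr_ge0// mulr_ge0// ltW.
have h1 : - (2 * K * d) <= 2 * Kb * (nn * (Z * Y)).
  have h2 : - d <= `|d| by rewrite -normrN ler_norm.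
  have h3 : K * - d <= K * `|d| by apply: ler_wpM2l.
  have h4 : K * `|d| <= Kb * (nn * (Z * Y)) by apply: ler_pM.
  lra.
have h5 : kap * Z ^+ 2 <= kap * dz by apply: ler_wpM2l => //; lra.
have h6 : (C + G) * Z ^+ 2 <= kap * Z ^+ 2 by apply: ler_wpM2r => //; exact: sqr_ge0.
suff h7 : B * (Z * Y) <= a * (Num.min r Y * Y) + G * Z ^+ 2.
  have h8 : B * (Z * Y) = 2 * Kb * (nn * (Z * Y)) + C * (Z * Y) by rewrite BE; ring.
  by move: h1 h5 h6 h7 hl; rewrite h8; lra.
have [Yr|rY] := leP Y r.
  have h9 : 0 <= 4 * a * (a * (Y * Y) + G * Z ^+ 2 - B * (Z * Y)).
    have -> : 4 * a * (a * (Y * Y) + G * Z ^+ 2 - B * (Z * Y)) = (2 * a * Y - B * Z) ^+ 2.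
      rewrite mulrBr mulrDr [4 * a * (G * _)]mulrA GE; ring.
    exact: sqr_ge0.
  by move: h9; rewrite pmulr_rge0 ?mulr_gt0// subr_ge0.
have h9 : B * Z * Y <= a * r * Y by apply: ler_wpM2r.
have h10 : 0 <= G * Z ^+ 2 by rewrite mulr_ge0// sqr_ge0.
by move: h9 h10; rewrite -!mulrA; lra.
Qed.

(** * Comparison with a strict subsolution along an extremal *)

Section comparison.
Context {R : realType} {n : nat} {M : smooth_manifold R n}.
Variables (g : riemannian_metric M) (L : M -> 'rV[R]_n -> R -> R).
Hypothesis hL : tonelli L g.
Variable u : M * circle R -> R.
Hypothesis hu : continuous u.
Local Notation E := 'rV[R]_n.
Implicit Types (y w v xi z : E) (s t : R).
Variable c : chart R n M.
Hypothesis ac : atlas c.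
Variables (J : set R) (q P p' : R -> E) (Lam : R -> R).
Hypotheses (oJ : open J) (Cq : Ck 1 J q) (tq : forall s, J s -> chart_target c (q s)).
Hypothesis dLam : forall s, J s -> is_derive s 1 Lam (lag_along L c q s).
Hypothesis dP : forall s, J s -> is_derive s 1 P (p' s).
Hypothesis cp' : forall s, J s -> {for s, continuous p'}.
Variables (r C a : R).
Hypotheses (r0 : 0 < r) (C0 : 0 <= C) (a0 : 0 < a).
Hypothesis est_position : forall s z, J s -> `|z| <= r -> chart_target c (q s + z) /\
  lagrangian_in L c (q s + z) ('D_1 q s) s <= lag_along L c q s + dot (p' s) z + C * `|z| ^+ 2.
Hypothesis est_velocity : forall s z xi, J s -> `|z| <= r ->
  lag_along L c q s + dot (p' s) z - C * `|z| ^+ 2 + dot (P s) xi - C * (`|z| * `|xi|)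
  + a * (Num.min r `|xi| * `|xi|) <= lagrangian_in L c (q s + z) ('D_1 q s + xi) s.

(** [al + Lam] is the expected value of [u] along the curve and [P] the momentum. The curvature
    grows at rate [kap] to dominate the second order errors, the term in [e] makes the inequality
    strict, and the last one lowers the function again between [s1] and [s2]. *)
Definition comparison_test (al K0 kap e N s0 s1 s2 : R) (p : E * R) : R :=
  al + Lam p.2 + dot (P p.2) (p.1 - q p.2)
  - (K0 + kap * (p.2 - s0)) * dot (p.1 - q p.2) (p.1 - q p.2)
  + e * (1 + s2 - p.2) - N * sqr_pos (p.2 - s1).

Lemma comparison_test_Ck1 al K0 kap e N s0 s1 s2 :
  Ck 1 [set p : E * R | J p.2] (comparison_test al K0 kap e N s0 s1 s2).
Proof.
set V := [set p : E * R | J p.2].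
have cs : continuous (@snd E R) by move=> z; exact: cvg_snd.
have oV : open V by exact: open_pre cs oJ.
have C2V : Ck 1 V (fun p : E * R => p.2) by apply: (Ck_snd oV); exact: Ck_id.
have Cid : Ck 1 J (id : R -> R) by exact: Ck_id.
have Csub (x : R) : Ck 1 J (fun s => s - x) by apply: (Ck_sub oJ Cid); exact: Ck_cst.
have Cz : Ck 1 V (fun p : E * R => p.1 - q p.2).
  apply: (Ck_sub oV); first by apply: (Ck_fst oV); exact: Ck_id.
  exact: (Ck_comp finite_dim_real oV oJ _ C2V Cq).
have C2 (f : R -> R) : Ck 1 J f -> Ck 1 V (fun p : E * R => f p.2).
  by move=> Cf; exact: (Ck_compR finite_dim_real oV _ C2V Cf).
have Csq : Ck 1 J (fun s => sqr_pos (s - s1)).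
  exact: (Ck_compR finite_dim_real oJ _ (Csub s1) sqr_pos_Ck1).
have CP : Ck 1 J P by apply: (CkS_real oJ dP).
have CPV : Ck 1 V (fun p : E * R => P p.2) by exact: (Ck_comp finite_dim_real oV oJ _ C2V CP).
have CLam : Ck 1 J Lam := Lam_Ck1 hL ac oJ Cq tq dLam.
have Ccst (x : R) : Ck 1 J (fun _ : R => x) by exact: Ck_cst.
have Ce : Ck 1 J (fun s => e * (1 + s2 - s)) by apply: (Ck_cmul e oJ); exact: (Ck_sub oJ (Ccst (1 + s2)) Cid).
have CK : Ck 1 J (fun s => K0 + kap * (s - s0)) by exact: (Ck_add oJ (Ccst K0) (Ck_cmul kap oJ (Csub s0))).
have Ca : Ck 1 J (fun s => al + Lam s) by exact: (Ck_add oJ (Ccst al) CLam).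
apply: (Ck_sub oV); last exact: (C2 _ (Ck_cmul N oJ Csq)).
apply: (Ck_add oV); last exact: (C2 _ Ce).
apply: (Ck_sub oV); last exact: (Ck_mul oV (C2 _ CK) (Ck_dot oV Cz Cz)).
exact: (Ck_add oV (C2 _ Ca) (Ck_dot oV CPV Cz)).
Qed.

Lemma is_derive_affine (V : normedModType R) (y v : V) s : is_derive s 1 (fun h => y + (h - s) *: v) v.
Proof.
have dr : is_derive s 1 (fun h : R => h - s) 1 by apply: is_derive_eq; rewrite subr0.
have dfr : differentiable (fun h : R => h - s) s by apply/derivable1_diffP; case: dr.
have d1 : is_derive s 1 (fun h => (h - s) *: v) v.
  apply: DeriveDef; first by apply/derivable1_diffP; exact: differentiableZl.
  rewrite deriveE ?diffZl//; last exact: differentiableZl.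
  by rewrite -deriveE//; case: dr => _ ->; rewrite scale1r.
by have := is_deriveD (is_derive_cst y s 1) d1; rewrite add0r.
Qed.

Lemma derive_comparison_test al K0 kap e N s0 s1 s2 y v s : J s ->
  let z := y - q s in let xi := v - 'D_1 q s in
  'D_(v, 1) (comparison_test al K0 kap e N s0 s1 s2) (y, s) =
  lag_along L c q s + dot (p' s) z + dot (P s) xi - kap * dot z z
  - 2 * (K0 + kap * (s - s0)) * dot z xi - e - N * (2 * Num.max (s - s1) 0).
Proof.
move=> Js z xi.
pose zc h := y + (h - s) *: v - q h.
pose G (h : R) := al + Lam h + dot (P h) (zc h) - (K0 + kap * (h - s0)) * dot (zc h) (zc h)
  + e * (1 + s2 - h) - N * sqr_pos (h - s1).
rewrite (@derive_on_line _ _ _ _ _ G _ _ s 1); last first.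
  move=> h; rewrite /comparison_test /G /zc /= [h *: 1]mulr1.
  by rewrite addrK [y + _]addrC.
have dz : is_derive s 1 zc xi.
  exact: is_deriveB (is_derive_affine y v s) (curve_is_derive Cq Js).
have zs : zc s = z by rewrite /zc subrr scale0r addr0.
have ds : is_derive s 1 (fun r => sqr_pos (r - s1)) (2 * Num.max (s - s1) 0).
  have [dp pE] := is_derive_sqr_pos (s - s1).
  apply: DeriveDef; last rewrite -pE; last by apply: derive_on_line => h; rewrite addrA.
  apply/derivable1_diffP; apply: (@differentiable_comp _ _ _ _ (fun r : R => r - s1) sqr_pos).
    by apply: differentiableB => //; exact: differentiable_cst.
  exact/derivable1_diffP.
have dd := is_derive_dot dz dz.
have dPz := is_derive_dot (dP Js) dz.
have dL := dLam Js.
have dk : is_derive s 1 (fun h => K0 + kap * (h - s0)) kap.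
  by apply: is_derive_eq; rewrite /GRing.scale/=; ring.
have de : is_derive s 1 (fun h => e * (1 + s2 - h)) (- e).
  by apply: is_derive_eq; rewrite /GRing.scale/=; ring.
have dkd := is_deriveM dk dd.
have dG : is_derive s 1 G (0 + lag_along L c q s + (dot (p' s) (zc s) + dot (P s) xi)
   - ((K0 + kap * (s - s0)) *: (dot xi (zc s) + dot (zc s) xi) + dot (zc s) (zc s) *: kap)
   + (- e) - N *: (2 * Num.max (s - s1) 0)).
  have d1 := is_deriveD (is_deriveD (is_derive_cst al s 1) dL) dPz.
  exact: (is_deriveB (is_deriveD (is_deriveB d1 dkd) de) (is_deriveZ N ds)).
case: dG => _ ->; rewrite zs /GRing.scale/= (dotC xi z); ring.
Qed.

Hypothesis sup : viscosity_supersolution L u.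

(** If [u] were above its expected value at [s0], then [u_in u c - f] would have a negative minimum
    on the tube; each part of the boundary carries only nonnegative values, so the minimum is
    interior and contradicts the supersolution inequality. *)
Lemma comparison_step (al K2 rho kap B s0 s2 : R) :
  0 < rho <= r -> 0 <= K2 -> B = 2 * (K2 + 2) * n%:R + C -> C + B ^+ 2 / (4 * a) <= kap ->
  s0 <= s2 <= s0 + 1 -> kap * (s2 - s0) <= 1 -> (forall s, s0 <= s <= s2 -> J s) ->
  (forall s z, s0 <= s <= s2 -> `|z| <= rho ->
    al + Lam s + dot (P s) z - K2 * dot z z <= u_in u c (q s + z, s)) ->
  u_in u c (q s2, s2) = al + Lam s2 -> u_in u c (q s0, s0) = al + Lam s0.
Proof.
move=> /andP[rho0 rhor] K20 BE hk /andP[s02 s021] hks Js lower u2.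
have J0 : J s0 by apply: Js; rewrite lexx.
have low0 : al + Lam s0 <= u_in u c (q s0, s0).
  have := lower s0 0; rewrite normr0 !dot0r !addr0 mulr0 subr0; apply; last exact: ltW.
  by rewrite lexx.
apply/eqP; rewrite eq_le low0 andbT leNgt; apply/negP => gap.
pose D0 := u_in u c (q s0, s0) - (al + Lam s0).
have D00 : 0 < D0 by rewrite subr_gt0.
have lt02 : s0 < s2.
  by rewrite lt_neqAle s02 andbT; apply/eqP => ss; move: gap; rewrite ss u2 ltxx.
have B0 : 0 <= B by rewrite BE addr_ge0// mulr_ge0// mulr_ge0//; lra.
have kap0 : 0 <= kap.
  by apply: le_trans hk; rewrite addr_ge0// divr_ge0 ?sqr_ge0// mulr_ge0// ltW.
(* The second bound gives [B * x <= a * r] on the tube, as the estimate for large velocity defects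
   demands. *)
pose rho' := Num.min rho (a * r / (B + 1)).
have rho'0 : 0 < rho'.
  by rewrite lt_min rho0 divr_gt0 ?mulr_gt0//; lra.
have [rr rB] : rho' <= rho /\ rho' <= a * r / (B + 1) by rewrite !ge_min !lexx orbT.
have Brho x : 0 <= x <= rho' -> B * x <= a * r.
  move=> /andP[x0 xr]; have : x <= a * r / (B + 1) := le_trans xr rB.
  rewrite ler_pdivlMr; last lra.
  by move: x0; rewrite mulrDr mulr1; lra.
(* By continuity half of the gap [D0] at time [s0] survives on a whole ball around the curve. *)
have [rho1 rho10 hrho1] : exists2 rho1, 0 < rho1 & forall z, `|z| <= rho1 ->
    al + Lam s0 + dot (P s0) z + D0 / 2 <= u_in u c (q s0 + z, s0).
  have cz : {for (0 : E), continuous (fun z => u_in u c (q s0 + z, s0) - dot (P s0) z)}.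
    apply: (@continuousB _ _ _ (fun z => u_in u c (q s0 + z, s0)) (fun z => dot (P s0) z)); last first.
      have oT : open [set: E] by exact: openT.
      have Cd : Ck 0 [set: E] (fun z => dot (P s0) z).
        by apply: (Ck_dot oT (f := fun _ => P s0) (g := id)); [exact: Ck_cst|exact: Ck_id].
      exact: (Cd 0 I).
    apply: (@continuous_comp _ _ _ (fun z : E => (z, s0)) (fun p : E * R => u_in u c (q p.2 + p.1, p.2))).
      by apply: continuous_pair; [exact: cvg_id|exact: cst_continuous].
    by apply: (u_shifted_cvg hu Cq J0); rewrite addr0; exact: tq.
  have D20 : 0 < D0 / 2 by lra.
  have /nbhs_normP[d /= d0 hd] := continuous_near_le cz D20.
  exists (d / 2); first lra.
  move=> z zd; have : `|u_in u c (q s0 + 0, s0) - dot (P s0) 0 - (u_in u c (q s0 + z, s0) - dot (P s0) z)| <= D0 / 2.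
    by apply: hd; rewrite /ball_/= sub0r normrN; lra.
  by rewrite addr0 dot0r subr0 ler_norml => /andP[_]; rewrite /D0; lra.
(* The offset never exceeds [2 * e]: this must stay below the values reached on the lateral
   boundary, and at time [s0] below half the gap near the curve and below the square of [rho1]
   farther away. *)
pose e := Num.min (rho' ^+ 2) (Num.min (D0 / 2) (rho1 ^+ 2)) / 4.
have [e0 e1 e2 e3] : [/\ 0 < e, 2 * e < rho' ^+ 2, 2 * e < D0 / 2 & 2 * e < rho1 ^+ 2].
  have : 0 < Num.min (rho' ^+ 2) (Num.min (D0 / 2) (rho1 ^+ 2)).
    by rewrite !lt_min !exprn_gt0// divr_gt0.
  rewrite /e; set m := Num.min _ _ => m0.
  have [h1 h2 h3] : [/\ m <= rho' ^+ 2, m <= D0 / 2 & m <= rho1 ^+ 2] by rewrite !ge_min !lexx !orbT.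
  by split; lra.
have J2 : J s2 by apply: Js; rewrite lexx s02.
(* Just before [s2] the excess of [u] over its expected value is still smaller than [e], hence than
   the offset at [s1]: there the difference is negative. *)
have [s1 /andP[s01 s12] hs1] : exists2 s1, s0 < s1 < s2 & u_in u c (q s1, s1) - (al + Lam s1) < e.
  have cD : {for s2, continuous (fun s => u_in u c (q s, s) - Lam s)}.
    apply: (@continuousB _ _ _ (fun s => u_in u c (q s, s)) Lam); first exact: (u_along_cvg hu Cq tq J2).
    by apply: (Ck_continuous (Lam_Ck1 hL ac oJ Cq tq dLam)).
  have e20 : 0 < e / 2 by lra.
  have /nbhs_normP[d /= d0 hd] := continuous_near_le cD e20.
  pose m := Num.min d (s2 - s0).
  have [m0 m1 m2] : [/\ 0 < m, m <= d & m <= s2 - s0].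
    by rewrite lt_min d0 subr_gt0 lt02 !ge_min !lexx orbT.
  exists (s2 - m / 2); first by apply/andP; split; lra.
  have : `|u_in u c (q s2, s2) - Lam s2 - (u_in u c (q (s2 - m / 2), s2 - m / 2) - Lam (s2 - m / 2))| <= e / 2.
    apply: hd; rewrite /ball_/= opprB addrCA subrr addr0 gtr0_norm; lra.
  by rewrite ler_norml u2 => /andP[h1 _]; lra.
(* Chosen so that the barrier costs exactly [2 * e] at [s2], where the offset [eta] becomes
   [- e]. *)
pose N := (2 * e) / (s2 - s1) ^+ 2.
have s120 : 0 < (s2 - s1) ^+ 2 by rewrite exprn_gt0// subr_gt0.
have N0 : 0 <= N by rewrite divr_ge0 ?(ltW s120)//; lra.
have NE : N * (s2 - s1) ^+ 2 = 2 * e by rewrite /N divfK// gt_eqF.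
pose eta s := e * (1 + s2 - s) - N * sqr_pos (s - s1).
have sqp s : 0 <= N * sqr_pos (s - s1) by rewrite mulr_ge0// sqr_ge0.
have eta_le s : s0 <= s -> eta s <= 2 * e.
  move=> ss; have := sqp s; rewrite /eta.
  have : e * (1 + s2 - s) <= e * 2 by apply: ler_wpM2l; [exact: ltW|lra].
  lra.
have eta2 : eta s2 = - e by rewrite /eta {1}/sqr_pos max_l ?subr_ge0 ?(ltW s12)// NE; ring.
have eta1 : e <= eta s1.
  rewrite /eta subrr /sqr_pos maxxx expr0n/= mulr0 subr0.
  have : e * 1 <= e * (1 + s2 - s1) by apply: ler_wpM2l; [exact: ltW|lra].
  by rewrite mulr1.
pose f := comparison_test al (K2 + 1) kap e N s0 s1 s2.
pose Theta (p : E * R) := u_in u c (q p.2 + p.1, p.2) - f (q p.2 + p.1, p.2).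
have ThetaE z s : Theta (z, s) = u_in u c (q s + z, s) -
    (al + Lam s + dot (P s) z - (K2 + 1 + kap * (s - s0)) * dot z z + eta s).
  by rewrite /Theta /f /comparison_test /eta/= [q s + z]addrC addrK addrA.
(* The curvature [K2 + 1] exceeds by one that of the known lower paraboloids, which leaves the
   margin [|z| ^+ 2]. *)
have Theta_ge z s : `|z| <= rho' -> s0 <= s <= s2 -> `|z| ^+ 2 - eta s <= Theta (z, s).
  move=> zr ss; have hl := lower s z ss (le_trans zr rr).
  have sq := sqr_norm_le_dot z; have dz0 := dot_ge0 z.
  have kz : 0 <= kap * (s - s0) * dot z z.
    by rewrite mulr_ge0// mulr_ge0// subr_ge0; case/andP: ss.
  by rewrite ThetaE; move: hl sq kz; rewrite !mulrDl mul1r; lra.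
pose Kset : set (E * R) := [set z | `|z - 0| <= rho'] `*` [set` `[s0, s2]].
have KsetP p : Kset p -> `|p.1| <= rho' /\ s0 <= p.2 <= s2.
  by move=> [/=]; rewrite subr0 in_itv.
have cK : compact Kset by apply: compact_setX; [exact: norm_ball_compact|exact: segment_compact].
have tz z s : `|z| <= rho' -> J s -> chart_target c (q s + z).
  by move=> zr Js'; have [] := est_position Js' (le_trans zr (le_trans rr rhor)).
have ctheta : {within Kset, continuous Theta}.
  apply: continuous_in_subspaceT => -[z s]; rewrite inE => /KsetP/= [zr ss].
  have Jss := Js s ss.
  apply: (@continuousB _ _ _ (fun p : E * R => u_in u c (q p.2 + p.1, p.2)) (fun p : E * R => f (q p.2 + p.1, p.2))).
    by apply: (u_shifted_cvg hu Cq Jss); exact: tz.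
  apply: (@continuous_comp _ _ _ (fun p : E * R => (q p.2 + p.1, p.2)) f).
    apply: continuous_pair; last exact: cvg_snd.
    by apply: (shifted_curve_cvg Cq); [exact: Jss|exact: cvg_fst|exact: cvg_snd].
  by apply: (Ck_continuous (@comparison_test_Ck1 al (K2 + 1) kap e N s0 s1 s2)).
have K0' : Kset !=set0.
  by exists (0, s0); split => /=; rewrite ?subrr ?normr0 ?(ltW rho'0)// in_itv/= lexx.
have [[z s]] := compact_EVT_min K0' cK ctheta.
rewrite inE => /KsetP/= [zr ss] hmin.
have hmin' z' s' : `|z'| <= rho' -> s0 <= s' <= s2 -> Theta (z, s) <= Theta (z', s').
  by move=> zr' ss'; apply: hmin; rewrite inE; split => /=; rewrite ?subr0 ?in_itv.
have neg : Theta (z, s) < 0.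
  apply: le_lt_trans (hmin' 0 s1 _ _) _; rewrite ?normr0 ?(ltW rho'0) ?(ltW s01) ?(ltW s12)//.
  by rewrite ThetaE addr0 !dot0r mulr0 addr0 subr0; move: hs1 eta1; lra.
have hT := Theta_ge z s zr ss.
have /andP[ss0 ss2] := ss.
have etas := eta_le s ss0.
have z20 : 0 <= `|z| ^+ 2 by exact: sqr_ge0.
have zr' : `|z| < rho'.
  by rewrite lt_neqAle zr andbT; apply/eqP => ez; move: hT; rewrite ez; lra.
have s_lt2 : s < s2.
  rewrite lt_neqAle ss2 andbT; apply/eqP => es.
  have etaE : eta s = - e by rewrite es.
  by move: hT; rewrite etaE; lra.
have s_gt0 : s0 < s.
  rewrite lt_neqAle ss0 andbT; apply/eqP => es; subst s.
  have [zr1|zr1] := leP `|z| rho1.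
    have h1 := hrho1 z zr1; have dz0 := dot_ge0 z.
    have kz : 0 <= (K2 + 1) * dot z z by rewrite mulr_ge0//; lra.
    by move: neg; rewrite ThetaE subrr mulr0 addr0; lra.
  have : rho1 ^+ 2 < `|z| ^+ 2 by rewrite ltr_pXn2r// ?nnegrE ?normr_ge0// ltW.
  by move: hT; lra.
have Jss := Js s ss; have tzs := tz z s zr Jss.
have oV : open [set p : E * R | J p.2].
  by apply: open_pre oJ => p; exact: cvg_snd.
have zE : q s + z - q s = z by rewrite addrAC subrr add0r.
have loc : \forall p \near (q s + z, s), u_in u c (q s + z, s) - f (q s + z, s) <= u_in u c p - f p.
  have cz : {for (q s + z, s), continuous (fun p : E * R => `|p.1 - q p.2|)}.
    apply: (@continuous_comp _ _ _ (fun p : E * R => p.1 - q p.2) Num.norm); last exact: norm_continuous.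
    apply: (@continuousB _ _ _ fst (fun p : E * R => q p.2)); first exact: cvg_fst.
    by apply: (@continuous_comp _ _ _ snd q); [exact: cvg_snd|exact: (curve_cvg Cq)].
  have n1 : \forall p \near (q s + z, s), `|p.1 - q p.2| < rho'.
    have hz : `|(q s + z, s).1 - q (q s + z, s).2| < rho' by rewrite /= zE.
    exact: (cz _ (lt_nbhsl hz)).
  have n2 : \forall p \near (q s + z, s), s0 < p.2 by apply: (cvg_snd (lt_nbhsr s_gt0)).
  have n3 : \forall p \near (q s + z, s), p.2 < s2 by apply: (cvg_snd (lt_nbhsl s_lt2)).
  near=> p.
  have h1 : `|p.1 - q p.2| <= rho' by apply: ltW; near: p.
  have h2 : s0 <= p.2 <= s2 by apply/andP; split; apply: ltW; near: p.
  have := hmin' _ _ h1 h2.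
  by rewrite /Theta/= [q p.2 + _]addrC subrK -surjective_pairing.
have := supersolution_chart hL sup ac oV (@comparison_test_Ck1 al (K2 + 1) kap e N s0 s1 s2) Jss tzs loc (B := - e).
suff bnd : forall w, 'D_(w, 1) f (q s + z, s) - lagrangian_in L c (q s + z) w s <= - e.
  by move=> /(_ bnd); lra.
move=> v; rewrite /f derive_comparison_test//= zE.
have hv := @est_velocity s z (v - 'D_1 q s) Jss (le_trans zr (le_trans rr rhor)).
rewrite [_ + (v - _)]addrC subrK in hv.
(* The curvature has grown by at most [kap * (s2 - s0) <= 1] above [K2 + 1], whence the bound
   [K2 + 2] that enters [B]. *)
apply: (@velocity_gap_bound _ C a r _ (K2 + 2) n%:R B kap e `|z| `|v - 'D_1 q s|) => //.
- apply/andP; split; first by rewrite addr_ge0 ?mulr_ge0 ?subr_ge0//; lra.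
  have : kap * (s - s0) <= kap * (s2 - s0) by apply: ler_wpM2l => //; lra.
  lra.
- exact: dot_le_norm.
- exact: sqr_norm_le_dot.
- by apply: Brho; rewrite normr_ge0.
- by rewrite mulr_ge0// mulr_ge0// le_max lexx orbT.
Unshelve. all: by end_near. Qed.

End comparison.

Lemma ler_sqr_mul {R : numDomainType} (a b c : R) : 0 <= a -> a <= c * b -> a ^+ 2 <= c ^+ 2 * b ^+ 2.
Proof. by move=> a0 h; rewrite -exprMn ler_pXn2r// nnegrE; exact: le_trans h. Qed.

Lemma itv_diff_le {R : realFieldType} (r d s t : R) : r - d < s -> t < r + d -> t - s <= 2 * d.
Proof. by move=> *; lra. Qed.

Lemma ge_sub_of_norm {R : realFieldType} (a b e f : R) : `|a - b| <= e -> e <= f -> b - f <= a.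
Proof. by rewrite ler_norml => /andP[h1 _] h2; lra. Qed.

Lemma lower_slope {R : realFieldType} (u0 u1 p p' k A B v w : R) : u0 + p' - k <= u1 ->
  p - A * v <= p' -> k <= B * v -> (A + B) * v <= (A + B) * w -> u0 + p - (A + B) * w <= u1.
Proof. by rewrite [(A + B) * v]mulrDl => *; lra. Qed.

Lemma ler_mul3 {R : numDomainType} (a b c d e : R) : 0 <= a -> 0 <= b -> d <= c * e ->
  a * (b * d) <= a * (b * c) * e.
Proof. by move=> a0 b0 h; rewrite -mulrA -(mulrA b); apply: ler_wpM2l => //; exact: ler_wpM2l. Qed.

Lemma sub_le3 {R : realFieldType} (l1 l2 d e : R) : l1 <= l2 + d + e -> l1 - l2 - d - e <= 0.
Proof. by move=> h; lra. Qed.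

Lemma lower_transport {R : realFieldType} (u0 u1 u2 z1 z2 l1 l2 p1 p2 e t1 t2 k k' ke : R) :
  u1 - u2 <= z1 - z2 -> z1 - l1 - p1 - e * t1 <= z2 - l2 - p2 - e * t2 ->
  u0 + p1 - k <= u1 -> e * (t1 - t2) <= ke -> k <= k' ->
  u0 - l1 + l2 + p2 - (k' + ke) <= u2.
Proof. by rewrite mulrBr => *; lra. Qed.

(** * Propagation of calibration along an extremal, from chart to chart *)

Section propagation.
Context {R : realType} {n : nat} {M : smooth_manifold R n}.
Variables (g : riemannian_metric M) (L : M -> 'rV[R]_n -> R -> R).
Hypothesis hL : tonelli L g.
Variable u : M * circle R -> R.
Hypothesis hu : continuous u.
Local Notation E := 'rV[R]_n.
Local Notation Z := (E * E * R)%type.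
Implicit Types (c : chart R n M) (y w v xi z : E) (s t : R) (X : Z) (gamma : R -> M) (J : set R).
Local Notation eb := (delta_mx 0 : 'I_n -> E).

(* The momentum of [gamma] at time t is the slope of a paraboloid touching
   u(-, t) from below at [gamma t]. *)
Definition quad_below c gamma t := exists K rho, 0 < rho /\ forall z, `|z| <= rho ->
  u_in u c ((chart_map c \o gamma) t, t) + lag_w L c z (phase_curve (chart_map c \o gamma) t)
  - K * dot z z <= u_in u c ((chart_map c \o gamma) t + z, t).

Definition momentum c X : E := \row_j lag_w L c (eb j) X.
Definition force c X : E := \row_j lag_x L c (eb j) X.

Lemma dot_momentum c X z : atlas c -> lag_dom c X -> dot (momentum c X) z = lag_w L c z X.
Proof.
move=> ac dX; rewrite (lag_w_sum hL ac)//; apply: eq_bigr => j _.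
by rewrite [X in X * _]mxE mulrC.
Qed.

Lemma dot_force c X z : atlas c -> lag_dom c X -> dot (force c X) z = lag_x L c z X.
Proof.
move=> ac dX; rewrite (lag_x_sum hL ac)//; apply: eq_bigr => j _.
by rewrite [X in X * _]mxE mulrC.
Qed.

Section local.
Variables (c : chart R n M) (gamma : R -> M) (J : set R) (Lam : R -> R).
Hypotheses (ac : atlas c) (elg : euler_lagrange_on L setT gamma) (oJ : open J).
Hypothesis dLam : forall s, J s -> is_derive s 1 Lam (lag_curve L gamma s).
Hypotheses (sub : viscosity_subsolution L u) (sup : viscosity_supersolution L u).
Local Notation q := (chart_map c \o gamma).

Let Cg2 : curve_Ck 2 setT gamma. Proof. by case: elg. Qed.
Let Cg1 : curve_Ck 1 setT gamma. Proof. exact: curve_Ck_le Cg2. Qed.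

(** Domination along the curves [q + z] carries the paraboloid at time [t] to every earlier time in
    the chart, with slope the momentum and one curvature [K2]. The equality of values is then
    obtained backwards by finitely many comparison steps. *)
Lemma propagation_local r0 : J r0 -> chart_source c (gamma r0) ->
  exists2 d, 0 < d & forall s t, r0 - d < s -> s <= t -> t < r0 + d ->
    [/\ chart_source c (gamma s), chart_source c (gamma t) & (quad_below c gamma t ->
    u_curve u gamma t - u_curve u gamma s = Lam t - Lam s /\ quad_below c gamma s)].
Proof.
move=> Jr cr.
have oS : open (curve_chart gamma setT c) by apply: (curve_chart_open openT Cg1).
have CqS : Ck 2 (curve_chart gamma setT c) q by case: Cg2 => _ /(_ c ac).
have tqS s : curve_chart gamma setT c s -> chart_target c (q s) by exact: curve_chart_target.
have Sr : curve_chart gamma setT c r0 by [].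
have [r [C [a [rp C0 a0 est1 est2]]]] := lag_estimates hL ac (tqS _ Sr : lag_dom c (phase_curve q r0)).
have [d0 d00 hd0] : exists2 d, 0 < d & forall s, `|s - r0| < d ->
    [/\ J s, curve_chart gamma setT c s & `|phase_curve q s - phase_curve q r0| <= r].
  have [dX _] := phase_curve_is_derive CqS Sr.
  have cX := differentiable_continuous dX.
  have n1 := open_near oJ Jr; have n2 := open_near oS Sr; have n3 := continuous_near_le cX rp.
  have : \forall s \near r0, [/\ J s, curve_chart gamma setT c s & `|phase_curve q s - phase_curve q r0| <= r].
    by near=> s; split; [near: s|near: s|rewrite distrC; near: s].
  move=> /nbhs_normP[d /= d0 hd]; exists d => // s sd; apply: hd.
  by rewrite /ball_/= distrC.
pose d := d0 / 2; have d_gt0 : 0 < d by rewrite divr_gt0.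
pose J1 := [set` `]r0 - d, r0 + d[].
have oJ1 : open J1 by exact: itv_open.
have J1P s : J1 s <-> r0 - d < s < r0 + d by rewrite /J1/= in_itv.
have inS s : r0 - d <= s <= r0 + d -> `|s - r0| < d0.
  by move=> /andP[h1 h2]; rewrite ltr_norml /d in h1 h2 *; apply/andP; split; lra.
have J1S s : J1 s -> `|s - r0| < d0.
  by move=> /J1P/andP[h1 h2]; apply: inS; rewrite !ltW.
have CqJ k : (k <= 2)%N -> Ck k J1 q.
  by move=> k2; apply: (Ck_le k2); apply: Ck_subset CqS => s /J1S/hd0[].
have Cq := CqJ 1%N isT.
have tq s : J1 s -> chart_target c (q s) by move=> /J1S/hd0[_ /tqS].
have dLam1 s : J1 s -> is_derive s 1 Lam (lag_along L c q s).
  move=> /J1S/hd0[Js Ss _]; rewrite -(lag_curve_chart L ac Cg1 Ss); exact: dLam.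
have dX s : J1 s -> lag_dom c (phase_curve q s) by exact: tq.
pose P s := momentum c (phase_curve q s); pose p' s := force c (phase_curve q s).
have dP s : J1 s -> is_derive s 1 P (p' s).
  move=> J1s; have [_ Ss _] := hd0 s (J1S s J1s).
  have [_ /(_ c s ac I Ss.2) el] := (euler_lagrange_onE L setT gamma).1 elg.
  apply: is_derive_row => j; have := el (eb j).
  rewrite [p' s 0 j]mxE (_ : (fun r => P r 0 j) = lag_w L c (eb j) \o phase_curve q)//.
  by apply/funext => s'; rewrite [LHS]mxE.
have cp' s : J1 s -> {for s, continuous p'}.
  move=> J1s; have Cp : Ck 0 (curve_chart gamma setT c) p'.
    apply: (Ck_mx oS) => i j; have := lag_x_Ck hL ac (eb j) 0 => Cx.
    move=> s' Ss'; rewrite (ord1 i).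
    rewrite (_ : (fun s => p' s 0 j) = lag_x L c (eb j) \o phase_curve q); last first.
      by apply/funext => s''; rewrite [LHS]mxE.
    apply: (@continuous_comp _ _ _ (phase_curve q) (lag_x L c (eb j))).
      by have [dX' _] := phase_curve_is_derive CqS Ss'; exact: differentiable_continuous dX'.
    by apply: Cx; exact: tqS.
  by apply: Cp; have [_ Ss _] := hd0 s (J1S s J1s).
have dotP s z : J1 s -> dot (P s) z = lag_w L c z (phase_curve q s).
  by move=> J1s; apply: dot_momentum => //; exact: dX.
have dotp' s z : J1 s -> dot (p' s) z = lag_x L c z (phase_curve q s).
  by move=> J1s; apply: dot_force => //; exact: dX.
have e1 s z : J1 s -> `|z| <= r -> chart_target c (q s + z) /\
    lagrangian_in L c (q s + z) ('D_1 q s) s <= lag_along L c q s + dot (p' s) z + C * `|z| ^+ 2.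
  move=> J1s zr; have [_ _ Xr] := hd0 s (J1S s J1s).
  have [tz hz] := est1 (q s) ('D_1 q s) s z Xr zr; split => //.
  rewrite dotp'//; move: hz; rewrite ler_norml => /andP[_]; rewrite /lag/=/lag_along/phase_curve.
  by move=> h; rewrite -lerBlDl opprD addrA.
have e2 s z xi : J1 s -> `|z| <= r ->
    lag_along L c q s + dot (p' s) z - C * `|z| ^+ 2 + dot (P s) xi - C * (`|z| * `|xi|)
    + a * (Num.min r `|xi| * `|xi|) <= lagrangian_in L c (q s + z) ('D_1 q s + xi) s.
  move=> J1s zr; have [_ _ Xr] := hd0 s (J1S s J1s).
  by have := est2 (q s) ('D_1 q s) s z xi Xr zr; rewrite -(dotP s xi J1s) -(dotp' s z J1s).
exists d => // s t rs st td.
have J1t : J1 t by apply/J1P; rewrite td andbT; exact: lt_le_trans rs st.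
have J1s : J1 s by apply/J1P; rewrite rs/=; exact: le_lt_trans st td.
have src s' : J1 s' -> chart_source c (gamma s') by move=> /J1S/hd0[_ []].
split; [exact: src|exact: src|].
move=> [K1 [rho1 [rho10 hK1]]].
have ucE s' : J1 s' -> u_curve u gamma s' = u_in u c (q s', s').
  by move=> /src cs'; exact: u_curve_chart.
pose al := u_in u c (q t, t) - Lam t.
pose rho := Num.min rho1 r.
have [rho0 rhor rhor1] : [/\ 0 < rho, rho <= r & rho <= rho1].
  by rewrite lt_min rho10 rp !ge_min !lexx orbT.
(* The Lagrangian along a translate costs [C * |z| ^+ 2] per unit of time, over a duration at most
   [2 * d]. *)
pose K2 := `|K1| + C * (2 * d).
have K20 : 0 <= K2 by rewrite addr_ge0// mulr_ge0//; lra.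
have inJ1 s' s'' : r0 - d < s' -> s'' <= t -> forall s, s' <= s <= s'' -> J1 s.
  by move=> h1 h2 s3 /andP[h3 h4]; apply/J1P; apply/andP; split; lra.
have lower s' z : r0 - d < s' <= t -> `|z| <= rho ->
    al + Lam s' + dot (P s') z - K2 * dot z z <= u_in u c (q s' + z, s').
  move=> /andP[rs' s't] zr.
  have zr' := le_trans zr rhor; have dz0 := dot_ge0 z.
  have J1s' : J1 s' by apply: (inJ1 s' t) => //; rewrite lexx.
  pose qz s := q s + z.
  have Cqz : Ck 1 J1 qz by apply: (Ck_add oJ1 Cq); exact: Ck_cst.
  have Dqz s3 : J1 s3 -> 'D_1 qz s3 = 'D_1 q s3.
    move=> J3; have d3 := curve_is_derive Cq J3.
    by have [_ ->] := is_deriveD d3 (is_derive_cst z s3 1); rewrite addr0.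
  have tqz s3 : J1 s3 -> chart_target c (qz s3) by move=> J3; case: (e1 s3 z J3 zr').
  have CqzS : Ck 1 (curve_chart gamma setT c) qz.
    by apply: (Ck_add oS (CkS CqS)); exact: Ck_cst.
  pose S0 := [set s | `|s - r0| < d0].
  have [Lz dLz] : exists Lz : R -> R, forall s, r0 - d < s < r0 + d -> is_derive s 1 Lz (lag_along L c qz s).
    apply: antiderivative; apply: continuous_in_subspaceT => s3; rewrite inE/= in_itv/= => /inS h3.
    apply: (lag_along_cvg hL ac (J := S0)) => //; first by apply: Ck_subset CqzS => s4 /hd0[].
    move=> s4 /hd0[_ S4 Xr]; have [tz _] := est1 (q s4) ('D_1 q s4) s4 z Xr zr'.
    exact: tz.
  have dLz' s3 : J1 s3 -> is_derive s3 1 Lz (lag_along L c qz s3) by move=> /J1P/dLz.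
  have hdom := subsolution_dominated_chart hL hu ac oJ1 Cqz tqz dLz' sub s't (inJ1 _ _ rs' (lexx t)).
  (* By the Euler-Lagrange equation the momentum has derivative [p'], which compensates the first
     order change of the Lagrangian from the curve to its translate; the last term pays the second
     order remainder. *)
  pose F s := Lz s - Lam s - dot (P s) z - C * `|z| ^+ 2 * s.
  have hF : F t <= F s'.
    apply: (@derive_le0_nincr R F (fun s => lag_along L c qz s - lag_along L c q s - dot (p' s) z - C * `|z| ^+ 2)) => //.
      move=> s3 /(inJ1 _ _ rs' (lexx t)) J3.
      have d1 := is_deriveB (is_deriveB (dLz' s3 J3) (dLam1 s3 J3)) (is_derive_dotr z (dP s3 J3)).
      have d2 : is_derive s3 1 (fun s => C * `|z| ^+ 2 * s) (C * `|z| ^+ 2).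
        by apply: is_derive_eq; rewrite /GRing.scale/= mulr1.
      exact: is_deriveB d1 d2.
    move=> s3 /(inJ1 _ _ rs' (lexx t)) J3; have [_ h3] := e1 s3 z J3 zr'.
    by rewrite {1}/lag_along Dqz// /qz; exact: sub_le3.
  have hq := hK1 z (le_trans zr rhor1); rewrite -dotP// in hq.
  have hz := sqr_norm_le_dot z.
  have ts : 0 <= t - s' <= 2 * d by rewrite subr_ge0 s't; exact: itv_diff_le rs' td.
  have h1 : C * `|z| ^+ 2 * (t - s') <= C * (2 * d) * dot z z.
    have h0 : `|z| ^+ 2 * (t - s') <= 2 * d * dot z z.
      by rewrite mulrC; case/andP: ts => t1 t2; apply: ler_pM => //; exact: sqr_ge0.
    by rewrite -(mulrA C (`|z| ^+ 2)) -(mulrA C (2 * d)); exact: ler_wpM2l.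
  have h2 : K1 * dot z z <= `|K1| * dot z z by apply: ler_wpM2r => //; exact: ler_norm.
  by rewrite /K2 mulrDl /al; exact: lower_transport hdom hF hq h1 h2.
pose B := 2 * (K2 + 2) * n%:R + C.
pose kap := C + B ^+ 2 / (4 * a).
have kap0 : 0 <= kap by rewrite addr_ge0// divr_ge0 ?sqr_ge0// mulr_ge0// ltW.
(* The length of a comparison step: at most 1, and such that [kap * eps <= 1]. It depends on [K2]
   only through [kap], hence is the same for all steps. *)
pose eps := (kap + 1)^-1.
have eps0 : 0 < eps by rewrite invr_gt0; lra.
have eps1 : eps <= 1 by rewrite invf_le1; lra.
have keps : kap * eps <= 1.
  have : (kap + 1) * eps = 1 by rewrite divff// gt_eqF//; lra.
  by rewrite mulrDl mul1r; lra.
(* Induction on the number of steps. The paraboloids come each time from [lower], that is from time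
   [t], so their curvature stays equal to [K2]. *)
have calib k s' : r0 - d < s' <= t -> t - s' <= k%:R * eps -> u_in u c (q s', s') = al + Lam s'.
  elim: k s' => [|k IH] s' /andP[rs' s't].
    rewrite mul0r => ts; have -> : s' = t by lra.
    by rewrite subrK.
  move=> ts; pose s2 := Num.min t (s' + eps).
  have [s2t s2e s's2] : [/\ s2 <= t, s2 <= s' + eps & s' <= s2].
    by rewrite /s2 le_min !ge_min !lexx orbT s't/=; split => //; lra.
  apply: (comparison_step hL hu ac oJ1 Cq tq dLam1 dP cp' rp C0 a0 e1 e2 sup (s0 := s') (s2 := s2)
    (rho := rho) (K2 := K2) (B := B) (kap := kap)).
  - by rewrite rho0.
  - exact: K20.
  - by [].
  - exact: lexx.
  - by apply/andP; split => //; lra.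
  - by apply: le_trans keps; apply: ler_wpM2l => //; lra.
  - exact: inJ1.
  - move=> s3 z /andP[h3 h4] zr; apply: lower => //.
    by rewrite (lt_le_trans rs' h3) (le_trans h4 s2t).
  - have [tse|set_] := leP t (s' + eps).
      have -> : s2 = t by apply/min_idPl.
      by rewrite subrK.
    have s2E : s2 = s' + eps by apply/min_idPr/ltW.
    apply: IH; first by rewrite s2t andbT; exact: lt_le_trans rs' s's2.
    by move: ts; rewrite s2E -natr1 mulrDl mul1r; lra.
have us s' : r0 - d < s' <= t -> u_in u c (q s', s') = al + Lam s'.
  move=> hs'; apply: (calib (Num.bound ((t - s') / eps))) => //.
  rewrite -ler_pdivrMr//; apply/ltW/archi_boundP; rewrite divr_ge0 ?(ltW eps0)// subr_ge0.
  by case/andP: hs'.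
have hs : r0 - d < s <= t by rewrite rs.
split; first by rewrite !ucE// (us s hs) /al; ring.
exists K2, rho; split => // z zr.
have := lower s z hs zr.
by rewrite (us s hs) dotP.
Unshelve. all: by end_near. Qed.

End local.
Lemma transition_taylor c c' y : atlas c -> atlas c' -> overlap c' c y ->
  exists rho C, [/\ 0 < rho, 0 <= C & forall z, `|z| <= rho -> overlap c' c (y + z) /\
    `|transition c' c (y + z) - transition c' c y - 'D_z (transition c' c) y| <= C * `|z| ^+ 2].
Proof.
move=> ac ac' oy; set psi := transition c' c.
have oo := @open_overlap _ _ _ c' c.
have /nbhs_normP[d /= d0 hd] := open_near oo oy.
pose rho := d / 2; have rho0 : 0 < rho by rewrite divr_gt0.
pose K := [set x : E | `|x - y| <= rho].
have KU : K `<=` overlap c' c.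
  by move=> x /= xr; apply: hd; rewrite /ball_/= distrC; apply: le_lt_trans xr _; rewrite /rho; lra.
have cK : compact K by exact: norm_ball_compact.
have Cpsi : Ck 2 (overlap c' c) psi := transition_Ck ac' ac 2.
have Cj j : Ck 2 (overlap c' c) (fun x => psi x 0 j) by apply: (Ck_coord _ _ oo).
have bnd j : exists C, 0 <= C /\ forall x v w, K x -> `|'D_v ('D_w (fun x => psi x 0 j)) x| <= C * (`|v| * `|w|).
  by have [C C0 hC] := derive2_bounded (finite_dim_row n) oo cK KU (Cj j); exists C.
have [C hC] := choice bnd.
have C0 j : 0 <= C j by case: (hC j).
exists rho, (\sum_j C j); split => //; first exact: sumr_ge0.
move=> z zr; have Kyz s : 0 <= s <= 1 -> K (s *: z + y).
  move=> s01; apply: ball_segment => //; first by rewrite subrr normr0 ltW.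
  by rewrite addrK.
split; first by apply: KU; rewrite /K/= [y + z]addrC addrK.
have S0 : 0 <= (\sum_j C j) * `|z| ^+ 2 by rewrite mulr_ge0 ?sqr_ge0// sumr_ge0.
apply: norm_row_le => // j; rewrite !rowB.
have dpsi : derivable psi y z by apply: diff_derivable; exact: (transition_differentiable ac' ac).
have -> : ('D_z psi y) 0 j = 'D_z (fun x => psi x 0 j) y by rewrite derive_mx// mxE.
rewrite [y + z]addrC; have [dj Dj] := Cj j.
apply: taylor2_le => s s01.
- exact/diff_derivable/dj/KU/Kyz.
- by have [dD _] := Dj z; exact/diff_derivable/dD/KU/Kyz.
have [_ /(_ _ z z (Kyz s s01)) h] := hC j; apply: le_trans h _; rewrite -expr2.
by apply: ler_wpM2r; [exact: sqr_ge0|rewrite (bigD1 j)//= lerDl sumr_ge0].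
Qed.

(** A change of chart modifies a paraboloid at second order only, which the curvature absorbs on a
    smaller ball, and its slope changes as a covector, like the momentum. *)
Lemma quad_below_transition c c' gamma t : atlas c -> atlas c' -> curve_Ck 1 setT gamma ->
  chart_source c (gamma t) -> chart_source c' (gamma t) ->
  quad_below c gamma t -> quad_below c' gamma t.
Proof.
move=> ac ac' Cg ct ct' [K [rho [rho0 hK]]].
have [oy XE] := phase_curve_transition ac ac' openT Cg I ct ct'.
set q2 := chart_map c' \o gamma in oy XE *; set q := chart_map c \o gamma in hK XE.
set psi := transition c' c in oy XE; set y2 := q2 t in oy XE *.
have qE : q t = psi y2 by rewrite -[q t]/((phase_curve q t).1.1) XE.
have [rho1 [C [rho10 C0 hpsi]]] := transition_taylor ac ac' oy.
have dpsi : differentiable psi y2 by exact: (transition_differentiable ac' ac).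
have [C1 C10 hC1] : exists2 C1, 0 <= C1 & forall z, `|'D_z psi y2| <= C1 * `|z|.
  have cK : compact [set y2] by exact: compact_set1.
  have KU : [set y2] `<=` overlap c' c by move=> _ ->.
  have [C1 C10 hC1] := derive_bounded (finite_dim_row n) cK KU (transition_Ck ac' ac 1).
  by exists C1 => // z; exact: hC1.
set X := phase_curve q t in hK XE.
have dX : lag_dom c X by exact: chart_map_target.
pose P := momentum c X.
pose C2 := C1 + C * rho1; have C20 : 0 <= C2 by rewrite addr_ge0// mulr_ge0// ltW.
pose r := Num.min rho1 (rho / (C2 + 1)).
have [r0 rr1 rr2] : [/\ 0 < r, r <= rho1 & r <= rho / (C2 + 1)].
  by rewrite lt_min rho10 divr_gt0 ?ge_min ?lexx ?orbT//; lra.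
exists (n%:R * (`|P| * C) + `|K| * (n%:R * C2 ^+ 2)), r; split => // z zr.
have [oz hz] := hpsi z (le_trans zr rr1).
pose zeta := psi (y2 + z) - psi y2.
have uE x : overlap c' c x -> u_in u c' (x, t) = u_in u c (psi x, t).
  by move=> ox; rewrite /u_in/= chart_inv_transition.
have ze : `|zeta| <= C2 * `|z|.
  apply: le_trans (norm_le_add hz) _.
  have : C * `|z| ^+ 2 <= C * rho1 * `|z|.
    by rewrite expr2 mulrA; apply: ler_wpM2r => //; apply: ler_wpM2l => //; exact: le_trans zr rr1.
  by have := hC1 z; rewrite /C2 mulrDl; lra.
have zrho : `|zeta| <= rho.
  apply: le_trans ze _; apply: (@le_trans _ _ (C2 * (rho / (C2 + 1)))).
    by apply: ler_wpM2l => //; exact: le_trans zr rr2.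
  rewrite mulrA ler_pdivrMr; last lra.
  by rewrite mulrC ler_pM2l//; lra.
have := hK zeta zrho.
have -> : q t + zeta = psi (y2 + z) by rewrite qE addrC subrK.
rewrite -uE// qE -uE//.
have lE : lag_w L c' z (phase_curve q2 t) = lag_w L c ('D_z psi y2) X.
  by rewrite XE; exact: (lag_w_transition L ac ac').
rewrite lE -!(dot_momentum _ ac dX) -/P.
have dP : dot P ('D_z psi y2) - n%:R * (`|P| * C) * `|z| ^+ 2 <= dot P zeta.
  have h1 := dot_le_norm P (zeta - 'D_z psi y2).
  have h2 : n%:R * (`|P| * `|zeta - 'D_z psi y2|) <= n%:R * (`|P| * C) * `|z| ^+ 2.
    exact: ler_mul3 (ler0n _ _) (normr_ge0 _) hz.
  by rewrite dotBr in h1; exact: ge_sub_of_norm h1 h2.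
have dK : K * dot zeta zeta <= `|K| * (n%:R * C2 ^+ 2) * `|z| ^+ 2.
  have h1 : K * dot zeta zeta <= `|K| * dot zeta zeta by apply: ler_wpM2r; [exact: dot_ge0|exact: ler_norm].
  have hz2 := ler_sqr_mul (normr_ge0 zeta) ze.
  have hd : dot zeta zeta <= n%:R * C2 ^+ 2 * `|z| ^+ 2.
    apply: le_trans (dot_sqr_le zeta) _; rewrite -(mulrA n%:R); exact: ler_wpM2l (ler0n _ _) _ _ hz2.
  apply: le_trans h1 _; rewrite -(mulrA `|K|); exact: ler_wpM2l (normr_ge0 _) _ _ hd.
have hn : (n%:R * (`|P| * C) + `|K| * (n%:R * C2 ^+ 2)) * `|z| ^+ 2 <=
    (n%:R * (`|P| * C) + `|K| * (n%:R * C2 ^+ 2)) * dot z z.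
  apply: ler_wpM2l; last exact: sqr_norm_le_dot.
  by rewrite addr_ge0 ?mulr_ge0 ?sqr_ge0.
by move=> hq; exact: lower_slope hq dP dK hn.
Qed.

Lemma propagation gamma J (Lam : R -> R) c a b : viscosity_solution L u ->
  euler_lagrange_on L setT gamma -> open J -> a <= b -> (forall s, a <= s <= b -> J s) ->
  (forall s, J s -> is_derive s 1 Lam (lag_curve L gamma s)) ->
  atlas c -> chart_source c (gamma b) -> quad_below c gamma b ->
  u_curve u gamma b - u_curve u gamma a = Lam b - Lam a.
Proof.
move=> [sub sup] elg oJ ab Jab dLam ac cb qb.
have Cg1 : curve_Ck 1 setT gamma by apply: curve_Ck_le (proj1 elg).
(* Quantifying over all charts makes the property at [t] independent of the chart, so that it can be
   handed from one local step to the next. *)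
pose Z t := forall c, atlas c -> chart_source c (gamma t) -> quad_below c gamma t.
pose Q s t := Z t -> u_curve u gamma t - u_curve u gamma s = Lam t - Lam s /\ Z s.
suff /(_ _)/proj1 : Q a b by apply => c' ac' cb'; exact: quad_below_transition Cg1 cb cb' qb.
apply: (@local_transitive_global R Q) => //.
  move=> x y z _ _ _ _ Qxy Qyz Zz; have [h1 Zy] := Qyz Zz; have [h2 Zx] := Qxy Zy.
  by split => //; lra.
move=> r rab; pose c0 := chart_at (gamma r).
have ac0 : atlas c0 by exact: atlas_chart_at.
have [d d0 hd] := propagation_local ac0 elg oJ dLam sub sup (Jab r rab) (source_chart_at _).
exists d => // s t _ st _ rs tr Zt.
have [cs ct hst] := hd s t rs st tr.
have [h1 qs] := hst (Zt c0 ac0 ct); split => // c' ac' cs'.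
exact: quad_below_transition Cg1 cs cs' qs.
Qed.

End propagation.

(** * Calibrated extremals ending arbitrarily close to a given point *)

Section calibrated_points.
Context {R : realType} {n : nat} {M : smooth_manifold R n}.
Variables (g : riemannian_metric M) (L : M -> 'rV[R]_n -> R -> R).
Hypothesis hL : tonelli L g.
Variable u : M * circle R -> R.
Hypothesis hu : continuous u.
Local Notation E := 'rV[R]_n.
Local Notation Z := (E * E * R)%type.
Implicit Types (c : chart R n M) (y w v p z : E) (s t : R) (X : Z) (gamma : R -> M) (J : set R).

Lemma dot_continuous (f h : E -> E) y : {for y, continuous f} -> {for y, continuous h} ->
  {for y, continuous (fun y => dot (f y) (h y))}.
Proof.
move=> cf ch; have oT : open [set: E * E] by exact: openT.
have Cd : Ck 0 [set: E * E] (fun x => dot x.1 x.2).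
  by apply: (Ck_dot oT); [apply: (Ck_fst oT (f := id))|apply: (Ck_snd oT (f := id))]; exact: Ck_id.
apply: (@continuous_comp _ _ _ (fun y => (f y, h y)) (fun x => dot x.1 x.2)); last exact: (Cd _ I).
exact: continuous_pair.
Qed.

(** A minimum of [u] plus a steep paraboloid centred at [y] is attained inside the ball; expanding
    the square about the minimum point gives the slope and the curvature. *)
Lemma touching_paraboloid c y t e : chart_target c y -> 0 < e ->
  exists y' p K rho, [/\ 0 < rho, `|y' - y| <= e, chart_target c y' &
    forall z, `|z| <= rho -> u_in u c (y', t) + dot p z - K * dot z z <= u_in u c (y' + z, t)].
Proof.
move=> cy e0; have /nbhs_normP[d /= d0 hd] := open_near (@open_chart_target _ _ _ c) cy.
pose r := Num.min e (d / 2).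
have [r0 re rd] : [/\ 0 < r, r <= e & r <= d / 2].
  by rewrite lt_min e0 divr_gt0// !ge_min !lexx orbT.
pose K := [set v : E | `|v - y| <= r].
have Kt v : K v -> chart_target c v.
  by move=> vr; apply: hd; rewrite /ball_/= distrC; apply: le_lt_trans vr _; lra.
have cK : compact K by exact: norm_ball_compact.
have Ky : K y by rewrite /K/= subrr normr0 ltW.
have K0 : K !=set0 by exists y.
have cu v : K v -> {for v, continuous (fun v => u_in u c (v, t))}.
  move=> Kv; apply: (@continuous_comp _ _ _ (fun v : E => (v, t)) (u_in u c)).
    by apply: continuous_pair; [exact: cvg_id|exact: cst_continuous].
  exact: (u_in_cvg hu (Kt v Kv)).
have [v0 Kv0 hv0] : exists2 v0, K v0 & forall v, K v -> u_in u c (v0, t) <= u_in u c (v, t).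
  have cuK : {within K, continuous (fun v => u_in u c (v, t))}.
    by apply: continuous_in_subspaceT => v; rewrite inE; exact: cu.
  have [v0 Kv0 h] := compact_EVT_min K0 cK cuK; exists v0; first by rewrite inE in Kv0.
  by move=> v Kv; apply: h; rewrite inE.
(* On the sphere of radius [r] the penalised function is at least [u_in u c (y, t) + 1], above its
   value at [y], so the minimum is interior. *)
pose k := (u_in u c (y, t) - u_in u c (v0, t) + 1) / r ^+ 2.
have r20 : 0 < r ^+ 2 by rewrite exprn_gt0.
have k0 : 0 <= k by rewrite divr_ge0 ?(ltW r20)//; have := hv0 y Ky; lra.
have kr : k * r ^+ 2 = u_in u c (y, t) - u_in u c (v0, t) + 1 by rewrite /k divfK// gt_eqF.
pose F v := u_in u c (v, t) + k * dot (v - y) (v - y).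
have cF : {within K, continuous F}.
  apply: continuous_in_subspaceT => v; rewrite inE => Kv.
  apply: (@continuousD _ _ _ (fun v => u_in u c (v, t)) (fun v => k * dot (v - y) (v - y))); first exact: cu.
  apply: (@continuousM _ _ (fun _ => k) (fun v => dot (v - y) (v - y))); first exact: cst_continuous.
  have cs : {for v, continuous (fun v : E => v - y)}.
    by apply: (@continuousB _ _ _ id (fun _ => y)); [exact: cvg_id|exact: cst_continuous].
  exact: dot_continuous.
have [v1] := compact_EVT_min K0 cK cF; rewrite inE => Kv1 hv1.
have h1 : F v1 <= u_in u c (y, t).
  by have := hv1 y; rewrite inE => /(_ Ky); rewrite /F subrr dot0l mulr0 addr0.
have v1r : `|v1 - y| < r.
  rewrite lt_neqAle Kv1 andbT; apply/eqP => er.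
  have : k * r ^+ 2 <= k * dot (v1 - y) (v1 - y) by rewrite ler_wpM2l// -er sqr_norm_le_dot.
  by rewrite kr; have := hv0 v1 Kv1; move: h1; rewrite /F; lra.
exists v1, (- (2 * k) *: (v1 - y)), k, (r - `|v1 - y|); split.
- by rewrite subr_gt0.
- exact: le_trans (ltW v1r) re.
- exact: Kt.
move=> z zr; have Kz : K (v1 + z).
  by rewrite /K/= addrAC; apply: le_trans (ler_normD _ _) _; lra.
have := hv1 (v1 + z); rewrite inE => /(_ Kz); rewrite /F [v1 + z - y]addrAC.
move: (u_in u c _) (u_in u c _) (v1 - y) => u1 u2 v2.
rewrite !dotDl !dotDr dotZl (dotC z v2); lra.
Qed.

(** A minimum point of the Lagrangian minus the linear form [p], which exists by superlinear growth,
    has momentum [p]. *)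
Lemma legendre_surjective c y t p : atlas c -> chart_target c y ->
  exists w, forall z, lag_w L c z (y, w, t) = dot p z.
Proof.
(* The part [n%:R * |p|] bounds the linear form; the additional 1 leaves a growth of slope one. *)
move=> ac cy; pose C := n%:R * `|p| + 1.
have [B hB] := legendre_bounded hL t C ac cy.
pose G w := lag L c (y, w, t) - dot p w.
have dG w : lag_dom c (y, w, t) by [].
have Gge w : `|w| - B <= G w.
  have h1 := hB w; have h2 := dot_le_norm p w.
  have h3 : dot p w <= n%:R * `|p| * `|w| by apply: le_trans (ler_norm _) _; rewrite -mulrA.
  by rewrite /G/lag/=; move: h1; rewrite /C mulrDl mul1r; lra.
pose r := `|B| + `|G 0| + 1; have r0 : 0 < r by rewrite /r ltr_wpDl// addr_ge0.
have cG : {within [set w | `|w - 0| <= r], continuous G}.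
  apply: continuous_subspaceT => w.
  apply: (@continuousB _ _ _ (fun w => lag L c (y, w, t)) (dot p)); last first.
    by apply: (@dot_continuous (fun _ => p) id); [exact: cst_continuous|exact: cvg_id].
  apply: (@continuous_comp _ _ _ (fun w : E => (y, w, t)) (lag L c)).
    apply: (@continuous_pair _ _ _ (fun w : E => (y, w)) (fun _ => t)); last exact: cst_continuous.
    by apply: (@continuous_pair _ _ _ (fun _ : E => y) id); [exact: cst_continuous|exact: cvg_id].
  exact: (Ck_continuous (lag_Ck hL 0 ac) (dG w)).
have K0 : [set w : E | `|w - 0| <= r] !=set0 by exists 0; rewrite /= subrr normr0 ltW.
have cK : compact [set w : E | `|w - 0| <= r] by exact: norm_ball_compact.
have [w] := compact_EVT_min K0 cK cG.
rewrite inE/= subr0 => wr hw.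
have hG v : G w <= G v.
  have [vr|rv] := leP `|v| r; first by apply: hw; rewrite inE/= subr0.
  have : G w <= G 0 by apply: hw; rewrite inE/= subrr normr0 ltW.
  have := Gge v; have := ler_norm B; have := ler_norm (G 0); move: rv; rewrite /r; lra.
exists w => z.
have dpsi v : is_derive (0 : R) 1 (fun h => G (w + h *: v)) (lag_w L c v (y, w, t) - dot p v).
  have d1 : is_derive (0 : R) 1 (fun h => lag L c (h *: dir_w v + (y, w, t))) (lag_w L c v (y, w, t)).
    have := @is_derive_line _ _ _ (lag L c) (y, w, t) (dir_w v) 0; rewrite scale0r add0r.
    by apply; apply: diff_derivable; exact: (lag_differentiable hL ac (dG w)).
  have d2 : is_derive (0 : R) 1 (fun h => dot (w + (h - 0) *: v) p) (dot v p).
    exact: is_derive_dotr (is_derive_affine w v 0).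
  have := is_deriveB d1 d2; rewrite [dot v p]dotC.
  rewrite (_ : (fun h => lag L c (h *: dir_w v + (y, w, t))) - (fun h => dot (w + (h - 0) *: v) p) = (fun h => G (w + h *: v)))//.
  apply/funext => h; rewrite -[LHS]/(lag L c (h *: dir_w v + (y, w, t)) - dot (w + (h - 0) *: v) p).
  by rewrite line_dir_w /G /= subr0 dotC [h *: v + w]addrC.
have le0 v : lag_w L c v (y, w, t) - dot p v <= 0.
  apply: (derive_left_le0 (dpsi v) ltr01) => s _.
  by rewrite scale0r addr0; exact: hG.
apply/eqP; rewrite -subr_eq0 eq_le le0/=.
have := le0 (- z); rewrite -scaleN1r (lag_wZ hL ac)// dotZr; lra.
Qed.

Definition calibrated gamma t := forall s, s <= t ->
  u_curve u gamma t - u_curve u gamma s = action L gamma s t.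

Lemma global_antiderivative gamma a b : a <= b -> curve_Ck 1 setT gamma ->
  exists2 Lam : R -> R, (forall s, a - 1 < s < b + 1 -> is_derive s 1 Lam (lag_curve L gamma s)) &
    forall s s', a <= s -> s <= s' -> s' <= b -> action L gamma s s' = Lam s' - Lam s.
Proof.
move=> ab Cg; have lt1 : a - 2 < b + 2 by lra.
have Cg2 : curve_Ck 1 `]a - 2, b + 2[ gamma by exact: curve_Ck_subset Cg.
have [||Lam dLam] := lag_curve_antiderivative hL lt1 Cg2 (a' := a - 1) (b' := b + 1); [lra|lra|].
exists Lam => // s s' as_ ss sb.
have Cs : curve_Ck 1 `]s - 1, s' + 1[ gamma by exact: curve_Ck_subset Cg.
have dLs r : s <= r <= s' -> is_derive r 1 Lam (lag_curve L gamma r) by move=> rss; apply: dLam; lra.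
have gg : {in `[s, s'], gamma =1 gamma} by [].
by have [_ ->] := action_antiderivative hL ss ltr01 Cs gg dLs.
Qed.

Lemma calibrated_of_quad_below gamma c t : viscosity_solution L u -> euler_lagrange_on L setT gamma ->
  atlas c -> chart_source c (gamma t) -> quad_below L u c gamma t -> calibrated gamma t.
Proof.
move=> vu elg ac ct qt s st.
have Cg : curve_Ck 1 setT gamma by exact: curve_Ck_le (proj1 elg).
have [Lam dLam aE] := global_antiderivative st Cg.
rewrite aE//; apply: (@propagation _ _ _ _ _ hL u hu gamma [set` `]s - 1, t + 1[] Lam c) => //.
by move=> r rst; rewrite /= in_itv/=; lra.
Qed.

Lemma calibrated_near x t e : viscosity_solution L u -> 0 < e ->
  exists gamma, [/\ euler_lagrange_on L setT gamma, calibrated gamma t,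
    chart_source (chart_at x) (gamma t) &
    `|chart_map (chart_at x) (gamma t) - chart_map (chart_at x) x| <= e].
Proof.
move=> vu e0; set c := chart_at x; have ac : atlas c by exact: atlas_chart_at.
have cx : chart_target c (chart_map c x) by apply: chart_map_target; exact: source_chart_at.
have [y' [p [K [rho [rho0 ye cy' hy']]]]] := touching_paraboloid t cx e0.
have [w hw] := legendre_surjective t p ac cy'.
have [gamma [elg gt Dg]] := el_exists hL w t ac cy'.
have [cs cE] := chart_invK cy'.
exists gamma; split => //; [|by rewrite gt|by rewrite gt cE].
apply: (calibrated_of_quad_below (c := c)) => //; first by rewrite gt.
exists K, rho; split => // z zr.
by rewrite /phase_curve Dg /= gt cE hw; exact: hy'.
Qed.

End calibrated_points.

(** * Limits of calibrated extremals *)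

Lemma norm_sub_half {R : realType} (V : normedModType R) (x y z : V) (r : R) :
  `|x - y| <= r / 2 -> `|y - z| <= r / 2 -> `|x - z| <= r.
Proof. by move=> h1 h2; rewrite -(subrKA y); apply: le_trans (ler_normD _ _) _; lra. Qed.

Lemma energy_rate_bound {R : realType} (a1 a2 m C N : R) : `|a1| <= m * 1 * N -> `|a2| <= m * C * N ->
  `|a1 + a1 + (a2 + a2)| <= 2 * m * (1 + C) * N.
Proof.
move=> h1 h2; apply: le_trans (ler_normD _ _) _.
have := ler_normD a1 a1; have := ler_normD a2 a2; lra.
Qed.

Lemma le_of_sqr_le {R : realFieldType} (A x y : R) : 0 <= A -> 0 <= x -> 0 <= y ->
  x ^+ 2 <= A * y ^+ 2 -> x <= (A + 1) * y.
Proof.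
move=> A0 x0 y0 h; have A1 : 0 <= A + 1 by rewrite addr_ge0.
rewrite -(@ler_pXn2r _ 2) ?nnegrE ?mulr_ge0//; apply: le_trans h _.
rewrite exprMn ler_wpM2r ?sqr_ge0//; nra.
Qed.

Section dependence.
Context {R : realType} {n : nat} {M : smooth_manifold R n}.
Variables (g : riemannian_metric M) (L : M -> 'rV[R]_n -> R -> R).
Hypothesis hL : tonelli L g.
Local Notation E := 'rV[R]_n.
Local Notation Z := (E * E * R)%type.
Implicit Types (c : chart R n M) (y w v p z : E) (s t : R) (X : Z) (gamma : R -> M).

(** The image of [K] in M is compact, hence closed, so a curve whose coordinates remain in [K]
    cannot leave the chart in the limit. *)
Lemma chart_limit gamma c (K : set E) (A : set R) b : {for b, continuous gamma} ->
  compact K -> K `<=` chart_target c -> closure A b ->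
  (forall s, A s -> chart_source c (gamma s) /\ K (chart_map c (gamma s))) ->
  chart_source c (gamma b).
Proof.
move=> cg cK Kt clA hA.
have cC : closed (chart_inv c @` K).
  apply: compact_closed; first exact: manifold_hausdorff.
  apply: continuous_compact => //; apply: continuous_in_subspaceT => y; rewrite inE => /Kt.
  exact: chart_inv_cvg.
suff [y /Kt ty <-] : (chart_inv c @` K) (gamma b) by have [] := chart_invK ty.
apply: contrapT => nC.
have oC : open (~` (chart_inv c @` K)) by exact: closed_openC.
have := cg _ (open_near oC nC) => /clA[s [As]]; apply.
by have [cs Ks] := hA s As; exists (chart_map c (gamma s)) => //; rewrite chart_mapK ?inE.
Qed.

Lemma el_ode gamma c s : euler_lagrange_on L setT gamma -> atlas c -> chart_source c (gamma s) ->
  let q := chart_map c \o gamma in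
  [/\ is_derive s 1 q ('D_1 q s), is_derive s 1 ('D_1 q) (el_field L c (phase_curve q s)) &
      {for s, continuous (phase_curve q)}].
Proof.
move=> elg ac cs q; have [Cg2 hel] := elg.
have [_ Cg] := Cg2; have [dq Dq] := Cg c ac; have [dw _] := Dq 1.
have Ss : ([set: R] `&` gamma @^-1` chart_source c) s by [].
have tq s' : ([set: R] `&` gamma @^-1` chart_source c) s' -> chart_target c (q s').
  by move=> [_ cs']; exact: chart_map_target.
split.
- by apply: DeriveDef => //; exact/diff_derivable/dq.
- apply: DeriveDef; first exact/diff_derivable/dw.
  by apply/(euler_lagrange_chart hL ac (Cg c ac) tq Ss) => w; exact: hel.
- by have [dX _] := phase_curve_is_derive (Cg c ac) Ss; exact: differentiable_continuous dX.
Qed.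

Lemma open_chart_times gamma c : euler_lagrange_on L setT gamma ->
  open [set s | chart_source c (gamma s)].
Proof.
move=> [[cg _] _].
have -> : [set s | chart_source c (gamma s)] = [set: R] `&` gamma @^-1` chart_source c.
  by rewrite setTI.
exact: open_curve_source openT cg.
Qed.

(** Gronwall's inequality is applied to a Euclidean energy, since the sup norm is not
    differentiable; returning to the norm costs the factor [2 * n%:R]. *)
Lemma phase_gronwall (q q0 f f0 : R -> E) (C a b : R) : 0 <= C ->
  (forall x, a <= x <= b -> [/\ is_derive x 1 q ('D_1 q x), is_derive x 1 ('D_1 q) (f x),
     is_derive x 1 q0 ('D_1 q0 x), is_derive x 1 ('D_1 q0) (f0 x) &
     `|f x - f0 x| <= C * `|phase_curve q x - phase_curve q0 x|]) ->
  forall s t, a <= s <= b -> a <= t <= b ->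
  `|phase_curve q t - phase_curve q0 t| ^+ 2 <=
    2 * n%:R * expR (2 * n%:R * (1 + C) * `|t - s|) * `|phase_curve q s - phase_curve q0 s| ^+ 2.
Proof.
move=> C0 hq; pose dq s := q s - q0 s; pose dw s := 'D_1 q s - 'D_1 q0 s.
pose En s := dot (dq s) (dq s) + dot (dw s) (dw s).
pose N s := `|phase_curve q s - phase_curve q0 s|.
have NE s : N s = Num.max `|dq s| `|dw s|.
  have -> : N s = `|(dq s, dw s, s - s)| by [].
  by rewrite prod_normE/= prod_normE/= subrr normr0 max_l// le_max normr_ge0.
have le_q s : `|dq s| <= N s by rewrite NE le_max lexx.
have le_w s : `|dw s| <= N s by rewrite NE le_max lexx orbT.
have N0 s : 0 <= N s by rewrite /N.
have le_E s : N s ^+ 2 <= En s.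
  have h1 := sqr_norm_le_dot (dq s); have h2 := sqr_norm_le_dot (dw s).
  have h3 := dot_ge0 (dq s); have h4 := dot_ge0 (dw s).
  by rewrite NE /En; case: (leP `|dq s| `|dw s|) => _; lra.
have E_le s : En s <= 2 * n%:R * N s ^+ 2.
  have sq (x : R) : 0 <= x -> x <= N s -> n%:R * x ^+ 2 <= n%:R * N s ^+ 2.
    by move=> x0 xb; apply: ler_wpM2l => //; rewrite ler_pXn2r// nnegrE.
  have h1 := le_trans (dot_sqr_le (dq s)) (sq _ (normr_ge0 _) (le_q s)).
  have h2 := le_trans (dot_sqr_le (dw s)) (sq _ (normr_ge0 _) (le_w s)).
  by rewrite -mulrA mulr_natl mulr2n; exact: lerD.
pose en x := dot (dw x) (dq x) + dot (dq x) (dw x) + (dot (f x - f0 x) (dw x) + dot (dw x) (f x - f0 x)).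
have h1 x : a <= x <= b -> is_derive x 1 En (en x).
  move=> /hq[d1 d2 d3 d4 _]; have e1 := is_deriveB d1 d3; have e2 := is_deriveB d2 d4.
  exact: is_deriveD (is_derive_dot e1 e1) (is_derive_dot e2 e2).
have G0 : 0 <= 2 * n%:R * (1 + C) by rewrite !mulr_ge0// addr_ge0.
have h2 x : a <= x <= b -> `|en x| <= 2 * n%:R * (1 + C) * En x.
  move=> /hq[_ _ _ _ hf]; rewrite -/(N x) in hf.
  have bd (v w : E) k : 0 <= k -> `|v| <= k * N x -> `|w| <= N x -> `|dot v w| <= n%:R * k * N x ^+ 2.
    move=> k0 vN wN; apply: le_trans (dot_le_norm v w) _; rewrite -mulrA; apply: ler_wpM2l => //.
    by rewrite expr2 mulrA; apply: ler_pM.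
  have b1 : `|dot (dw x) (dq x)| <= n%:R * 1 * N x ^+ 2 by apply: bd; rewrite ?mul1r.
  have b2 := bd _ _ C C0 hf (le_w x).
  rewrite /en (dotC (dq x)) (dotC (dw x) (f x - f0 x)).
  apply: le_trans (energy_rate_bound b1 b2) _; exact: ler_wpM2l.
move=> s t sab tab; apply: le_trans (le_E t) _.
apply: le_trans (gronwall h1 h2 sab tab) _.
rewrite [X in _ <= X]mulrAC; apply: ler_wpM2r; first exact: expR_ge0.
exact: E_le.
Qed.

Lemma closure_centered_ball (sigma s : R) : s != sigma ->
  closure [set x | `|x - sigma| < `|s - sigma|] s.
Proof.
move=> ss U /nbhs_normP[e /= e0 he].
have r0 : 0 < `|s - sigma| by rewrite normr_gt0 subr_eq0.
pose h := Num.min (1 / 2) (e / (2 * `|s - sigma|)).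
have [h0 h1 h2] : [/\ 0 < h, h <= 1 / 2 & h <= e / (2 * `|s - sigma|)].
  by rewrite lt_min !ge_min !lexx !orbT !divr_gt0// mulr_gt0.
exists (s - h * (s - sigma)); split => /=.
  have -> : s - h * (s - sigma) - sigma = (1 - h) * (s - sigma) by ring.
  by rewrite normrM ger0_norm; [rewrite gtr_pMl//; lra|lra].
apply: he; rewrite /ball_/= opprB addrCA subrr addr0 normrM gtr0_norm//.
have h3 : h * (2 * `|s - sigma|) <= e by rewrite -ler_pdivlMr// mulr_gt0.
have h4 : 0 < h * `|s - sigma| by rewrite mulr_gt0.
lra.
Qed.

(** Real induction on the radius of the time interval around [sigma]; enlarging the radius only
    requires openness of [good] at the two ends. *)
Lemma radius_continuation (good : R -> Prop) (sigma R1 : R) : 0 <= R1 -> good sigma ->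
  (forall rho, 0 <= rho < R1 -> (forall s, `|s - sigma| <= rho -> good s) ->
    forall s, `|s - sigma| <= rho -> \forall x \near s, good x) ->
  (forall s, `|s - sigma| <= R1 -> s != sigma ->
    (forall x, `|x - sigma| < `|s - sigma| -> good x) -> good s) ->
  forall s, `|s - sigma| <= R1 -> good s.
Proof.
move=> R10 g0 hopen hclosed; pose S rho := forall s, `|s - sigma| <= rho -> good s.
apply: (@real_induction R S 0 R1) => //.
- by move=> s; rewrite normr_le0 subr_eq0 => /eqP ->.
- move=> r1 r1R hS; have Sr1 : S r1 by apply: hS; case/andP: r1R => ->/=.
  have nb s : `|s - sigma| <= r1 -> exists2 e, 0 < e & forall x, `|x - s| < e -> good x.
    move=> /(hopen r1 r1R Sr1)/nbhs_normP[e /= e0 he]; exists e => // x xs.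
    by apply: he; rewrite /ball_/= distrC.
  have r10 : 0 <= r1 by case/andP: r1R.
  have [e1 e10 he1] := nb (sigma + r1) (ltac:(by rewrite addrAC subrr add0r ger0_norm)).
  have [e2 e20 he2] := nb (sigma - r1) (ltac:(by rewrite addrAC subrr add0r normrN ger0_norm)).
  exists (Num.min e1 e2); first by rewrite lt_min e10.
  move=> rho /andP[r1rho]; rewrite -ltrBlDl lt_min => /andP[rho1 rho2] _ s sr.
  have [sr1|r1s] := leP `|s - sigma| r1; first exact: Sr1.
  move: sr r1s; have [ss|ss] := leP 0 (s - sigma); rewrite ?(ger0_norm ss) ?(ltr0_norm ss) => sr r1s.
    by apply: he1; rewrite ltr_norml; apply/andP; split; lra.
  by apply: he2; rewrite ltr_norml; apply/andP; split; lra.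
- move=> r1 /andP[r10 r12] hS s sr1.
  have [->//|ss] := eqVneq s sigma.
  apply: hclosed => // [|x xr]; first exact: le_trans r12.
  by apply: (hS `|x - sigma|); rewrite ?normr_ge0//; exact: lt_le_trans xr sr1.
- by rewrite R10/=.
Qed.

Definition phase c gamma : R -> Z := phase_curve (chart_map c \o gamma).

Lemma phase_sub_radius (b A : R) (r : R) : 0 < r -> 0 <= A ->
  b <= 1 -> b <= r ^+ 2 / (2 * (A + 1)) -> 0 < b -> A * b ^+ 2 < r ^+ 2.
Proof.
move=> r0 A0 b1 bA b0.
have A1 : 0 < 2 * (A + 1) by lra.
have h1 : b ^+ 2 <= b by rewrite expr2 ler_piMl// ltW.
have h2 : b * (2 * (A + 1)) <= r ^+ 2 by rewrite -ler_pdivlMr.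
have h3 : A * b ^+ 2 <= A * b by apply: ler_wpM2l.
have h4 : 0 <= A * b by rewrite mulr_ge0// ltW.
by move: h2; rewrite mulrDr mulr1 mulrDr mulrA (mulrC b); lra.
Qed.

(** Remaining in the chart is part of the conclusion. While the two phases stay within [r / 2],
    Gronwall's inequality keeps them strictly closer than that, so the bound and the membership in
    the chart continue together. The initial time [sigma] is left free because it will vary along a
    family. *)
Lemma el_dependence gamma0 c r0 : euler_lagrange_on L setT gamma0 -> atlas c ->
  chart_source c (gamma0 r0) ->
  exists d eta A B, [/\ [/\ 0 < d, 0 < eta, 0 <= A & 0 <= B], forall s, `|s - r0| < d -> chart_source c (gamma0 s) &
    forall gamma sigma, euler_lagrange_on L setT gamma -> `|sigma - r0| < d ->
      chart_source c (gamma sigma) ->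
      `|phase c gamma sigma - phase c gamma0 sigma| <= eta -> forall s, `|s - r0| < d ->
      [/\ chart_source c (gamma s),
          `|phase c gamma s - phase c gamma0 s| <= A * `|phase c gamma sigma - phase c gamma0 sigma| &
          `|lag L c (phase c gamma s) - lag L c (phase c gamma0 s)| <= B * `|phase c gamma s - phase c gamma0 s|]].
Proof.
move=> el0 ac c0; set X0 := phase c gamma0.
have dX0 : lag_dom c (X0 r0) by exact: chart_map_target.
have [r r_gt0 rd] := phase_ball_dom dX0.
have [C C0 hC] := el_field_lipschitz hL ac rd.
have [B B0 hB] : exists2 B, 0 <= B & forall X Y, `|X - X0 r0| <= r -> `|Y - X0 r0| <= r ->
    `|lag L c X - lag L c Y| <= B * `|X - Y|.
  have C1 := lag_Ck hL 1 ac; have [dl _] := C1.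
  have [B B0 hB] := derive_bounded phase_finite_dim (@phase_ball_compact R n (X0 r0) r) rd C1.
  exists B => // X Y Xr Yr; have XE : X = X - Y + Y by rewrite subrK.
  rewrite {1}XE; apply: segment_le => s s01.
    by apply/diff_derivable/dl/rd; apply: ball_segment => //; rewrite subrK.
  by apply: hB; apply: ball_segment => //; rewrite subrK.
have [_ _ cX0] := el_ode el0 ac c0; rewrite -/(phase c gamma0) -/X0 in cX0.
have r20 : 0 < r / 2 by rewrite divr_gt0.
have rr : r / 2 <= r by lra.
have [d0 d00 hd0] : exists2 d, 0 < d & forall s, `|s - r0| < d ->
    chart_source c (gamma0 s) /\ `|X0 s - X0 r0| <= r / 2.
  have n1 := open_near (open_chart_times (c := c) el0) c0.
  have n2 := continuous_near_le cX0 r20.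
  have : \forall s \near r0, chart_source c (gamma0 s) /\ `|X0 s - X0 r0| <= r / 2.
    by near=> s; split; [near: s|rewrite distrC; near: s].
  move=> /nbhs_normP[d /= d0 hd]; exists d => // s sd; apply: hd.
  by rewrite /ball_/= distrC.
(* Times within [d] of [r0] are within [2 * d] of [sigma], and times within [2 * d] of [sigma] are
   within [3 * d < d0] of [r0]. *)
pose d := d0 / 4; have d_gt0 : 0 < d by rewrite divr_gt0.
pose G := 2 * n%:R * (1 + C); have G0 : 0 <= G by rewrite !mulr_ge0// addr_ge0.
pose A := 2 * n%:R * expR (G * (2 * d)); have A0 : 0 <= A by rewrite !mulr_ge0// expR_ge0.
(* Small enough for Gronwall's bound to give [A * eta ^+ 2 < (r / 2) ^+ 2], which makes the
   continuation strict. *)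
pose eta := Num.min (Num.min 1 (r / 2)) ((r / 2) ^+ 2 / (2 * (A + 1))).
have A1 : 0 < 2 * (A + 1) by lra.
have r40 : 0 < (r / 2) ^+ 2 by rewrite exprn_gt0.
have [eta0 eta1 etar etaA] : [/\ 0 < eta, eta <= 1, eta <= r / 2 & eta <= (r / 2) ^+ 2 / (2 * (A + 1))].
  by rewrite !lt_min ltr01 r20 divr_gt0// !ge_min !lexx !orbT.
have Aeta : A * eta ^+ 2 < (r / 2) ^+ 2 by exact: phase_sub_radius.
have dd0 : d <= d0 by rewrite /d; lra.
have d20 : 0 <= 2 * d by rewrite mulr_ge0// ltW.
exists d, eta, (A + 1), B; split => //.
  by split => //; rewrite addr_ge0.
  by move=> s sd; have [] := hd0 s (lt_le_trans sd dd0).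
move=> gamma sigma elg sigd cs; set X := phase c gamma => Xsig.
have inI s : `|s - sigma| <= 2 * d -> `|s - r0| < d0.
  move: sigd; rewrite ltr_norml ler_norml ltr_norml /d => /andP[h1 h2] /andP[h3 h4].
  by apply/andP; split; lra.
pose good s := chart_source c (gamma s) /\ `|X s - X0 s| <= r / 2.
have goodX s : `|s - sigma| <= 2 * d -> good s -> `|X s - X0 r0| <= r.
  by move=> /inI/hd0[_ h1] [_ h2]; exact: norm_sub_half h2 h1.
have gron rho : rho <= 2 * d -> (forall s, `|s - sigma| <= rho -> good s) ->
    forall s, `|s - sigma| <= rho -> `|X s - X0 s| ^+ 2 <= A * `|X sigma - X0 sigma| ^+ 2.
  move=> rho2 hg s srho.
  have rho0 : 0 <= rho := le_trans (normr_ge0 _) srho.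
  have inN x : (sigma - rho <= x <= sigma + rho) = (`|x - sigma| <= rho) by rewrite ler_distl.
  have hode x : sigma - rho <= x <= sigma + rho ->
    [/\ is_derive x 1 (chart_map c \o gamma) ('D_1 (chart_map c \o gamma) x),
       is_derive x 1 ('D_1 (chart_map c \o gamma)) (el_field L c (phase_curve (chart_map c \o gamma) x)),
       is_derive x 1 (chart_map c \o gamma0) ('D_1 (chart_map c \o gamma0) x),
       is_derive x 1 ('D_1 (chart_map c \o gamma0)) (el_field L c (phase_curve (chart_map c \o gamma0) x)) &
       `|el_field L c (phase_curve (chart_map c \o gamma) x) - el_field L c (phase_curve (chart_map c \o gamma0) x)| <=
       C * `|phase_curve (chart_map c \o gamma) x - phase_curve (chart_map c \o gamma0) x|].
    rewrite inN => xr; have gx := hg x xr; have xd := le_trans xr rho2.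
    have [cx _] := gx; have [c0x X0x] := hd0 x (inI x xd).
    have [d1 d2 _] := el_ode elg ac cx; have [d3 d4 _] := el_ode el0 ac c0x.
    have hf := hC _ _ (goodX x xd gx) (le_trans X0x rr).
    exact: (And5 d1 d2 d3 d4 hf).
  have sI : sigma - rho <= sigma <= sigma + rho by rewrite inN subrr normr0.
  have xI : sigma - rho <= s <= sigma + rho by rewrite inN.
  have h := phase_gronwall C0 hode sI xI; apply: le_trans h _.
  apply: ler_wpM2r; first exact: sqr_ge0.
  apply: ler_wpM2l; first by rewrite mulr_ge0.
  rewrite ler_expR; apply: ler_wpM2l => //; exact: le_trans srho rho2.
have Xsig2 : A * `|X sigma - X0 sigma| ^+ 2 <= A * eta ^+ 2.
  by apply: ler_wpM2l => //; rewrite ler_pXn2r// nnegrE// ltW.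
have cont s : `|s - sigma| <= 2 * d -> chart_source c (gamma s) -> {for s, continuous (fun s => `|X s - X0 s|)}.
  move=> /inI/hd0[c0s _] cs'; have [_ _ h1] := el_ode elg ac cs'; have [_ _ h2] := el_ode el0 ac c0s.
  apply: (@continuous_comp _ _ _ (fun s => X s - X0 s) Num.norm); last exact: norm_continuous.
  exact: continuousB h1 h2.
have allS s : `|s - sigma| <= 2 * d -> good s.
  apply: radius_continuation => //.
  - by split => //; exact: le_trans Xsig etar.
  - move=> rho /andP[rho0 rho2] Sr1 s1 sr1.
    have sd := le_trans sr1 (ltW rho2).
    have [cs1 _] := Sr1 s1 sr1; have hs := gron rho (ltW rho2) Sr1 s1 sr1.
    have lt_r : `|X s1 - X0 s1| < r / 2.
      rewrite -(ltr_pXn2r (ltn0Sn 1)) ?nnegrE ?normr_ge0 ?(ltW r20)//.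
      exact: le_lt_trans (le_trans hs Xsig2) Aeta.
    have n1 := open_near (open_chart_times (c := c) elg) cs1.
    have n2 : \forall x \near s1, `|X x - X0 x| < r / 2 := cont s1 sd cs1 _ (lt_nbhsl lt_r).
    by apply: filterS2 n1 n2 => x cx xr; split; [exact: cx|exact: ltW].
  - move=> s1 sd ss lt_good; have clA := closure_centered_ball ss.
    have cs1 : chart_source c (gamma s1).
      apply: (@chart_limit gamma c [set y | `|y - (X0 r0).1.1| <= r] _ s1 _ _ _ clA).
      - by case: elg => -[cg _] _; exact: cg.
      - exact: norm_ball_compact.
      - move=> y yr; apply: (rd (y, (X0 r0).1.2, (X0 r0).2)).
        by rewrite /= !norm_pair_le/= !subrr !normr0 yr (ltW r_gt0).
      - move=> x xr; have gx := lt_good x xr; split; first by case: gx.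
        have := goodX x (le_trans (ltW xr) sd) gx.
        by rewrite !norm_pair_le/= => /andP[/andP[]].
    split => //; rewrite leNgt; apply/negP => gt_r.
    have := cont s1 sd cs1 _ (lt_nbhsr gt_r) => /clA[x [/lt_good[_ xr]]] /=.
    by rewrite ltNge xr.
move=> s sd.
have ssig : `|s - sigma| <= 2 * d.
  move: sd sigd; rewrite !ltr_norml ler_norml => /andP[? ?] /andP[? ?]; apply/andP; split; lra.
have gs := allS s ssig; split; first by case: gs.
  exact: (le_of_sqr_le A0 (normr_ge0 _) (normr_ge0 _) (gron _ (lexx _) allS s ssig)).
apply: hB; first exact: goodX ssig gs.
by have [_ h] := hd0 s (inI s ssig); exact: le_trans h rr.
Unshelve. all: by end_near. Qed.

End dependence.

Lemma ultra_fmap (I T : Type) (F : set_system I) (f : I -> T) : UltraFilter F -> UltraFilter (f @ F).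
Proof.
move=> UF; apply: (Build_UltraFilter (fmap_proper_filter f _)) => G PG sG.
apply/seteqP; split=> // A GA.
have [//|nA] := in_ultra_setVsetC (f @^-1` A) UF.
have GC : G (~` A) by apply: sG.
have := @filterI _ G _ _ _ GA GC; rewrite setICr => G0.
by case: (@filter_not_empty _ G PG (G0 _)).
Qed.

(** Ultrafilters replace the extraction of subsequences: times, points and velocities all converge
    along the same filter. *)
Lemma compact_ultra_cvg (I : Type) (T : ptopologicalType) (F : set_system I) (f : I -> T) (K : set T) :
  UltraFilter F -> compact K -> (\forall k \near F, K (f k)) -> exists2 p, K p & f @ F --> p.
Proof.
move=> UF; rewrite compact_ultra => cK hK.
by have [p [Kp fp]] := cK _ (ultra_fmap f UF) hK; exists p.
Qed.

Lemma min_le_r {R : realFieldType} (x y : R) : Num.min x y <= y.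
Proof. by rewrite ge_min lexx orbT. Qed.

Lemma dependence_bound {R : realFieldType} (B e f : R) : 0 <= B -> 0 <= e -> f <= e / (B + 1) -> B * f <= e.
Proof.
move=> B0 e0 fe; have B1 : 0 < B + 1 by lra.
apply: le_trans (ler_wpM2l B0 fe) _; rewrite mulrCA -[leRHS]mulr1 ler_wpM2l//.
by rewrite ler_pdivrMr// mul1r lerDl.
Qed.

(** The map is the tangent map of a transition, by which phases pass from one chart to another; the
    time component is fixed at [s]. *)
Lemma prolongation_continuous {R : realType} (V : normedModType R) (s : R) (U : set V) (psi : V -> V)
    (X : V * V * R) : finite_dim V -> open U -> Ck 1 U psi -> U X.1.1 ->
  {for X, continuous (fun X : V * V * R => (psi X.1.1, 'D_(X.1.2) psi X.1.1, s))}.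
Proof.
move=> fV oU Cpsi UX.
have c1 : {for X, continuous (@fst (V * V) R)} by exact: cvg_fst.
have c2 : {for X.1, continuous (@fst V V)} by exact: cvg_fst.
have [dpsi _] := Cpsi.
have c3 : {for X, continuous (fun X : V * V * R => psi X.1.1)}.
  apply: (@continuous_comp _ _ _ (fun X : V * V * R => X.1.1) psi).
    exact: (@continuous_comp _ _ _ fst fst).
  exact/differentiable_continuous/dpsi.
have c4 : {for X, continuous (fun X : V * V * R => 'D_(X.1.2) psi X.1.1)}.
  apply: (@continuous_comp _ _ _ fst (fun z : V * V => 'D_(z.2) psi z.1)) => //.
  by have := derive_cvg_joint fV (v := X.1.2) oU Cpsi UX; rewrite -surjective_pairing.
apply: continuous_pair; last exact: cst_continuous.
exact: continuous_pair.
Qed.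

Lemma cvg_distP {R : realType} (V : normedModType R) (T : Type) (F : set_system T) (FF : Filter F)
    (f : T -> V) (l : V) :
  f @ F --> l <-> forall e : R, 0 < e -> \forall k \near F, `|f k - l| <= e.
Proof.
split=> [cf e e0|h]; first by have /cvgrPdist_le/(_ e e0) := cf; apply: filterS => k; rewrite distrC.
by apply/cvgrPdist_le => e /h; apply: filterS => k; rewrite distrC.
Qed.

(** * Convergence of families of extremals along a filter *)

Section families_of_extremals.
Context {R : realType} {n : nat} {M : smooth_manifold R n}.
Variables (g : riemannian_metric M) (L : M -> 'rV[R]_n -> R -> R).
Hypothesis hL : tonelli L g.
Local Notation E := 'rV[R]_n.
Local Notation Z := (E * E * R)%type.
Variables (T : Type) (F : set_system T) (gam : T -> R -> M) (gamma : R -> M).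
Hypotheses (FF : ProperFilter F) (elk : forall k, euler_lagrange_on L setT (gam k))
  (el0 : euler_lagrange_on L setT gamma).
Implicit Types (c : chart R n M) (y w v : E) (s t r : R) (X : Z).

Definition phase_cvg c s := (\forall k \near F, chart_source c (gam k s)) /\
  phase c (gam k) s @[k --> F] --> phase c gamma s.

Lemma curve_C1 delta : euler_lagrange_on L setT delta -> curve_Ck 1 setT delta.
Proof. by case=> Cd _; exact: curve_Ck_le Cd. Qed.

Lemma phase_cvg_point c s : chart_source c (gamma s) -> phase_cvg c s -> gam k s @[k --> F] --> gamma s.
Proof.
move=> cs [nc cX]; have ts := chart_map_target cs.
have cinv : {for phase c gamma s, continuous (fun X : Z => chart_inv c X.1.1)}.
  apply: (@continuous_comp _ _ _ (fun X : Z => X.1.1) (chart_inv c)).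
    by apply: (@continuous_comp _ _ _ fst fst); exact: cvg_fst.
  exact: chart_inv_cvg.
have h := cvg_comp _ _ cX cinv.
have E0 : chart_inv c (phase c gamma s).1.1 = gamma s by rewrite /phase/phase_curve/= chart_mapK ?inE.
rewrite E0 in h; apply: cvg_trans h.
apply: near_eq_cvg; apply: filterS nc => k ck.
by rewrite /phase/phase_curve/= chart_mapK ?inE.
Qed.

Lemma phase_cvg_transition c c' s : atlas c -> atlas c' -> chart_source c (gamma s) ->
  chart_source c' (gamma s) -> phase_cvg c s -> phase_cvg c' s.
Proof.
move=> ac ac' cs cs' cX; have cp := phase_cvg_point cs cX; have [nc hX] := cX.
have nc' : \forall k \near F, chart_source c' (gam k s).
  by apply: cp; apply: open_near => //; exact: chart_source_open.
split; first exact: nc'.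
have [ov E0] := phase_curve_transition ac' ac openT (curve_C1 el0) I cs' cs.
rewrite /phase E0.
have cPsi := prolongation_continuous (X := phase c gamma s) (s := s) (finite_dim_row n)
  (@open_overlap _ _ _ c c') (transition_Ck ac ac' 1) ov.
have := cvg_comp _ _ hX cPsi; apply: cvg_trans; apply: near_eq_cvg.
near=> k.
have ck : chart_source c (gam k s) by near: k.
have ck' : chart_source c' (gam k s) by near: k.
by have [_ ->] := phase_curve_transition ac' ac openT (curve_C1 (elk k)) I ck' ck.
Unshelve. all: by end_near. Qed.

(** The times [sig k] may depend on [k]: the instant at which an extremal is known to be slow
    differs from one extremal to another. *)
Lemma phase_dependence c r0 : atlas c -> chart_source c (gamma r0) ->
  exists2 d, 0 < d & (forall s, `|s - r0| < d -> chart_source c (gamma s)) /\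
  forall sig : T -> R, (\forall k \near F, `|sig k - r0| < d) ->
    (\forall k \near F, chart_source c (gam k (sig k))) ->
    (forall e : R, 0 < e -> \forall k \near F, `|phase c (gam k) (sig k) - phase c gamma (sig k)| <= e) ->
    forall e : R, 0 < e -> \forall k \near F, forall s, `|s - r0| < d ->
      [/\ chart_source c (gam k s), `|phase c (gam k) s - phase c gamma s| <= e &
          `|lag_curve L (gam k) s - lag_curve L gamma s| <= e].
Proof.
move=> ac c0; have [d [eta [A [B [[d0 eta0 A0 B0] hs hdep]]]]] := el_dependence hL el0 ac c0.
exists d => //; split=> // sig nsig nc dX e e0.
pose e1 := Num.min e (e / (B + 1)).
have B1 : 0 < B + 1 by lra.
have e10 : 0 < e1 by rewrite lt_min e0 divr_gt0.
pose e2 := Num.min eta (e1 / (A + 1)).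
have A1 : 0 < A + 1 by lra.
have e20 : 0 < e2 by rewrite lt_min eta0 divr_gt0.
have hn := dX _ e20.
near=> k => s sd.
have hk : `|phase c (gam k) (sig k) - phase c gamma (sig k)| <= e2 by near: k.
have [||| cs h1 h2] := hdep (gam k) (sig k) (elk k) _ _ _ s sd.
- by near: k.
- by near: k.
- by apply: le_trans hk _; rewrite ge_min lexx.
have he : `|phase c (gam k) s - phase c gamma s| <= e1.
  apply: le_trans h1 _; apply: le_trans (ler_wpM2l A0 hk) _.
  exact: (dependence_bound A0 (ltW e10) (min_le_r _ _)).
split => //; first by apply: le_trans he _; rewrite ge_min lexx.
rewrite (lag_curve_chart L ac (curve_C1 (elk k)) (conj I cs)).
rewrite (lag_curve_chart L ac (curve_C1 el0) (conj I (hs _ sd))).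
apply: le_trans h2 _; apply: le_trans (ler_wpM2l B0 he) _.
exact: (dependence_bound B0 (ltW e0) (min_le_r _ _)).
Unshelve. all: by end_near. Qed.

Hypothesis hcvg : exists c s, [/\ atlas c, chart_source c (gamma s) & phase_cvg c s].

Lemma phase_cvg_near c r0 : atlas c -> chart_source c (gamma r0) ->
  exists2 d, 0 < d & (forall s, `|s - r0| < d -> chart_source c (gamma s)) /\
  forall s, `|s - r0| < d -> phase_cvg c s ->
    forall e : R, 0 < e -> \forall k \near F, forall t, `|t - r0| < d ->
      [/\ chart_source c (gam k t), `|phase c (gam k) t - phase c gamma t| <= e &
          `|lag_curve L (gam k) t - lag_curve L gamma t| <= e].
Proof.
move=> ac c0; have [d d0 [hs hd]] := phase_dependence ac c0.
exists d => //; split=> // s sd [nc cX]; apply: (hd (fun=> s)) => //; first exact: nearW.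
exact/cvg_distP.
Qed.

Lemma phase_cvg_all c s : atlas c -> chart_source c (gamma s) -> phase_cvg c s.
Proof.
have acs r : atlas (chart_at (gamma r)) by exact: atlas_chart_at.
have scs r : chart_source (chart_at (gamma r)) (gamma r) by exact: source_chart_at.
pose good r := phase_cvg (chart_at (gamma r)) r.
have loc r : exists2 d, 0 < d & forall t t', `|t - r| < d -> `|t' - r| < d -> good t -> good t'.
  have [d d0 [hs hd]] := phase_cvg_near (acs r) (scs r).
  exists d => // t t' td t'd /(phase_cvg_transition (acs t) (acs r) (scs t) (hs t td)) gt.
  apply: (phase_cvg_transition (acs r) (acs t') (hs t' t'd) (scs t')).
  have h := hd t td gt; split.
    by apply: filterS (h 1 ltr01) => k /(_ t' t'd)[].
  by apply/cvg_distP => e e0; apply: filterS (h e e0) => k /(_ t' t'd)[].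
(* Stated as an equivalence so that one passage of [local_transitive_global] carries convergence
   both forward and backward in time. *)
have glob a b : a <= b -> (good a <-> good b).
  move=> ab; apply: (local_transitive_global (P := fun s t => good s <-> good t)) ab _ _.
    by move=> x y z _ _ _ _ [h1 h2] [h3 h4]; split=> h; [exact/h3/h1|exact/h2/h4].
  move=> r _; have [d d0 hd] := loc r; exists d => // s' t' _ st _ h1 h2.
  have sd : `|s' - r| < d by rewrite ltr_norml; lra.
  have td : `|t' - r| < d by rewrite ltr_norml; lra.
  by split; [exact: hd sd td|exact: hd td sd].
move=> ac cs; have [c1 [s1 [ac1 cs1 h1]]] := hcvg.
have g1 : good s1 by exact: phase_cvg_transition h1.
apply: (phase_cvg_transition (acs s) ac (scs s) cs).
have [le|/ltW le] := leP s1 s; first exact/(glob _ _ le).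
exact/(glob _ _ le).
Qed.

Lemma curve_cvg_all s : gam k s @[k --> F] --> gamma s.
Proof.
have cs := source_chart_at (gamma s).
exact: phase_cvg_point cs (phase_cvg_all (atlas_chart_at _) cs).
Qed.

Lemma action_split delta (a b c : R) : euler_lagrange_on L setT delta -> a <= b -> b <= c ->
  action L delta a c = action L delta a b + action L delta b c.
Proof.
move=> eld ab bc; have ac := le_trans ab bc.
have [Lam _ aE] := global_antiderivative hL ac (curve_C1 eld).
by rewrite !aE// [in RHS]addrC subrKA.
Qed.

(** On a short interval the Lagrangians along the curves converge uniformly, which controls the
    difference of the antiderivatives; the general case follows by additivity. *)
Lemma action_cvg (a b : R) : a <= b -> forall e : R, 0 < e ->
  \forall k \near F, `|action L (gam k) a b - action L gamma a b| <= e.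
Proof.
move=> ab; apply: (local_transitive_global (P := fun a b => forall e : R, 0 < e ->
  \forall k \near F, `|action L (gam k) a b - action L gamma a b| <= e)) ab _ _.
  move=> x y z _ xy yz _ h1 h2 e e0; have e20 : 0 < e / 2 by rewrite divr_gt0.
  apply: filterS2 (h1 _ e20) (h2 _ e20) => k k1 k2.
  rewrite (action_split (elk k) xy yz) (action_split el0 xy yz) opprD addrACA.
  by apply: le_trans (ler_normD _ _) _; lra.
move=> r _; have cs := source_chart_at (gamma r); have ac := atlas_chart_at (gamma r).
have [d d0 [hs hd]] := phase_cvg_near ac cs.
exists d => // s t _ st _ sd td e e0.
have r0 : `|r - r| < d by rewrite subrr normr0.
have e10 : 0 < e / (2 * d) by rewrite divr_gt0// mulr_gt0.
apply: filterS (hd r r0 (phase_cvg_all ac cs) _ e10) => k hk.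
have [Lam dLam aE] := global_antiderivative hL st (curve_C1 (elk k)).
have [Lam0 dLam0 aE0] := global_antiderivative hL st (curve_C1 el0).
rewrite aE// aE0//.
have dB x : s <= x <= t -> is_derive x 1 (Lam - Lam0) (lag_curve L (gam k) x - lag_curve L gamma x).
  by move=> xst; apply: is_deriveB; [apply: dLam|apply: dLam0]; lra.
have bB x : s <= x <= t -> `|lag_curve L (gam k) x - lag_curve L gamma x| <= e / (2 * d).
  by move=> xst; have [|_ _] := hk x; [rewrite ltr_norml; lra|].
have := derive_bounded_lipschitz st dB bB.
rewrite -[(Lam - Lam0) t]/(Lam t - Lam0 t) -[(Lam - Lam0) s]/(Lam s - Lam0 s) => h.
have -> : Lam t - Lam s - (Lam0 t - Lam0 s) = Lam t - Lam0 t - (Lam s - Lam0 s) by ring.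
apply: le_trans h _; rewrite -mulrA -[leRHS]mulr1 ler_wpM2l ?(ltW e0)//.
by rewrite ler_pdivrMl ?mulr_gt0// mulr1; lra.
Qed.

End families_of_extremals.

Section calibrated_limits.
Context {R : realType} {n : nat} {M : smooth_manifold R n}.
Variables (g : riemannian_metric M) (L : M -> 'rV[R]_n -> R -> R).
Hypothesis hL : tonelli L g.
Variable u : M * circle R -> R.
Hypotheses (hu : continuous u) (hcompact : compact [set: M]).
Local Notation E := 'rV[R]_n.
Implicit Types (c : chart R n M) (y w v : E) (s t r : R) (gamma : R -> M).

Lemma continuous_circle_bounded : exists U : R, forall z, `|u z| <= U.
Proof.
pose f (z : M * R) := `|u (z.1, circle_of z.2)|.
have cf : {within [set: M] `*` [set` `[- 2^-1 : R, 2^-1]], continuous f}.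
  apply: continuous_subspaceT => z.
  apply: (@continuous_comp _ _ _ (fun z : M * R => u (z.1, circle_of z.2)) Num.norm); last exact: norm_continuous.
  apply: (@continuous_comp _ _ _ (fun z : M * R => (z.1, circle_of z.2)) u); last exact: hu.
  apply: continuous_pair; first exact: cvg_fst.
  apply: (@continuous_comp _ _ _ snd (@circle_of R)); first exact: cvg_snd.
  exact: circle_of_continuous.
have K0 : ([set: M] `*` [set` `[- 2^-1 : R, 2^-1]]) !=set0.
  by exists (point, 0); split => //=; rewrite in_itv/= oppr_le0 invr_ge0 ler0n.
have [z0 _ hz] := compact_EVT_max K0 (compact_setX hcompact (@segment_compact R _ _)) cf.
exists (f z0) => -[x tau]; have := hz (x, local_lift 0 tau).
rewrite /f/= circle_of_lift; apply; rewrite inE; split => //=.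
by have := local_lift_dist 0 tau; rewrite subr0 ler_norml in_itv.
Qed.

(** Over the unit interval ending at [t] the action is a difference of two values of [u], so its
    integrand is at most [2 * U] somewhere by the mean value theorem. *)
Lemma calibrated_slow (U : R) gamma t : (forall z, `|u z| <= U) -> euler_lagrange_on L setT gamma ->
  calibrated L u gamma t -> exists2 s, t - 1 <= s <= t & lag_curve L gamma s <= 2 * U.
Proof.
move=> uU elg cal; have t1 : t - 1 <= t by lra.
have [Lam dLam aE] := global_antiderivative hL t1 (curve_C1 elg).
have dB x : t - 1 <= x <= t -> is_derive x 1 Lam (lag_curve L gamma x).
  by move=> xst; apply: dLam; lra.
have [s sI sE] := MVT_closed t1 dB; exists s => //.
have := cal _ t1; rewrite aE// sE /u_curve => h.
have := uU (gamma t, circle_of t); have := uU (gamma (t - 1), circle_of (t - 1)).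
move: h; move: (u _) (u _) (lag_curve _ _ _) => a b l h.
rewrite !ler_norml => /andP[h1 h2] /andP[h3 h4]; lra.
Qed.

Lemma velocity_bound (A : R) : exists2 B, 0 < B & forall x v t, L x v t <= A -> metric_norm g x v <= B.
Proof.
have [_ _ _ hsup _] := hL; have [B B0 hB] := hsup 1.
exists (B + `|A|) => [|x v t Lv]; first by rewrite ltr_wpDr.
have [le|/ltW ge] := leP (metric_norm g x v) B; first by apply: le_trans le _; rewrite lerDl.
have n0 : 0 < metric_norm g x v := lt_le_trans B0 ge.
have := hB x v t ge; rewrite ler_pdivlMr// mul1r => h.
apply: le_trans h _; apply: le_trans Lv _; apply: le_trans (ler_norm A) _.
by rewrite lerDr ltW.
Qed.

(** Slow times lie in a compact interval, positions in M, and superlinear growth bounds the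
    velocities at those times: the initial data converge along the ultrafilter, and both sides of
    the calibration identity pass to the limit. *)
Lemma calibrated_limit (T : Type) (F : set_system T) (gam : T -> R -> M) t : UltraFilter F ->
  (forall k, euler_lagrange_on L setT (gam k)) -> (forall k, calibrated L u (gam k) t) ->
  exists gamma, [/\ euler_lagrange_on L setT gamma, calibrated L u gamma t &
    gam k t @[k --> F] --> gamma t].
Proof.
move=> UF elk calk; have PF : ProperFilter F by exact: ultra_proper.
have [U hU] := continuous_circle_bounded.
have hsl k : exists r, t - 1 <= r <= t /\ lag_curve L (gam k) r <= 2 * U.
  by have [r h1 h2] := calibrated_slow hU (elk k) (calk k); exists r.
have [s hs] := choice hsl.
have [B B0 hB] := velocity_bound (2 * U).
have hv k : metric_norm g (gam k (s k)) (velocity (gam k) (s k)) <= B.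
  by have [_ hk] := hs k; exact: hB hk.
have [s0 _ cs] := compact_ultra_cvg UF (@segment_compact R (t - 1) t) (nearW _ (fun k => proj1 (hs k))).
have [m0 _ cm] := compact_ultra_cvg (f := fun k => gam k (s k)) UF hcompact (nearW _ (fun k => I)).
set c := chart_at m0; have ac : atlas c by exact: atlas_chart_at.
have c0 : chart_source c m0 by exact: source_chart_at.
have t0 := chart_map_target c0.
have nc : \forall k \near F, chart_source c (gam k (s k)).
  by apply: cm; apply: open_near => //; exact: chart_source_open.
have cy : chart_map c (gam k (s k)) @[k --> F] --> chart_map c m0.
  exact: cvg_comp cm (chart_map_cvg c0).
have [kap kap0 hkap] := metric_norm_lower g ac t0.
have nkap := cy _ hkap.
have nw : \forall k \near F, [set w : E | `|w - 0| <= B / kap] ('D_1 (chart_map c \o gam k) (s k)).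
  near=> k; rewrite /= subr0 ler_pdivlMr// mulrC; apply: le_trans (hv k).
  have ck : chart_source c (gam k (s k)) by near: k.
  have [[cg Cg] _] := elk k; have [dg _] := Cg c ac.
  have cgk : {for s k, continuous (gam k)} by exact: cg.
  have dgk : derivable (chart_map c \o gam k) (s k) 1 by apply/diff_derivable/dg.
  rewrite (velocityE ac cgk ck dgk) derive1E -[X in metric_norm g X _](chart_mapK (mem_set ck)).
  have hk : forall w, kap * `|w| <= metric_norm g (chart_inv c (chart_map c (gam k (s k))))
      (tangent_of c (chart_map c (gam k (s k))) w) by near: k; exact: nkap.
  exact: hk.
have [w0 _ cw] := compact_ultra_cvg UF (@norm_ball_compact _ _ _ _) nw.
(* The limit curve is the extremal with the limit data at the limit time [s0]; its convergence at
   other times comes from continuous dependence. *)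
have [gamma [elg gE gD]] := el_exists hL w0 s0 ac t0.
have gs0 : gamma s0 = m0 by rewrite gE chart_mapK ?inE.
have cg0 : chart_source c (gamma s0) by rewrite gs0.
have [_ _ cX0] := el_ode hL elg ac cg0.
have cX : phase c (gam k) (s k) @[k --> F] --> phase c gamma s0.
  have -> : phase c gamma s0 = (chart_map c m0, w0, s0) by rewrite /phase/phase_curve gD /= gs0.
  exact: cvg_pair (cvg_pair cy cw) cs.
(* Continuous dependence compares the two phases at the same time [s k], while the data converge to
   the phase at [s0]; the continuity of the limit phase makes up the difference. *)
have cX0' : phase c gamma (s k) @[k --> F] --> phase c gamma s0 by exact: cvg_comp cs cX0.
have [d d0 [_ hdep]] := phase_dependence hL PF elk elg ac cg0.
have hd : forall e : R, 0 < e -> \forall k \near F, forall s1, `|s1 - s0| < d ->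
      [/\ chart_source c (gam k s1), `|phase c (gam k) s1 - phase c gamma s1| <= e &
          `|lag_curve L (gam k) s1 - lag_curve L gamma s1| <= e].
  apply: (hdep s) => //.
    by apply: (cs [set r | `|r - s0| < d]); apply/nbhs_ballP; exists d => // r; rewrite /ball/= distrC.
  move=> e e0; have e20 : 0 < e / 2 by rewrite divr_gt0.
  apply: filterS2 ((cvg_distP _ _ _).1 cX _ e20) ((cvg_distP _ _ _).1 cX0' _ e20) => k h1 h2.
  by apply: norm_sub_half h1 _; rewrite distrC.
have ss0 : `|s0 - s0| < d by rewrite subrr normr0.
have hcvg : exists c s, [/\ atlas c, chart_source c (gamma s) & phase_cvg F gam gamma c s].
  exists c, s0; split => //; split; first by apply: filterS (hd 1 ltr01) => k /(_ s0 ss0)[].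
  by apply/cvg_distP => e e0; apply: filterS (hd e e0) => k /(_ s0 ss0)[].
have cpt r : gam k r @[k --> F] --> gamma r by exact: (curve_cvg_all hL PF elk elg hcvg).
exists gamma; split => // r rt.
have cu r' : u_curve u (gam k) r' @[k --> F] --> u_curve u gamma r'.
  have cp : (gam k r', circle_of r') @[k --> F] --> (gamma r', circle_of r').
    exact: cvg_pair (cpt r') (cvg_cst _).
  exact: cvg_comp cp (@hu (gamma r', circle_of r')).
have ca : action L (gam k) r t @[k --> F] --> action L gamma r t.
  apply/cvg_distP; exact: (action_cvg hL PF elk elg hcvg rt).
have cd : u_curve u (gam k) t - u_curve u (gam k) r @[k --> F] --> u_curve u gamma t - u_curve u gamma r.
  by apply: cvgB; exact: cu.
have E0 : (fun k => u_curve u (gam k) t - u_curve u (gam k) r) = (fun k => action L (gam k) r t).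
  by apply/funext => k; exact: calk.
by rewrite E0 in cd; exact: cvg_unique cd ca.
Unshelve. all: by end_near. Qed.

(** Calibrated extremals ending within [k.+1%:R^-1] of the point, in the chart at [x], have a
    calibrated limit along an ultrafilter finer than the filter at infinity; its end is [x] by
    uniqueness of limits in M. *)
Lemma calibrated_exists x t : viscosity_solution L u -> exists gamma,
  [/\ euler_lagrange_on L setT gamma, calibrated L u gamma t & gamma t = x].
Proof.
move=> vu; pose e (k : nat) : R := k.+1%:R^-1.
have e0 k : 0 < e k by rewrite invr_gt0.
have [gam hgam] := choice (fun k => calibrated_near hL hu x t vu (e0 k)).
have [F [UF oF]] := ultraFilterLemma eventually_filter.
have elk k : euler_lagrange_on L setT (gam k) by case: (hgam k).
have calk k : calibrated L u (gam k) t by case: (hgam k).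
have [gamma [elg calg cg]] := calibrated_limit UF elk calk.
exists gamma; split => //.
have PF : ProperFilter F by exact: ultra_proper.
set c := chart_at x; have cx : chart_source c x by exact: source_chart_at.
have cy : chart_map c (gam k t) @[k --> F] --> chart_map c x.
  apply/cvg_distP => e1 e10; apply: oF; near=> k.
  have [_ _ _ h] := hgam k; apply: le_trans h _; rewrite /e ltW//; near: k.
  exact: near_infty_natSinv_lt (PosNum e10).
have cx' : gam k t @[k --> F] --> x.
  have := cvg_comp _ _ cy (chart_inv_cvg (chart_map_target cx)).
  rewrite chart_mapK ?inE//; apply: cvg_trans; apply: near_eq_cvg.
  by apply: nearW => k /=; rewrite chart_mapK// inE; case: (hgam k).
exact: (cvg_unique (@manifold_hausdorff _ _ M) cg cx').
Unshelve. all: by end_near. Qed.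

End calibrated_limits.

Theorem proposition3p12 (R : realType) (n : nat) (M : smooth_manifold R n)
  (hcompact : compact [set: M]) (hconnected : connected [set: M])
  (g : riemannian_metric M) (L : M -> 'rV[R]_n -> R -> R)
  (hL : tonelli L g) (hcL : mane_critical_value L 0)
  (u : M * circle R -> R) (hu : continuous u) :
  backward_weak_KAM L u <-> viscosity_solution L u.
Proof.
split=> [kam|vu].
  by split; [exact: (weak_KAM_subsolution hL kam)|exact: (weak_KAM_supersolution hL kam)].
split.
  have [sub _] := vu; exact: (subsolution_action_potential hL hu sub).
move=> x tau; have tauE : circle_of (repr tau) = tau by rewrite /circle_of reprK.
have [gamma [elg cal gx]] := calibrated_exists hL hu hcompact x (repr tau) vu.
exists gamma, (repr tau); split => // t tle.
  by apply: (is_path_C1 tle ltr01); exact: curve_Ck_subset (curve_C1 elg).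
by rewrite -(cal _ tle) /u_curve gx tauE.
Qed.
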